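(* Let $d\ge 1$ be an integer and let $p,q,r,s_1,s_2,\theta$ be real numbers such that (1) $1<p,q<\infty$; (2) $0\le r\le s_1$ and $s_2>\max\{0,\frac d2-\frac dp\}$; (3) $0<\theta<1$ and $$\frac1q-\frac{s_1-r}{d}=(1-\theta)\left(\frac1p-\frac rd\right)+\theta\left(\frac12-\frac{r+s_2}{d}\right);$$ (4) if $0\le r<\frac{s_1}{2}$, then $s_1-2r<\theta s_2$; and if $\frac{s_1}{2}\le r\le s_1$, then $2r-s_1<\frac dp$. For $\psi\in\mathcal X$ let $$A(\psi)=\|D^{r+s_2}\psi\|_{L^2}^2,\quad B(\psi)=\|D^{s_1-r}\psi\|_{L^q}^q,\quad M(\psi)=\|D^r\psi\|_{L^p}^p,$$ $$E(\psi)=\tfrac12A(\psi)-\tfrac1qB(\psi),\qquad P(\psi)=A(\psi)-\theta B(\psi),$$ and for $\lambda>0$ let $\mathcal S_\lambda=\{\psi\in\mathcal X:M(\psi)=\lambda\}$ and $\mathcal P_\lambda=\{\psi\in\mathcal S_\lambda:P(\psi)=0\}$. Let $$q_0(r)=\frac{dp}{d+p(s_1-2r)},\qquad q_c(r)=\frac{2(d+ps_2)}{d+p(s_1-2r)},\qquad q_S(r)=\begin{cases}\dfrac{2d}{d-2(s_2+2r-s_1)},&0<s_2+2r-s_1<\frac d2,\\[1ex]+\infty,&s_2+2r-s_1\ge\frac d2,\end{cases}$$ and $$C_*=\sup_{\phi\ne 0}\frac{\|D^{s_1-r}\phi\|_{L^q}}{\|D^r\phi\|_{L^p}^{1-\theta}\,\|D^{r+s_2}\phi\|_{L^2}^{\theta}}$$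 (supremum over all nonzero $\phi\in\mathcal S'(\mathbb R^d)$ modulo polynomials with $D^r\phi\in L^p$, $D^{r+s_2}\phi\in L^2$). Let $\lambda>0$ and let $\psi_\lambda$ be one of the following: (a) a minimizer of $E$ on $\mathcal S_\lambda$, in the case $q_0(r)<q<q_c(r)$; (b) a minimizer of $E$ on $\mathcal S_\lambda$, in the case $q=q_c(r)$ and $\lambda=\lambda_*:=\left(\frac{q}{2C_*^q}\right)^{\frac{p}{(1-\theta)q}}$; (c) a minimizer of $E$ on $\mathcal P_\lambda$, in the case $q_c(r)<q<q_S(r)$. Then there exists a positive Lagrange multiplier $$\omega_\lambda=\frac{1-\theta}{\theta\lambda}A(\psi_\lambda)>0$$ such that $$D^{2(r+s_2)}\psi_\lambda-D^{s_1-r}\left(|D^{s_1-r}\psi_\lambda|^{q-2}D^{s_1-r}\psi_\lambda\right)+\omega_\lambda D^r\left(|D^r\psi_\lambda|^{p-2}D^r\psi_\lambda\right)=0\quad\text{in }\mathcal X'.$$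
   Context: Multipliers. $\mathcal P$ is the space of polynomials on $\mathbb R^d$ (not to be confused with $\mathcal P_\lambda$). For $\sigma\in\mathbb R$, $D^\sigma\phi=\mathcal F^{-1}(|\xi|^\sigma\mathcal F\phi)$. It acts on $\mathcal S'(\mathbb R^d)/\mathcal P$, identified with the dual of $\mathcal S_\infty(\mathbb R^d)=\{\varphi\in\mathcal S(\mathbb R^d):\int x^\alpha\varphi\,dx=0\ \forall\alpha\}$, by $\langle D^\sigma\phi,\varphi\rangle=\langle\phi,D^\sigma\varphi\rangle$. For $1<\ell<\infty$, $D^\sigma\phi\in L^\ell(\mathbb R^d)$ means that the class $D^\sigma\phi$ contains a (necessarily unique) representative in $L^\ell(\mathbb R^d)$, and $\|D^\sigma\phi\|_{L^\ell}$ is the norm of that representative. $\dot L^\ell_r(\mathbb R^d)$ is the space of $\phi\in\mathcal S'/\mathcal P$ with $D^r\phi\in L^\ell(\mathbb R^d)$. The space $\mathcal X=\mathcal X_{r,p,s_2}$. It is the Banach space $\{\psi\in E^{r,p}(\mathbb R^d): D^{r+s_2}\psi\in L^2(\mathbb R^d)\}$ with norm $\|D^r\psi\|_{L^p}+\|D^{r+s_2}\psi\|_{L^2}$. Here $E^{0,\ell}=L^\ell(\mathbb R^d)$, and for $r>0$, $E^{r,\ell}(\mathbb R^d)\subset\mathcal S'(\mathbb R^d)$ is a space of tempered distributions containing exactly one representative of each class of $\dot L^\ell_r(\mathbb R^d)$, with norm $\|D^r\phi\|_{L^\ell}$, chosen as follows (fix a ball $B\subset\mathbb R^d$; $\phi_B$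 is the average of $\phi$ on $B$; $P_{\phi;m;0}$ is the Taylor polynomial of $\phi$ of degree $m$ at $0$): if $0<r<d/\ell$, the representative in $L^{d\ell/(d-\ell r)}(\mathbb R^d)$; if $r=d/\ell$, the representative in $\mathrm{BMO}(\mathbb R^d)$ with $\phi_B=0$; if $r>d/\ell$ and $r-d/\ell\notin\mathbb N$, the representative in the homogeneous Lipschitz space $\dot\Lambda^{\gamma}$, $\gamma=r-d/\ell$, (continuous $\phi$ with $\sup_{x,\,h\ne0}|\Delta_h^{m+1}\phi(x)|/|h|^{\gamma}<\infty$, $m=\lfloor\gamma\rfloor$, $\Delta_h\phi(x)=\phi(x+h)-\phi(x)$) with $P_{\phi;m;0}=0$; if $r-d/\ell=m\in\mathbb N=\{1,2,\dots\}$, the representative in $C^{m-1}(\mathbb R^d)$ with $\partial^\alpha\phi\in\mathrm{BMO}$ for all $|\alpha|=m$, $P_{\phi;m-1;0}=0$ and $(\partial^\alpha\phi)_B=0$ for $|\alpha|=m$. Thus $\mathcal X$ is identified isometrically with the space of classes $\psi\in\mathcal S'/\mathcal P$ with $D^r\psi\in L^p$ and $D^{r+s_2}\psi\in L^2$; the functionals $A,B,M,E,P$ depend only on the class. Under the hypotheses $C_*$ is finite, so $B$ is finite on $\mathcal X$. The equation in $\mathcal X'$ (the dual of $\mathcal X$) is meant in the weak sense: for every $\varphi\in\mathcal X$, $$\int D^{r+s_2}\psi_\lambda\,\overline{D^{r+s_2}\varphi}\,dx-\int|D^{s_1-r}\psi_\lambda|^{q-2}D^{s_1-r}\psi_\lambda\,\overline{D^{s_1-r}\varphi}\,dx+\omega_\lambda\int|D^r\psi_\lambda|^{p-2}D^r\psi_\lambda\,\overline{D^r\varphi}\,dx=0.$$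 *)

(* Defs.v *)
From HB Require Import structures.
From mathcomp Require Import all_boot all_order all_algebra.
From mathcomp Require Import complex.
From mathcomp Require Import all_classical all_reals all_analysis.
Set Implicit Arguments.
Unset Strict Implicit.
Unset Printing Implicit Defensive.
Import Order.TTheory GRing.Theory Num.Theory.
Import numFieldNormedType.Exports.
Local Open Scope classical_set_scope.
Local Open Scope ring_scope.

Definition rV_display : measure_display. Proof. by constructor. Qed.

(* The sigma-algebra on R^n generated by the coordinates, that is, the Borel
   sigma-algebra of 'rV[R]_n. *)
Section rV_measurable.
Context (R : realType) (n : nat).

Definition rV_coord (i : 'I_n) (x : 'rV[R]_n) : measurableTypeR R := x ord0 i.

Let rV_set0 : g_sigma_preimage rV_coord set0.
Proof. exact: sigma_algebra0. Qed.

Let rV_setC A : g_sigma_preimage rV_coord A -> g_sigma_preimage rV_coord (~` A).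
Proof. exact: sigma_algebraC. Qed.

Let rV_bigcup (F : (set _)^nat) : (forall i, g_sigma_preimage rV_coord (F i)) ->
  g_sigma_preimage rV_coord (\bigcup_i (F i)).
Proof. exact: sigma_algebra_bigcup. Qed.

HB.instance Definition _ := @isMeasurable.Build rV_display
  'rV[R]_n (g_sigma_preimage rV_coord) rV_set0 rV_setC rV_bigcup.

Lemma measurable_rV_coord i : measurable_fun [set: 'rV[R]_n] (rV_coord i).
Proof.
move=> _ Y mY; rewrite setTI; apply: sub_sigma_algebra => /=.
rewrite -bigcup_seq/=; exists i => /=; first by rewrite mem_index_enum.
by exists Y => //; rewrite setTI.
Qed.

Lemma measurable_fun_rV d (T : measurableType d) (f : T -> 'rV[R]_n) :
  (forall i, measurable_fun [set: T] (rV_coord i \o f)) ->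
  measurable_fun [set: T] f.
Proof.
move=> mf _ Y mY.
suff : g_sigma_preimage rV_coord `<=` image_set_system [set: T] f measurable.
  exact.
apply: smallest_sub.
  by apply: sigma_algebra_image; exact: sigma_algebra_measurable.
rewrite -bigcup_seq => A/= [i _ [B mB <-]].
rewrite /image_set_system/= setTI.
exact: mf.
Qed.

End rV_measurable.

Section leb_step.
Context (R : realType) (n : nat).

Definition rV_cons (z : measurableTypeR R * 'rV[R]_n) : 'rV[R]_n.+1 :=
  row_mx z.1%:M z.2.

Let rV_coord_cons0 z : rV_coord ord0 (rV_cons z) = z.1.
Proof.
rewrite /rV_coord (_ : rV_cons z _ _ = rV_cons z ord0 (lshift n (ord0 : 'I_1))).
  by apply: etrans (row_mxEl _ _ _ _) _; rewrite mxE eqxx mulr1n.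
by congr (rV_cons _ _ _); exact/val_inj.
Qed.

Let rV_coord_consS z (i : 'I_n) : rV_coord (lift ord0 i) (rV_cons z) = rV_coord i z.2.
Proof.
rewrite /rV_coord (_ : rV_cons z _ _ = rV_cons z ord0 (rshift 1 i)).
  exact: row_mxEr.
by congr (rV_cons _ _ _); exact/val_inj.
Qed.

Lemma measurable_rV_cons : measurable_fun setT rV_cons.
Proof.
apply: measurable_fun_rV => i; case: (unliftP ord0 i) => [j ->|->].
- rewrite (_ : _ \o _ = rV_coord j \o snd).
    exact: measurableT_comp (measurable_rV_coord _) measurable_snd.
  by apply/funext => z; exact: rV_coord_consS.
- rewrite (_ : _ \o _ = fst); first exact: measurable_fst.
  by apply/funext => z; exact: rV_coord_cons0.
Qed.

Let rV_uncons (x : 'rV[R]_n.+1) : measurableTypeR R * 'rV[R]_n :=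
  (rV_coord ord0 x, \row_(i < n) rV_coord (lift ord0 i) x).

Let measurable_rV_uncons : measurable_fun setT rV_uncons.
Proof.
apply: measurable_fun_pair; first exact: measurable_rV_coord.
apply: measurable_fun_rV => i.
rewrite (_ : _ \o _ = rV_coord (lift ord0 i)); first exact: measurable_rV_coord.
by apply/funext => x; rewrite /rV_coord/= mxE.
Qed.

Let rV_consK : cancel rV_cons rV_uncons.
Proof.
move=> [a t]; congr pair; first exact: rV_coord_cons0.
by apply/rowP => i; rewrite mxE rV_coord_consS.
Qed.

Let rV_unconsK : cancel rV_uncons rV_cons.
Proof.
move=> x; apply/rowP => i; case: (unliftP ord0 i) => [j ->|->].
- by rewrite -[LHS]/(rV_coord _ _) rV_coord_consS /rV_coord mxE.
- by rewrite -[LHS]/(rV_coord _ _) rV_coord_cons0.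
Qed.

Variable mu : {sigma_finite_measure set 'rV[R]_n -> \bar R}.

Definition leb_succ : set 'rV[R]_n.+1 -> \bar R :=
  pushforward (lebesgue_measure \x mu)%E rV_cons.

Let leb_succ0 : leb_succ set0 = 0%E.
Proof. by rewrite /leb_succ /pushforward preimage_set0 measure0. Qed.

Let leb_succ_ge0 A : (0 <= leb_succ A)%E.
Proof. by rewrite /leb_succ /pushforward. Qed.

Let leb_succ_sigma_additive : semi_sigma_additive leb_succ.
Proof.
move=> F mF tF mUF; rewrite /leb_succ /pushforward preimage_bigcup.
apply: measure_semi_sigma_additive.
- by move=> k; rewrite -[X in measurable X]setTI; exact: measurable_rV_cons.
- apply/trivIsetP => /= i j _ _ ij; rewrite -preimage_setI.
  by move/trivIsetP : tF => /(_ _ _ _ _ ij) ->//; rewrite preimage_set0.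
- by rewrite -preimage_bigcup -[X in measurable X]setTI; exact: measurable_rV_cons.
Qed.

HB.instance Definition _ := isMeasure.Build _ _ _ leb_succ
  leb_succ0 leb_succ_ge0 leb_succ_sigma_additive.

Let leb_succ_sigma_finite : sigma_finite setT leb_succ.
Proof.
have /sigma_finiteP[F [TF ndF Foo]] := sigma_finiteT (@lebesgue_measure R).
have /sigma_finiteP[G [TG ndG Goo]] := sigma_finiteT mu.
exists (fun k => rV_uncons @^-1` (F k `*` G k)).
  apply/esym/seteqP; split=> // x _ /=.
  have [i _ Fi] : (\bigcup_i F i) (rV_uncons x).1 by rewrite -TF.
  have [j _ Gj] : (\bigcup_j G j) (rV_uncons x).2 by rewrite -TG.
  exists (maxn i j) => //; split.
  - by move: Fi; exact/subsetPset/ndF/leq_maxl.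
  - by move: Gj; exact/subsetPset/ndG/leq_maxr.
move=> k; have [mF ltF] := Foo k; have [mG ltG] := Goo k; split.
  rewrite -[X in measurable X]setTI; apply: measurable_rV_uncons => //.
  exact: measurableX.
rewrite /leb_succ /pushforward (_ : _ @^-1` _ = F k `*` G k).
  by rewrite product_measure1E// lte_mul_pinfty// ge0_fin_numE.
by apply/funext => z; rewrite /preimage/= -[in RHS](rV_consK z).
Qed.

HB.instance Definition _ := Measure_isSigmaFinite.Build _ _ _ leb_succ
  leb_succ_sigma_finite.

End leb_step.

(* d-dimensional Lebesgue measure, as the iterated product of the Lebesgue
   measure of R; on R^0 it is the unit mass. *)
Fixpoint leb (R : realType) (n : nat) :
    {sigma_finite_measure set 'rV[R]_n -> \bar R} :=
  match n with
  | 0 => dirac (0 : 'rV[R]_0)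
  | n'.+1 => leb_succ (leb R n')
  end.

Section functions_on_Rd.
Context {R : realType} {d : nat}.
Notation Rd := 'rV[R]_d.
Notation C := R[i].
Implicit Types (f g : Rd -> C) (x xi : Rd) (s : seq 'I_d).

Definition cabs (z : C) : R := Normc.normc z.

Definition dotp x xi : R := \sum_(i < d) x ord0 i * xi ord0 i.

(* Euclidean norm; the library norm of 'rV[R]_d is the sup norm *)
Definition enorm x : R := Num.sqrt (dotp x x).

Definition cint f : C :=
  Complex (\int[leb R d]_x complex.Re (f x))%R (\int[leb R d]_x complex.Im (f x))%R.

Definition cmeasurable f : Prop :=
  measurable_fun [set: Rd] (fun x => complex.Re (f x)) /\
  measurable_fun [set: Rd] (fun x => complex.Im (f x)).

Definition Lpnorm (l : R) f : \bar R :=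
  Lnorm (leb R d) l%:E (fun x => (cabs (f x))%:E).

Definition in_Lp (l : R) f : Prop := cmeasurable f /\ (Lpnorm l f < +oo)%E.

(* [iter_partial [:: i1; ...; ik] f] is d/dx_{i1} ... d/dx_{ik} f *)
Definition partial (i : 'I_d) f : Rd -> C := fun x =>
  Complex ('D_(delta_mx ord0 i) (fun y => complex.Re (f y)) x)
          ('D_(delta_mx ord0 i) (fun y => complex.Im (f y)) x).

Definition iter_partial s f : Rd -> C := foldr partial f s.

Definition smooth f : Prop := forall s x,
  differentiable (fun y => complex.Re (iter_partial s f y)) x /\
  differentiable (fun y => complex.Im (iter_partial s f y)) x.

Definition schwartz_norm (N : nat) f : \bar R :=
  ereal_sup [set ((1 + enorm sx.2) ^+ N * cabs (iter_partial sx.1 f sx.2))%:E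
            | sx in [set sx : seq 'I_d * Rd | (size sx.1 <= N)%N]].

Definition schwartz : set (Rd -> C) :=
  [set f | smooth f /\ forall N, (schwartz_norm N f < +oo)%E].

Definition monomial (a : {ffun 'I_d -> nat}) x : R :=
  \prod_(i < d) x ord0 i ^+ a i.

Definition schwartz0 : set (Rd -> C) :=
  [set f | schwartz f /\ forall a, cint (fun x => (monomial a x)%:C%C * f x) = 0].

Definition cis (t : R) : C := Complex (cos t) (sin t).

Definition fourier f : Rd -> C :=
  fun xi => cint (fun x => cis (- dotp x xi) * f x).

Definition inv_fourier f : Rd -> C :=
  fun x => ((2 * pi) ^- d)%:C%C * cint (fun xi => cis (dotp x xi) * f xi).

Definition Dtest (sigma : R) f : Rd -> C :=
  inv_fourier (fun xi => (enorm xi `^ sigma)%:C%C * fourier f xi).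

End functions_on_Rd.

(* Elements of S'(R^d); only the values on Schwartz functions matter. The
   pairing <u, f> is bilinear. *)
Record tempered (R : realType) (d : nat) := Tempered {
  pairing :> ('rV[R]_d -> R[i]) -> R[i];
  pairing_linear : forall (a : R[i]) f g, schwartz f -> schwartz g ->
    pairing (fun x => a * f x + g x) = a * pairing f + pairing g;
  pairing_continuous : exists (c : R) (N : nat), forall f, schwartz f ->
    ((cabs (pairing f))%:E <= c%:E * schwartz_norm N f)%E
}.

Section classes.
Context {R : realType} {d : nat}.
Notation Rd := 'rV[R]_d.
Notation C := R[i].
Implicit Types (u : tempered R d) (g : Rd -> C).

Definition polynomial_fun (P : Rd -> C) : Prop :=
  exists s : seq (C * {ffun 'I_d -> nat}),
    forall x, P x = \sum_(t <- s) t.1 * (monomial t.2 x)%:C%C.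

(* [u] is the zero class of S'/P. All the notions below depend only on the
   class of [u] in S'/P, of which [u] is a representative. *)
Definition is_polynomial u : Prop :=
  exists2 P, polynomial_fun P &
    forall f, schwartz f -> u f = cint (fun x => P x * f x).

(* the class D^sigma u contains the function [g] of L^l *)
Definition D_represents (sigma l : R) u : set (Rd -> C) :=
  [set g | in_Lp l g /\
           forall f, schwartz0 f -> u (Dtest sigma f) = cint (fun x => g x * f x)].

Definition D_in_Lp (sigma l : R) u : Prop := exists g, D_represents sigma l u g.

(* the representative of D^sigma u in L^l, which is unique a.e. *)
Definition Drep (sigma l : R) u : Rd -> C :=
  xget (fun=> 0) (D_represents sigma l u).

(* ||D^sigma u||_{L^l}, infinite when D^sigma u is not in L^l *)
Definition Dnorm (sigma l : R) u : \bar R :=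
  if `[< D_in_Lp sigma l u >] then Lpnorm l (Drep sigma l u) else +oo%E.

End classes.

Section functionals.
Context {R : realType} {d : nat}.
Variables (p q r s1 s2 theta : R).
Implicit Types (psi phi : tempered R d) (lam omega : R).

(* The space X, as the set of representatives of its classes. *)
Definition Xspace : set (tempered R d) :=
  [set psi | D_in_Lp r p psi /\ D_in_Lp (r + s2) 2 psi].

(* On [Xspace], [A_fun] and [M_fun] are finite by definition; [B_fun] is
   finite there only by the interpolation inequality (finiteness of [C_star]),
   so that all the functionals are valued in the extended reals. *)
Definition A_fun psi : \bar R := (Dnorm (r + s2) 2 psi `^ 2)%E.
Definition B_fun psi : \bar R := (Dnorm (s1 - r) q psi `^ q)%E.
Definition M_fun psi : \bar R := (Dnorm r p psi `^ p)%E.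

Definition E_fun psi : \bar R := (2^-1%:E * A_fun psi - q^-1%:E * B_fun psi)%E.
Definition P_fun psi : \bar R := (A_fun psi - theta%:E * B_fun psi)%E.

Definition S_sphere lam : set (tempered R d) :=
  [set psi | Xspace psi /\ M_fun psi = lam%:E].

Definition P_set lam : set (tempered R d) :=
  [set psi | S_sphere lam psi /\ P_fun psi = 0%E].

Definition minimizer (F : tempered R d -> \bar R) (K : set (tempered R d)) psi :=
  K psi /\ forall phi, K phi -> (F psi <= F phi)%E.

(* |z|^{l-2} z *)
Definition dual_power (l : R) (z : R[i]) : R[i] := (cabs z `^ (l - 2))%:C%C * z.

(* D^{2(r+s2)} psi - D^{s1-r}(|D^{s1-r} psi|^{q-2} D^{s1-r} psi)
     + omega D^r(|D^r psi|^{p-2} D^r psi) = 0 in the dual of X *)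
Definition euler_lagrange omega psi : Prop :=
  forall phi, Xspace phi ->
    cint (fun x => Drep (r + s2) 2 psi x * (Drep (r + s2) 2 phi x)^*%C)
    - cint (fun x => dual_power q (Drep (s1 - r) q psi x)
                     * (Drep (s1 - r) q phi x)^*%C)
    + omega%:C%C * cint (fun x => dual_power p (Drep r p psi x)
                                  * (Drep r p phi x)^*%C) = 0.

End functionals.

Section constants.
Context {R : realType} (d : nat).
Variables (p q r s1 s2 theta : R).

Definition q_0 : R := d%:R * p / (d%:R + p * (s1 - 2 * r)).

Definition q_c : R := 2 * (d%:R + p * s2) / (d%:R + p * (s1 - 2 * r)).

Definition q_S : \bar R :=
  let t := s2 + 2 * r - s1 in
  if (0 < t) && (t < d%:R / 2) then (2 * d%:R / (d%:R - 2 * t))%:E else +oo%E.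

Definition C_star : \bar R :=
  ereal_sup [set (Dnorm (s1 - r) q phi /
                  (Dnorm r p phi `^ (1 - theta) *
                   Dnorm (r + s2) 2 phi `^ theta))%E
            | phi in [set phi : tempered R d | ~ is_polynomial phi /\ Xspace p r s2 phi]].

Definition lambda_star : R :=
  (q / (2 * fine C_star `^ q)) `^ (p / ((1 - theta) * q)).

End constants.

(* Main.v *)
(* Each of the three kinds of minimizers satisfies the Pohozaev identity
   A = theta B and maximizes the Weinstein quotient B / (A^x M^y), where
   x = theta q / 2 and y = (1 - theta) q / p: along the dilations that fix M, A is
   multiplied by mu and B by mu^x, and q < q_c, q = q_c, q > q_c mean x < 1,
   x = 1, x > 1. Differentiating K A^x M^y - B >= 0, an equality at psi_lambda,
   along psi_lambda + t phi and psi_lambda + t i phi gives the equation. Neither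
   C_* nor the bounds q_0 and q_S enter.

   That B is finite on X is an interpolation inequality. With the frequency
   pieces g_j = chi(2^-j D) D^(s1-r) u of a smooth dyadic partition of unity, Jensen's
   inequality bounds |g_j|^p and |g_j|^2 by 2^j-dependent multiples of averages
   of |D^r u|^p and |D^(r+s2) u|^2, so that |g_j|^q has an integral decaying
   geometrically in |j|, and the pieces sum up in L^q.

   Test functions are handled by real and imaginary parts, and the Fourier
   transform is replaced by the Hartley transform, with kernel
   cas = cos + sin, which is real and its own inverse up to (2 pi)^d. *)

Require Import Defs.
From HB Require Import structures.
From mathcomp Require Import all_boot all_order all_algebra.
From mathcomp Require Import complex.
From mathcomp Require Import all_classical all_reals all_analysis.
From mathcomp Require Import measurable_realfun.
From mathcomp Require Import ring lra.
Set Implicit Arguments.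
Unset Strict Implicit.
Unset Printing Implicit Defensive.
Import Order.TTheory GRing.Theory Num.Theory.
Import numFieldNormedType.Exports.
Local Open Scope classical_set_scope.
Local Open Scope ring_scope.

(** * Real-valued integrals and Lebesgue measure on R^d *)

(** The quotient inequality replaces constrained calculus: minimizers of kind (c) obey two
    constraints, while the inequality is invariant under multiples and dilations, so that a free
    derivative in one variable suffices. The three kinds merge because on [A = theta B] the energy
    is [A] times a factor with the sign of x - 1.

    The decay of the pieces comes from |g|^q = (|g|^p)^alpha (|g|^2)^beta. At alpha = (1 - theta) q
    / p, beta = theta q / 2 the scaling relation makes the power of 2^j vanish; raising beta
    slightly for j >= 0 and lowering it for j < 0 gives decay, since s_2 + d/p - d/2 > 0. The
    averages are usable for alpha + beta >= 1, and the room for this is s_1 - 2r < theta s_2.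

    The obstacle is that D^sigma u is known only on S_oo, that is, modulo polynomials: one and the
    same piece arises once from L^p and once from L^2, and the two functions must be shown equal
    almost everywhere. The pairings of L^l functions with low-pass parts of Schwartz functions tend
    to 0, which removes the ambiguity. Estimates are proved for families, uniformly in the dilation
    parameter. *)

Section real_integral.
Context d0 (T : measurableType d0) (R : realType).
Variable mu : {measure set T -> \bar R}.
Implicit Types f g : T -> R.

Definition intg f := mu.-integrable [set: T] (EFin \o f).

Lemma intg_measurable f : intg f -> measurable_fun [set: T] f.
Proof. by move/measurable_int/measurable_EFinP. Qed.

Lemma intg_le f g : measurable_fun [set: T] f -> (forall x, `|f x| <= g x) ->
  intg g -> intg f.
Proof.
move=> mf fg; apply: le_integrable => //; first exact/measurable_EFinP.
by move=> x _ /=; rewrite lee_fin (le_trans (fg x))// ler_norm.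
Qed.

Lemma intgD f g : intg f -> intg g -> intg (fun x => f x + g x).
Proof. by move=> ? ?; exact: (@integrableD _ _ _ mu setT _ (EFin \o f) (EFin \o g)). Qed.

Lemma intgB f g : intg f -> intg g -> intg (fun x => f x - g x).
Proof. by move=> ? ?; exact: (@integrableB _ _ _ mu setT _ (EFin \o f) (EFin \o g)). Qed.

Lemma intgZ (k : R) f : intg f -> intg (fun x => k * f x).
Proof. by move=> ?; exact: (@integrableZl _ _ _ mu setT _ k (EFin \o f)). Qed.

Lemma intg_norm f : intg f -> intg (fun x => `|f x|).
Proof. by move=> fi; exact: (@integrable_norm _ _ _ mu setT f fi). Qed.

Lemma intg0 : intg (fun=> 0).
Proof. exact: (@integrable0 _ _ _ mu setT). Qed.

Lemma intg_sum (I : Type) (s : seq I) (F : I -> T -> R) :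
  (forall i, intg (F i)) -> intg (fun x => \sum_(i <- s) F i x).
Proof.
move=> Fi; elim: s => [|i s IH].
  by under eq_fun do rewrite big_nil; exact: intg0.
by under eq_fun do rewrite big_cons; exact: intgD.
Qed.

Lemma Rint_sum (I : Type) (s : seq I) (F : I -> T -> R) :
  (forall i, intg (F i)) ->
  \int[mu]_x (\sum_(i <- s) F i x) = \sum_(i <- s) \int[mu]_x F i x.
Proof.
move=> Fi; elim: s => [|i s IH].
  under eq_Rintegral do rewrite big_nil.
  by rewrite big_nil Rintegral_cst// mul0r.
under eq_Rintegral do rewrite big_cons.
by rewrite RintegralD ?IH ?big_cons//; [exact: Fi|exact: intg_sum].
Qed.

Lemma RintN f : intg f -> \int[mu]_x (- f x) = - \int[mu]_x f x.
Proof.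
move=> fi; under eq_Rintegral do rewrite -mulN1r.
by rewrite RintegralZl// mulN1r.
Qed.

Lemma Rint_le f g : intg f -> intg g -> (forall x, f x <= g x) ->
  \int[mu]_x f x <= \int[mu]_x g x.
Proof. by move=> fi gi fg; apply: le_Rintegral => // x _; exact: fg. Qed.

Lemma Rint_norm_le f g : intg f -> intg g -> (forall x, `|f x| <= g x) ->
  `|\int[mu]_x f x| <= \int[mu]_x g x.
Proof.
move=> fi gi fg; apply: le_trans (le_normr_Rintegral _ _) _ => //.
by apply: Rint_le => //; exact: intg_norm.
Qed.

Lemma Rint_ge0 f : (forall x, 0 <= f x) -> 0 <= \int[mu]_x f x.
Proof. by move=> f0; exact: Rintegral_ge0. Qed.

Lemma EFin_Rint f : intg f -> (\int[mu]_x f x)%:E = (\int[mu]_x (f x)%:E)%E.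
Proof. by move=> fi; rewrite /Rintegral fineK//; exact: integrable_fin_num. Qed.

Lemma intg_ge0 f : measurable_fun [set: T] f -> (forall x, 0 <= f x) ->
  ((\int[mu]_x (f x)%:E)%E < +oo)%E -> intg f.
Proof.
move=> mf f0 oo; apply/integrableP; split; first exact/measurable_EFinP.
by under eq_integral do rewrite /= ger0_norm//.
Qed.

Lemma eq_ae_Rint f g : measurable_fun [set: T] f -> measurable_fun [set: T] g ->
  {ae mu, forall x, f x = g x} -> \int[mu]_x f x = \int[mu]_x g x.
Proof.
move=> mf mg fg; rewrite /Rintegral; congr fine.
apply: ae_eq_integral => //; [exact/measurable_EFinP|exact/measurable_EFinP|].
by apply: filterS fg => x -> .
Qed.

Lemma ae_eq0_Rint f : intg f -> (forall x, 0 <= f x) -> \int[mu]_x f x = 0 ->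
  {ae mu, forall x, f x = 0}.
Proof.
move=> fi f0 If.
have mf := intg_measurable fi.
have : (\int[mu]_(x in setT) `|(EFin \o f) x| = 0)%E.
  under eq_integral do rewrite /= ger0_norm//.
  by rewrite -EFin_Rint// If.
move/(ae_eq_integral_abs mu measurableT ((measurable_EFinP setT f).2 mf)).
by apply: filterS => x /(_ Logic.I) [].
Qed.

Lemma dct_Rint (f_ : (T -> R)^nat) f g :
  (forall n, measurable_fun [set: T] (f_ n)) -> measurable_fun [set: T] f ->
  {ae mu, forall x, f_ n x @[n --> \oo] --> f x} -> intg g ->
  (forall n x, `|f_ n x| <= g x) ->
  intg f /\ (\int[mu]_x f_ n x @[n --> \oo] --> \int[mu]_x f x).
Proof.
move=> mf_ mf cf gi fg.
have [|||||fi _ c] := @dominated_convergence _ _ _ mu setT measurableT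
   (fun n => EFin \o f_ n) (EFin \o f) (EFin \o g).
- by move=> n; exact/measurable_EFinP.
- exact/measurable_EFinP.
- apply: filterS cf => x cx _; apply/cvg_EFin; last exact: cx.
  by apply: nearW.
- exact: gi.
- by apply: aeW => x n _ /=; rewrite lee_fin.
split=> //.
by apply: fine_cvg; rewrite EFin_Rint//; exact: c.
Qed.

End real_integral.

(** * Fubini's theorem for real-valued integrals *)

Section real_fubini.
Context d1 d2 (T1 : measurableType d1) (T2 : measurableType d2) (R : realType).
Variable m1 : {sigma_finite_measure set T1 -> \bar R}.
Variable m2 : {sigma_finite_measure set T2 -> \bar R}.
Variable f : T1 * T2 -> R.

(** The bound [g] on the fibre norms makes [f] jointly integrable by Tonelli. As [Rintegral] is
    total, the integral in the second order is an integrable function of [y] although its fibres are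
    integrable only almost everywhere. *)
Lemma Rfubini (g : T1 -> R) : measurable_fun [set: T1 * T2] f ->
  (forall x, intg m2 (fun y => f (x, y))) -> intg m1 g ->
  (forall x, \int[m2]_y `|f (x, y)| <= g x) ->
  [/\ intg (m1 \x m2)%E f,
      intg m1 (fun x => \int[m2]_y f (x, y)),
      {ae m2, forall y, intg m1 (fun x => f (x, y))},
      intg m2 (fun y => \int[m1]_x f (x, y)) &
      \int[m1]_x \int[m2]_y f (x, y) = \int[(m1 \x m2)%E]_z f z /\
      \int[m2]_y \int[m1]_x f (x, y) = \int[(m1 \x m2)%E]_z f z].
Proof.
move=> mf fi gi fg.
have mfE : measurable_fun [set: T1 * T2] (EFin \o f) by exact/measurable_EFinP.
have fi2 : (m1 \x m2)%E.-integrable [set: T1 * T2] (EFin \o f).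
  apply/(integrable12ltyP m1 m2 mfE).
  have /integrableP[_] := gi; apply: le_lt_trans.
  apply: ge0_le_integral => //.
  - by move=> x _; exact: integral_ge0.
  - apply: (@measurable_fun_fubini_tonelli_F _ _ _ _ _ m2
      (fun z => `|(EFin \o f) z|%E)) => //.
    exact: measurableT_comp.
  - by apply: measurableT_comp => //; exact: measurable_int gi.
  - move=> x _ /=; rewrite -(EFin_Rint (intg_norm (fi x))) lee_fin.
    by rewrite (le_trans (fg x))// ler_norm.
have F1 := integrable_fubini_F fi2.
have mG1 := measurable_fubini_G fi2.
have G1 : m2.-integrable setT (fubini_G m1 (EFin \o f)).
  apply/integrableP; split=> //.
  apply: le_lt_trans ((integrable21ltyP m1 m2 mfE).1 fi2).
  apply: ge0_le_integral => //.
  - exact: measurableT_comp.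
  - apply: (@measurable_fun_fubini_tonelli_G _ _ _ _ _ m1
      (fun z => `|(EFin \o f) z|%E)) => //.
    exact: measurableT_comp.
  - move=> y _; apply: le_abse_integral => //.
    by apply: measurableT_comp => //; exact: pair2_measurable.
have EF : fubini_F m2 (EFin \o f) = EFin \o (fun x => \int[m2]_y f (x, y)).
  by apply/funext => x /=; rewrite EFin_Rint//; exact: fi.
have aeG := ae_integrable2 fi2.
have aeGE : {ae m2, forall y, fubini_G m1 (EFin \o f) y =
     (EFin \o (fun y => \int[m1]_x f (x, y))) y}.
  by apply: filterS aeG => y yi /=; rewrite EFin_Rint.
have mG : measurable_fun [set: T2] (fun y => \int[m1]_x f (x, y)).
  apply: (measurableT_comp (@fine_measurable R setT measurableT)).
  exact: measurable_int G1.
have Gi : intg m2 (fun y => \int[m1]_x f (x, y)).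
  apply/integrableP; split; first exact/measurable_EFinP.
  move/integrableP : G1 => [_]; congr (_ < _)%E; apply: ae_eq_integral => //.
  - exact: measurableT_comp.
  - by apply: measurableT_comp => //; exact/measurable_EFinP.
  - by apply: filterS aeGE => y ->.
split=> //; first by rewrite /intg -EF.
split.
  by rewrite /Rintegral -(integral12_prod_meas1 fi2) EF.
rewrite /Rintegral -(integral21_prod_meas1 fi2); congr fine.
apply: ae_eq_integral => //.
- exact/measurable_EFinP.
- by apply: filterS aeGE => y ->.
Qed.

End real_fubini.

(** * Change of variables, product integrals and open sets for [leb] *)

Section leb_theory.
Context {R : realType}.
Local Notation Rd d := 'rV[R]_d.

Lemma coord_rV_cons0 d (z : measurableTypeR R * Rd d) : rV_cons z ord0 ord0 = z.1.
Proof.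
rewrite (_ : rV_cons z _ _ = rV_cons z ord0 (lshift d (ord0 : 'I_1))).
  by apply: etrans (row_mxEl _ _ _ _) _; rewrite mxE eqxx mulr1n.
by congr (rV_cons _ _ _); exact/val_inj.
Qed.

Lemma coord_rV_consS d (z : measurableTypeR R * Rd d) (i : 'I_d) :
  rV_cons z ord0 (lift ord0 i) = z.2 ord0 i.
Proof.
rewrite (_ : rV_cons z _ _ = rV_cons z ord0 (rshift 1 i)); first exact: row_mxEr.
by congr (rV_cons _ _ _); exact/val_inj.
Qed.

Lemma measurable_coord d (i : 'I_d) : measurable_fun [set: Rd d] (fun x : Rd d => x ord0 i).
Proof. exact: (@measurable_rV_coord R d i). Qed.

Lemma ge0_integral_leb_succ d (f : Rd d.+1 -> \bar R) :
  measurable_fun [set: Rd d.+1] f -> (forall x, 0 <= f x)%E ->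
  (\int[leb R d.+1]_x f x =
   \int[lebesgue_measure]_s \int[leb R d]_y f (rV_cons (s, y)))%E.
Proof.
move=> mf f0.
rewrite -(@fubini_tonelli1 _ _ _ _ _ lebesgue_measure (leb R d)
  (f \o @rV_cons R d)); last 2 first.
- by apply: measurableT_comp mf _; exact: measurable_rV_cons.
- by move=> x; exact: f0.
rewrite -[RHS](@ge0_integral_pushforward _ _ _ _ R _ (@measurable_rV_cons R d) _ setT f)//.
Qed.

(** The image of Lebesgue measure under the affine map, scaled by |b|, agrees with Lebesgue measure
    on half-open intervals, and these determine it. *)
Lemma leb_affine1 (b a : R) (f : measurableTypeR R -> \bar R) : b != 0 ->
  measurable_fun [set: measurableTypeR R] f -> (forall x, 0 <= f x)%E ->
  (\int[lebesgue_measure]_s f s =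
   `|b|%:E * \int[lebesgue_measure]_s f (b * s + a)%R)%E.
Proof.
move=> b0 mf f0.
pose phi (s : measurableTypeR R) : measurableTypeR R := b * s + a.
have mphi : measurable_fun [set: measurableTypeR R] phi.
  apply: (@measurable_funD _ _ _ setT (fun s : measurableTypeR R => b * s) (cst a)) => //.
  exact: (@measurable_funM _ _ _ setT (cst b) id).
have bn : (0 <= `|b|)%R by [].
pose m := mscale (NngNum bn) (measure_function_pushforward__canonical__measure_function_Measure lebesgue_measure mphi).
have -> : (\int[lebesgue_measure]_s f s = \int[m]_s f s)%E.
  apply: eq_measure_integral => A mA _.
  apply: (@lebesgue_measure_unique R m _ A mA) => X /ocitvP[->|[[x y]/= xy ->]].
    by rewrite !measure0.
  rewrite [RHS]/mscale/= /pushforward/= lebesgue_measure_itv/= lte_fin xy.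
  have [bp|bneg] : 0 < b \/ b < 0 by move: b0; rewrite neq_lt => /orP[]; auto.
    have -> : phi @^-1` `]x, y] = `](x - a) / b, (y - a) / b]%classic.
      apply/seteqP; split => s /=; rewrite !in_itv/= /phi ltr_pdivrMr// ler_pdivlMr//;
        lra.
    rewrite lebesgue_measure_itv/= lte_fin ltr_pM2r ?invr_gt0// ltrD2r xy.
    by rewrite -!EFinD -EFinM gtr0_norm//; congr EFin; field.
  (* A decreasing map exchanges the open and the closed end; the length does not notice. *)
  have -> : phi @^-1` `]x, y] = `[(y - a) / b, (x - a) / b[%classic.
    apply/seteqP; split => s /=; rewrite !in_itv/= /phi ltr_ndivlMr// ler_ndivrMr//;
        lra.
  rewrite lebesgue_measure_itv/= lte_fin ltr_nM2r ?invr_lt0// ltrD2r xy.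
  by rewrite -!EFinD -EFinM ltr0_norm//; congr EFin; field.
rewrite ge0_integral_mscale//; congr (_ * _)%E.
by rewrite ge0_integral_pushforward.
Qed.

Lemma measurable_affine d (b : R) (a : Rd d) :
  measurable_fun [set: Rd d] (fun x : Rd d => b *: x + a).
Proof.
apply: measurable_fun_rV => i.
rewrite (_ : _ \o _ = fun x : Rd d => b * x ord0 i + a ord0 i); last first.
  by apply/funext => x; rewrite /rV_coord/= !mxE.
apply: (@measurable_funD _ _ _ setT _ (cst (a ord0 i))) => //.
by apply: (@measurable_funM _ _ _ setT (cst b)) => //; exact: measurable_coord.
Qed.

(** Induction on the dimension: Tonelli splits off the first coordinate, to which [leb_affine1]
    applies. *)
Lemma leb_affine_ge0 d (b : R) (a : Rd d) (f : Rd d -> \bar R) : b != 0 ->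
  measurable_fun [set: Rd d] f -> (forall x, 0 <= f x)%E ->
  (\int[leb R d]_x f x =
   (`|b| ^+ d)%:E * \int[leb R d]_x f (b *: x + a)%R)%E.
Proof.
move=> b0; elim: d a f => [|d IH] a f mf f0.
  rewrite expr0 mul1e; apply: eq_integral => x _; congr f.
  by apply/rowP; case.
have mfb : measurable_fun [set: Rd d.+1] (fun x => f (b *: x + a)).
  by apply: measurableT_comp => //; exact: measurable_affine.
rewrite [in LHS]ge0_integral_leb_succ// [in RHS]ge0_integral_leb_succ//.
pose a' : Rd d := \row_i a ord0 (lift ord0 i).
have mfc : measurable_fun [set: measurableTypeR R * Rd d] (f \o @rV_cons R d).
  exact: measurableT_comp (@measurable_rV_cons R d).
have mfs s : measurable_fun [set: Rd d] (fun y => f (rV_cons (s, y))).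
  exact: measurableT_comp mfc (pair1_measurable s).
have E s y : b *: rV_cons (s, y) + a = rV_cons (b * s + a ord0 ord0, b *: y + a').
  apply/rowP => i; rewrite 2!mxE; case: (unliftP ord0 i) => [j ->|->].
    by rewrite !coord_rV_consS /= !mxE.
  by rewrite !coord_rV_cons0.
under [in RHS]eq_integral do under eq_integral do rewrite E.
rewrite exprS EFinM -muleA.
rewrite (@leb_affine1 b (a ord0 ord0)) //; last 2 first.
- by apply: (@measurable_fun_fubini_tonelli_F _ _ _ _ _ (leb R d) (f \o @rV_cons R d) mfc) => z; exact: f0.
- by move=> s; exact: integral_ge0.
congr (_ * _)%E; rewrite -ge0_integralZl//; last 2 first.
- rewrite (_ : (fun s => _) = fubini_F (leb R d) (fun z => f (b *: rV_cons z + a))).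
    apply: measurable_fun_fubini_tonelli_F => [|z]; last exact: f0.
    exact: measurableT_comp mfb (@measurable_rV_cons R d).
  by apply/funext => s; apply: eq_integral => y _; rewrite E.
- by move=> s _; exact: integral_ge0.
by apply: eq_integral => s _; rewrite [LHS](IH a').
Qed.

Lemma intg_affine d (b : R) (a : Rd d) (f : Rd d -> R) : b != 0 ->
  intg (leb R d) f -> intg (leb R d) (fun x => f (b *: x + a)).
Proof.
move=> b0 fi; have mf := intg_measurable fi.
have mfb : measurable_fun [set: Rd d] (fun x => f (b *: x + a)).
  by apply: measurableT_comp mf _; exact: measurable_affine.
apply/integrableP; split; first exact/measurable_EFinP.
have /integrableP[_] := fi.
rewrite (leb_affine_ge0 a b0); last 2 first.
- by apply: measurableT_comp => //; exact/measurable_EFinP.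
- by move=> x; exact: abse_ge0.
move=> H; rewrite ltNge leye_eq; apply: contraTN H => /eqP /= ->.
by rewrite gt0_muley ?ltxx// lte_fin exprn_gt0// normr_gt0.
Qed.

Lemma Rint_affine d (b : R) (a : Rd d) (f : Rd d -> R) : b != 0 ->
  intg (leb R d) f ->
  \int[leb R d]_x f x = `|b| ^+ d * \int[leb R d]_x f (b *: x + a).
Proof.
move=> b0.
have P g : intg (leb R d) g -> (forall x, 0 <= g x) ->
    \int[leb R d]_x g x = `|b| ^+ d * \int[leb R d]_x g (b *: x + a).
  move=> gi g0; apply/EFin_inj; rewrite EFinM EFin_Rint// EFin_Rint; last exact: intg_affine.
  apply: (@leb_affine_ge0 d b a (EFin \o g)) => //.
  by apply/measurable_EFinP; exact: intg_measurable gi.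
move=> fi.
have mf := intg_measurable fi.
pose f1 x := Num.max (f x) 0; pose f2 x := Num.max (- f x) 0.
have fE x : f x = f1 x - f2 x by rewrite /f1 /f2 !maxEle; do 2 case: ifPn; rewrite -?ltNge; lra.
have f1i : intg (leb R d) f1.
  apply: (intg_le _ _ (intg_norm fi)).
    exact: (@measurable_maxr _ _ _ setT f (cst 0)).
  by move=> x; rewrite /f1 maxEle; case: ifPn => // _; rewrite normr0.
have f2i : intg (leb R d) f2.
  apply: (intg_le _ _ (intg_norm fi)).
    apply: (@measurable_maxr _ _ _ setT (fun x => - f x) (cst 0)) => //.
    exact: measurable_funN.
  by move=> x; rewrite /f2 maxEle; case: ifPn => // _; rewrite ?normr0 ?normrN.
under eq_Rintegral do rewrite fE.
under [in RHS]eq_Rintegral do rewrite fE.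
rewrite RintegralB// RintegralB//; [|exact: intg_affine|exact: intg_affine].
by rewrite mulrBr -!P// => x; rewrite /f1 /f2 le_max lexx orbT.
Qed.

Lemma intg_shift d (a : Rd d) (f : Rd d -> R) :
  intg (leb R d) f -> intg (leb R d) (fun x => f (x + a)).
Proof.
move=> fi; have := @intg_affine d 1 a f (oner_neq0 _) fi.
by under eq_fun do rewrite scale1r.
Qed.

Lemma Rint_shift d (a : Rd d) (f : Rd d -> R) : intg (leb R d) f ->
  \int[leb R d]_x f (x + a) = \int[leb R d]_x f x.
Proof.
move=> fi; rewrite (@Rint_affine d 1 a f (oner_neq0 _) fi) normr1 expr1n mul1r.
by under [in RHS]eq_Rintegral do rewrite scale1r.
Qed.

Let N10 : (-1 : R) != 0. Proof. by rewrite oppr_eq0 oner_eq0. Qed.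

Lemma intg_reflect d (a : Rd d) (f : Rd d -> R) :
  intg (leb R d) f -> intg (leb R d) (fun x => f (a - x)).
Proof.
move=> fi; have := @intg_affine d (-1) a f N10 fi.
by under eq_fun do rewrite scaleN1r addrC.
Qed.

Lemma Rint_reflect d (a : Rd d) (f : Rd d -> R) : intg (leb R d) f ->
  \int[leb R d]_x f (a - x) = \int[leb R d]_x f x.
Proof.
move=> fi; rewrite (@Rint_affine d (-1) a f N10 fi).
rewrite normrN1 expr1n mul1r.
by under [in RHS]eq_Rintegral do rewrite scaleN1r addrC.
Qed.

Lemma Rint_odd d (f : Rd d -> R) : intg (leb R d) f ->
  (forall x, f (- x) = - f x) -> \int[leb R d]_x f x = 0.
Proof.
move=> fi fodd; have := Rint_reflect 0 fi.
under eq_Rintegral do rewrite sub0r fodd.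
by rewrite RintN// => /eqP; rewrite eq_sym -addr_eq0 -mulr2n mulrn_eq0 => /eqP.
Qed.

(** Product integrals are computed one coordinate at a time with this. With [d = 0] and [h] constant
    it also carries statements about [leb] over to the line. *)
Lemma intg_tensor d (g : R -> R) (h : Rd d -> R) :
  intg lebesgue_measure (g : measurableTypeR R -> R) -> intg (leb R d) h ->
  let F (x : Rd d.+1) := g (x ord0 ord0) * h (\row_i x ord0 (lift ord0 i)) in
  intg (leb R d.+1) F /\
  \int[leb R d.+1]_x F x =
    \int[lebesgue_measure]_s (g : measurableTypeR R -> R) s * \int[leb R d]_y h y.
Proof.
move=> gi hi F.
have mg := intg_measurable gi; have mh := intg_measurable hi.
pose f (z : measurableTypeR R * Rd d) := g z.1 * h z.2.
have mf : measurable_fun [set: measurableTypeR R * Rd d] f.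
  apply: measurable_funM; first exact: measurableT_comp mg measurable_fst.
  exact: measurableT_comp mh measurable_snd.
have FE : F \o @rV_cons R d = f.
  apply/funext => -[s y]; rewrite /F /f /= coord_rV_cons0; congr (_ * h _).
  by apply/rowP => i; rewrite mxE coord_rV_consS.
have mF : measurable_fun [set: Rd d.+1] F.
  apply: measurable_funM.
    exact: measurableT_comp mg (@measurable_coord d.+1 ord0).
  apply: measurableT_comp mh _; apply: measurable_fun_rV => i.
  rewrite (_ : _ \o _ = fun x : Rd d.+1 => x ord0 (lift ord0 i)).
    exact: measurable_coord.
  by apply/funext => x; rewrite /rV_coord /= mxE.
have [||||fi _ _ _ [fE _]] := @Rfubini _ _ _ _ R lebesgue_measure (leb R d) f
   (fun s => `|g s| * \int[leb R d]_y `|h y|).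
- exact: mf.
- by move=> s; exact: (@intgZ _ _ _ (leb R d) (g s) h).
- under eq_fun do rewrite mulrC.
  by apply: intgZ; exact: intg_norm.
- move=> s; under eq_Rintegral do rewrite /f /= normrM.
  by rewrite RintegralZl//; exact: intg_norm.
have mFE : measurable_fun [set: Rd d.+1] (EFin \o F) by exact/measurable_EFinP.
have Fi2 : (lebesgue_measure \x leb R d)%E.-integrable (@rV_cons R d @^-1` setT)
    ((EFin \o F) \o @rV_cons R d).
  by rewrite -compA FE.
split; first exact: (integrable_pushforward (@measurable_rV_cons R d) mFE Fi2).
have -> : \int[leb R d.+1]_x F x = \int[(lebesgue_measure \x leb R d)%E]_z f z.
  rewrite /Rintegral; congr fine.
  rewrite [LHS](integral_pushforward (@measurable_rV_cons R d) mFE Fi2)//.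
  by rewrite -compA FE.
rewrite -fE; under eq_Rintegral do rewrite /f /= RintegralZl//.
by rewrite RintegralZr.
Qed.

Let leb0T : leb R 0 setT = 1%E. Proof. exact: diracT. Qed.

Lemma intg_leb0 (h : Rd 0 -> R) : intg (leb R 0) h.
Proof.
rewrite (_ : h = cst (h 0)); last by apply/funext => x; congr h; apply/rowP; case.
apply/integrableP; split; first exact/measurable_EFinP.
rewrite [X in (X < _)%E](_ : _ = \int[leb R 0]_x cst `|h 0|%:E x)%E//.
rewrite integral_cst//; apply: (@le_lt_trans _ _ (`|h 0|%:E * 1)%E); last by rewrite mule1 ltry.
by rewrite -leb0T.
Qed.

Lemma Rint_leb0 (h : Rd 0 -> R) : \int[leb R 0]_x h x = h 0.
Proof.
rewrite [X in Rintegral _ _ X](_ : h = cst (h 0)).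
  transitivity (h 0 * fine (leb R 0 setT)); first exact: Rintegral_cst.
  by rewrite leb0T mulr1.
by apply/funext => x; congr h; apply/rowP; case.
Qed.

Lemma intg_prod d (g : 'I_d -> R -> R) :
  (forall i, intg lebesgue_measure (g i : measurableTypeR R -> R)) ->
  intg (leb R d) (fun x => \prod_i g i (x ord0 i)) /\
  \int[leb R d]_x \prod_i g i (x ord0 i) =
    \prod_i \int[lebesgue_measure]_s (g i : measurableTypeR R -> R) s.
Proof.
elim: d g => [|d IH] g gi.
  by split; [exact: intg_leb0|rewrite Rint_leb0 !big_ord0].
have [hi hE] := IH (fun i => g (lift ord0 i)) (fun i => gi _).
have [Fi FE] := intg_tensor (gi ord0) hi.
have E : (fun x : Rd d.+1 => g ord0 (x ord0 ord0) *
    \prod_i g (lift ord0 i) ((\row_i x ord0 (lift ord0 i)) ord0 i)) =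
    fun x => \prod_i g i (x ord0 i).
  apply/funext => x; rewrite big_ord_recl; congr (_ * _).
  by apply: eq_bigr => i _; rewrite mxE.
by rewrite -E; split=> //; rewrite FE hE [in RHS]big_ord_recl.
Qed.

(** The addition formulas split off one coordinate, and every term that contains a sine factor
    integrates to 0. *)
Lemma Rint_prod_cos d (g : 'I_d -> R -> R) (z : Rd d) :
  (forall i, intg lebesgue_measure (g i : measurableTypeR R -> R)) ->
  (forall i, \int[lebesgue_measure]_s (g i s * sin (z ord0 i * s)) = 0) ->
  \int[leb R d]_x (\prod_i g i (x ord0 i) * cos (dotp z x)) =
    \prod_i \int[lebesgue_measure]_s (g i s * cos (z ord0 i * s)) /\
  \int[leb R d]_x (\prod_i g i (x ord0 i) * sin (dotp z x)) = 0.
Proof.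
have mtrig (h : R -> R) (c : R) : continuous h ->
    measurable_fun [set: measurableTypeR R] (fun s : measurableTypeR R => h (c * s)).
  move=> ch; apply: measurableT_comp; first exact: continuous_measurable_fun.
  exact: (@measurable_funM _ _ _ setT (cst c) id).
have trigi (k h : R -> R) (c : R) : continuous h -> (forall s, `|h s| <= 1) ->
    intg lebesgue_measure (k : measurableTypeR R -> R) ->
    intg lebesgue_measure (fun s : measurableTypeR R => k s * h (c * s)).
  move=> ch h1 ki; apply: (intg_le _ _ (intg_norm ki)).
    by apply: measurable_funM; [exact: intg_measurable ki|exact: mtrig].
  by move=> s; rewrite normrM ler_piMr.
have cos1 (s : R) : `|cos s| <= 1 by rewrite ler_norml cos_geN1 cos_le1.
have sin1 (s : R) : `|sin s| <= 1 by rewrite ler_norml sin_geN1 sin_le1.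
elim: d g z => [|d IH] g z gi gs.
  by rewrite !Rint_leb0 !big_ord0 /dotp big_ord0 cos0 sin0 mulr1 mulr0.
pose z' : Rd d := \row_i z ord0 (lift ord0 i).
have [||IHc IHs] := IH (fun i => g (lift ord0 i)) z'.
- by move=> i; exact: gi.
- by move=> i; rewrite mxE; exact: gs.
have [hi hE] := intg_prod (fun i => gi (lift ord0 i)).
have mdot : measurable_fun [set: Rd d] (fun y : Rd d => dotp z' y).
  apply: measurable_sum => i; apply: (@measurable_funM _ _ _ setT (cst (z' ord0 i))) => //.
  exact: measurable_coord.
have hti (h : R -> R) : continuous h -> (forall s, `|h s| <= 1) ->
    intg (leb R d) (fun y => \prod_i g (lift ord0 i) (y ord0 i) * h (dotp z' y)).
  move=> ch h1; apply: (intg_le _ _ (intg_norm hi)).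
    apply: measurable_funM; first exact: intg_measurable hi.
    by apply: measurableT_comp mdot; exact: continuous_measurable_fun.
  by move=> s; rewrite normrM ler_piMr.
have dE (x : Rd d.+1) : dotp z x = z ord0 ord0 * x ord0 ord0 +
    dotp z' (\row_i x ord0 (lift ord0 i)).
  rewrite /dotp big_ord_recl; congr (_ + _); apply: eq_bigr => i _.
  by rewrite !mxE.
have pE (x : Rd d.+1) : \prod_i g i (x ord0 i) = g ord0 (x ord0 ord0) *
    \prod_i g (lift ord0 i) ((\row_i x ord0 (lift ord0 i)) ord0 i).
  by rewrite big_ord_recl; congr (_ * _); apply: eq_bigr => i _; rewrite mxE.
have [ccos csin] := (@continuous_cos R, @continuous_sin R).
have [F1 E1] := intg_tensor (trigi _ _ (z ord0 ord0) ccos cos1 (gi ord0)) (hti _ ccos cos1).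
have [F2 E2] := intg_tensor (trigi _ _ (z ord0 ord0) csin sin1 (gi ord0)) (hti _ csin sin1).
have [F3 E3] := intg_tensor (trigi _ _ (z ord0 ord0) csin sin1 (gi ord0)) (hti _ ccos cos1).
have [F4 E4] := intg_tensor (trigi _ _ (z ord0 ord0) ccos cos1 (gi ord0)) (hti _ csin sin1).
split.
  under eq_Rintegral do rewrite pE dE cosD mulrBr mulrACA [X in _ - X]mulrACA.
  by rewrite RintegralB// E1 E2 IHc IHs mulr0 subr0 big_ord_recl; under eq_bigr do rewrite mxE.
under eq_Rintegral do rewrite pE dE sinD mulrDr mulrACA [X in _ + X]mulrACA.
by rewrite RintegralD// E3 E4 gs IHs mul0r mulr0 addr0.
Qed.

(** The sigma-algebra is generated by the coordinates, so an open set has to be exhibited as a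
    countable union of measurable sets: the boxes [box q k] with rational centre and radius 1/(k+1)
    that it contains, enumerated through [unpickle]. *)
Lemma open_measurable_rV d (U : set (Rd d)) : open U -> measurable U.
Proof.
move=> oU.
pose box (q : 'rV[rat]_d) (k : nat) : set (Rd d) :=
  [set y | forall i, `|ratr (q ord0 i) - y ord0 i| < k.+1%:R^-1].
have mbox q k : measurable (box q k).
  rewrite (_ : box q k = \bigcap_(i in [set: 'I_d])
      [set y : Rd d | `|ratr (q ord0 i) - y ord0 i| < k.+1%:R^-1]).
    apply: fin_bigcap_measurable => // i _.
    have mi : measurable_fun [set: Rd d] (fun y : Rd d => `|ratr (q ord0 i) - y ord0 i|).
      apply: measurableT_comp => //; apply: measurable_funB => //; exact: measurable_coord.
    have := mi measurableT _ (measurable_itv `]-oo, k.+1%:R^-1[).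
    by rewrite setTI; congr (measurable _); apply/seteqP; split => y /=; rewrite in_itv.
  apply/seteqP; split => y yB; first by move=> i _; exact: yB.
  by move=> i; exact: yB.
pose F n : set (Rd d) := if @unpickle ('rV[rat]_d * nat)%type n is Some p then
  (if `[< box p.1 p.2 `<=` U >] then box p.1 p.2 else set0) else set0.
rewrite (_ : U = \bigcup_n F n).
  apply: bigcupT_measurable => n; rewrite /F; case: unpickle => // p.
  by case: ifP => // _; exact: mbox.
apply/seteqP; split => [x Ux|x [n _]]; last first.
  by rewrite /F; case: unpickle => // p; case: ifPn => // /asboolP; exact.
have /nbhs_ballP[e /= e0 eU] := open_nbhs_nbhs (conj oU Ux).
have [k ke] : exists k : nat, k.+1%:R^-1 < e / 2.
  by have [k _ /(_ _ (leqnn k))] := near_infty_natSinv_lt (PosNum (divr_gt0 e0 (ltr0n R 2))); exists k.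
have [q qx] : exists q : 'rV[rat]_d, forall i, `|ratr (q ord0 i) - x ord0 i| < k.+1%:R^-1.
  have H (i : 'I_d) : exists r : rat, `|ratr r - x ord0 i| < k.+1%:R^-1.
    have [|r] := @rat_in_itvoo R (x ord0 i) (x ord0 i + k.+1%:R^-1).
      by rewrite ltrDl invr_gt0.
    rewrite in_itv/= => /andP[r1 r2]; exists r.
    by rewrite gtr0_norm ?subr_gt0// ltrBlDl.
  exists (\row_i xget 0 [set r : rat | `|ratr r - x ord0 i| < k.+1%:R^-1]) => i.
  rewrite mxE; have [r rP] := H i.
  by have := @xgetPex _ 0 [set r : rat | `|ratr r - x ord0 i| < k.+1%:R^-1]; apply; exists r.
exists (pickle (q, k)) => //; rewrite /F pickleK /=.
rewrite ifT//; apply/asboolP => y yb; apply: eU.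
rewrite /ball/= /mx_ball; split=> // i j; rewrite ord1 {i}.
rewrite /ball/= (_ : _ - _ = (x ord0 j - ratr (q ord0 j)) + (ratr (q ord0 j) - y ord0 j)); last by ring.
apply: le_lt_trans (ler_normD _ _) _; rewrite distrC.
by rewrite [ltRHS]splitr ltrD// (lt_trans _ ke).
Qed.

Lemma continuous_measurable_rV d (f : Rd d -> R) :
  continuous f -> measurable_fun [set: Rd d] f.
Proof.
move=> cf; apply: (measurability _ (RGenOInfty.measurableE R)) => _ /= [_ [x ->] <-].
rewrite setTI; apply: open_measurable_rV; exact: open_comp.
Qed.

End leb_theory.

(** * Families of smooth functions with uniform bounds *)

Section euclidean_norm.
Context {R : realType} {d : nat}.
Local Notation Rd := 'rV[R]_d.
Implicit Types x y h : Rd.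

Lemma dotpC x y : dotp x y = dotp y x.
Proof. by apply: eq_bigr => i _; rewrite mulrC. Qed.

Lemma dotpDl x y h : dotp (x + y) h = dotp x h + dotp y h.
Proof. by rewrite /dotp -big_split; apply: eq_bigr => i _; rewrite mxE mulrDl. Qed.

Lemma dotpDr x y h : dotp h (x + y) = dotp h x + dotp h y.
Proof. by rewrite dotpC dotpDl dotpC (dotpC h y). Qed.

Lemma dotpZl a x y : dotp (a *: x) y = a * dotp x y.
Proof. by rewrite /dotp mulr_sumr; apply: eq_bigr => i _; rewrite mxE mulrA. Qed.

Lemma dotpZr a x y : dotp x (a *: y) = a * dotp x y.
Proof. by rewrite dotpC dotpZl dotpC. Qed.

Lemma dotpNl x y : dotp (- x) y = - dotp x y.
Proof. by rewrite -scaleN1r dotpZl mulN1r. Qed.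

Lemma dotpNr x y : dotp x (- y) = - dotp x y.
Proof. by rewrite dotpC dotpNl dotpC. Qed.

Lemma dotp_ge0 x : 0 <= dotp x x.
Proof. by apply: sumr_ge0 => i _; rewrite -expr2 sqr_ge0. Qed.

Lemma enorm_ge0 x : 0 <= enorm x.
Proof. exact: sqrtr_ge0. Qed.

Lemma sqr_enorm x : enorm x ^+ 2 = dotp x x.
Proof. by rewrite sqr_sqrtr// dotp_ge0. Qed.

Lemma ler_coord_enorm x i : `|x ord0 i| <= enorm x.
Proof.
rewrite -(@ler_pXn2r _ 2)// ?nnegrE ?enorm_ge0// sqr_enorm real_normK ?num_real//.
rewrite /dotp (bigD1 i)//= -expr2 lerDl sumr_ge0// => j _.
by rewrite -expr2 sqr_ge0.
Qed.

Lemma enormZ a x : enorm (a *: x) = `|a| * enorm x.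
Proof. by rewrite /enorm dotpZl dotpZr mulrA -expr2 sqrtrM ?sqr_ge0// sqrtr_sqr. Qed.

Lemma enormN x : enorm (- x) = enorm x.
Proof. by rewrite -scaleN1r enormZ normrN1 mul1r. Qed.

Lemma enorm_eq0 x : (enorm x == 0) = (x == 0).
Proof.
apply/eqP/eqP => [x0|->]; last by rewrite -[0](scale0r 0) enormZ normr0 mul0r.
apply/rowP => i; rewrite mxE; apply/eqP; rewrite -normr_le0 -x0.
exact: ler_coord_enorm.
Qed.

Lemma enorm0 : enorm (0 : Rd) = 0.
Proof. by apply/eqP; rewrite enorm_eq0. Qed.

Lemma enorm_gt0 x : (0 < enorm x) = (x != 0).
Proof. by rewrite lt_neqAle eq_sym enorm_eq0 enorm_ge0 andbT. Qed.

Lemma dotp_le x y : `|dotp x y| <= enorm x * enorm y.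
Proof.
have [->|y0] := eqVneq y 0.
  by rewrite enorm0 mulr0 dotpC -[0](scale0r 0) dotpZl mul0r normr0.
have yy : 0 < dotp y y by rewrite -sqr_enorm exprn_gt0// enorm_gt0.
rewrite -(@ler_pXn2r _ 2)// ?nnegrE ?mulr_ge0 ?enorm_ge0// exprMn !sqr_enorm.
rewrite real_normK ?num_real//.
have := dotp_ge0 (dotp y y *: x - dotp x y *: y).
rewrite !(dotpDl, dotpDr, dotpNl, dotpNr, dotpZl, dotpZr) (dotpC y x) => H.
have : 0 <= dotp y y * (dotp x x * dotp y y - dotp x y ^+ 2).
  by apply: le_trans H _; rewrite le_eqVlt; apply/orP; left; apply/eqP; ring.
by rewrite pmulr_rge0// subr_ge0.
Qed.

Lemma enormD x y : enorm (x + y) <= enorm x + enorm y.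
Proof.
rewrite -(@ler_pXn2r _ 2)// ?nnegrE ?addr_ge0 ?enorm_ge0//.
rewrite sqrrD !sqr_enorm !(dotpDl, dotpDr) (dotpC y x).
have := le_trans (ler_norm _) (dotp_le x y); rewrite mulr2n; lra.
Qed.

Lemma enorm_le_sum x : enorm x <= \sum_i `|x ord0 i|.
Proof.
have s0 : 0 <= \sum_i `|x ord0 i| by exact: sumr_ge0.
rewrite -(@ler_pXn2r _ 2)// ?nnegrE ?enorm_ge0// sqr_enorm expr2 mulr_suml.
apply: ler_sum => i _; rewrite -expr2 -[leLHS]real_normK ?num_real// expr2 ler_wpM2l//.
by rewrite (bigD1 i)//= lerDl sumr_ge0.
Qed.

Lemma ler_coord_norm x i : `|x ord0 i| <= `|x|.
Proof.
rewrite [leRHS]mx_normrE.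
exact: (@le_bigmax _ _ _ 0 (fun ij : 'I_1 * 'I_d => `|x ij.1 ij.2|) (ord0, i)).
Qed.

Lemma enorm_le_norm x : enorm x <= d%:R * `|x|.
Proof.
apply: le_trans (enorm_le_sum x) _.
apply: (@le_trans _ _ (\sum_(i < d) `|x|)).
  by apply: ler_sum => i _; exact: ler_coord_norm.
by rewrite sumr_const card_ord mulr_natl.
Qed.

End euclidean_norm.

(** * Total differentiability with prescribed partial derivatives *)

Section gradient.
Context {R : realType} {d : nat}.
Local Notation Rd := 'rV[R]_d.
Local Notation e_ i := (delta_mx ord0 i : 'rV[R]_d).
Implicit Types (f g : Rd -> R) (x y h : Rd) (G : 'I_d -> R).

Definition gradmap G h : R := \sum_i h ord0 i * G i.

Lemma gradmap_linear G : linear (gradmap G).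
Proof.
move=> a x y; rewrite /gradmap scaler_sumr -big_split; apply: eq_bigr => i _.
by rewrite !mxE mulrDl scalerAl.
Qed.

HB.instance Definition _ G :=
  GRing.isLinear.Build R 'rV[R]_d R *:%R (gradmap G) (gradmap_linear G).

(** The partial derivatives are named explicitly so that those of a family form a family again;
    total differentiability is kept beside them because [smooth] asks for it and the chain rule uses
    it. *)
Definition hasgrad f x G :=
  differentiable f x /\ forall i, 'D_(e_ i) f x = G i.

Lemma gradmap_delta G i : gradmap G (e_ i) = G i.
Proof.
rewrite /gradmap (bigD1 i)//= mxE !eqxx mul1r big1 ?addr0// => j ji.
by rewrite mxE (negbTE ji) andbF mul0r.
Qed.

Lemma row_sum_delta_scale h : h = \sum_i h ord0 i *: e_ i.
Proof. exact: row_sum_delta. Qed.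

Lemma hasgrad_diff f x G : hasgrad f x G -> 'd f x = gradmap G :> (Rd -> R).
Proof.
move=> [df fG]; apply/funext => h; rewrite [in LHS](row_sum_delta_scale h) linear_sum.
by apply: eq_bigr => i _; rewrite linearZ /= -deriveE// fG.
Qed.

Lemma gradmap_continuous G : continuous (gradmap G : Rd -> R).
Proof.
rewrite (_ : gradmap G = \sum_i (fun h : Rd => h ord0 i * G i)); last first.
  by apply/funext => h; rewrite fct_sumE.
elim/big_ind : _ => [|f g cf cg x|i _ x]; first exact: cst_continuous.
  exact: (@continuousD _ _ _ f g x (cf x) (cg x)).
apply: (@continuousM R Rd (fun h : Rd => h ord0 i) (cst (G i))).
  exact: coord_continuous.
exact: cst_continuous.
Qed.

Lemma hasgrad_littleo f x G :
  (forall eps : R, 0 < eps -> \forall h \near (0 : Rd),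
    `|f (h + x) - (f x + gradmap G h)| <= eps * `|h|) -> hasgrad f x G.
Proof.
move=> lo.
have dE : 'd f x = gradmap G :> (Rd -> R).
  apply: (@diff_unique _ _ _ f (gradmap G) x (@gradmap_continuous G)).
  by apply/eqaddoP => eps /lo.
have df : differentiable f x.
  apply/diff_locallyP; split; first by rewrite dE; exact: gradmap_continuous.
  by rewrite dE; apply/eqaddoP => eps /lo.
by split=> // i; rewrite deriveE// dE gradmap_delta.
Qed.

(** Explicit quadratic remainders are what the applications supply: flat functions at the origin,
    and Taylor's formula under the integral of the Hartley transform. *)
Lemma hasgrad_quadratic f x G (C e : R) : 0 < e ->
  (forall h, `|h| < e -> `|f (x + h) - f x - gradmap G h| <= C * `|h| ^+ 2) ->
  hasgrad f x G.
Proof.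
move=> e0 fh.
have lo (eps : R) : 0 < eps -> \forall h \near (0 : Rd),
    `|f (h + x) - (f x + gradmap G h)| <= eps * `|h|.
  move=> eps0; near=> h.
  have he : `|h| < e.
    near: h; apply/nbhs_ballP; exists e => //= h; rewrite mx_norm_ball /ball_/=.
    by rewrite sub0r normrN.
  have hC : `|h| < eps / (`|C| + 1).
    near: h; apply/nbhs_ballP; exists (eps / (`|C| + 1)) => /=.
      by rewrite divr_gt0// ltr_wpDl.
    by move=> h; rewrite mx_norm_ball /ball_/= sub0r normrN.
  rewrite opprD addrA [in h + x]addrC.
  apply: le_trans (fh h he) _; rewrite expr2 mulrA ler_wpM2r//.
  apply: (@le_trans _ _ ((`|C| + 1) * `|h|)).
    by rewrite ler_wpM2r// (le_trans (ler_norm C))// lerDl.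
  by rewrite mulrC -ler_pdivlMr ?ltr_wpDl// ltW.
exact: hasgrad_littleo.
Unshelve. all: by end_near. Qed.

Lemma hasgrad_cst (c : R) x : hasgrad (cst c) x (fun=> 0).
Proof. by split=> // i; rewrite derive_cst. Qed.

Lemma hasgrad_coord j x : hasgrad (fun y => y ord0 j) x (fun i => (i == j)%:R).
Proof.
apply: (@hasgrad_quadratic _ _ _ 0 1) => // h _.
rewrite mul0r normr_le0 mxE /gradmap (bigD1 j)//= eqxx mulr1 big1 ?addr0.
  by rewrite [_ - x ord0 j]addrAC subrr add0r subrr.
by move=> i /negbTE ->; rewrite mulr0.
Qed.

Lemma hasgradD f g x F G : hasgrad f x F -> hasgrad g x G ->
  hasgrad (fun y => f y + g y) x (fun i => F i + G i).
Proof.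
move=> [df fF] [dg gG]; split; first exact: (@differentiableD _ _ _ f g x df dg).
move=> i; rewrite -fF -gG -(@deriveD _ _ _ f g)//; exact: diff_derivable.
Qed.

Lemma hasgradM f g x F G : hasgrad f x F -> hasgrad g x G ->
  hasgrad (fun y => f y * g y) x (fun i => F i * g x + f x * G i).
Proof.
move=> [df fF] [dg gG]; split; first exact: (@differentiableM _ _ f g x df dg).
move=> i; rewrite -fF -gG [LHS](@deriveM _ _ f g x (e_ i)); last 2 first.
- exact: diff_derivable.
- exact: diff_derivable.
by rewrite addrC; congr (_ + _); exact: mulrC.
Qed.

Lemma hasgradZ (c : R) f x F : hasgrad f x F ->
  hasgrad (fun y => c * f y) x (fun i => c * F i).
Proof.
move=> fF.
rewrite (_ : (fun i => _) = (fun i => (fun=> 0) i * f x + cst c x * F i)).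
  exact: hasgradM (hasgrad_cst c x) fF.
by apply/funext => i; rewrite mul0r add0r.
Qed.

Lemma hasgrad_comp (phi : R -> R) (a : R) f x F :
  is_derive (f x) 1 phi a -> hasgrad f x F ->
  hasgrad (fun y => phi (f y)) x (fun i => a * F i).
Proof.
move=> [dphi phia] [df fF].
have dp : differentiable phi (f x) by exact/derivable1_diffP.
split; first exact: (@differentiable_comp _ _ _ _ f phi).
move=> i; rewrite deriveE; last exact: (@differentiable_comp _ _ _ _ f phi).
rewrite (diff_comp df dp) /= diff1E// -deriveE// fF derive1E phia.
exact: mulrC.
Qed.

Lemma hasgrad_near f g x F : (\forall y \near x, f y = g y) ->
  hasgrad f x F -> hasgrad g x F.
Proof.
move=> fg [df fF].
have fgx := nbhs_singleton fg.
have dfE := hasgrad_diff (conj df fF).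
have [_ /eqaddoP fo] := (diff_locallyP x f).1 df.
apply: hasgrad_littleo => eps /fo feps; near=> h.
have -> : g (h + x) = f (h + x).
  by symmetry; near: h; move: fg; rewrite (near_shift (0 : Rd)) subr0.
rewrite -fgx -dfE; near: h; exact: feps.
Unshelve. all: by end_near. Qed.

Lemma hasgrad_continuous f x G : hasgrad f x G -> {for x, continuous f}.
Proof. by move=> [df _]; exact: differentiable_continuous. Qed.

Lemma hasgrad_line f x h G (t : R) : hasgrad f (x + t *: h) G ->
  is_derive t 1 (fun s : R => f (x + s *: h)) (gradmap G h).
Proof.
move=> fG; have [df _] := fG.
have E : (fun e : R => e^-1 *: (f (x + (e *: 1 + t) *: h) - f (x + t *: h))) =
         (fun e : R => e^-1 *: (f (e *: h + (x + t *: h)) - f (x + t *: h))).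
  apply/funext => e; congr (_ *: (f _ - _)).
  by rewrite scalerDl addrCA; congr (_ *: _ + _); exact: mulr1.
apply: DeriveDef; rewrite /derivable /derive /= E; first exact: diff_derivable.
by rewrite -(hasgrad_diff fG) -deriveE.
Qed.

Lemma hasgrad_MVT f x h (G : R -> 'I_d -> R) :
  (forall s, 0 <= s <= 1 -> hasgrad f (x + s *: h) (G s)) ->
  exists2 c, 0 < c < 1 & f (x + h) - f x = gradmap (G c) h.
Proof.
move=> fG.
have [||c] := @MVT R (fun s => f (x + s *: h)) (fun s => gradmap (G s) h) 0 1 ltr01.
- move=> s; rewrite in_itv/= => /andP[s0 s1]; apply: hasgrad_line; apply: fG.
  by rewrite !ltW.
- apply: continuous_in_subspaceT => s; rewrite inE/= in_itv/= => /fG/hasgrad_line[ds _].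
  by apply: differentiable_continuous; exact/derivable1_diffP.
rewrite in_itv/= => c01; rewrite scale1r scale0r addr0 subr0 mulr1 => E.
by exists c.
Qed.

Lemma gradmap_le G h (C : R) : (forall i, `|G i| <= C) ->
  `|gradmap G h| <= d%:R * C * enorm h.
Proof.
move=> GC; apply: le_trans (ler_norm_sum _ _ _) _.
apply: (@le_trans _ _ (\sum_(i < d) enorm h * C)).
  by apply: ler_sum => i _; rewrite normrM ler_pM// ler_coord_enorm.
by rewrite sumr_const card_ord -[leLHS]mulr_natl (mulrC (enorm h)) mulrA.
Qed.

End gradient.

(** * Calculus of bounded families under sums, products and dilations *)

Section smooth_families.
Context {R : realType} {d : nat}.
Local Notation Rd := 'rV[R]_d.
Local Notation e_ i := (delta_mx ord0 i : 'rV[R]_d).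
Local Notation fam T := (T -> 'rV[R]_d -> R).

(* [Cn Om bd n F]: on [Om], the members of the family [F] are [n] times
   differentiable, and the bound [bd] holds for the families of all their
   partial derivatives of order at most [n]. *)
Fixpoint Cn {T : Type} (Om : set Rd) (bd : fam T -> Prop) (n : nat) (F : fam T) : Prop :=
  bd F /\ if n is n'.+1 then exists G : 'I_d -> fam T,
    (forall t x, Om x -> hasgrad (F t) x (fun i => G i t x)) /\
    forall i, Cn Om bd n' (G i) else True.

Section Cn_theory.
Context {T : Type} (Om : set Rd).
Implicit Types (bd : fam T -> Prop) (F G : fam T).

Lemma Cn_bd bd n F : Cn Om bd n F -> bd F.
Proof. by case: n => [|n] []. Qed.

Lemma Cn_weak bd bd' n F : (forall F, bd F -> bd' F) -> Cn Om bd n F -> Cn Om bd' n F.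
Proof.
move=> bb; elim: n F => [|n IH] F /= [bF]; first by split => //; exact: bb.
move=> [G [FG HG]]; split; first exact: bb.
by exists G; split => // i; exact: IH.
Qed.

Lemma Cn_pred bd n F : Cn Om bd n.+1 F -> Cn Om bd n F.
Proof.
elim: n F => [|n IH] F; first by move=> [bF _].
move=> [bF [G [FG HG]]]; split => //; exists G; split => // i; exact: IH.
Qed.

(** A class [P] of families that satisfy the bound and whose gradients stay in [P] consists of
    smooth families. This replaces explicit formulas for higher derivatives throughout. *)
Lemma Cn_coind bd (P : fam T -> Prop) :
  (forall F, P F -> bd F /\ exists G : 'I_d -> fam T,
    (forall t x, Om x -> hasgrad (F t) x (fun i => G i t x)) /\ forall i, P (G i)) ->
  forall n F, P F -> Cn Om bd n F.
Proof.
move=> H; elim=> [|n IH] F PF; first by split => //; exact: (H F PF).1.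
have [bF [G [FG HG]]] := H F PF; split=> //.
by exists G; split=> // i; exact: IH.
Qed.

Lemma CnD bd n F G : (forall F G, bd F -> bd G -> bd (fun t x => F t x + G t x)) ->
  Cn Om bd n F -> Cn Om bd n G -> Cn Om bd n (fun t x => F t x + G t x).
Proof.
move=> bD; elim: n F G => [|n IH] F G /=.
  by move=> [bF _] [bG _]; split => //; exact: bD.
move=> [bF [F' [FF' HF]]] [bG [G' [GG' HG]]]; split; first exact: bD.
exists (fun i t x => F' i t x + G' i t x); split => [t x Omx|i].
  by apply: hasgradD; [exact: FF'|exact: GG'].
by apply: IH.
Qed.

(** Three bounds are allowed because a moderate factor times a rapidly decaying one is rapidly
    decaying; the product rule produces sums of such products, hence the closure of [bd3] under
    addition. *)
Lemma CnM bd1 bd2 bd3 n F G :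
  (forall F G, bd1 F -> bd2 G -> bd3 (fun t x => F t x * G t x)) ->
  (forall F G, bd3 F -> bd3 G -> bd3 (fun t x => F t x + G t x)) ->
  Cn Om bd1 n F -> Cn Om bd2 n G -> Cn Om bd3 n (fun t x => F t x * G t x).
Proof.
move=> bM bD; elim: n F G => [|n IH] F G.
  by move=> [bF _] [bG _]; split => //; exact: bM.
move=> HF HG; have HF0 := Cn_pred HF; have HG0 := Cn_pred HG.
move: HF HG => [bF [F' [FF' HF]]] [bG [G' [GG' HG]]]; split; first exact: bM.
exists (fun i t x => F' i t x * G t x + F t x * G' i t x); split => [t x Omx|i].
  by apply: hasgradM; [exact: FF'|exact: GG'].
exact: (CnD bD (IH _ _ (HF i) HG0) (IH _ _ HF0 (HG i))).
Qed.

Lemma Cn_eq bd n F F' : open Om ->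
  (forall F F', (forall t x, Om x -> F t x = F' t x) -> bd F -> bd F') ->
  (forall t x, Om x -> F t x = F' t x) -> Cn Om bd n F -> Cn Om bd n F'.
Proof.
move=> oOm bE FF'; case: n => [|n].
  by move=> [bF _]; split => //; exact: bE bF.
move=> [bF [G [FG HG]]]; split; first exact: bE bF.
exists G; split=> // t x Omx; apply: hasgrad_near (FG t x Omx).
by apply: filterS (open_nbhs_nbhs (conj oOm Omx)) => y; exact: FF'.
Qed.

Lemma Cn_partial bd n F : open Om ->
  (forall F F', (forall t x, Om x -> F t x = F' t x) -> bd F -> bd F') ->
  Cn Om bd n.+1 F ->
  (forall t x, Om x -> hasgrad (F t) x (fun i => 'D_(e_ i) (F t) x)) /\
  forall i, Cn Om bd n (fun t x => 'D_(e_ i) (F t) x).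
Proof.
move=> oOm bE [bF [G [FG HG]]]; split.
  by move=> t x Omx; have [df _] := FG t x Omx; split.
move=> i; apply: Cn_eq (HG i) => // t x Omx.
by have [_ ->] := FG t x Omx.
Qed.

End Cn_theory.

Lemma hasgrad_scale (lam : R) (f : Rd -> R) x G : hasgrad f (lam *: x) G ->
  hasgrad (fun y => f (lam *: y)) x (fun i => lam * G i).
Proof.
move=> fG; have [df _] := fG.
have dl : differentiable (fun y : Rd => lam *: y) x by exact: (@differentiableZ _ _ _ id).
have dc : differentiable (f \o (fun y : Rd => lam *: y)) x by exact: differentiable_comp.
split=> // i; rewrite deriveE// (diff_comp dl df) /=.
rewrite (@diff_lin _ _ _ ( *:%R lam)); last first.
  by move=> y; apply: differentiable_continuous; exact: (@differentiableZ _ _ _ id).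
by rewrite linearZ /= (hasgrad_diff fG) gradmap_delta.
Qed.

(** Each derivative of a dilate brings out one more factor [lam t]; an arbitrary power [k] in front
    closes the induction. *)
Lemma Cn_dilate {T T' : Type} (Om : set Rd) (bd : fam T -> Prop) (bd' : fam T' -> Prop)
    (phi : T' -> T) (lam : T' -> R) n k (F : fam T) :
  (forall t x, Om x -> Om (lam t *: x)) ->
  (forall F k, bd F -> bd' (fun t x => lam t ^+ k * F (phi t) (lam t *: x))) ->
  Cn Om bd n F -> Cn Om bd' n (fun t x => lam t ^+ k * F (phi t) (lam t *: x)).
Proof.
move=> Oml bb; elim: n k F => [|n IH] k F; first by move=> [bF _]; split => //; exact: bb.
move=> [bF [G [FG HG]]]; split; first exact: bb.
exists (fun i t x => lam t ^+ k.+1 * G i (phi t) (lam t *: x)); split => [t x Omx|i].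
  have := hasgradZ (lam t ^+ k) (hasgrad_scale (FG (phi t) _ (Oml t x Omx))).
  rewrite (_ : (fun i => lam t ^+ k * _) =
     (fun i => lam t ^+ k.+1 * G i (phi t) (lam t *: x)))//.
  by apply/funext => i; rewrite mulrA -exprSr.
exact: (IH k.+1 _ (HG i)).
Qed.

(* moderate growth, respectively rapid decay, relative to the weight [W],
   uniformly up to the factor [eps t] *)
Definition modb {T : Type} (Om : set Rd) (W : Rd -> R) (eps : T -> R) (F : fam T) :=
  exists N C, 0 <= C /\ forall t x, Om x -> `|F t x| <= C * eps t * W x ^+ N.

Definition rapb {T : Type} (Om : set Rd) (W : Rd -> R) (eps : T -> R) (F : fam T) :=
  forall N, exists C, 0 <= C /\ forall t x, Om x -> `|F t x| * W x ^+ N <= C * eps t.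

Definition Mod {T : Type} Om W (eps : T -> R) (F : fam T) := forall n, Cn Om (modb Om W eps) n F.
Definition Rap {T : Type} Om W (eps : T -> R) (F : fam T) := forall n, Cn Om (rapb Om W eps) n F.

Section bounds.
Context {T : Type} (Om : set Rd) (W : Rd -> R).
Hypothesis W1 : forall x, Om x -> 1 <= W x.
Implicit Types (F G : fam T) (eps : T -> R).

Let W0 x n : Om x -> 0 <= W x ^+ n.
Proof. by move=> Omx; rewrite exprn_ge0// (le_trans ler01)// W1. Qed.

Let Wle x m n : Om x -> (m <= n)%N -> W x ^+ m <= W x ^+ n.
Proof. by move=> Omx mn; rewrite ler_weXn2l// W1. Qed.

Lemma modbD eps F G : (forall t, 0 <= eps t) -> modb Om W eps F -> modb Om W eps G ->
  modb Om W eps (fun t x => F t x + G t x).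
Proof.
move=> e0 [N [C [C0 FC]]] [N' [C' [C'0 GC]]].
exists (maxn N N'), (C + C'); split; first exact: addr_ge0.
move=> t x Omx; apply: le_trans (ler_normD _ _) _; rewrite !mulrDl; apply: lerD.
  apply: le_trans (FC t x Omx) _; rewrite ler_wpM2l ?mulr_ge0//.
  by rewrite Wle// leq_maxl.
apply: le_trans (GC t x Omx) _; rewrite ler_wpM2l ?mulr_ge0//.
by rewrite Wle// leq_maxr.
Qed.

Lemma rapbD eps F G : rapb Om W eps F -> rapb Om W eps G ->
  rapb Om W eps (fun t x => F t x + G t x).
Proof.
move=> HF HG N; have [C [C0 FC]] := HF N; have [C' [C'0 GC]] := HG N.
exists (C + C'); split; first exact: addr_ge0.
move=> t x Omx; rewrite mulrDl; apply: le_trans (lerD (FC t x Omx) (GC t x Omx)).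
by rewrite -mulrDl ler_wpM2r ?W0// ler_normD.
Qed.

Lemma modbM eps eps' F G : (forall t, 0 <= eps t) ->
  modb Om W eps F -> modb Om W eps' G ->
  modb Om W (fun t => eps t * eps' t) (fun t x => F t x * G t x).
Proof.
move=> e0 [N [C [C0 FC]]] [N' [C' [C'0 GC]]].
exists (N + N')%N, (C * C'); split; first exact: mulr_ge0.
move=> t x Omx; rewrite normrM exprD.
rewrite [leRHS](_ : _ = (C * eps t * W x ^+ N) * (C' * eps' t * W x ^+ N')); last by ring.
by apply: ler_pM => //; [exact: FC|exact: GC].
Qed.

Lemma rapbM eps eps' F G : (forall t, 0 <= eps t) ->
  modb Om W eps F -> rapb Om W eps' G ->
  rapb Om W (fun t => eps t * eps' t) (fun t x => F t x * G t x).
Proof.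
move=> e0 [N [C [C0 FC]]] HG M; have [C' [C'0 GC]] := HG (N + M)%N.
exists (C * C'); split; first exact: mulr_ge0.
move=> t x Omx; rewrite normrM.
apply: (@le_trans _ _ ((C * eps t * W x ^+ N) * `|G t x| * W x ^+ M)).
  by rewrite ler_wpM2r ?W0// ler_wpM2r// FC.
rewrite [leLHS](_ : _ = C * eps t * (`|G t x| * W x ^+ (N + M))); last by rewrite exprD; ring.
rewrite [leRHS](_ : _ = C * eps t * (C' * eps' t)); last by ring.
by rewrite ler_wpM2l ?mulr_ge0// GC.
Qed.

Lemma modb_eq eps F F' : (forall t x, Om x -> F t x = F' t x) ->
  modb Om W eps F -> modb Om W eps F'.
Proof.
move=> FF' [N [C [C0 FC]]]; exists N, C; split => // t x Omx.
by rewrite -FF'// FC.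
Qed.

Lemma rapb_eq eps F F' : (forall t x, Om x -> F t x = F' t x) ->
  rapb Om W eps F -> rapb Om W eps F'.
Proof.
move=> FF' HF N; have [C [C0 FC]] := HF N; exists C; split => // t x Omx.
by rewrite -FF'// FC.
Qed.

Lemma rapb_modb eps F : rapb Om W eps F -> modb Om W eps F.
Proof.
move=> /(_ 0%N)[C [C0 FC]]; exists 0%N, C; split=> // t x Omx.
by rewrite expr0 mulr1; have := FC t x Omx; rewrite expr0 mulr1.
Qed.

Lemma Rap_bd eps F : Rap Om W eps F -> rapb Om W eps F.
Proof. by move=> /(_ 0%N)/Cn_bd. Qed.

Lemma ModD eps F G : (forall t, 0 <= eps t) -> Mod Om W eps F -> Mod Om W eps G ->
  Mod Om W eps (fun t x => F t x + G t x).
Proof. by move=> e0 HF HG n; apply: CnD => // *; exact: modbD. Qed.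

Lemma RapD eps F G : Rap Om W eps F -> Rap Om W eps G ->
  Rap Om W eps (fun t x => F t x + G t x).
Proof. by move=> HF HG n; apply: CnD => // *; exact: rapbD. Qed.

Lemma ModM eps eps' F G : (forall t, 0 <= eps t) -> (forall t, 0 <= eps' t) ->
  Mod Om W eps F -> Mod Om W eps' G ->
  Mod Om W (fun t => eps t * eps' t) (fun t x => F t x * G t x).
Proof.
move=> e0 e0' HF HG n; apply: CnM (HF n) (HG n) => [F' G'|F' G']; first exact: modbM.
by apply: modbD => t; exact: mulr_ge0.
Qed.

Lemma RapM eps eps' F G : (forall t, 0 <= eps t) ->
  Mod Om W eps F -> Rap Om W eps' G ->
  Rap Om W (fun t => eps t * eps' t) (fun t x => F t x * G t x).
Proof.
move=> e0 HF HG n; apply: CnM (HF n) (HG n) => [F' G'|F' G']; first exact: rapbM.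
exact: rapbD.
Qed.

Lemma Rap_Mod eps F : Rap Om W eps F -> Mod Om W eps F.
Proof. by move=> HF n; apply: Cn_weak (HF n) => F'; exact: rapb_modb. Qed.

Lemma Rap_weak eps eps' F : (exists2 K, 0 <= K & forall t, eps t <= K * eps' t) ->
  Rap Om W eps F -> Rap Om W eps' F.
Proof.
move=> [K K0 ee] HF n; apply: Cn_weak (HF n) => F' + N => /(_ N)[C [C0 FC]].
exists (C * K); split; first exact: mulr_ge0.
by move=> t x Omx; rewrite (le_trans (FC t x Omx))// -mulrA ler_wpM2l.
Qed.

Lemma Mod_cst (c : R) : Mod Om W (fun=> 1 : R) (fun (_ : T) _ => c).
Proof.
move=> n; apply: (@Cn_coind _ _ _ (fun F => exists c, F = (fun _ _ => c))); last by exists c.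
move=> _ [{}c ->]; split.
  by exists 0%N, `|c|; split => // t x _; rewrite !mulr1.
exists (fun=> fun _ _ => 0); split => [t x _|i]; first exact: hasgrad_cst.
by exists 0.
Qed.

Lemma Mod_coord j : (forall x, Om x -> `|x ord0 j| <= W x) ->
  Mod Om W (fun=> 1 : R) (fun (_ : T) x => x ord0 j).
Proof.
move=> xW [|n]; first by split => //; exists 1%N, 1; split => // t x Omx; rewrite !mul1r expr1 xW.
split; first by exists 1%N, 1; split => // t x Omx; rewrite !mul1r expr1 xW.
exists (fun i _ _ => (i == j)%:R); split => [t x _|i]; first exact: hasgrad_coord.
exact: Mod_cst.
Qed.

Lemma Rap_partial eps F : open Om -> Rap Om W eps F ->
  (forall t x, Om x -> hasgrad (F t) x (fun i => 'D_(e_ i) (F t) x)) /\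
  forall i, Rap Om W eps (fun t x => 'D_(e_ i) (F t) x).
Proof.
move=> oOm HF; split; first by have [] := Cn_partial oOm (@rapb_eq eps) (HF 1%N).
by move=> i n; have [_ +] := Cn_partial oOm (@rapb_eq eps) (HF n.+1); exact.
Qed.

Lemma Mod_partial eps F : open Om -> Mod Om W eps F ->
  (forall t x, Om x -> hasgrad (F t) x (fun i => 'D_(e_ i) (F t) x)) /\
  forall i, Mod Om W eps (fun t x => 'D_(e_ i) (F t) x).
Proof.
move=> oOm HF; split; first by have [] := Cn_partial oOm (@modb_eq eps) (HF 1%N).
by move=> i n; have [_ +] := Cn_partial oOm (@modb_eq eps) (HF n.+1); exact.
Qed.

Lemma RapZ eps (c : R) F : Rap Om W eps F -> Rap Om W eps (fun t x => c * F t x).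
Proof.
move=> HF; have := RapM (fun=> ler01) (@Mod_cst c) HF.
by under eq_fun do rewrite mul1r.
Qed.

End bounds.

End smooth_families.

(** * Weights at infinity and at the origin *)

Section weights.
Context {R : realType} {d : nat}.
Local Notation Rd := 'rV[R]_d.
Local Notation fam T := (T -> 'rV[R]_d -> R).

Definition Ws (x : Rd) : R := 1 + enorm x.
Definition Wp (x : Rd) : R := enorm x + (enorm x)^-1.
Definition Omp : set Rd := [set x | x != 0].

(* families of Schwartz functions, and of functions on R^d minus the origin
   whose derivatives decay rapidly both at infinity and at the origin *)
Definition SF {T : Type} (eps : T -> R) (F : fam T) := Rap setT Ws eps F.
Definition FlatF {T : Type} (eps : T -> R) (F : fam T) := Rap Omp Wp eps F.

Lemma open_Omp : open Omp.
Proof.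
rewrite (_ : Omp = ~` [set 0]).
  exact/closed_openC/(@accessible_closed_set1 _ (hausdorff_accessible (@norm_hausdorff R Rd))).
by apply/seteqP; split => x /eqP.
Qed.

Lemma Omp_gt0 x : Omp x -> 0 < enorm x.
Proof. by rewrite enorm_gt0. Qed.

Lemma Ws_ge1 x : 1 <= Ws x.
Proof. by rewrite /Ws lerDl enorm_ge0. Qed.

Lemma Ws_ge1' x : [set: Rd] x -> 1 <= Ws x.
Proof. by move=> _; exact: Ws_ge1. Qed.

Lemma Ws_gt0 x : 0 < Ws x.
Proof. by rewrite (lt_le_trans ltr01)// Ws_ge1. Qed.

Lemma enorm_le_Wp x : enorm x <= Wp x.
Proof. by rewrite /Wp lerDl invr_ge0 enorm_ge0. Qed.

Lemma invenorm_le_Wp x : (enorm x)^-1 <= Wp x.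
Proof. by rewrite /Wp lerDr enorm_ge0. Qed.

Lemma Wp_ge1 x : Omp x -> 1 <= Wp x.
Proof.
move=> /Omp_gt0 x0; have [r1|r1] := leP 1 (enorm x).
  exact: le_trans r1 (enorm_le_Wp x).
by apply: le_trans (invenorm_le_Wp x); rewrite invf_ge1// ltW.
Qed.

Lemma Wp_gt0 x : Omp x -> 0 < Wp x.
Proof. by move=> /Wp_ge1; exact: lt_le_trans. Qed.

Lemma Ws_le_Wp x : Omp x -> Ws x <= 2 * Wp x.
Proof. by move=> x0; rewrite mulr2n mulrDl mul1r; apply: lerD; [exact: Wp_ge1|exact: enorm_le_Wp]. Qed.

Lemma coord_le_Ws (x : Rd) i : `|x ord0 i| <= Ws x.
Proof. by rewrite (le_trans (ler_coord_enorm x i))// /Ws lerDr. Qed.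

Lemma coord_le_Wp (x : Rd) i : `|x ord0 i| <= Wp x.
Proof. exact: le_trans (ler_coord_enorm x i) (enorm_le_Wp x). Qed.

(** Splits a bound against [Wp] into one at infinity and one at the origin. *)
Lemma WpX_le x N : Omp x -> Wp x ^+ N <= 2 ^+ N * (enorm x ^+ N + (enorm x)^-1 ^+ N).
Proof.
move=> /Omp_gt0 x0; set r := enorm x.
have r0 : 0 <= r^-1 by rewrite invr_ge0 ltW.
have [r1|r1] := leP 1 r.
  apply: (@le_trans _ _ ((2 * r) ^+ N)).
    rewrite lerXn2r ?nnegrE ?mulr_ge0 ?addr_ge0 ?(ltW x0)// (_ : 2 * r = r + r) ?lerD2l; last by ring.
    by rewrite (le_trans _ r1)// invf_le1.
  by rewrite exprMn ler_wpM2l ?exprn_ge0// lerDl exprn_ge0.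
apply: (@le_trans _ _ ((2 * r^-1) ^+ N)).
  rewrite lerXn2r ?nnegrE ?mulr_ge0 ?addr_ge0 ?(ltW x0)// (_ : 2 * r^-1 = r^-1 + r^-1) ?lerD2r; last by ring.
  by rewrite (le_trans (ltW r1))// invf_ge1// ltW.
by rewrite exprMn ler_wpM2l ?exprn_ge0// lerDr exprn_ge0// ltW.
Qed.

(** Decay of order 2 at the origin is a quadratic remainder, so the gradient exists at 0 and
    vanishes. The value at 0 is assumed separately, because [FlatF] speaks of the punctured space
    only; the gradient inherits both properties. *)
Lemma flat_hasgrad {T : Type} (eps : T -> R) (F : fam T) : (forall t, 0 <= eps t) ->
  FlatF eps F -> (forall t, F t 0 = 0) ->
  exists G : 'I_d -> fam T, (forall t x, hasgrad (F t) x (fun i => G i t x)) /\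
    forall i, FlatF eps (G i) /\ forall t, G i t 0 = 0.
Proof.
move=> e0 HF F0.
have [FG HG] := Rap_partial open_Omp HF.
exists (fun i t x => if x == 0 then 0 else 'D_(delta_mx ord0 i) (F t) x); split.
  move=> t x; have [->|x0] := eqVneq x 0.
    have [C [C0 FC]] := Rap_bd HF 2%N.
    apply: (@hasgrad_quadratic _ _ _ _ _ (C * eps t * d%:R ^+ 2) 1) => // h _.
    rewrite add0r F0 subr0 /gradmap big1 ?subr0; last by move=> i _; rewrite mulr0.
    have [->|h0] := eqVneq h 0; first by rewrite F0 normr0 !mulr_ge0// exprn_ge0.
    have hp := Omp_gt0 h0.
    apply: (@le_trans _ _ (C * eps t * enorm h ^+ 2)).
      rewrite -ler_pdivrMr ?exprn_gt0//; apply: le_trans (FC t h h0).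
      rewrite ler_wpM2l// -exprVn lerXn2r ?nnegrE ?invr_ge0 ?(ltW hp)//; last exact: invenorm_le_Wp.
      by rewrite ltW// Wp_gt0.
    rewrite -[leRHS]mulrA -exprMn ler_wpM2l ?mulr_ge0// lerXn2r ?nnegrE ?mulr_ge0 ?enorm_ge0//.
    exact: enorm_le_norm.
  exact: FG.
move=> i; split; last by move=> t; rewrite eqxx.
move=> m; apply: Cn_eq (HG i m); first exact: open_Omp.
- exact: rapb_eq.
- by move=> t x /negbTE ->.
Qed.

(** Off the origin [Ws] is at most twice [Wp], and the flat families that vanish at 0 are closed
    under differentiation by [flat_hasgrad]. *)
Lemma flat_SF {T : Type} (eps : T -> R) (F : fam T) : (forall t, 0 <= eps t) ->
  FlatF eps F -> (forall t, F t 0 = 0) -> SF eps F.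
Proof.
move=> e0 HF F0 n.
have rapS (G : fam T) : rapb Omp Wp eps G -> (forall t, G t 0 = 0) ->
    rapb setT Ws eps G.
  move=> HG G0 N; have [C [C0 GC]] := HG N; exists (2 ^+ N * C).
  split; first by rewrite mulr_ge0// exprn_ge0.
  move=> t x _; have [->|x0] := eqVneq x 0.
    by rewrite G0 normr0 mul0r !mulr_ge0// exprn_ge0.
  apply: (@le_trans _ _ (`|G t x| * (2 * Wp x) ^+ N)).
    rewrite ler_wpM2l// lerXn2r ?nnegrE ?(ltW (Ws_gt0 _))//; last exact: Ws_le_Wp.
    by rewrite mulr_ge0// ltW// Wp_gt0.
  by rewrite exprMn mulrCA -mulrA ler_wpM2l ?exprn_ge0// GC.
apply: (@Cn_coind _ _ _ _ _ (fun F => FlatF eps F /\ forall t, F t 0 = 0)); last by split.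
move=> {HF F0}F [HF F0]; split; first by apply: rapS => //; exact: Rap_bd HF.
have [G [FG HG]] := flat_hasgrad e0 HF F0.
by exists G; split => [t x _|]; [exact: FG|exact: HG].
Qed.

Lemma SF_hasgrad {T : Type} (eps : T -> R) (F : fam T) : SF eps F ->
  exists G : 'I_d -> fam T, (forall t x, hasgrad (F t) x (fun i => G i t x)) /\
    forall i, SF eps (G i).
Proof.
move=> HF; have [FG HG] := Rap_partial openT HF.
exists (fun i t x => 'D_(delta_mx ord0 i) (F t) x); split => // t x; exact: FG.
Qed.

Lemma Rap_intro {T : Type} Om W (eps : T -> R) (F : fam T) (G : 'I_d -> fam T) :
  rapb Om W eps F -> (forall t x, Om x -> hasgrad (F t) x (fun i => G i t x)) ->
  (forall i, Rap Om W eps (G i)) -> Rap Om W eps F.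
Proof.
move=> bF FG HG [|n]; first by split.
by split=> //; exists G; split => // i; exact: HG.
Qed.

Lemma hasgrad_dotp (x : Rd) : hasgrad (fun y : Rd => dotp y y) x (fun i => 2 * x ord0 i).
Proof.
apply: (@hasgrad_quadratic _ _ _ _ _ (d%:R ^+ 2) 1) => // h _.
rewrite dotpDl !dotpDr (_ : gradmap _ h = 2 * dotp x h); last first.
  by rewrite /gradmap /dotp mulr_sumr; apply: eq_bigr => i _; rewrite mulrC mulrA.
rewrite (dotpC h x) (_ : _ - _ - _ = dotp h h); last by ring.
rewrite ger0_norm ?dotp_ge0// -sqr_enorm -exprMn.
by rewrite ler_pXn2r ?nnegrE ?mulr_ge0 ?enorm_ge0// enorm_le_norm.
Qed.

Lemma enorm_powR (x : Rd) (tau : R) : enorm x `^ tau = dotp x x `^ (2^-1 * tau).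
Proof. by rewrite powRrM powR12_sqrt// dotp_ge0. Qed.

Lemma hasgrad_enorm_powR (tau : R) (x : Rd) : x != 0 ->
  hasgrad (fun y : Rd => enorm y `^ tau) x
    (fun i => tau * x ord0 i * enorm x `^ (tau - 2)).
Proof.
move=> x0; have x2 : 0 < dotp x x by rewrite -sqr_enorm exprn_gt0// enorm_gt0.
rewrite (_ : (fun y => _) = fun y : Rd => dotp y y `^ (2^-1 * tau)); last first.
  by apply/funext => y; rewrite enorm_powR.
have := @hasgrad_comp _ _ _ _ (fun y : Rd => dotp y y) _ _ (is_derive1_powR (2^-1 * tau) x2) (hasgrad_dotp x).
rewrite (_ : (fun i => 2^-1 * tau * _ * _) = (fun i => tau * x ord0 i * enorm x `^ (tau - 2)))//.
apply/funext => i; rewrite enorm_powR (_ : 2^-1 * (tau - 2) = 2^-1 * tau - 1); last by field.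
by field.
Qed.

Lemma powR_le_Wp (tau : R) : exists N, forall x : Rd, Omp x -> enorm x `^ tau <= Wp x ^+ N.
Proof.
exists (Num.truncn `|tau|).+1 => x x0.
have W1 := Wp_ge1 x0; have r0 := Omp_gt0 x0.
have tN : `|tau| <= (Num.truncn `|tau|).+1%:R by rewrite ltW// truncnS_gt.
apply: (@le_trans _ _ (Wp x `^ `|tau|)); last first.
  by rewrite -powR_mulrn ?(le_trans ler01)// ler_powR.
have mono u : 0 <= u <= Wp x -> u `^ `|tau| <= Wp x `^ `|tau|.
  move=> /andP[u0 uW]; apply: ge0_ler_powR => //; rewrite nnegrE//.
  exact: le_trans u0 uW.
have [t0|t0] := leP 0 tau.
  by rewrite -{1}(ger0_norm t0) mono// enorm_ge0 enorm_le_Wp.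
rewrite -[in leLHS](opprK tau) -[- - _]mulN1r powRrM powR_inv1 ?enorm_ge0//.
by rewrite -{1}(ltr0_norm t0) mono// invr_ge0 enorm_ge0 invenorm_le_Wp.
Qed.

(** The gradient of |x|^tau is tau x_i |x|^(tau-2), so the induction on the order of differentiation
    runs over all real exponents at once. *)
Lemma Mod_powR {T : Type} (tau : R) :
  Mod Omp Wp (fun=> 1) (fun (_ : T) x => enorm x `^ tau).
Proof.
move=> n; elim: n tau => [|n IH] tau; have [N tN] := powR_le_Wp tau.
  split=> //; exists N, 1; split => // t x x0.
  by rewrite !mul1r ger0_norm ?powR_ge0// tN.
split.
  exists N, 1; split => // t x x0.
  by rewrite !mul1r ger0_norm ?powR_ge0// tN.
exists (fun i _ (x : Rd) => tau * x ord0 i * enorm x `^ (tau - 2)); split => [t x x0|i].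
  exact: hasgrad_enorm_powR.
have bD (F G : fam T) := @modbD R d T Omp Wp Wp_ge1 (fun=> 1) F G (fun=> ler01).
have bM (F G : fam T) : modb Omp Wp (fun=> 1) F -> modb Omp Wp (fun=> 1) G ->
    modb Omp Wp (fun=> 1) (fun t x => F t x * G t x).
  move=> HF HG; have := modbM (fun=> ler01) HF HG.
  by under eq_fun do rewrite mul1r.
apply: (CnM bM bD _ (IH _)); apply: (CnM bM bD); first exact: Mod_cst.
by apply: Mod_coord => x _; exact: coord_le_Wp.
Qed.

End weights.

(** * A dyadic partition of unity *)

Section sigmoid.
Context {R : realType}.

(** The logistic function. Its derivative is a polynomial in itself, so that the functions p(sg(y))
    with p a polynomial are closed under differentiation up to derivatives of y; this makes
    smoothness an algebraic matter. *)
Definition sg (t : R) : R := (1 + expR (- t))^-1.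

Lemma sg_gt0 t : 0 < sg t.
Proof. by rewrite invr_gt0 addr_gt0// expR_gt0. Qed.

Lemma sgN t : sg (- t) = 1 - sg t.
Proof.
rewrite /sg opprK expRN; have e0 := expR_gt0 t.
by field; rewrite !gt_eqF// addr_gt0.
Qed.

Lemma sg_lt1 t : sg t < 1.
Proof. by rewrite -subr_gt0 -sgN sg_gt0. Qed.

Lemma sg_le_expR t : sg t <= expR t.
Proof.
rewrite /sg -[leRHS]invrK -expRN lef_pV2 ?posrE ?addr_gt0 ?expR_gt0//.
by rewrite lerDr.
Qed.

Lemma sg_itv t : 0 <= sg t <= 1.
Proof. by rewrite ltW ?sg_gt0// ltW// sg_lt1. Qed.

Lemma is_derive_sg (t : R) : is_derive t 1 sg (sg t * (1 - sg t)).
Proof.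
have e0 := expR_gt0 (- t).
have n0 : 1 + expR (- t) != 0 by rewrite gt_eqF// addr_gt0.
have d1 : is_derive t (1 : R) (fun t : R => 1 + expR (- t)) (- expR (- t)).
  have dN : is_derive t (1 : R) (fun t : R => - t) (- 1) by exact: is_deriveN.
  have dE := @is_derive1_comp R expR (fun t : R => - t) t _ _ (is_derive_expR _) dN.
  have := @is_deriveD R R R (cst 1) _ t 1 _ _ (is_derive_cst _ _ _) dE.
  by rewrite add0r mulrN1.
have := @is_deriveV _ (fun t : R => 1 + expR (- t)) t _ 1 n0 d1.
move=> d2; apply: is_derive_eq d2 _.
rewrite /sg /GRing.scale/=; field.
by [].
Qed.

Lemma horner_bounded (p : {poly R}) : exists2 C : R, 0 <= C & forall s : R, 0 <= s <= 1 -> `|p.[s]| <= C.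
Proof.
exists (\sum_(i < size p) `|p`_i|); first exact: sumr_ge0.
move=> s /andP[s0 s1]; rewrite horner_coef; apply: le_trans (ler_norm_sum _ _ _) _.
apply: ler_sum => i _; rewrite normrM ler_piMr// ger0_norm ?exprn_ge0//.
by rewrite exprn_ile1.
Qed.

Lemma is_derive_horner_sg (p : {poly R}) (t : R) :
  is_derive t 1 (fun t => p.[sg t]) (p^`().[sg t] * (sg t * (1 - sg t))).
Proof.
have dp : is_derive (sg t) 1 (horner p) p^`().[sg t].
  apply: DeriveDef; first exact: derivable_horner.
  by rewrite derivE derive1E.
exact: (@is_derive1_comp R (horner p) sg t _ _ dp (is_derive_sg t)).
Qed.

Section sigmoid_families.
Context {d : nat} {T : Type} (Om : set 'rV[R]_d) (W : 'rV[R]_d -> R).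
Hypothesis W1 : forall x, Om x -> 1 <= W x.
Variable y : T -> 'rV[R]_d -> R.
Hypothesis My : Mod Om W (fun=> 1) y.

Let bD F G := @modbD R d T Om W W1 (fun=> 1) F G (fun=> ler01).

Let bM F G : modb Om W (fun=> 1) F -> modb Om W (fun=> 1) G ->
  modb Om W (fun=> 1) (fun (t : T) x => F t x * G t x).
Proof.
move=> HF HG; have := modbM (fun=> ler01) HF HG.
by under eq_fun do rewrite mul1r.
Qed.

Lemma Mod_horner_sg (p : {poly R}) : Mod Om W (fun=> 1) (fun t x => p.[sg (y t x)]).
Proof.
move=> n.
elim: n p => [|n IH] p; have [C C0 pC] := horner_bounded p;
  have bp : modb Om W (fun=> 1) (fun t x => p.[sg (y t x)]) by
    exists 0%N, C; split => // t x _; rewrite !mulr1 pC// sg_itv.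
  by split.
split => //; have [_ [G [yG HG]]] := My n.+1.
exists (fun i t x => (p^`() * ('X * (1 - 'X))).[sg (y t x)] * G i t x); split.
  move=> t x Omx; rewrite !(hornerM, hornerD, hornerN, hornerX, hornerC).
  exact: (@hasgrad_comp _ _ _ _ (y t) x _ (is_derive_horner_sg p (y t x)) (yG t x Omx)).
by move=> i; exact: (CnM bM bD (IH _) (HG i)).
Qed.

Hypothesis Dy : forall N, exists2 C : R, 0 <= C & forall t x, Om x ->
  sg (y t x) * (1 - sg (y t x)) * W x ^+ N <= C.

(** With q = p X (1 - X), the derivative of q(sg(y)) is q'(sg(y)) sg(y) (1 - sg(y)) times that of y:
    the factor that carries the decay [Dy] survives every differentiation. *)
Lemma Rap_horner_sg (p : {poly R}) :
  Rap Om W (fun=> 1) (fun t x => p.[sg (y t x)] * (sg (y t x) * (1 - sg (y t x)))).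
Proof.
have bp q : rapb Om W (fun=> 1) (fun (t : T) x => q.[sg (y t x)] * (sg (y t x) * (1 - sg (y t x)))).
  move=> N; have [C C0 qC] := horner_bounded q; have [C' C'0 DC] := Dy N.
  exists (C * C'); split; first exact: mulr_ge0.
  move=> t x Omx; rewrite normrM mulr1 -mulrA ler_pM// ?mulr_ge0 ?exprn_ge0//.
  - by rewrite (le_trans ler01)// W1.
  - by rewrite qC// sg_itv.
  - rewrite ger0_norm; first exact: DC.
    by rewrite mulr_ge0 ?(ltW (sg_gt0 _))// subr_ge0 ltW// sg_lt1.
move=> n; elim: n p => [|n IH] p; first by split.
split => //; have [_ [G [yG HG]]] := My n.+1.
pose q := p * ('X * (1 - 'X)).
have qE s : q.[s] = p.[s] * (s * (1 - s)) by rewrite !(hornerM, hornerD, hornerN, hornerX, hornerC).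
exists (fun i t x => G i t x * (q^`().[sg (y t x)] * (sg (y t x) * (1 - sg (y t x))))); split.
  move=> t x Omx; under [X in hasgrad X]eq_fun do rewrite -qE.
  under [X in hasgrad _ _ X]eq_fun do rewrite mulrC.
  exact: (@hasgrad_comp _ _ _ _ (y t) x _ (is_derive_horner_sg q (y t x)) (yG t x Omx)).
move=> i; apply: (CnM _ _ (HG i) (IH _)) => F H.
  move=> HF HH; have := rapbM W1 (fun=> ler01) HF HH.
  by under eq_fun do rewrite mul1r.
exact: rapbD.
Qed.

End sigmoid_families.

(** The exponent is odd under r -> 1/r, which exchanges [th] and 1 - [th]: rapid decay at infinity
    is the same statement as approach to 1 of infinite order at 0. *)
Definition th (r : R) : R := sg (r ^-2 - r ^+ 2).

Lemma th_inv r : th r^-1 = 1 - th r.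
Proof. by rewrite /th -sgN opprB exprVn invrK. Qed.

(** Write e^u as the power N+1 of e^(u/(N+1)) and use e^t >= t for N of the factors. Dividing by N+1
    rather than N covers N = 0. *)
Lemma expRN_le (u : R) N : 0 < u -> expR (- u) <= (N.+1%:R / u) ^+ N.
Proof.
move=> u0.
have uN : 0 < u / N.+1%:R by rewrite divr_gt0.
rewrite expRN -[leRHS]invrK -exprVn invf_div lef_pV2 ?posrE ?expR_gt0 ?exprn_gt0//.
have E : expR u = expR (u / N.+1%:R) ^+ N.+1.
  by rewrite -expRM_natl -mulr_natl mulrC divfK.
have e1 : 1 <= expR (u / N.+1%:R) by rewrite -[leLHS]expR0 ler_expR ltW.
rewrite E (@le_trans _ _ (expR (u / N.+1%:R) ^+ N))//; last by rewrite ler_weXn2l.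
rewrite lerXn2r ?nnegrE ?(ltW uN) ?expR_ge0//.
by rewrite (le_trans _ (expR_ge1Dx _))// lerDr.
Qed.

Lemma th_le N : exists2 C : R, 0 <= C & forall r, 0 < r -> th r * r ^+ N <= C.
Proof.
exists (1 + expR 1 * N.+1%:R ^+ N).
  by rewrite addr_ge0// mulr_ge0 ?expR_ge0// exprn_ge0.
move=> r r0; have [r1|r1] := leP r 1.
  apply: (@le_trans _ _ 1); last by rewrite lerDl mulr_ge0 ?expR_ge0// exprn_ge0.
  rewrite -[leRHS]mulr1 ler_pM ?(ltW (sg_gt0 _)) ?exprn_ge0 ?(ltW r0) ?(ltW (sg_lt1 _))//.
  by rewrite exprn_ile1// ltW.
apply: (@le_trans _ _ (expR 1 * N.+1%:R ^+ N)); last by rewrite lerDr.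
apply: (@le_trans _ _ (expR 1 * expR (- r ^+ 2) * r ^+ N)).
  rewrite ler_wpM2r ?exprn_ge0 ?(ltW r0)//; apply: le_trans (sg_le_expR _) _.
  rewrite expRD ler_wpM2r ?expR_ge0// ler_expR invf_le1 ?exprn_gt0//.
  by rewrite exprn_ege1// ltW.
rewrite -mulrA ler_wpM2l ?expR_ge0//.
apply: (@le_trans _ _ ((N.+1%:R / r ^+ 2) ^+ N * r ^+ N)).
  by rewrite ler_wpM2r ?exprn_ge0 ?(ltW r0)// expRN_le// exprn_gt0.
rewrite -exprMn lerXn2r ?nnegrE ?mulr_ge0 ?invr_ge0 ?exprn_ge0 ?(ltW r0)//.
rewrite -mulrA ler_piMr// expr2 invfM -mulrA mulVf ?gt_eqF// mulr1 invf_le1//.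
exact: ltW.
Qed.

Lemma thC_le N : exists2 C : R, 0 <= C & forall r, 0 < r -> 1 - th r <= C * r ^+ N.
Proof.
have [C C0 thC] := th_le N; exists C => // r r0; rewrite -th_inv.
have := thC r^-1; rewrite invr_gt0 => /(_ r0).
by rewrite exprVn ler_pdivrMr// exprn_gt0.
Qed.

Lemma th_itv r : 0 <= th r <= 1. Proof. exact: sg_itv. Qed.

End sigmoid.

(** * The cutoff [Theta] and its dilates *)

Section cutoff.
Context {R : realType} {d : nat}.
Local Notation Rd := 'rV[R]_d.
Local Notation fam T := (T -> 'rV[R]_d -> R).

Lemma Cn_sub {T : Type} (Om Om' : set Rd) (bd bd' : fam T -> Prop) n F :
  Om' `<=` Om -> (forall F, bd F -> bd' F) -> Cn Om bd n F -> Cn Om' bd' n F.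
Proof.
move=> OO bb; elim: n F => [|n IH] F; first by move=> [bF _]; split; [exact: bb|].
move=> [bF [G [FG HG]]]; split; first exact: bb.
exists G; split => [t x /OO|i]; first exact: FG.
exact: (IH _ (HG i)).
Qed.

Lemma hasgrad_eq (f g : Rd -> R) x (F G : 'I_d -> R) :
  (forall y, f y = g y) -> (forall i, F i = G i) -> hasgrad f x F -> hasgrad g x G.
Proof. by move=> /funext -> /funext ->. Qed.

(* equal to 1 to infinite order at the origin and rapidly decreasing *)
Definition Theta (x : Rd) : R := if x == 0 then 1 else th (enorm x).

Lemma Theta0 : Theta 0 = 1.
Proof. by rewrite /Theta eqxx. Qed.

Lemma ThetaN x : Theta (- x) = Theta x.
Proof. by rewrite /Theta oppr_eq0 enormN. Qed.

Lemma Theta_itv x : 0 <= Theta x <= 1.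
Proof. by rewrite /Theta; case: ifP => // _; [rewrite ler01 lexx|exact: th_itv]. Qed.

Lemma Theta_le N : exists2 C : R, 0 <= C & forall x, Theta x * enorm x ^+ N <= C.
Proof.
have [C C0 thC] := @th_le R N; exists (C + 1); first by rewrite addr_ge0.
move=> x; rewrite /Theta; have [->|x0] := eqVneq x 0.
  by rewrite enorm0 mul1r expr0n; case: (N == 0%N); rewrite ?ler_wpDl// addr_ge0.
by rewrite (le_trans (thC _ _)) ?enorm_gt0// lerDl.
Qed.

Lemma ThetaC_le N : exists2 C : R, 0 <= C & forall x, 1 - Theta x <= C * enorm x ^+ N.
Proof.
have [C C0 thC] := @thC_le R N; exists C => // x.
rewrite /Theta; have [->|x0] := eqVneq x 0.
  by rewrite subrr mulr_ge0// exprn_ge0// enorm_ge0.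
by rewrite thC// enorm_gt0.
Qed.

Let yth (x : Rd) : R := enorm x `^ (- 2) + (-1) * enorm x `^ 2.

Let thE x : x != 0 -> Theta x = sg (yth x).
Proof.
move=> x0; rewrite /Theta (negbTE x0) /th /yth mulN1r powRN.
by rewrite -[2]/(2%:R) !powR_mulrn ?enorm_ge0.
Qed.

Let Myth : Mod Omp Wp (fun=> 1) (fun _ : unit => yth).
Proof.
apply: (ModD Wp_ge1 (fun=> ler01)); first exact: Mod_powR.
have := ModM Wp_ge1 (fun=> ler01) (fun=> ler01) (Mod_cst Omp Wp (-1)) (@Mod_powR R d unit 2).
by under eq_fun do rewrite mul1r.
Qed.

Let Dyth N : exists2 C : R, 0 <= C & forall (t : unit) x, Omp x ->
  sg (yth x) * (1 - sg (yth x)) * Wp x ^+ N <= C.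
Proof.
have [C C0 HC] := Theta_le N; have [C' C'0 HC'] := ThetaC_le N.
exists (2 ^+ N * (C + C')).
  by rewrite mulr_ge0 ?exprn_ge0// addr_ge0.
move=> _ x x0; rewrite -!(thE x0).
have /andP[t0 t1] := Theta_itv x.
apply: le_trans (ler_wpM2l _ (WpX_le N x0)) _; first by rewrite mulr_ge0// subr_ge0.
rewrite mulrCA ler_wpM2l ?exprn_ge0// mulrDr.
have r0 : 0 <= enorm x ^+ N by rewrite exprn_ge0// enorm_ge0.
have r1 : 0 <= (enorm x)^-1 ^+ N by rewrite exprn_ge0// invr_ge0 enorm_ge0.
apply: lerD.
  apply: le_trans (HC x); rewrite ler_wpM2r// ler_piMr//; lra.
apply: (@le_trans _ _ ((1 - Theta x) * (enorm x)^-1 ^+ N)).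
  by rewrite ler_wpM2r// ler_piMl// subr_ge0.
by rewrite exprVn ler_pdivrMr ?HC'// exprn_gt0// enorm_gt0.
Qed.

(** Off the origin [Theta] is the logistic function of |x|^-2 - |x|^2, which has moderate growth,
    and the derivative sg (1 - sg) decays rapidly at both ends. *)
Lemma Theta_grad : exists G : 'I_d -> Rd -> R,
  (forall x, x != 0 -> hasgrad Theta x (fun i => G i x)) /\
  forall i, Rap Omp Wp (fun=> 1) (fun _ : unit => G i).
Proof.
have [yG HG] := Mod_partial (@open_Omp R d) Myth.
exists (fun i x => 'D_(delta_mx ord0 i) yth x * (1.[sg (yth x)] * (sg (yth x) * (1 - sg (yth x))))).
split=> [x x0|i]; last first.
  have := RapM Wp_ge1 (fun=> ler01) (HG i) (Rap_horner_sg Wp_ge1 Myth Dyth 1).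
  by under eq_fun do rewrite mul1r.
have := @hasgrad_comp _ _ _ _ yth x _ (is_derive_sg (yth x)) (yG tt x x0).
rewrite (_ : (fun i => _) = (fun i => 'D_(delta_mx ord0 i) yth x *
  (1.[sg (yth x)] * (sg (yth x) * (1 - sg (yth x)))))); last first.
  by apply/funext => i; rewrite hornerC mul1r mulrC.
apply: hasgrad_near.
apply: filterS (open_nbhs_nbhs (conj (@open_Omp R d) x0)) => z z0.
by rewrite thE.
Qed.

(** The gradient is flat, hence extends by 0 to a Schwartz family. Only the function itself needs an
    estimate at the origin, the quadratic one from [ThetaC_le 2]. *)
Lemma Theta_SF : SF (fun=> 1) (fun _ : unit => Theta).
Proof.
have [G [TG HG]] := Theta_grad.
have [C C0 HC] := ThetaC_le 2.
pose G' i x := if x == 0 then 0 else G i x.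
apply: (@Rap_intro _ _ _ _ _ _ _ (fun i (_ : unit) => G' i)).
- move=> N; have [C' C'0 HC'] := Theta_le N.
  exists (2 ^+ N * (1 + C')); split; first by rewrite mulr_ge0 ?exprn_ge0 ?addr_ge0.
  move=> _ x _; have /andP[t0 t1] := Theta_itv x.
  have x0 := enorm_ge0 x.
  have WsX : Ws x ^+ N <= 2 ^+ N * (1 + enorm x ^+ N).
    have [r1|r1] := leP 1 (enorm x).
      apply: (@le_trans _ _ ((2 * enorm x) ^+ N)).
        rewrite lerXn2r ?nnegrE ?(ltW (Ws_gt0 _)) ?mulr_ge0// /Ws.
        by rewrite (_ : 2 * _ = enorm x + enorm x) ?lerD2r//; ring.
      by rewrite exprMn ler_wpM2l ?exprn_ge0// lerDr.
    apply: (@le_trans _ _ (2 ^+ N)).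
      by rewrite lerXn2r ?nnegrE ?(ltW (Ws_gt0 _))// /Ws lerD2l ltW.
    by rewrite ler_peMr ?exprn_ge0// lerDl exprn_ge0.
  rewrite mulr1 ger0_norm//; apply: le_trans (ler_wpM2l t0 WsX) _.
  by rewrite mulrCA ler_wpM2l ?exprn_ge0// mulrDr mulr1 lerD.
- move=> _ x _; rewrite /G'; have [->|x0] := eqVneq x 0; last exact: TG.
  apply: (@hasgrad_quadratic _ _ _ _ _ (C * d%:R ^+ 2) 1) => // h _.
  rewrite add0r Theta0 /gradmap big1 ?subr0; last by move=> i _; rewrite mulr0.
  have /andP[t0 t1] := Theta_itv h.
  rewrite distrC ger0_norm ?subr_ge0//; apply: le_trans (HC h) _.
  rewrite -mulrA -exprMn ler_wpM2l// lerXn2r ?nnegrE ?mulr_ge0 ?enorm_ge0//.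
  exact: enorm_le_norm.
- move=> i; apply: flat_SF => //; last by move=> _; rewrite /G' eqxx.
  move=> n; apply: Cn_eq (HG i n); first exact: open_Omp.
  + exact: rapb_eq.
  + by move=> _ x /negbTE x0; rewrite /G' x0.
Qed.

(* The dilates [chi (2^-j x)] sum up telescopically to 1 off the origin; [chi] is
   not compactly supported, but it vanishes to infinite order at the origin. *)
Definition chi (x : Rd) : R := Theta (2^-1 *: x) - Theta x.

(** At infinity both terms of [chi] decay rapidly; at the origin it is the difference of 1 - Theta x
    and 1 - Theta(x/2), which both vanish to infinite order. *)
Lemma chi_flat : FlatF (fun=> 1) (fun _ : unit => chi).
Proof.
have [G [TG HG]] := Theta_grad.
have s0 x : x != 0 -> 2^-1 *: x != 0 :> Rd by rewrite scaler_eq0 invr_eq0 pnatr_eq0.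
apply: (@Rap_intro _ _ _ _ _ _ _
  (fun i (_ : unit) x => 2^-1 ^+ 1 * G i (2^-1 *: x) + (-1) * G i x)).
- move=> N; have [C C0 HC] := Theta_le N; have [C' C'0 HC'] := ThetaC_le N.
  exists (2 ^+ N * ((2 ^+ N * C + C) + (C' * 2^-1 ^+ N + C'))).
  have h0 : 0 <= 2^-1 ^+ N :> R by rewrite exprn_ge0.
  have h1 : 0 <= 2 ^+ N :> R by rewrite exprn_ge0.
  split; first by rewrite mulr_ge0// !addr_ge0// mulr_ge0.
  move=> _ x x0; rewrite mulr1.
  apply: le_trans (ler_wpM2l (normr_ge0 _) (WpX_le N x0)) _.
  rewrite mulrCA ler_wpM2l// mulrDr.
  have /andP[t0 t1] := Theta_itv x.
  have /andP[u0 u1] := Theta_itv (2^-1 *: x).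
  have xp := Omp_gt0 x0.
  have r0 : 0 <= enorm x ^+ N by rewrite exprn_ge0// enorm_ge0.
  have r1 : 0 <= (enorm x)^-1 ^+ N by rewrite exprn_ge0// invr_ge0 enorm_ge0.
  have xN : enorm (2^-1 *: x) = 2^-1 * enorm x by rewrite enormZ ger0_norm.
  apply: lerD.
    apply: (@le_trans _ _ ((Theta (2^-1 *: x) + Theta x) * enorm x ^+ N)).
      by rewrite ler_wpM2r// /chi ler_norml; apply/andP; split; lra.
    rewrite mulrDl; apply: lerD; last exact: HC.
    have := HC (2^-1 *: x); rewrite xN exprMn => H.
    apply: le_trans (ler_wpM2l h1 H); rewrite mulrCA ler_wpM2l// mulrA -exprMn.
    by rewrite divff ?pnatr_eq0// expr1n mul1r.
  apply: (@le_trans _ _ (((1 - Theta (2^-1 *: x)) + (1 - Theta x)) * (enorm x)^-1 ^+ N)).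
    by rewrite ler_wpM2r// /chi ler_norml; apply/andP; split; lra.
  rewrite exprVn ler_pdivrMr ?exprn_gt0// mulrDl; apply: lerD; last exact: HC'.
  by have := HC' (2^-1 *: x); rewrite xN exprMn mulrA.
- move=> _ x x0; rewrite /chi.
  have h1 := hasgradZ (2^-1 ^+ 0) (hasgrad_scale (TG _ (s0 x x0))).
  have h2 := hasgradZ (-1) (TG x x0).
  apply: hasgrad_eq (hasgradD h1 h2) => [y|i]; first by rewrite expr0 mul1r mulN1r.
  by rewrite expr0 mul1r expr1.
- move=> i; apply: (RapD Wp_ge1); last exact: (RapZ Wp_ge1).
  move=> n; apply: (@Cn_dilate _ _ unit unit Omp _ _ id (fun=> 2^-1) n 1 (fun=> G i)) (HG i n).
    by move=> _ x; exact: s0.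
  move=> F k HF N; have [C [C0 FC]] := HF N.
  exists (2 ^+ N * C); split; first by rewrite mulr_ge0 ?exprn_ge0.
  move=> t x x0; have xp := Omp_gt0 x0; have := FC t _ (s0 x x0); rewrite !mulr1 => H.
  rewrite normrM mulrAC.
  have k1 : `|2^-1 ^+ k| <= 1 :> R.
    by rewrite ger0_norm ?exprn_ge0// exprn_ile1// invf_le1// ler1n.
  have W2 : Wp x <= 2 * Wp (2^-1 *: x).
    rewrite /Wp enormZ ger0_norm// invfM invrK mulrDr mulrA divff ?pnatr_eq0// mul1r lerD2l.
    by rewrite mulrA ler_peMl ?invr_ge0 ?(ltW xp)//; lra.
  have Wp0 : 0 <= Wp x by rewrite ltW// Wp_gt0.
  have Wp20 : 0 <= Wp (2^-1 *: x) by rewrite ltW// Wp_gt0//; exact: s0.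
  apply: (@le_trans _ _ (1 * (2 * Wp (2^-1 *: x)) ^+ N * `|F t (2^-1 *: x)|)).
    rewrite ler_wpM2r// ler_pM ?exprn_ge0//.
    by rewrite lerXn2r ?nnegrE ?mulr_ge0.
  by rewrite mul1r exprMn -mulrA ler_wpM2l ?exprn_ge0// mulrC.
Qed.

(** The gain [lam t] comes from the vanishing of [F] at the origin to first order, evaluated at lam
    x. *)
Let dilate_small {T : Type} (lam : T -> R) (F : fam unit) k :
  (forall t, 0 < lam t <= 1) -> rapb Omp Wp (fun=> 1) F ->
  modb Omp Wp lam (fun t x => lam t ^+ k * F tt (lam t *: x)).
Proof.
move=> l01 /(_ 1%N)[C [C0 FC]]; exists 1%N, C; split => // t x x0.
have /andP[l0 l1] := l01 t; have xp := Omp_gt0 x0.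
have lx0 : lam t *: x != 0 by rewrite scaler_eq0 negb_or gt_eqF.
have lxp := Omp_gt0 lx0.
rewrite normrM ger0_norm ?exprn_ge0 ?(ltW l0)//.
apply: (@le_trans _ _ (1 * `|F tt (lam t *: x)|)).
  by rewrite ler_wpM2r// exprn_ile1// ltW.
rewrite mul1r -mulrA; apply: (@le_trans _ _ (C * (lam t * enorm x))).
  have := FC tt _ lx0; rewrite mulr1 expr1 => H.
  have -> : lam t * enorm x = enorm (lam t *: x) by rewrite enormZ gtr0_norm.
  rewrite -ler_pdivrMr//; apply: le_trans H; rewrite ler_wpM2l//.
  exact: invenorm_le_Wp.
by rewrite expr1 ler_wpM2l// ler_wpM2l ?(ltW l0)// enorm_le_Wp.
Qed.

(** Decay of order k+1 at infinity: k powers of [lam t] pay for the factor in front, the last one is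
    the gain. *)
Let dilate_large {T : Type} (lam : T -> R) (F : fam unit) k :
  (forall t, 1 <= lam t) -> rapb Omp Wp (fun=> 1) F ->
  modb Omp Wp (fun t => (lam t)^-1) (fun t x => lam t ^+ k * F tt (lam t *: x)).
Proof.
move=> l1 /(_ k.+1)[C [C0 FC]]; exists k.+1, C; split => // t x x0.
have l0 : 0 < lam t by rewrite (lt_le_trans ltr01).
have xp := Omp_gt0 x0.
have lx0 : lam t *: x != 0 by rewrite scaler_eq0 negb_or gt_eqF.
have lxp := Omp_gt0 lx0.
rewrite normrM ger0_norm ?exprn_ge0 ?(ltW l0)//.
have := FC tt _ lx0; rewrite mulr1 => H.
have W0 : 0 <= Wp (lam t *: x) by rewrite ltW// Wp_gt0.
have H2 : `|F tt (lam t *: x)| * (lam t * enorm x) ^+ k.+1 <= C.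
  apply: le_trans H; rewrite ler_wpM2l// lerXn2r ?nnegrE ?mulr_ge0 ?(ltW l0) ?(ltW xp)//.
  by have := enorm_le_Wp (lam t *: x); rewrite enormZ gtr0_norm.
have L0 : 0 < lam t * enorm x ^+ k.+1 by rewrite mulr_gt0// exprn_gt0.
rewrite -(@ler_pM2r _ (lam t * enorm x ^+ k.+1))//.
apply: (@le_trans _ _ C).
  apply: le_trans H2; rewrite le_eqVlt; apply/orP; left; apply/eqP.
  by rewrite exprMn [lam t ^+ k.+1]exprS; ring.
rewrite [leRHS](_ : _ = C * (Wp x * enorm x) ^+ k.+1); last first.
  by rewrite exprMn; field; rewrite gt_eqF.
rewrite ler_peMr// exprn_ege1// /Wp mulrDl mulVf ?gt_eqF//.
by rewrite lerDr mulr_ge0 ?(ltW xp).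
Qed.

Let Theta_dilate_grad {T : Type} (lam eps : T -> R) (c : R) :
  (forall t, 0 <= eps t) -> (forall t, 0 < lam t) ->
  (forall (F : fam unit) k, rapb Omp Wp (fun=> 1) F ->
    modb Omp Wp eps (fun t x => lam t ^+ k * F tt (lam t *: x))) ->
  exists G : 'I_d -> fam T,
    (forall t x, Omp x -> hasgrad (fun x => c * Theta (lam t *: x)) x (fun i => G i t x)) /\
    forall i, Mod Omp Wp eps (G i).
Proof.
move=> e0 l0 H; have [G [TG HG]] := Theta_grad.
have lx0 t (x : Rd) : Omp x -> Omp (lam t *: x).
  by rewrite /Omp/= scaler_eq0 => /negbTE ->; rewrite orbF gt_eqF.
exists (fun i t x => c * (lam t ^+ 1 * G i (lam t *: x))); split.
  move=> t x x0; have := hasgradZ c (hasgrad_scale (TG _ (lx0 t x x0))).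
  by under eq_fun do rewrite -[X in X * _]expr1.
move=> i.
have Hi : Mod Omp Wp eps (fun t x => lam t ^+ 1 * G i (lam t *: x)).
  move=> n; apply: (@Cn_dilate _ _ unit T Omp _ _ (fun=> tt) lam n 1 (fun=> G i)) (HG i n).
    exact: lx0.
  exact: H.
have := ModM Wp_ge1 (fun=> ler01) e0 (Mod_cst Omp Wp c) Hi.
by under eq_fun do rewrite mul1r.
Qed.

(** As [lam] tends to 0 the low-pass filter tends to 1 with rate [lam] in every derivative. Fed into
    a distribution, this and [Theta_dilate_Mod] give the limits at both ends of the telescoping sum
    of frequency pieces. *)
Lemma ThetaC_dilate_Mod {T : Type} (lam : T -> R) : (forall t, 0 < lam t <= 1) ->
  Mod Omp Wp lam (fun t x => 1 - Theta (lam t *: x)).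
Proof.
move=> l01 n; have [C C0 HC] := ThetaC_le 1.
have l0 t : 0 < lam t by have /andP[] := l01 t.
have bT : modb Omp Wp lam (fun t x => 1 - Theta (lam t *: x)).
  exists 1%N, C; split => // t x x0; have /andP[t0 t1] := Theta_itv (lam t *: x).
  rewrite ger0_norm ?subr_ge0//; apply: le_trans (HC _) _.
  rewrite !expr1 -mulrA ler_wpM2l// enormZ gtr0_norm// ler_wpM2l ?(ltW (l0 t))//.
  exact: enorm_le_Wp.
case: n => [|n]; first by split.
split=> //; have [G [TG HG]] := Theta_dilate_grad (-1) (fun t => ltW (l0 t)) l0
  (fun F k => @dilate_small T lam F k l01).
exists G; split=> [t x x0|i]; last exact: HG.
apply: hasgrad_eq (hasgradD (hasgrad_cst 1 x) (TG t x x0)) => [y|j].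
  by rewrite mulN1r.
by rewrite add0r.
Qed.

Lemma Theta_dilate_Mod {T : Type} (lam : T -> R) : (forall t, 1 <= lam t) ->
  Mod Omp Wp (fun t => (lam t)^-1) (fun t x => Theta (lam t *: x)).
Proof.
move=> l1 n; have [C C0 HC] := Theta_le 1.
have l0 t : 0 < lam t by rewrite (lt_le_trans ltr01).
have bT : modb Omp Wp (fun t => (lam t)^-1) (fun t x => Theta (lam t *: x)).
  exists 1%N, C; split => // t x x0; have /andP[t0 t1] := Theta_itv (lam t *: x).
  have xp := Omp_gt0 x0.
  rewrite ger0_norm//; have := HC (lam t *: x).
  rewrite !expr1 enormZ gtr0_norm// -ler_pdivlMr ?mulr_gt0// invfM mulrA => H.
  apply: le_trans H _; rewrite ler_wpM2l ?mulr_ge0 ?invr_ge0 ?(ltW (l0 t))//.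
  exact: invenorm_le_Wp.
case: n => [|n]; first by split.
have e0 t : 0 <= (lam t)^-1 by rewrite invr_ge0 ltW.
split=> //; have [G [TG HG]] := Theta_dilate_grad 1 e0 l0
  (fun F k => @dilate_large T lam F k l1).
exists G; split=> [t x x0|i]; last exact: HG.
by have := TG t x x0; under eq_fun do rewrite mul1r.
Qed.

(** Removing the origin with 1 - Theta turns a Schwartz family into a flat one; this splits a
    Schwartz function on the frequency side into an element of S_oo and a low-pass part. *)
Lemma ThetaC_flat {T : Type} (eps : T -> R) (F : fam T) (lam : R) : 0 < lam ->
  SF eps F -> FlatF eps (fun t x => (1 - Theta (lam *: x)) * F t x).
Proof.
move=> l0 HF n.
(* The factor 1 - Theta vanishes at the origin to every order but does not decay at infinity. Decay
   there is left to [F], at the cost of N+1 powers of the weight. *)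
pose flat0 (m : fam T) := forall N, exists2 C : R, 0 <= C &
  forall t x, Omp x -> `|m t x| <= C * enorm x ^+ N.+1.
have [G [TG HG]] := Theta_grad.
have lx0 (x : Rd) : Omp x -> Omp (lam *: x).
  by rewrite /Omp/= scaler_eq0 => /negbTE ->; rewrite orbF gt_eqF.
have b0 : flat0 (fun (_ : T) x => 1 - Theta (lam *: x)).
  move=> N; have [C C0 HC] := ThetaC_le N.+1; exists (C * lam ^+ N.+1).
    by rewrite mulr_ge0// exprn_ge0// ltW.
  move=> _ x x0; have /andP[t0 t1] := Theta_itv (lam *: x).
  rewrite ger0_norm ?subr_ge0//; apply: le_trans (HC _) _.
  by rewrite enormZ gtr0_norm// exprMn mulrA.
have H0 : Cn Omp flat0 n (fun (_ : T) x => 1 - Theta (lam *: x)).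
  case: n => [|n]; first by split.
  split=> //; exists (fun i _ x => - lam ^+ 1 * G i (lam *: x)); split.
    move=> _ x x0; have h1 := hasgradZ (-1) (hasgrad_scale (TG _ (lx0 x x0))).
    apply: hasgrad_eq (hasgradD (hasgrad_cst 1 x) h1) => [y|j].
      by rewrite mulN1r.
    by rewrite add0r mulN1r mulNr expr1.
  move=> i; have Hr : Rap Omp Wp (fun=> 1) (fun _ : unit => (fun x => - G i x)).
    rewrite (_ : (fun _ : unit => fun x => - G i x) = (fun _ x => (-1) * G i x)).
      exact: (RapZ Wp_ge1).
    by apply/funext => _; apply/funext => x; rewrite mulN1r.
  rewrite (_ : (fun _ x => _) = (fun _ x => lam ^+ 1 * (- G i (lam *: x)))); last first.
    by apply/funext => _; apply/funext => x; rewrite mulrN mulNr.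
  apply: (@Cn_dilate _ _ unit T Omp _ _ (fun=> tt) (fun=> lam) n 1 _) (Hr n).
    by move=> _ x; exact: lx0.
  move=> F0 k HF' N; have [C [C0 FC]] := HF' N.+1.
  exists (lam ^+ k * C * lam ^+ N.+1).
    by rewrite !mulr_ge0// ?exprn_ge0// ltW.
  move=> _ x x0; have := FC tt _ (lx0 x x0); rewrite mulr1 => H.
  have lxp := Omp_gt0 (lx0 x x0).
  rewrite normrM ger0_norm ?exprn_ge0 ?(ltW l0)// -!mulrA ler_wpM2l ?exprn_ge0 ?(ltW l0)//.
  have -> : lam ^+ N.+1 * enorm x ^+ N.+1 = enorm (lam *: x) ^+ N.+1.
    by rewrite enormZ gtr0_norm// exprMn.
  rewrite -ler_pdivrMr ?exprn_gt0//; apply: le_trans H; rewrite ler_wpM2l// -exprVn.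
  rewrite lerXn2r ?nnegrE ?invr_ge0 ?(ltW lxp)//; last exact: invenorm_le_Wp.
  by rewrite ltW// Wp_gt0//; exact: lx0.
have H1 : Cn Omp (rapb Omp Ws eps) n F.
  apply: Cn_sub (HF n) => // {HF H0}F HF N.
  by have [C [C0 FC]] := HF N; exists C; split => // t x _; exact: FC.
apply: (CnM _ _ H0 H1) => [F1 F2 b1 b2 N|F1 F2]; last exact: (rapbD Wp_ge1).
have [C1 C10 HC1] := b1 N; have [C2 C20 HC2] := b1 0%N.
have [C3 [C30 HC3]] := b2 N.+1; have [C4 [C40 HC4]] := b2 1%N.
exists (2 ^+ N * (C2 * C3 + C1 * C4)).
split; first by rewrite mulr_ge0 ?exprn_ge0// addr_ge0// mulr_ge0.
move=> t x x0; have xp := Omp_gt0 x0.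
have e3 := HC3 t x x0; have e4 := HC4 t x x0; have e1 := HC1 t x x0; have e2 := HC2 t x x0.
have Wx : enorm x <= Ws x by rewrite /Ws lerDr.
apply: le_trans (ler_wpM2l (normr_ge0 _) (WpX_le N x0)) _.
rewrite mulrCA -!mulrA ler_wpM2l ?exprn_ge0// mulrDr mulrDl normrM; apply: lerD.
  apply: (@le_trans _ _ (C2 * enorm x ^+ 1 * `|F2 t x| * enorm x ^+ N)).
    by rewrite ler_wpM2r ?exprn_ge0 ?(ltW xp)// ler_wpM2r.
  rewrite -!mulrA ler_wpM2l// mulrCA -exprD; apply: le_trans e3; rewrite ler_wpM2l//.
  by rewrite add1n lerXn2r ?nnegrE ?(ltW xp) ?(ltW (Ws_gt0 _)).
apply: (@le_trans _ _ (C1 * enorm x ^+ N.+1 * `|F2 t x| * (enorm x)^-1 ^+ N)).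
  by rewrite ler_wpM2r ?exprn_ge0 ?invr_ge0 ?(ltW xp)// ler_wpM2r.
rewrite -!mulrA ler_wpM2l// mulrCA exprS -mulrA -exprMn divff ?gt_eqF// expr1n mulr1.
by apply: le_trans e4; rewrite ler_wpM2l// expr1.
Qed.

End cutoff.

(** * The Hartley transform *)

Section one_dimensional_integrals.
Context {R : realType}.
Local Notation mu := (@lebesgue_measure R).

Lemma derive1D (f g : R -> R) (x a b : R) : is_derive x 1 f a -> is_derive x 1 g b ->
  is_derive x 1 (fun y => f y + g y) (a + b).
Proof. by move=> df dg; exact: (@is_deriveD R R R f g x 1 a b df dg). Qed.

Lemma derive1M (f g : R -> R) (x a b : R) : is_derive x 1 f a -> is_derive x 1 g b ->
  is_derive x 1 (fun y => f y * g y) (a * g x + f x * b).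
Proof.
move=> df dg.
have dfg : is_derive x 1 (fun y => f y * g y) (f x *: b + g x *: a).
  exact: (@is_deriveM _ _ f g x 1 a b df dg).
apply: is_derive_eq dfg _.
by rewrite addrC; congr (_ + _); exact: mulrC.
Qed.

Lemma derive1Z (c : R) (f : R -> R) (x a : R) : is_derive x 1 f a ->
  is_derive x 1 (fun y => c * f y) (c * a).
Proof.
move=> df; apply: is_derive_eq (derive1M (is_derive_cst c x 1) df) _.
by rewrite mul0r add0r.
Qed.

Lemma derive1_lin (c x : R) : is_derive x 1 (fun y => c * y) c.
Proof.
apply: is_derive_eq (derive1Z c (is_derive_id x 1)) _.
exact: mulr1.
Qed.

Lemma even_intg (f : R -> R) (c : R) : (forall x, 0 <= f x) -> continuous f ->
  (forall x, f (- x) = f x) ->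
  (\int[mu]_(x in `[0%R, +oo[) (f x)%:E = c%:E)%E ->
  intg mu (f : measurableTypeR R -> R) /\ \int[mu]_x f x = 2 * c.
Proof.
move=> f0 cf fe fc.
have E : (\int[mu]_x (f x)%:E = (2 * c)%:E)%E.
  rewrite ge0_symfun_integralT//; last by move=> x /=; rewrite fe.
  rewrite (_ : [set x | _] = `[0, +oo[%classic) ?fc//.
  by apply/seteqP; split => x/=; rewrite in_itv/= andbT.
split; last by rewrite /Rintegral E.
apply: intg_ge0 => //; first exact: continuous_measurable_fun.
by rewrite E ltry.
Qed.

Lemma Rint_Vsqr : intg mu (fun s : measurableTypeR R => (1 + s ^+ 2)^-1) /\
  \int[mu]_s (1 + s ^+ 2)^-1 = pi.
Proof.
have := @even_intg (fun s => (1 + s ^+ 2)^-1) (pi / 2).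
rewrite mulrCA divff ?pnatr_eq0// mulr1; apply.
- by move=> x; rewrite invr_ge0 addr_ge0// sqr_ge0.
- exact: continuous_oneDsqrV.
- by move=> x; rewrite sqrrN.
- exact: integral0y_oneDsqr.
Qed.

Lemma Rint_odd1 (f : R -> R) : intg mu (f : measurableTypeR R -> R) ->
  (forall x, f (- x) = - f x) -> \int[mu]_s f s = 0.
Proof.
move=> fi fo.
have [hi hE] := intg_tensor fi (@intg_leb0 R (fun=> 1)).
rewrite -[LHS]mulr1 -(@Rint_leb0 R (fun=> 1)) -hE.
by apply: Rint_odd => // x; rewrite mxE fo mulNr.
Qed.

(** The antiderivative of e^(-es) (1 + cos(zs)) that vanishes at +oo. *)
Let primitive (e z s : R) : R :=
  expR (- e * s) * (- e^-1 + (e ^+ 2 + z ^+ 2)^-1 * (z * sin (z * s) + - e * cos (z * s))).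

Let primitive_derive (e z s : R) : 0 < e ->
  is_derive s 1 (primitive e z) (expR (- e * s) * (1 + cos (z * s))).
Proof.
move=> e0.
have dE : is_derive s 1 (fun s : R => expR (- e * s)) (expR (- e * s) * - e).
  exact: (@is_derive1_comp R expR (fun s => - e * s) s _ _ (is_derive_expR _) (derive1_lin _ _)).
have dS : is_derive s 1 (fun s : R => sin (z * s)) (cos (z * s) * z).
  exact: (@is_derive1_comp R sin (fun s => z * s) s _ _ (is_derive_sin _) (derive1_lin _ _)).
have dC : is_derive s 1 (fun s : R => cos (z * s)) (- sin (z * s) * z).
  exact: (@is_derive1_comp R cos (fun s => z * s) s _ _ (is_derive_cos _) (derive1_lin _ _)).
have dB := derive1D (is_derive_cst (- e^-1) s 1)
   (derive1Z (e ^+ 2 + z ^+ 2)^-1 (derive1D (derive1Z z dS) (derive1Z (- e) dC))).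
apply: is_derive_eq (derive1M dE dB) _.
have ez : e ^+ 2 + z ^+ 2 != 0 by rewrite gt_eqF// ltr_wpDr ?sqr_ge0// exprn_gt0.
by rewrite /cst; field; rewrite ez gt_eqF.
Qed.

Let primitive_cvg (e z : R) : 0 < e -> primitive e z s @[s --> +oo] --> (0 : R).
Proof.
move=> e0; pose C := e^-1 + (e ^+ 2 + z ^+ 2)^-1 * (`|z| + e).
have D0 : 0 <= (e ^+ 2 + z ^+ 2)^-1 by rewrite invr_ge0 addr_ge0// sqr_ge0.
have C0 : 0 < C.
  by rewrite /C ltr_pwDl ?invr_gt0// mulr_ge0// addr_ge0// ltW.
apply/cvgr0Pnorm_le => eps eps0.
near=> s.
have s0 : 0 < s by near: s; exact: nbhs_pinfty_gt.
apply: (@le_trans _ _ ((2 / (e * s)) * C)).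
  rewrite /primitive normrM ler_pM//.
    rewrite ger0_norm ?expR_ge0// mulNr -[leRHS]expr1.
    exact: (@expRN_le R (e * s) 1 (mulr_gt0 e0 s0)).
  apply: le_trans (ler_normD _ _) _; rewrite /C normrN ger0_norm ?invr_ge0 ?(ltW e0)//.
  rewrite lerD2l normrM ger0_norm// ler_wpM2l//.
  apply: le_trans (ler_normD _ _) _; rewrite !normrM normrN (gtr0_norm e0).
  apply: lerD; rewrite ler_piMr ?(ltW e0)// ler_norml.
    by rewrite sin_geN1 sin_le1.
  by rewrite cos_geN1 cos_le1.
have sC : 2 * C / (e * eps) <= s by near: s; apply: nbhs_pinfty_ge; exact: num_real.
rewrite ler_pdivrMr ?mulr_gt0// in sC.
rewrite mulrAC ler_pdivrMr ?mulr_gt0//.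
by apply: le_trans sC _; rewrite le_eqVlt; apply/orP; left; apply/eqP; ring.
Unshelve. all: by end_near. Qed.

Let trig_continuous (h : R -> R) (c : R) : continuous h -> continuous (fun s => h (c * s)).
Proof.
move=> ch s; apply: (@continuous_comp _ _ _ (fun s : R => c * s) h); last exact: ch.
by apply: differentiable_continuous; apply/derivable1_diffP; have [] := derive1_lin c s.
Qed.

(** Adding 1 to the cosine makes the integrand nonnegative, so that the fundamental theorem on a
    half-line applies without prior integrability. The instance z = 0 is subtracted afterwards. *)
Let abel_cos1 (e z : R) : 0 < e ->
  intg mu (fun s : measurableTypeR R => expR (- e * `|s|) * (1 + cos (z * s))) /\
  \int[mu]_s (expR (- e * `|s|) * (1 + cos (z * s))) = 2 * (e^-1 + e / (e ^+ 2 + z ^+ 2)).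
Proof.
move=> e0; apply: even_intg.
- by move=> s; rewrite mulr_ge0 ?expR_ge0// -lerBlDl sub0r cos_geN1.
- move=> s; apply: cvgM.
    apply: continuous_comp; last exact: continuous_expR.
    by apply: cvgM; [exact: cvg_cst|exact: norm_continuous].
  by apply: cvgD; [exact: cvg_cst|apply: trig_continuous; exact: continuous_cos].
- by move=> s; rewrite normrN mulrN cosN.
have -> : (e^-1 + e / (e ^+ 2 + z ^+ 2))%:E = (0%:E - (primitive e z 0)%:E)%E.
  rewrite [RHS](_ : _ = (0 - primitive e z 0)%:E)//; congr EFin.
  by rewrite /primitive !mulr0 expR0 sin0 cos0; ring.
rewrite -(@ge0_continuous_FTC2y _ (fun s => expR (- e * s) * (1 + cos (z * s))) (primitive e z) 0 0).
- by apply: eq_integral => s; rewrite inE/= in_itv/= andbT => s0; rewrite ger0_norm.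
- by move=> s s0; rewrite mulr_ge0 ?expR_ge0// -lerBlDl sub0r cos_geN1.
- apply: continuous_subspaceT => s; apply: cvgM.
    apply: trig_continuous; exact: continuous_expR.
  by apply: cvgD; [exact: cvg_cst|apply: trig_continuous; exact: continuous_cos].
- exact: primitive_cvg.
- by move=> s s0; have [] := primitive_derive z s e0.
- apply: cvg_at_right_filter; apply: differentiable_continuous; apply/derivable1_diffP.
  by have [] := primitive_derive z 0 e0.
- by move=> s _; have [_] := primitive_derive z s e0; rewrite derive1E.
Qed.

Lemma Rint_abel (e z : R) : 0 < e ->
  [/\ intg mu (fun s : measurableTypeR R => expR (- e * `|s|)),
      \int[mu]_s (expR (- e * `|s|) * cos (z * s)) = 2 * e / (e ^+ 2 + z ^+ 2) &
      \int[mu]_s (expR (- e * `|s|) * sin (z * s)) = 0].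
Proof.
move=> e0; have [i0 E0] := abel_cos1 0 e0; have [iz Ez] := abel_cos1 z e0.
have i1 : intg mu (fun s : measurableTypeR R => expR (- e * `|s|)).
  have := intgZ 2^-1 i0; congr intg; apply/funext => s.
  by rewrite mul0r cos0; field.
have E1 : \int[mu]_s expR (- e * `|s|) = 2 / e.
  have -> : 2 / e = 2^-1 * (2 * (e^-1 + e / (e ^+ 2 + 0 ^+ 2))) :> R.
    by rewrite expr0n/= addr0; field; rewrite gt_eqF.
  rewrite -E0 -RintegralZl//; apply: eq_Rintegral => s _.
  by rewrite mul0r cos0; field.
split=> //.
  have -> : 2 * e / (e ^+ 2 + z ^+ 2) = 2 * (e^-1 + e / (e ^+ 2 + z ^+ 2)) - 2 / e by ring.
  rewrite -Ez -E1 -RintegralB//; apply: eq_Rintegral => s _.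
  by ring.
apply: Rint_odd1; last by move=> s; rewrite normrN mulrN sinN mulrN.
apply: (intg_le _ _ i1) => [|s].
  apply: measurable_funM; first exact: intg_measurable i1.
  by apply: continuous_measurable_fun; apply: trig_continuous; exact: continuous_sin.
rewrite normrM ger0_norm ?expR_ge0// ler_piMr ?expR_ge0//.
by rewrite ler_norml sin_geN1 sin_le1.
Qed.

End one_dimensional_integrals.

(** * Integrals of Schwartz functions *)

Section schwartz_integrals.
Context {R : realType} {d : nat}.
Local Notation Rd := 'rV[R]_d.
Local Notation fam T := (T -> 'rV[R]_d -> R).
Local Notation intgd := (intg (leb R d)).

Lemma measurable_enorm : measurable_fun [set: Rd] (@enorm R d).
Proof.
apply: (measurableT_comp (@continuous_measurable_fun R Num.sqrt (@sqrt_continuous R))).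
apply: measurable_sum => i; apply: measurable_funM; exact: measurable_coord.
Qed.

Lemma measurable_WsV N : measurable_fun [set: Rd] (fun x : Rd => (Ws x)^-1 ^+ N).
Proof.
pose h (r : R) : R := (1 + `|r|)^-1 ^+ N.
have ch : continuous h.
  move=> r; apply: (@continuous_comp _ _ _ (fun r : R => (1 + `|r|)^-1) (fun y => y ^+ N)).
    apply: cvgV; first by rewrite gt_eqF// ltr_wpDr.
    by apply: cvgD; [exact: cvg_cst|exact: norm_continuous].
  exact: exprn_continuous.
rewrite (_ : (fun x => _) = h \o (@enorm R d)).
  by apply: measurableT_comp measurable_enorm; exact: continuous_measurable_fun.
by apply/funext => x; rewrite /h /= ger0_norm// enorm_ge0.
Qed.

(** Each 1 + x_i^2 is at most (1 + |x|)^2, so the weight of order 2d is dominated by a product of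
    Cauchy densities. This is the origin of the exponent 2d in all later estimates. *)
Lemma intg_WsV : intgd (fun x : Rd => (Ws x)^-1 ^+ (2 * d)).
Proof.
have [gi _] := intg_prod (fun _ : 'I_d => (@Rint_Vsqr R).1).
apply: intg_le (measurable_WsV _) _ gi => x.
have Ws0 := Ws_gt0 x.
rewrite ger0_norm ?exprn_ge0 ?invr_ge0 ?(ltW Ws0)//.
rewrite prodfV exprVn lef_pV2 ?posrE ?exprn_gt0//; last first.
  by apply: prodr_gt0 => i _; rewrite ltr_wpDr ?sqr_ge0.
rewrite exprM -[X in _ <= _ ^+ X](card_ord d) -prodr_const.
apply: ler_prod => i _; rewrite addr_ge0 ?sqr_ge0//= /Ws sqrrD expr1n mul1r.
rewrite -addrA lerD2l (le_trans (y := enorm x ^+ 2))//.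
  rewrite -[leLHS]real_normK ?num_real// lerXn2r ?nnegrE ?enorm_ge0//.
  exact: ler_coord_enorm.
by rewrite lerDr mulrn_wge0// enorm_ge0.
Qed.

Lemma hasgrad_measurable (f : Rd -> R) (G : Rd -> 'I_d -> R) :
  (forall x, hasgrad f x (G x)) -> measurable_fun [set: Rd] f.
Proof.
by move=> fG; apply: continuous_measurable_rV => x; exact: hasgrad_continuous (fG x).
Qed.

Definition schw (f : Rd -> R) := SF (fun=> 1) (fun _ : unit => f).

Lemma Rap_reindex {T T' : Type} (phi : T' -> T) Om W (eps : T -> R) (F : fam T) :
  Rap Om W eps F -> Rap Om W (eps \o phi) (fun t => F (phi t)).
Proof.
move=> + n => /(_ n); elim: n F => [|n IH] F.
  move=> [bF _]; split=> // N; have [C [C0 FC]] := bF N.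
  by exists C; split=> // t x; exact: FC.
move=> [bF [G [FG HG]]]; split.
  move=> N; have [C [C0 FC]] := bF N.
  by exists C; split=> // t x; exact: FC.
exists (fun i t => G i (phi t)); split=> [t|i]; first exact: FG.
exact: (IH _ (HG i)).
Qed.

Lemma SF_schw {T : Type} (eps : T -> R) (F : fam T) t : SF eps F -> schw (F t).
Proof.
move=> HF; have H := Rap_reindex (fun _ : unit => t) HF.
apply: (Rap_weak _ H); exists `|eps t| => // _ /=.
by rewrite mulr1 ler_norm.
Qed.

Lemma schw_SF {T : Type} (f : Rd -> R) : schw f -> SF (fun=> 1) (fun _ : T => f).
Proof. by move=> /(Rap_reindex (fun _ : T => tt)). Qed.

Lemma schw_measurable f : schw f -> measurable_fun [set: Rd] f.
Proof.
move=> /SF_hasgrad[G [fG _]].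
exact: (@hasgrad_measurable f (fun x i => G i tt x) (fun x => fG tt x)).
Qed.

Lemma SF_measurable {T : Type} (eps : T -> R) (F : fam T) t : SF eps F ->
  measurable_fun [set: Rd] (F t).
Proof. by move=> /(SF_schw t)/schw_measurable. Qed.

Lemma rapb_intg {T : Type} (eps : T -> R) (F : fam T) N :
  (forall t, measurable_fun [set: Rd] (F t)) -> rapb setT Ws eps F ->
  (forall t, intgd (fun x => `|F t x| * Ws x ^+ N)) /\
  exists2 C : R, 0 <= C & forall t, \int[leb R d]_x (`|F t x| * Ws x ^+ N) <= C * eps t.
Proof.
move=> mF HF; have [C [C0 FC]] := HF (N + 2 * d)%N.
have B t x : `|F t x| * Ws x ^+ N <= C * eps t * (Ws x)^-1 ^+ (2 * d).
  rewrite exprVn ler_pdivlMr ?exprn_gt0 ?Ws_gt0// -mulrA -exprD; exact: FC.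
have mW : measurable_fun [set: Rd] (fun x : Rd => Ws x ^+ N).
  apply: measurable_funX; apply: measurable_funD => //; exact: measurable_enorm.
have i1 t : intgd (fun x => `|F t x| * Ws x ^+ N).
  apply: (intg_le _ _ (intgZ (C * eps t) intg_WsV)).
    by apply: measurable_funM => //; exact: measurableT_comp.
  by move=> x; rewrite ger0_norm ?B// mulr_ge0// exprn_ge0// ltW// Ws_gt0.
split=> //.
exists (C * \int[leb R d]_x (Ws x)^-1 ^+ (2 * d)).
  by rewrite mulr_ge0// Rint_ge0// => x; rewrite exprn_ge0// invr_ge0 ltW// Ws_gt0.
move=> t; rewrite mulrAC -RintegralZl//; last exact: intg_WsV.
by apply: Rint_le => //; apply: intgZ; exact: intg_WsV.
Qed.

Lemma SF_intgW {T : Type} (eps : T -> R) (F : fam T) N t : SF eps F ->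
  intgd (fun x => `|F t x| * Ws x ^+ N).
Proof.
move=> HF; have [+ _] := rapb_intg N (fun t => SF_measurable t HF) (Rap_bd HF).
exact.
Qed.

Lemma SF_intg {T : Type} (eps : T -> R) (F : fam T) t : SF eps F -> intgd (F t).
Proof.
move=> HF; apply: intg_le (SF_measurable t HF) _ (SF_intgW 0 t HF) => x.
by rewrite expr0 mulr1.
Qed.

Lemma schw_intg f : schw f -> intgd f.
Proof. by move=> /(SF_intg tt). Qed.

Lemma SF_intg_norm {T : Type} (eps : T -> R) (F : fam T) : SF eps F ->
  exists2 C : R, 0 <= C & forall t, \int[leb R d]_x `|F t x| <= C * eps t.
Proof.
move=> HF; have [_ [C C0 H]] := rapb_intg 0 (fun t => SF_measurable t HF) (Rap_bd HF).
exists C => // t; have := H t.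
by under eq_Rintegral do rewrite expr0 mulr1.
Qed.

Lemma Ws_shift (x y : Rd) : enorm y <= 1 -> Ws x <= 2 * Ws (x + y).
Proof.
move=> y1; have := enormD (x + y) (- y); rewrite addrK enormN => H.
rewrite /Ws; have := enorm_ge0 (x + y); lra.
Qed.

(* Translation invariance kills the difference quotients of the integral. *)
Lemma Rint_partial (g : Rd -> R) (G : 'I_d -> Rd -> R) i : schw g ->
  (forall x, hasgrad g x (fun i => G i x)) -> (forall i, schw (G i)) ->
  \int[leb R d]_x G i x = 0.
Proof.
move=> Hg gG HG.
have [G2 [GG2 HG2]] := SF_hasgrad (HG i).
have [C [C0 HC]] := Rap_bd (HG2 i) (2 * d)%N.
pose e : Rd := delta_mx ord0 i.
have ge (f : Rd -> R) x F (t : R) : (forall y, hasgrad f y (F^~ y)) ->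
    exists2 c, 0 < c < 1 & f (x + t *: e) - f x = t * F i (x + c *: (t *: e)).
  move=> fF; have [c c01 E] := @hasgrad_MVT R d f x (t *: e) (fun s => F^~ (x + s *: (t *: e)))
    (fun s _ => fF _).
  exists c => //; rewrite E /gradmap (bigD1 i)//= !mxE !eqxx mulr1 big1 ?addr0//.
  by move=> j ji; rewrite !mxE (negbTE ji) andbF mulr0 mul0r.
have e1 : enorm e <= 1.
  apply: le_trans (enorm_le_sum _) _; rewrite (bigD1 i)//= mxE !eqxx normr1 big1 ?addr0//.
  by move=> j ji; rewrite mxE (negbTE ji) andbF normr0.
pose K := C * 2 ^+ (2 * d).
(* Two applications of the mean value theorem give a remainder of order t^2 times an integrable
   function. As the shift of [g] drops out of the integral, the integral of [G i] is at most t J for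
   every t in ]0, 1]. *)
have bnd (t : R) x : 0 < t <= 1 -> `|g (x + t *: e) - g x - t * G i x| <=
    t ^+ 2 * K * (Ws x)^-1 ^+ (2 * d).
  move=> /andP[t0 t1]; have [c /andP[c0 c1] ->] := ge g x G t gG.
  have [c' /andP[c'0 c'1]] := ge (G i) x (fun j => G2 j tt) (c * t) (fun y => GG2 tt y).
  rewrite -mulrBr [c *: (t *: e)]scalerA => ->; set y := x + c' *: _.
  rewrite !normrM (gtr0_norm t0) (gtr0_norm c0) expr2 -!mulrA ler_wpM2l ?(ltW t0)//.
  rewrite mulrCA ler_wpM2l ?(ltW t0)//.
  apply: (@le_trans _ _ `|G2 i tt y|); first by rewrite ler_piMl// ltW.
  have := HC tt y I; rewrite mulr1 => H.
  rewrite /K exprVn mulrA ler_pdivlMr ?exprn_gt0 ?Ws_gt0//.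
  apply: (@le_trans _ _ (`|G2 i tt y| * (2 * Ws y) ^+ (2 * d))).
    rewrite ler_wpM2l// lerXn2r ?nnegrE ?mulr_ge0 ?(ltW (Ws_gt0 _))//.
    rewrite /y; apply: Ws_shift; rewrite scalerA enormZ ger0_norm; last first.
      by rewrite !mulr_ge0// ltW.
    rewrite mulr_ile1 ?enorm_ge0//; first by rewrite !mulr_ge0// ltW.
    by rewrite !mulr_ile1 ?mulr_ge0// ltW.
  by rewrite exprMn mulrCA [leRHS]mulrC ler_wpM2l ?exprn_ge0.
pose J := K * \int[leb R d]_x (Ws x)^-1 ^+ (2 * d).
have gi := schw_intg Hg; have Gi := schw_intg (HG i).
have bJ (t : R) : 0 < t <= 1 -> `|\int[leb R d]_x G i x| <= t * J.
  move=> t01; have /andP[t0 t1] := t01.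
  have si := intg_shift (t *: e) gi.
  have E : \int[leb R d]_x (g (x + t *: e) - g x - t * G i x) = - (t * \int[leb R d]_x G i x).
    rewrite RintegralB//; [|exact: intgB|exact: intgZ].
    by rewrite RintegralB// Rint_shift// subrr sub0r RintegralZl.
  have Wi := intgZ (t ^+ 2 * K) intg_WsV.
  have := Rint_norm_le (intgB (intgB si gi) (intgZ t Gi)) Wi (fun x => bnd t x t01).
  rewrite E normrN normrM (gtr0_norm t0) RintegralZl//; last exact: intg_WsV.
  have -> : t ^+ 2 * K * \int[leb R d]_x (Ws x)^-1 ^+ (2 * d) = t * (t * J).
    by rewrite /J expr2 !mulrA.
  by rewrite ler_pM2l.
have J0 : 0 <= J by have := bJ 1; rewrite ltr01 lexx mul1r => /(_ isT); exact: le_trans.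
apply/eqP; rewrite -normr_le0 leNgt; apply/negP => I0.
set A := `|_| in I0 bJ.
have D0 : 0 < A + J + A by lra.
(* At t = A / (2A + J) the bound t J is strictly smaller than A, a contradiction. *)
have t01 : 0 < A / (A + J + A) <= 1.
  apply/andP; split; first exact: divr_gt0.
  by rewrite ler_pdivrMr// mul1r; lra.
have := bJ _ t01; rewrite mulrAC ler_pdivlMr// ler_pM2l//; lra.
Qed.

End schwartz_integrals.

(** * The kernel of the Hartley transform *)

Section cas.
Context {R : realType}.

Definition cas (t : R) : R := cos t + sin t.

Lemma is_derive_cas (t : R) : is_derive t 1 cas (cas (- t)).
Proof.
apply: is_derive_eq (derive1D (is_derive_cos t) (is_derive_sin t)) _.
by rewrite /cas cosN sinN addrC.
Qed.

Lemma cas_continuous : continuous cas.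
Proof.
by move=> t; apply: differentiable_continuous; apply/derivable1_diffP; have [] := is_derive_cas t.
Qed.

Lemma cas_le2 (t : R) : `|cas t| <= 2.
Proof.
apply: le_trans (ler_normD _ _) _; rewrite [leRHS](_ : 2 = 1 + 1)//.
by apply: lerD; rewrite ler_norml ?cos_geN1 ?cos_le1// sin_geN1 sin_le1.
Qed.

Let cas_MVT (a b : R) : exists2 c, `|c - a| <= `|b - a| & cas b - cas a = cas (- c) * (b - a).
Proof.
have cc x y : {within `[x, y], continuous cas}.
  by apply: continuous_subspaceT => z; exact: cas_continuous.
have [ab|/ltW ba] := leP a b.
  have [c + E] := @MVT_segment R cas (fun t => cas (- t)) a b ab (fun t _ => is_derive_cas t) (cc _ _).
  rewrite in_itv/= => /andP[ac cb]; exists c => //.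
  by rewrite !ger0_norm ?subr_ge0// lerD2r.
have [c + E] := @MVT_segment R cas (fun t => cas (- t)) b a ba (fun t _ => is_derive_cas t) (cc _ _).
rewrite in_itv/= => /andP[bc ca]; exists c => //.
  by rewrite !ler0_norm ?subr_le0// lerN2 lerD2r.
by rewrite -opprB E -mulrN opprB.
Qed.

Lemma cas_lip (a b : R) : `|cas b - cas a| <= 2 * `|b - a|.
Proof.
have [c _ ->] := cas_MVT a b.
by rewrite normrM ler_wpM2r// cas_le2.
Qed.

Lemma cas_taylor (a b : R) : `|cas (a + b) - cas a - b * cas (- a)| <= 2 * b ^+ 2.
Proof.
have [c ca ->] := cas_MVT a (a + b).
rewrite addrAC subrr add0r in ca *.
rewrite mulrC -mulrBr normrM -[b ^+ 2]real_normK ?num_real// expr2 mulrCA ler_wpM2l//.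
apply: le_trans (cas_lip _ _) _; rewrite ler_wpM2l//.
by rewrite opprK addrC -normrN opprD opprK addrC; exact: ca.
Qed.

(** The substitute for e^(ia) e^(-ib) = e^(i(a-b)): the cosine yields a convolution kernel, and the
    sine is disposed of by parity. *)
Lemma casM (a b : R) : cas a * cas b = cos (a - b) + sin (a + b).
Proof. by rewrite /cas cosB sinD; ring. Qed.

Lemma cas0 : cas 0 = 1.
Proof. by rewrite /cas cos0 sin0 addr0. Qed.

End cas.

(** * Hartley transform of Schwartz functions and of functions without moments *)

Section hartley.
Context {R : realType} {d : nat}.
Local Notation Rd := 'rV[R]_d.
Local Notation fam T := (T -> 'rV[R]_d -> R).
Local Notation intgd := (intg (leb R d)).

Lemma measurable_dotp (xi : Rd) : measurable_fun [set: Rd] (fun x : Rd => dotp x xi).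
Proof.
apply: measurable_sum => i; apply: measurable_funM; first exact: measurable_coord.
exact: measurable_cst.
Qed.

Lemma measurable_cas (xi : Rd) : measurable_fun [set: Rd] (fun x : Rd => cas (dotp x xi)).
Proof.
apply: (measurableT_comp (continuous_measurable_fun (@cas_continuous R))).
exact: measurable_dotp.
Qed.

(* the Hartley transform *)
Definition Ht (f : Rd -> R) (xi : Rd) : R := \int[leb R d]_x (cas (dotp x xi) * f x).

Lemma cas_intg (f : Rd -> R) (xi : Rd) : intgd f -> intgd (fun x => cas (dotp x xi) * f x).
Proof.
move=> fi; apply: (intg_le _ _ (intgZ 2 (intg_norm fi))).
  by apply: measurable_funM; [exact: measurable_cas|exact: intg_measurable fi].
by move=> x; rewrite normrM ler_wpM2r// cas_le2.
Qed.

Lemma Ht_le (f : Rd -> R) (xi : Rd) : intgd f ->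
  `|Ht f xi| <= 2 * \int[leb R d]_x `|f x|.
Proof.
move=> fi; rewrite -RintegralZl//; last exact: intg_norm.
apply: Rint_norm_le; [exact: cas_intg|by apply: intgZ; exact: intg_norm|].
by move=> x; rewrite normrM ler_wpM2r// cas_le2.
Qed.

Lemma HtD (f g : Rd -> R) xi : intgd f -> intgd g ->
  Ht (fun x => f x + g x) xi = Ht f xi + Ht g xi.
Proof.
move=> fi gi; rewrite /Ht -RintegralD//; [|exact: cas_intg|exact: cas_intg].
by apply: eq_Rintegral => x _; rewrite mulrDr.
Qed.

Lemma HtZ (c : R) (f : Rd -> R) xi : intgd f -> Ht (fun x => c * f x) xi = c * Ht f xi.
Proof.
move=> fi; rewrite /Ht -RintegralZl//; last exact: cas_intg.
by apply: eq_Rintegral => x _; rewrite mulrCA.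
Qed.

Lemma Ht_reflect (f : Rd -> R) (xi : Rd) : intgd f ->
  Ht (fun x => f (- x)) xi = \int[leb R d]_x (cas (- dotp x xi) * f x).
Proof.
move=> fi; have fi' : intgd (fun x => f (- x)).
  by have := intg_reflect 0 fi; under eq_fun do rewrite sub0r.
rewrite /Ht -(@Rint_reflect R d 0); last exact: cas_intg.
by apply: eq_Rintegral => x _; rewrite sub0r opprK dotpNl.
Qed.

Lemma SF_dilate {T : Type} (eps : T -> R) (F : fam T) (c : R) : c != 0 ->
  SF eps F -> SF eps (fun t x => F t (c *: x)).
Proof.
move=> c0 HF n.
rewrite (_ : (fun t x => _) = (fun t x => c ^+ 0 * F t (c *: x))); last first.
  by apply/funext => t; apply/funext => x; rewrite expr0 mul1r.
apply: (@Cn_dilate _ _ T T setT (rapb setT Ws eps) _ id (fun=> c)) (HF n) => //.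
move=> {HF}F k HF N; have [C [C0 FC]] := HF N.
exists (`|c| ^+ k * (1 + `|c|^-1) ^+ N * C).
split; first by rewrite !mulr_ge0 ?exprn_ge0// addr_ge0// invr_ge0.
move=> t x _; rewrite normrM normrX -!mulrA ler_wpM2l ?exprn_ge0//.
apply: le_trans (ler_wpM2l _ (FC t (c *: x) I)); last by rewrite exprn_ge0// addr_ge0// invr_ge0.
have ci : 0 <= `|c|^-1 by rewrite invr_ge0.
rewrite mulrCA ler_wpM2l// -exprMn lerXn2r//.
- by rewrite nnegrE ltW// Ws_gt0.
- by rewrite nnegrE; apply: mulr_ge0; [rewrite addr_ge0|rewrite ltW// Ws_gt0].
rewrite /Ws enormZ mulrDr mulr1 mulrDl mul1r mulrA mulVf ?normr_eq0// mul1r.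
have := normr_ge0 c; have := enorm_ge0 x => x0 cp.
by rewrite -!addrA lerD2l addrA lerDr addr_ge0// mulr_ge0.
Qed.

Lemma SF_reflect {T : Type} (eps : T -> R) (F : fam T) :
  SF eps F -> SF eps (fun t x => F t (- x)).
Proof.
move=> HF; have := @SF_dilate T eps F (-1) _ HF.
rewrite oppr_eq0 oner_eq0 => /(_ isT).
by under eq_fun do under eq_fun do rewrite scaleN1r.
Qed.

Lemma SF_coordM {T : Type} (eps : T -> R) (F : fam T) i :
  SF eps F -> SF eps (fun t x => x ord0 i * F t x).
Proof.
move=> HF.
have := RapM (@Ws_ge1' R d) (fun=> ler01)
  (@Mod_coord R d T setT Ws i (fun x _ => coord_le_Ws x i)) HF.
by under eq_fun do rewrite mul1r.
Qed.

Lemma SFZ {T : Type} (eps : T -> R) (F : fam T) (c : R) :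
  SF eps F -> SF eps (fun t x => c * F t x).
Proof. exact: (RapZ (@Ws_ge1' R d)). Qed.

Lemma SFD {T : Type} (eps : T -> R) (F G : fam T) :
  SF eps F -> SF eps G -> SF eps (fun t x => F t x + G t x).
Proof. exact: (RapD (@Ws_ge1' R d)). Qed.

(** What differentiating the transform in the direction i does to the function. The derivative of
    cas t is cas(-t), hence the reflection beside the multiplication by the coordinate. *)
Definition Xr (i : 'I_d) (f : Rd -> R) (x : Rd) : R := - x ord0 i * f (- x).

Lemma SF_Xr {T : Type} (eps : T -> R) (F : fam T) i :
  SF eps F -> SF eps (fun t => Xr i (F t)).
Proof.
move=> /SF_reflect/(SF_coordM i)/(SFZ (-1)).
by under eq_fun do under eq_fun do rewrite mulN1r -mulNr.
Qed.

Lemma schw_Xr (f : Rd -> R) i : schw f -> schw (Xr i f).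
Proof. exact: SF_Xr. Qed.

(** Taylor's formula for [cas] under the integral; the second moment of |f| bounds the quadratic
    remainder. *)
Lemma Ht_hasgrad (f : Rd -> R) (xi : Rd) : schw f -> hasgrad (Ht f) xi (fun i => Ht (Xr i f) xi).
Proof.
move=> Hf; have fi := schw_intg Hf.
have f2 : intgd (fun x => `|f x| * Ws x ^+ 2) := SF_intgW 2 tt Hf.
pose K := \int[leb R d]_x (`|f x| * Ws x ^+ 2).
have xfi i : intgd (fun x => x ord0 i * f x) by exact: (schw_intg (SF_coordM i Hf)).
have xci i : intgd (fun x => cas (- dotp x xi) * (x ord0 i * f x)).
  have := cas_intg (- xi) (xfi i).
  by under eq_fun do rewrite dotpNr.
have XE i : Ht (Xr i f) xi = \int[leb R d]_x (cas (- dotp x xi) * (x ord0 i * f x)).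
  rewrite -Ht_reflect//; apply: eq_Rintegral => x _.
  by rewrite /Xr mxE.
apply: (@hasgrad_quadratic _ _ _ _ _ (2 * K * d%:R ^+ 2) 1) => // h _.
have -> : gradmap (fun i => Ht (Xr i f) xi) h =
    \int[leb R d]_x (dotp x h * cas (- dotp x xi) * f x).
  transitivity (\sum_i \int[leb R d]_x (h ord0 i * (cas (- dotp x xi) * (x ord0 i * f x)))).
    by apply: eq_bigr => i _; rewrite XE RintegralZl//; exact: xci.
  rewrite -Rint_sum; last by move=> i; exact: intgZ.
  apply: eq_Rintegral => x _; rewrite /dotp !mulr_suml; apply: eq_bigr => i _.
  by ring.
have di : intgd (fun x => dotp x h * cas (- dotp x xi) * f x).
  have := @intg_sum _ _ _ (leb R d) _ (index_enum 'I_d)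
    (fun i x => h ord0 i * (cas (- dotp x xi) * (x ord0 i * f x))) (fun i => intgZ _ (xci i)).
  congr intg; apply/funext => x; rewrite /dotp !mulr_suml; apply: eq_bigr => i _.
  by ring.
have i1 := cas_intg (xi + h) fi; have i2 := cas_intg xi fi; have i3 := intgB i1 i2.
rewrite /Ht -RintegralB// -RintegralB//.
have bx x : `|cas (dotp x (xi + h)) * f x - cas (dotp x xi) * f x -
    dotp x h * cas (- dotp x xi) * f x| <= 2 * (d%:R * `|h|) ^+ 2 * (`|f x| * Ws x ^+ 2).
  rewrite -!mulrBl normrM dotpDr.
  apply: le_trans (ler_wpM2r (normr_ge0 _) (cas_taylor _ _)) _.
  rewrite [leRHS](_ : _ = 2 * (d%:R * `|h| * Ws x) ^+ 2 * `|f x|); last by rewrite !exprMn; ring.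
  apply: ler_wpM2r => //; apply: ler_wpM2l => //.
  rewrite -[leLHS]real_normK ?num_real// lerXn2r ?nnegrE//.
    by apply: mulr_ge0; [exact: mulr_ge0|exact: ltW (Ws_gt0 _)].
  apply: le_trans (dotp_le _ _) _; rewrite mulrC.
  apply: ler_pM; [exact: enorm_ge0|exact: enorm_ge0|exact: enorm_le_norm|].
  by rewrite /Ws lerDr.
apply: le_trans (Rint_norm_le _ _ bx) _.
- apply: intgB => //; apply: intgB; exact: cas_intg.
- exact: intgZ.
by rewrite RintegralZl// -/K le_eqVlt; apply/orP; left; apply/eqP; rewrite exprMn; ring.
Qed.

Lemma cas_Mod (xi : Rd) (c : R) :
  Mod setT (@Ws R d) (fun _ : unit => 1) (fun _ x => cas (c * dotp x xi)).
Proof.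
move=> n.
apply: (@Cn_coind _ _ _ _ _ (fun F => exists a b : R, F = fun _ x => a * cas (b * dotp x xi))).
  move=> _ [a [b ->]]; split.
    exists 0%N, (`|a| * 2); split; first by rewrite mulr_ge0.
    by move=> _ x _; rewrite !mulr1 normrM ler_wpM2l// cas_le2.
  exists (fun i _ x => (a * b * xi ord0 i) * cas (- b * dotp x xi)); split; last first.
    by move=> i; exists (a * b * xi ord0 i), (- b).
  move=> _ x _.
  have gd : hasgrad (fun x : Rd => b * dotp x xi) x (fun i => b * xi ord0 i).
    apply: hasgradZ; apply: (@hasgrad_quadratic _ _ _ _ _ 0 1) => // h _.
    by rewrite mul0r normr_le0 dotpDl (addrC (dotp x xi)) addrK subr_eq0.
  apply: hasgrad_eq (hasgradZ a (hasgrad_comp (is_derive_cas _) gd)) => // i.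
  by rewrite mulNr; ring.
by exists 1, c; apply/funext => _; apply/funext => x; rewrite mul1r.
Qed.

(** Integration by parts: the integral of the i-th derivative of cas(-x.xi) f(x) is 0 by
    [Rint_partial], and the remaining kernel cas(-x.xi) is a reflection of the argument. *)
Lemma Ht_coord (f : Rd -> R) (G : 'I_d -> Rd -> R) (i : 'I_d) (xi : Rd) : schw f ->
  (forall x, hasgrad f x (fun i => G i x)) -> (forall i, schw (G i)) ->
  xi ord0 i * Ht f xi = Ht (fun x => G i (- x)) xi.
Proof.
move=> Hf fG HG.
have fi := schw_intg Hf; have Gi := schw_intg (HG i).
have sM (h : Rd -> R) c : schw h -> schw (fun x => cas (c * dotp x xi) * h x).
  move=> Hh; have := RapM (@Ws_ge1' R d) (fun=> ler01) (cas_Mod xi c) Hh.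
  by under eq_fun do rewrite mul1r.
have gg x : hasgrad (fun x => cas (-1 * dotp x xi) * f x) x
    (fun i => - xi ord0 i * (cas (1 * dotp x xi) * f x) + cas (-1 * dotp x xi) * G i x).
  have gd : hasgrad (fun x : Rd => -1 * dotp x xi) x (fun i => -1 * xi ord0 i).
    apply: hasgradZ; apply: (@hasgrad_quadratic _ _ _ _ _ 0 1) => // h _.
    by rewrite mul0r normr_le0 dotpDl (addrC (dotp x xi)) addrK subr_eq0.
  apply: hasgrad_eq (hasgradM (hasgrad_comp (is_derive_cas _) gd) (fG x)) => // j.
  by rewrite mulN1r opprK mul1r; ring.
have := @Rint_partial R d _ (fun i x => - xi ord0 i * (cas (1 * dotp x xi) * f x) +
   cas (-1 * dotp x xi) * G i x) i (sM f (-1) Hf) gg.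
move=> /(_ (fun j => SFD (SFZ _ (sM _ _ Hf)) (sM _ _ (HG j)))).
rewrite RintegralD//; last 2 first.
- by apply: intgZ; apply: schw_intg; exact: sM.
- by apply: schw_intg; exact: sM.
rewrite RintegralZl//; last by apply: schw_intg; exact: sM.
rewrite Ht_reflect// /Ht mulNr.
under eq_Rintegral do rewrite mul1r.
under [X in _ + X]eq_Rintegral do rewrite mulN1r.
by move=> /eqP; rewrite addrC subr_eq0 => /eqP ->.
Qed.

(** Decay: one power of the weight is at most 1 + sum |x_i|, and each coordinate becomes a
    derivative by [Ht_coord]. Smoothness: the transforms are closed under differentiation through
    [Xr]. *)
Lemma SF_Ht {T : Type} (eps : T -> R) (F : fam T) : (forall t, 0 <= eps t) ->
  SF eps F -> SF eps (fun t => Ht (F t)).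
Proof.
move=> e0 HF n.
have bH (H : fam T) : SF eps H -> rapb setT Ws eps (fun t => Ht (H t)).
  move=> + N; elim: N H => [|N IH] H HH.
    have [C C0 HC] := SF_intg_norm HH; exists (2 * C); split; first by rewrite mulr_ge0.
    move=> t x _; rewrite expr0 mulr1; apply: le_trans (Ht_le _ (SF_intg t HH)) _.
    by rewrite -mulrA ler_wpM2l.
  have [G [HG GG]] := SF_hasgrad HH.
  have [C [C0 HC]] := IH _ HH.
  have /choice[K HK] : forall i, exists K : R, 0 <= K /\ forall t x, [set: Rd] x ->
      `|Ht (fun y => G i t (- y)) x| * Ws x ^+ N <= K * eps t.
    by move=> i; exact: IH (SF_reflect (GG i)).
  exists (C + \sum_i K i); split; first by rewrite addr_ge0// sumr_ge0// => i _; have [] := HK i.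
  move=> t x _; rewrite exprSr mulrA {2}/Ws mulrDr mulr1 mulrDl; apply: lerD; first exact: HC.
  apply: (@le_trans _ _ (`|Ht (H t) x| * Ws x ^+ N * \sum_i `|x ord0 i|)).
    by rewrite ler_wpM2l ?enorm_le_sum// mulr_ge0// exprn_ge0// ltW// Ws_gt0.
  rewrite mulr_sumr mulr_suml; apply: ler_sum => i _.
  rewrite mulrC mulrA -normrM (@Ht_coord (H t) (fun i => G i t))//.
  - by have [_] := HK i; apply.
  - exact: SF_schw HH.
  - by move=> j; exact: SF_schw (GG j).
apply: (@Cn_coind _ _ _ _ _ (fun F' => exists2 H, SF eps H & F' = fun t => Ht (H t))).
  move=> _ [H HH ->]; split; first exact: bH.
  exists (fun i t => Ht (Xr i (H t))); split.
    by move=> t x _; apply: Ht_hasgrad; exact: SF_schw HH.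
  by move=> i; exists (fun t => Xr i (H t)) => //; exact: SF_Xr.
by exists F.
Qed.

Lemma schw_Ht (f : Rd -> R) : schw f -> schw (Ht f).
Proof. by move=> Hf; exact: SF_Ht. Qed.

(* the real-valued elements of S_oo *)
Definition schw0 (f : Rd -> R) := schw f /\
  forall a, \int[leb R d]_x (monomial a x * f x) = 0.

Lemma monomialN a (x : Rd) : monomial a (- x) = (-1) ^+ (\sum_i a i) * monomial a x.
Proof.
rewrite /monomial -prodrXr -big_split; apply: eq_bigr => i _.
by rewrite mxE; exact: exprNn.
Qed.

Lemma monomial_coord a (x : Rd) i :
  monomial a x * x ord0 i = monomial [ffun j => (a j + (j == i))%N] x.
Proof.
rewrite /monomial (bigD1 i)//= [RHS](bigD1 i)//= ffunE eqxx addn1 exprSr mulrAC.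
by congr (_ * _); apply: eq_bigr => j /negbTE ji; rewrite ffunE ji addn0.
Qed.

Lemma schw_monomial a (f : Rd -> R) : schw f -> schw (fun x => monomial a x * f x).
Proof.
move=> Hf; rewrite /monomial.
have P i k (h : Rd -> R) : schw h -> schw (fun x => x ord0 i ^+ k * h x).
  move=> Hh; elim: k => [|k IHk].
    by rewrite (_ : (fun x => _) = h)//; apply/funext => x; rewrite mul1r.
  rewrite (_ : (fun x => _) = (fun x : Rd => x ord0 i * (x ord0 i ^+ k * h x))).
    exact: (SF_coordM i IHk).
  by apply/funext => x; rewrite exprS mulrA.
have H (s : seq 'I_d) : schw (fun x => (\prod_(i <- s) x ord0 i ^+ a i) * f x).
  elim: s => [|i s IH].
    by rewrite (_ : (fun x => _) = f)//; apply/funext => x; rewrite big_nil mul1r.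
  rewrite (_ : (fun x => _) = (fun x : Rd => x ord0 i ^+ a i *
    ((\prod_(i <- s) x ord0 i ^+ a i) * f x))); first exact: P.
  by apply/funext => x; rewrite big_cons mulrA.
exact: H.
Qed.

Lemma schw0_Xr (f : Rd -> R) i : schw0 f -> schw0 (Xr i f).
Proof.
move=> [Hf f0]; split; first exact: schw_Xr.
move=> a; have Hm := schw_intg (schw_monomial a (schw_Xr i Hf)).
rewrite -(Rint_reflect 0 Hm).
transitivity (\int[leb R d]_x ((-1) ^+ (\sum_i a i) *
    (monomial [ffun j => (a j + (j == i))%N] x * f x))).
  apply: eq_Rintegral => x _; rewrite sub0r /Xr opprK mxE opprK monomialN -monomial_coord.
  by ring.
rewrite RintegralZl ?f0 ?mulr0//; exact: (schw_intg (schw_monomial _ Hf)).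
Qed.

Lemma schw0_Ht0 (f : Rd -> R) : schw0 f -> Ht f 0 = 0.
Proof.
move=> [_ /(_ [ffun=> 0%N])] f0; rewrite -[RHS]f0; apply: eq_Rintegral => x _.
rewrite (_ : dotp x 0 = 0) ?cas0; last by rewrite /dotp big1// => i _; rewrite mxE mulr0.
by rewrite /monomial big1// => i _; rewrite ffunE expr0.
Qed.

(** The transform vanishes at 0, and so do its derivatives, which are transforms of functions
    without moments again. The mean value theorem then yields one more power of |x| at each
    induction step. *)
Lemma schw0_Ht_flat {T : Type} (f : Rd -> R) : schw0 f -> FlatF (fun=> 1) (fun _ : T => Ht f).
Proof.
move=> Hf n.
have small N g : schw0 g -> exists2 C : R, 0 <= C & forall x, `|Ht g x| <= C * enorm x ^+ N.
  elim: N g => [|N IH] g Hg.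
    exists (2 * \int[leb R d]_x `|g x|).
      by rewrite mulr_ge0// Rint_ge0.
    by move=> x; rewrite expr0 mulr1 Ht_le//; exact: schw_intg Hg.1.
  have /choice[K HK] : forall i, exists K : R, 0 <= K /\
      forall x, `|Ht (Xr i g) x| <= K * enorm x ^+ N.
    by move=> i; have [C C0 HC] := IH _ (schw0_Xr i Hg); exists C.
  have K0 : 0 <= \sum_i K i by rewrite sumr_ge0// => i _; have [] := HK i.
  exists (d%:R * \sum_i K i); first by rewrite mulr_ge0.
  move=> x; have [c /andP[c0 c1]] := @hasgrad_MVT R d (Ht g) 0 x
    (fun s i => Ht (Xr i g) (0 + s *: x)) (fun s _ => Ht_hasgrad _ Hg.1).
  rewrite add0r schw0_Ht0// subr0 => ->.
  apply: le_trans (@gradmap_le R d _ x ((\sum_i K i) * enorm x ^+ N) _) _.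
    move=> i; rewrite add0r; have [Ki0 HKi] := HK i.
    apply: le_trans (HKi _) _; apply: ler_pM => //; first by rewrite exprn_ge0// enorm_ge0.
      by rewrite (bigD1 i)//= lerDl sumr_ge0// => j _; have [] := HK j.
    rewrite enormZ gtr0_norm// lerXn2r ?nnegrE ?mulr_ge0 ?enorm_ge0 ?(ltW c0)//.
    by rewrite ler_piMl ?enorm_ge0// ltW.
  by rewrite exprSr !mulrA.
apply: (@Cn_coind _ _ _ _ _ (fun F => exists2 g, schw0 g & F = fun=> Ht g)); last by exists f.
move=> _ [g Hg ->]; split; last first.
  exists (fun i _ => Ht (Xr i g)); split; first by move=> _ x _; exact: Ht_hasgrad Hg.1.
  by move=> i; exists (Xr i g) => //; exact: schw0_Xr.
move=> N; have [C C0 HC] := small N g Hg.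
have [C' [C'0 HC']] := Rap_bd (schw_Ht Hg.1) N.
exists (2 ^+ N * (C' + C)); split; first by rewrite mulr_ge0 ?exprn_ge0// addr_ge0.
move=> _ x x0; have xp := Omp_gt0 x0.
apply: le_trans (ler_wpM2l (normr_ge0 _) (WpX_le N x0)) _.
rewrite mulrCA mulr1 ler_wpM2l ?exprn_ge0// mulrDr; apply: lerD.
  have := HC' tt x I; rewrite mulr1; apply: le_trans; rewrite ler_wpM2l//.
  by rewrite lerXn2r ?nnegrE ?(ltW xp) ?(ltW (Ws_gt0 _))// /Ws lerDr.
by rewrite exprVn ler_pdivrMr// exprn_gt0.
Qed.

End hartley.

(** * Inversion and Fourier multipliers *)

Section inversion.
Context {R : realType} {d : nat}.
Local Notation Rd := 'rV[R]_d.
Local Notation intgd := (intg (leb R d)).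

Lemma measurable_coord_comp d1 (T : measurableType d1) (f : T -> Rd) i :
  measurable_fun [set: T] f -> measurable_fun [set: T] (fun z => f z ord0 i).
Proof. exact: measurableT_comp (@measurable_coord R d i). Qed.

Lemma measurable_dotp2 d1 (T : measurableType d1) (f g : T -> Rd) :
  measurable_fun [set: T] f -> measurable_fun [set: T] g ->
  measurable_fun [set: T] (fun z => dotp (f z) (g z)).
Proof.
move=> mf mg; apply: measurable_sum => i.
by apply: measurable_funM; exact: measurable_coord_comp.
Qed.

Lemma Rint_swap (m phi : Rd -> R) (tau : Rd * Rd -> R) (K : R) :
  intgd m -> intgd phi -> measurable_fun [set: Rd * Rd] tau ->
  (forall z, `|tau z| <= K) ->
  \int[leb R d]_xi (m xi * \int[leb R d]_y (tau (xi, y) * phi y)) =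
  \int[leb R d]_y (phi y * \int[leb R d]_xi (tau (xi, y) * m xi)).
Proof.
move=> mi phii mtau tauK.
have mm := intg_measurable mi; have mphi := intg_measurable phii.
have ty xi : intgd (fun y => tau (xi, y) * phi y).
  apply: (intg_le _ _ (intgZ K (intg_norm phii))).
    by apply: measurable_funM => //; exact: measurableT_comp mtau (pair1_measurable xi).
  by move=> y; rewrite normrM ler_wpM2r.
have tx y : intgd (fun xi => tau (xi, y) * m xi).
  apply: (intg_le _ _ (intgZ K (intg_norm mi))).
    by apply: measurable_funM => //; exact: measurableT_comp mtau (pair2_measurable y).
  by move=> xi; rewrite normrM ler_wpM2r.
have [||||_ _ _ _ [E1 E2]] := @Rfubini _ _ _ _ R (leb R d) (leb R d)
  (fun z => m z.1 * (tau z * phi z.2)) (fun xi => `|m xi| * (K * \int[leb R d]_y `|phi y|)).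
- apply: measurable_funM; first exact: measurableT_comp mm measurable_fst.
  by apply: measurable_funM => //; exact: measurableT_comp mphi measurable_snd.
- by move=> xi; apply: (@intgZ _ _ _ (leb R d) (m xi) (fun y => tau (xi, y) * phi y)).
- under eq_fun do rewrite mulrC.
  by apply: intgZ; exact: intg_norm.
- move=> xi; rewrite -RintegralZl//; last exact: intg_norm.
  rewrite -RintegralZl//; last by apply: intgZ; exact: intg_norm.
  apply: Rint_le.
  + by apply: intg_norm; apply: (@intgZ _ _ _ (leb R d) (m xi) (fun y => tau (xi, y) * phi y)).
  + by apply: intgZ; apply: intgZ; exact: intg_norm.
  + by move=> y /=; rewrite !normrM ler_wpM2l// ler_wpM2r.
transitivity (\int[leb R d]_xi \int[leb R d]_y (m xi * (tau (xi, y) * phi y))).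
  by apply: eq_Rintegral => xi _; rewrite RintegralZl//; exact: ty.
rewrite E1 -E2; apply: eq_Rintegral => y _; rewrite -RintegralZl//; last exact: tx.
by apply: eq_Rintegral => xi _ /=; ring.
Qed.

Let en (n : nat) : R := n.+1%:R^-1.

Let en_gt0 n : 0 < en n.
Proof. by rewrite invr_gt0. Qed.

Let en_cvg (c : R) : (fun n => en n * c) @ \oo --> (0 : R).
Proof.
by rewrite -[X in _ --> X](mul0r c); apply: cvgM; [exact: cvg_harmonic|exact: cvg_cst].
Qed.

(** Abel regularisation of the inversion integral. The transform of this product of exponentials is
    a product of Poisson kernels, rescalings of [pois], which has mass (2 pi)^d. *)
Let kap n (xi : Rd) : R := \prod_i expR (- en n * `|xi ord0 i|).

Let kap_intg n : intgd (kap n).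
Proof.
have [i0 _ _] := Rint_abel 0 (en_gt0 n).
by have [] := @intg_prod R d (fun _ s => expR (- en n * `|s|)) (fun _ => i0).
Qed.

Let kap_itv n xi : 0 <= kap n xi <= 1.
Proof.
rewrite prodr_ge0/=; last by move=> i _; exact: expR_ge0.
rewrite -[leRHS](expr1n R d) -[X in _ <= 1 ^+ X](card_ord d) -prodr_const.
apply: ler_prod => i _; rewrite expR_ge0/= -expR0 ler_expR mulNr oppr_le0 mulr_ge0//.
exact: ltW (en_gt0 n).
Qed.

Let kap_cvg xi : kap n xi @[n --> \oo] --> (1 : R).
Proof.
rewrite (_ : (fun n => kap n xi) = fun n => expR (en n * - \sum_i `|xi ord0 i|)).
  rewrite -expR0; apply: continuous_cvg; first exact: continuous_expR.
  exact: en_cvg.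
apply/funext => n; rewrite mulrN mulr_sumr -sumrN expR_sum.
by apply: eq_bigr => i _; rewrite mulNr.
Qed.

Let kap_cos n (z : Rd) : \int[leb R d]_xi (kap n xi * cos (dotp z xi)) =
    \prod_i (2 * en n / (en n ^+ 2 + z ord0 i ^+ 2)) /\
  \int[leb R d]_xi (kap n xi * sin (dotp z xi)) = 0.
Proof.
have [||-> ->] := @Rint_prod_cos R d (fun _ s => expR (- en n * `|s|)) z.
- by move=> i; have [] := Rint_abel 0 (en_gt0 n).
- by move=> i; have [] := Rint_abel (z ord0 i) (en_gt0 n).
split=> //; apply: eq_bigr => i _.
by have [] := Rint_abel (z ord0 i) (en_gt0 n).
Qed.

Let pois (z : Rd) : R := \prod_i (2 * (1 + z ord0 i ^+ 2)^-1).

Let pois_intg : intgd pois /\ \int[leb R d]_z pois z = (2 * pi) ^+ d.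
Proof.
have i1 := intgZ 2 (@Rint_Vsqr R).1.
have [pint pE] := @intg_prod R d (fun _ s => 2 * (1 + s ^+ 2)^-1) (fun _ => i1).
split=> //; rewrite pE RintegralZl//; last exact: (@Rint_Vsqr R).1.
by rewrite (@Rint_Vsqr R).2 prodr_const card_ord.
Qed.

Let pois_le z : 0 <= pois z <= 2 ^+ d.
Proof.
rewrite prodr_ge0/=; last by move=> i _; rewrite mulr_ge0// invr_ge0 addr_ge0// sqr_ge0.
rewrite -[X in _ <= _ ^+ X](card_ord d) -prodr_const; apply: ler_prod => i _.
have s1 : 1 <= 1 + z ord0 i ^+ 2 by rewrite lerDl sqr_ge0.
rewrite mulr_ge0 ?ler0n ?invr_ge0 ?(le_trans ler01)//=.
by rewrite ler_piMr ?ler0n// invf_le1// ?(lt_le_trans ltr01)// ler0n.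
Qed.

Lemma continuous_dilate (f : Rd -> R) (x z : Rd) : continuous f ->
  f (- en n *: z + x) @[n --> \oo] --> f x.
Proof.
move=> cf; apply: (@continuous_cvg _ _ _ _ _ (fun n => - en n *: z + x) f x); first exact: cf.
rewrite -[X in _ --> X]add0r; apply: cvgD; last exact: cvg_cst.
rewrite -(scale0r z); apply: cvgZr_tmp; rewrite -oppr0; apply: cvgN.
exact: cvg_harmonic.
Qed.

(** The double transform is the limit of its regularisations by [kap]; each of these is an average
    of [f] around [x] against the mass [pois], concentrating at [x]. *)
Lemma Ht_inversion (f : Rd -> R) (x : Rd) : schw f ->
  Ht (Ht f) x = (2 * pi) ^+ d * f x.
Proof.
move=> Hf; have fi := schw_intg Hf; have Hfi := schw_intg (schw_Ht Hf).
have mH := intg_measurable Hfi; have mf := schw_measurable Hf.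
have c2 : forall n (xi : Rd), `|kap n xi * (cas (dotp xi x) * Ht f xi)| <= 2 * `|Ht f xi|.
  move=> n xi; have /andP[k0 k1] := kap_itv n xi.
  rewrite normrM (ger0_norm k0) normrM (le_trans (ler_piMl _ k1))// ?mulr_ge0//.
  by rewrite ler_wpM2r// cas_le2.
have cM1 (u : nat -> R) c : u n @[n --> \oo] --> (1 : R) -> u n * c @[n --> \oo] --> c.
  by move=> uc; rewrite -[X in _ --> X]mul1r; apply: cvgM uc (cvg_cst _).
have [||||_ A] := @dct_Rint _ _ R (leb R d) (fun n xi => kap n xi * (cas (dotp xi x) * Ht f xi))
  (fun xi => cas (dotp xi x) * Ht f xi) (fun xi => 2 * `|Ht f xi|) _ _ _ _ c2.
- move=> n; apply: measurable_funM; first exact: intg_measurable (kap_intg n).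
  exact: intg_measurable (cas_intg x Hfi).
- exact: intg_measurable (cas_intg x Hfi).
- by apply: aeW => xi; exact: cM1.
- exact: intgZ (intg_norm Hfi).
have [C [C0 HC]] := Rap_bd Hf 0%N.
have fC y : `|f y| <= C by have := HC tt y I; rewrite expr0 !mulr1.
have cf : continuous f.
  have [G [fG _]] := SF_hasgrad Hf.
  by move=> y; exact: hasgrad_continuous (fG tt y).
(* Fubini and [casM] turn the regularised integral into a convolution with the Poisson kernel, the
   sine term having integral 0; the substitution y = x - en n z then makes the kernel independent of
   n. *)
have B n : \int[leb R d]_xi (kap n xi * (cas (dotp xi x) * Ht f xi)) =
    \int[leb R d]_z (f (- en n *: z + x) * pois z).
  transitivity (\int[leb R d]_xi (kap n xi * \int[leb R d]_y
      (cas (dotp xi x) * cas (dotp y xi) * f y))).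
    apply: eq_Rintegral => xi _; congr (_ * _).
    rewrite /Ht -RintegralZl//; last exact: cas_intg.
    by apply: eq_Rintegral => y _; rewrite mulrA.
  rewrite (@Rint_swap (kap n) f (fun z => cas (dotp z.1 x) * cas (dotp z.2 z.1)) 4)//; last 2 first.
  - apply: measurable_funM.
      apply: measurableT_comp; first exact: continuous_measurable_fun (@cas_continuous R).
      by apply: measurable_dotp2.
    apply: measurableT_comp; first exact: continuous_measurable_fun (@cas_continuous R).
    by apply: measurable_dotp2.
  - move=> z; rewrite normrM (_ : 4 = 2 * 2 :> R); last by ring.
    by rewrite ler_pM// cas_le2.
  have e0 := en_gt0 n.
  transitivity (\int[leb R d]_y (f y * \prod_i (2 * en n / (en n ^+ 2 + (x - y) ord0 i ^+ 2)))).
    apply: eq_Rintegral => y _; congr (_ * _).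
    have [E1 _] := kap_cos n (x - y); have [_ E2] := kap_cos n (x + y).
    have tri (h : R -> R) z : continuous h -> (forall s, `|h s| <= 1) ->
        intgd (fun xi => kap n xi * h (dotp z xi)).
      move=> ch h1; apply: (intg_le _ _ (kap_intg n)).
        apply: measurable_funM; first exact: intg_measurable (kap_intg n).
        apply: measurableT_comp; first exact: continuous_measurable_fun ch.
        apply: measurable_dotp2 => //; exact: measurable_cst.
      move=> xi; have /andP[k0 k1] := kap_itv n xi.
      by rewrite normrM (ger0_norm k0) ler_piMr.
    rewrite -E1 -[RHS]addr0 -E2 -RintegralD//.
    - apply: eq_Rintegral => xi _ /=; rewrite (dotpC xi x) casM -dotpNl -!dotpDl.
      by ring.
    - by apply: tri; [exact: continuous_cos|by move=> s; rewrite ler_norml cos_geN1 cos_le1].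
    - by apply: tri; [exact: continuous_sin|by move=> s; rewrite ler_norml sin_geN1 sin_le1].
  have KE y : \prod_i (2 * en n / (en n ^+ 2 + (x - y) ord0 i ^+ 2)) =
      (en n)^-1 ^+ d * pois (- (en n)^-1 *: y + (en n)^-1 *: x).
    rewrite -[X in _ = _ ^+ X * _](card_ord d) -prodr_const -big_split; apply: eq_bigr => i _.
    rewrite (_ : (- _ *: y + _) ord0 i = (en n)^-1 * (x - y) ord0 i); last by rewrite !mxE; ring.
    move: ((x - y) ord0 i) => t; have e2 : en n ^+ 2 + t ^+ 2 != 0.
      by rewrite gt_eqF// ltr_wpDr ?sqr_ge0 ?exprn_gt0.
    have e3 : en n != 0 by rewrite gt_eqF.
    by rewrite /=; field; rewrite ?e2 ?e3.
  have e1 : - (en n)^-1 != 0 by rewrite oppr_eq0 invr_eq0 gt_eqF.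
  have mK := intg_measurable (intg_affine ((en n)^-1 *: x) e1 pois_intg.1).
  have I0 : intgd (fun y => f y * \prod_i (2 * en n / (en n ^+ 2 + (x - y) ord0 i ^+ 2))).
    under eq_fun do rewrite KE mulrCA.
    apply: intgZ; apply: (intg_le _ _ (intgZ (2 ^+ d) (intg_norm fi))).
      by apply: measurable_funM.
    move=> y; have /andP[p0 p1] := pois_le (- (en n)^-1 *: y + (en n)^-1 *: x).
    by rewrite normrM mulrC ler_wpM2r// ger0_norm.
  have en0 : - en n != 0 by rewrite oppr_eq0 gt_eqF.
  rewrite (Rint_affine x en0 I0) -RintegralZl//; last exact: (intg_affine x en0 I0).
  apply: eq_Rintegral => z _; rewrite KE mulrCA; congr (_ * _).
  rewrite normrN gtr0_norm// mulrA -exprMn divff ?expr1n ?mul1r ?gt_eqF//.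
  congr pois; apply/rowP => i; rewrite !mxE; field.
  by rewrite gt_eqF.
(* As [f] is continuous and bounded, the averages converge to f(x) times the mass of [pois]. *)
have [|||||_ D] := @dct_Rint _ _ R (leb R d) (fun n z => f (- en n *: z + x) * pois z)
  (fun z => f x * pois z) (fun z => C * pois z).
- move=> n; apply: measurable_funM; last exact: intg_measurable pois_intg.1.
  exact: measurableT_comp mf (measurable_affine _ _).
- exact: intg_measurable (intgZ _ pois_intg.1).
- apply: aeW => z; apply: cvgM; last exact: cvg_cst.
  exact: continuous_dilate.
- exact: intgZ _ pois_intg.1.
- by move=> n z; have /andP[p0 _] := pois_le z; rewrite normrM (ger0_norm p0) ler_wpM2r.
move: A; rewrite (_ : (fun n => _) = fun n => \int[leb R d]_z (f (- en n *: z + x) * pois z)).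
  move=> A; apply: (cvg_unique (@Rhausdorff R) A); move: D.
  by rewrite RintegralZl ?pois_intg.2 1?mulrC//; exact: pois_intg.1.
by apply/funext => n; exact: B.
Qed.

End inversion.

(** * Fourier multipliers on functions without moments *)

Section multiplier.
Context {R : realType} {d : nat}.
Local Notation Rd := 'rV[R]_d.
Local Notation fam T := (T -> 'rV[R]_d -> R).
Local Notation intgd := (intg (leb R d)).

Definition flat (F : Rd -> R) := FlatF (fun=> 1) (fun _ : unit => F) /\ F 0 = 0.

(** Symbols may be singular at the origin, as |xi|^sigma is for negative sigma; multiplying a flat
    function by them is harmless. *)
Definition Mult (m : Rd -> R) := Mod (@Omp R d) Wp (fun=> 1) (fun _ : unit => m).

Lemma flat_schw F : flat F -> schw F.
Proof. by move=> [HF F0]; apply: flat_SF. Qed.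

Lemma FlatF_reflect {T : Type} (eps : T -> R) (F : fam T) :
  FlatF eps F -> FlatF eps (fun t x => F t (- x)).
Proof.
move=> HF n.
rewrite (_ : (fun t x => _) = (fun t x => (-1) ^+ 0 * F t (-1 *: x))); last first.
  by apply/funext => t; apply/funext => x; rewrite expr0 mul1r scaleN1r.
apply: (@Cn_dilate _ _ T T Omp (rapb Omp Wp eps) _ id (fun=> -1)) (HF n) => //.
  by move=> _ x; rewrite /Omp/= scaleN1r oppr_eq0.
move=> {HF}F k HF N; have [C [C0 FC]] := HF N; exists C; split => // t x x0.
have x0' : Omp (-1 *: x) by move: x0; rewrite /Omp/= scaleN1r oppr_eq0.
rewrite normrM normrX normrN1 expr1n mul1r; apply: le_trans (FC t _ x0').
by rewrite /Wp enormZ normrN1 mul1r.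
Qed.

Lemma flat_reflect F : flat F -> flat (fun x => F (- x)).
Proof. by move=> [HF F0]; split; [exact: FlatF_reflect HF|rewrite oppr0]. Qed.

Lemma flatM m F : Mult m -> flat F -> flat (fun x => m x * F x).
Proof.
move=> Hm [HF F0]; split; last by rewrite F0 mulr0.
have := RapM (@Wp_ge1 R d) (fun=> ler01) Hm HF.
by under [X in Rap _ _ X]eq_fun do rewrite mul1r.
Qed.

Lemma schw0_flat f : schw0 f -> flat (Ht f).
Proof. by move=> Hf; split; [exact: schw0_Ht_flat|exact: schw0_Ht0]. Qed.

(** A monomial times [Ht F] is the transform of a flat function again, by [Ht_coord]. Its integral
    is therefore a double transform at 0, that is, a multiple of the value of a flat function at
    0. *)
Lemma flat_schw0 F : flat F -> schw0 (Ht F).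
Proof.
move=> HF; split; first exact/schw_Ht/flat_schw.
pose Q (h : Rd -> R) := exists2 G, flat G & h = Ht G.
have P1 i h : Q h -> Q (fun x => x ord0 i * h x).
  move=> [G HG ->]; have [G' [GG' HG']] := flat_hasgrad (fun=> ler01) HG.1 (fun=> HG.2).
  have fG' j : flat (G' j tt) by split; [exact: Rap_reindex (fun=> tt) _ _ _ _ (HG' j).1|exact: (HG' j).2].
  exists (fun x => G' i tt (- x)); first exact: flat_reflect.
  apply/funext => x; apply: (@Ht_coord R d G (fun i => G' i tt) i x) => //.
  - exact: flat_schw.
  - by move=> j; exact/flat_schw.
have P2 i k h : Q h -> Q (fun x => x ord0 i ^+ k * h x).
  move=> Qh; elim: k => [|k IHk].
    by rewrite (_ : (fun x => _) = h)//; apply/funext => x; rewrite mul1r.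
  rewrite (_ : (fun x => _) = (fun x : Rd => x ord0 i * (x ord0 i ^+ k * h x))).
    exact: P1.
  by apply/funext => x; rewrite exprS mulrA.
move=> a; suff [G HG E] : Q (fun x => monomial a x * Ht F x).
  rewrite E (_ : Rintegral _ _ _ = Ht (Ht G) 0).
    by rewrite Ht_inversion ?HG.2 ?mulr0//; exact: flat_schw.
  apply: eq_Rintegral => x _.
  rewrite (_ : dotp x 0 = 0) ?cas0 ?mul1r//.
  by rewrite /dotp big1// => i _; rewrite mxE mulr0.
rewrite /monomial; elim: (index_enum _) => [|i s IH].
  rewrite (_ : (fun x => _) = Ht F); first by exists F.
  by apply/funext => x; rewrite big_nil mul1r.
rewrite (_ : (fun x => _) = (fun x : Rd => x ord0 i ^+ a i *
  ((\prod_(i <- s) x ord0 i ^+ a i) * Ht F x))); first exact: P2.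
by apply/funext => x; rewrite big_cons mulrA.
Qed.

(* For even [m] this is the Fourier multiplier with symbol [m]. *)
Definition Tm (m f : Rd -> R) (x : Rd) : R :=
  (2 * pi) ^- d * Ht (fun xi => m xi * Ht f xi) x.

Lemma twopi_gt0 : 0 < (2 * pi) ^+ d :> R.
Proof. by rewrite exprn_gt0// mulr_gt0// pi_gt0. Qed.

Lemma schwZ (c : R) (f : Rd -> R) : schw f -> schw (fun x => c * f x).
Proof. exact: SFZ. Qed.

Lemma schw0Z (c : R) (f : Rd -> R) : schw0 f -> schw0 (fun x => c * f x).
Proof.
move=> [Hf f0]; split; first exact: schwZ.
move=> a; under eq_Rintegral do rewrite mulrCA.
by rewrite RintegralZl ?f0 ?mulr0//; exact: schw_intg (schw_monomial a Hf).
Qed.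

Lemma Ht_Tm m f : schw (fun xi => m xi * Ht f xi) -> Ht (Tm m f) = fun xi => m xi * Ht f xi.
Proof.
move=> Hm; apply/funext => xi; rewrite /Tm HtZ; last exact/schw_intg/schw_Ht.
by rewrite Ht_inversion// mulrA mulVf ?mul1r// gt_eqF// twopi_gt0.
Qed.

Lemma schw_Tm m f : schw (fun xi => m xi * Ht f xi) -> schw (Tm m f).
Proof. by move=> Hm; apply: schwZ; exact: schw_Ht. Qed.

Lemma schw0_Tm m f : Mult m -> schw0 f -> schw0 (Tm m f).
Proof.
by move=> Hm Hf; apply/schw0Z/flat_schw0/flatM => //; exact: schw0_flat.
Qed.

Lemma schw0_TmF m f : flat (fun xi => m xi * Ht f xi) -> schw0 (Tm m f).
Proof. by move=> Hm; apply/schw0Z/flat_schw0. Qed.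

(** The transform of [f] vanishes at 0, so the value of a symbol there is immaterial. This frees
    identities between powers of |xi| from the convention for powers of 0. *)
Lemma Tm_eq m m' f : (forall xi, xi != 0 -> m xi = m' xi) -> schw0 f -> Tm m f = Tm m' f.
Proof.
move=> mm' Hf; rewrite /Tm; apply/funext => x; congr (_ * Ht _ _); apply/funext => xi.
by have [->|/mm' ->//] := eqVneq xi 0; rewrite schw0_Ht0// !mulr0.
Qed.

Lemma Tm1 f : schw f -> Tm (fun=> 1) f = f.
Proof.
move=> Hf; apply/funext => x; rewrite /Tm; under eq_fun do rewrite mul1r.
by rewrite Ht_inversion// mulrA mulVf ?mul1r// gt_eqF// twopi_gt0.
Qed.

Lemma Tm_comp m m' f : Mult m -> schw0 f -> Tm m' (Tm m f) = Tm (fun xi => m' xi * m xi) f.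
Proof.
move=> Hm Hf; rewrite {1}/Tm /Tm Ht_Tm.
  by apply/funext => x; congr (_ * Ht _ _); apply/funext => xi; rewrite mulrA.
exact/flat_schw/flatM/schw0_flat.
Qed.

Lemma TmDm m m' f : schw (fun xi => m xi * Ht f xi) -> schw (fun xi => m' xi * Ht f xi) ->
  Tm (fun xi => m xi + m' xi) f = fun x => Tm m f x + Tm m' f x.
Proof.
move=> H1 H2; apply/funext => x; rewrite /Tm -mulrDr -HtD; try exact: schw_intg.
by congr (_ * Ht _ _); apply/funext => xi; rewrite mulrDl.
Qed.

Lemma SF_Tm {T : Type} (eps : T -> R) (m : fam T) f : (forall t, 0 <= eps t) ->
  SF eps (fun t xi => m t xi * Ht f xi) -> SF eps (fun t => Tm (m t) f).
Proof. by move=> e0 Hm; apply: SFZ; exact: SF_Ht. Qed.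

(** Smallness of symbols, measured by [eps], becomes smallness of the multiplied test functions in
    every Schwartz seminorm, and hence of their pairings with a distribution. *)
Lemma SF_Tm0 {T : Type} (eps : T -> R) (m : fam T) f : (forall t, 0 <= eps t) ->
  Mod Omp Wp eps m -> schw0 f -> SF eps (fun t => Tm (m t) f).
Proof.
move=> e0 Hm Hf; apply: SF_Tm => //; apply: flat_SF => //.
  have := RapM (@Wp_ge1 R d) e0 Hm (Rap_reindex (fun _ : T => tt) (schw0_flat Hf).1).
  by under [X in Rap _ _ X]eq_fun do rewrite /= mulr1.
by move=> t; rewrite schw0_Ht0// mulr0.
Qed.

Lemma Mult_powR tau : Mult (fun x => enorm x `^ tau).
Proof. exact: Mod_powR. Qed.

(* The sine part of the product [cas (x.xi) cas (y.xi)] is odd in [xi], so that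
   an even multiplier acts by convolution with its transform. *)
Lemma Tm_conv m f x : intgd m -> (forall xi, m (- xi) = m xi) -> schw f ->
  Tm m f x = (2 * pi) ^- d * \int[leb R d]_y (Ht m (x - y) * f y).
Proof.
move=> mi meven Hf; have fi := schw_intg Hf; congr (_ * _).
transitivity (\int[leb R d]_xi (m xi * \int[leb R d]_y
    (cas (dotp xi x) * cas (dotp y xi) * f y))).
  apply: eq_Rintegral => xi _; rewrite mulrCA; congr (_ * _).
  rewrite -RintegralZl//; last exact: cas_intg.
  by apply: eq_Rintegral => y _; rewrite mulrA.
have mcas (a : Rd) : measurable_fun [set: Rd] (fun xi => cas (dotp a xi)).
  by under eq_fun do rewrite dotpC; exact: measurable_cas.
rewrite (@Rint_swap _ _ m f (fun z => cas (dotp z.1 x) * cas (dotp z.2 z.1)) 4)//; last 2 first.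
- apply: measurable_funM.
    apply: measurableT_comp; first exact: continuous_measurable_fun (@cas_continuous R).
    by apply: measurable_dotp2.
  apply: measurableT_comp; first exact: continuous_measurable_fun (@cas_continuous R).
  by apply: measurable_dotp2.
- move=> z; rewrite normrM (_ : 4 = 2 * 2 :> R); last by ring.
  by rewrite ler_pM// cas_le2.
have tri (h : R -> R) z : continuous h -> (forall s, `|h s| <= 1) ->
    intgd (fun xi => m xi * h (dotp z xi)).
  move=> ch h1; apply: (intg_le _ _ (intg_norm mi)).
    apply: measurable_funM; first exact: intg_measurable mi.
    apply: measurableT_comp; first exact: continuous_measurable_fun ch.
    by apply: measurable_dotp2 => //; exact: measurable_cst.
  by move=> xi; rewrite normrM ler_piMr.
have tc z : intgd (fun xi => m xi * cos (dotp z xi)).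
  by apply: tri; [exact: continuous_cos|by move=> s; rewrite ler_norml cos_geN1 cos_le1].
have ts z : intgd (fun xi => m xi * sin (dotp z xi)).
  by apply: tri; [exact: continuous_sin|by move=> s; rewrite ler_norml sin_geN1 sin_le1].
have odd0 z : \int[leb R d]_xi (m xi * sin (dotp z xi)) = 0.
  by apply: Rint_odd => [|xi]; [exact: ts|rewrite meven dotpNr sinN mulrN].
apply: eq_Rintegral => y _; rewrite [LHS]mulrC; congr (_ * _).
transitivity (\int[leb R d]_xi (m xi * cos (dotp (x - y) xi))).
  rewrite -[RHS]addr0 -(odd0 (x + y)) -RintegralD//; [|exact: tc|exact: ts].
  apply: eq_Rintegral => xi _ /=; rewrite (dotpC xi x) casM -dotpNl -!dotpDl.
  by ring.
rewrite -[LHS]addr0 -(odd0 (x - y)) -RintegralD//; [|exact: tc|exact: ts].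
by apply: eq_Rintegral => xi _; rewrite dotpC /cas; ring.
Qed.

End multiplier.

(** * Powers, moduli and integrability of powers *)

Section powR_facts.
Context {R : realType}.

Lemma powR_le (l a b : R) : 0 <= l -> 0 <= a -> a <= b -> a `^ l <= b `^ l.
Proof.
by move=> l0 a0 ab; apply: ge0_ler_powR => //; rewrite nnegrE// (le_trans a0).
Qed.

Lemma powR_add_le (l a b : R) : 0 <= l -> 0 <= a -> 0 <= b ->
  (a + b) `^ l <= 2 `^ l * (a `^ l + b `^ l).
Proof.
move=> l0; wlog ab : a b / a <= b => [H|] a0 b0.
  have [/H->//|/ltW/H ba] := leP a b.
  by rewrite addrC [X in _ * X]addrC; exact: ba.
rewrite mulrDr -!powRM//; apply: (@le_trans _ _ ((2 * b) `^ l)).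
  by apply: powR_le; rewrite ?addr_ge0// mulr2n mulrDl !mul1r lerD2r.
by rewrite lerDr powR_ge0.
Qed.

Lemma le_powR1 (l a : R) : 1 <= l -> 0 <= a -> a <= 1 + a `^ l.
Proof.
move=> l1 a0; have [a1|/ltW a1] := leP a 1.
  by apply: le_trans a1 _; rewrite lerDl powR_ge0.
by apply: (le_trans (le1r_powR a1 l1)); rewrite lerDr.
Qed.

Lemma cabs_ge0 (z : R[i]) : 0 <= cabs z.
Proof. by case: z => a b; exact: sqrtr_ge0. Qed.

Lemma sqr_cabs (z : R[i]) : cabs z ^+ 2 = complex.Re z ^+ 2 + complex.Im z ^+ 2.
Proof. by case: z => a b; rewrite /cabs/= sqr_sqrtr// addr_ge0// sqr_ge0. Qed.

Lemma Re_le_cabs (z : R[i]) : `|complex.Re z| <= cabs z.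
Proof.
rewrite -(@ler_pXn2r _ 2)// ?nnegrE ?cabs_ge0//.
by rewrite sqr_cabs real_normK ?num_real// lerDl sqr_ge0.
Qed.

Lemma Im_le_cabs (z : R[i]) : `|complex.Im z| <= cabs z.
Proof.
rewrite -(@ler_pXn2r _ 2)// ?nnegrE ?cabs_ge0//.
by rewrite sqr_cabs real_normK ?num_real// lerDr sqr_ge0.
Qed.

Lemma cabs_le (z : R[i]) : cabs z <= `|complex.Re z| + `|complex.Im z|.
Proof.
rewrite -(@ler_pXn2r _ 2)// ?nnegrE ?cabs_ge0 ?addr_ge0//.
rewrite sqr_cabs sqrrD !real_normK ?num_real// -addrA lerD2l lerDr.
by rewrite mulrn_wge0// mulr_ge0.
Qed.

Lemma cabs_eq0 (z : R[i]) : (cabs z == 0) = (z == 0).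
Proof.
rewrite -(@sqrf_eq0 R) sqr_cabs paddr_eq0 ?sqr_ge0// !sqrf_eq0.
by rewrite eq_complex.
Qed.

End powR_facts.

Section real_Lp.
Context d (T : measurableType d) (R : realType) (mu : {measure set T -> \bar R}).

Definition rLp (l : R) (f : T -> R) :=
  measurable_fun [set: T] f /\ intg mu (fun x => `|f x| `^ l).

Lemma measurable_abs_powR (l : R) (f : T -> R) : measurable_fun [set: T] f ->
  measurable_fun [set: T] (fun x => `|f x| `^ l).
Proof.
move=> mf; apply: (measurableT_comp (measurable_powR l)).
exact: measurableT_comp.
Qed.

Lemma rLp_le (l : R) (f g : T -> R) : 0 <= l -> measurable_fun [set: T] f ->
  (forall x, `|f x| <= `|g x|) -> rLp l g -> rLp l f.
Proof.
move=> l0 mf fg [mg gi]; split => //; apply: intg_le _ _ gi.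
  exact: measurable_abs_powR.
by move=> x; rewrite ger0_norm ?powR_ge0// powR_le.
Qed.

Lemma rLpD (l : R) (f g : T -> R) : 0 <= l -> rLp l f -> rLp l g ->
  rLp l (fun x => f x + g x).
Proof.
move=> l0 [mf fi] [mg gi]; have mfg := measurable_funD mf mg; split => //.
apply: (intg_le _ _ (intgZ (2 `^ l) (intgD fi gi))); first exact: measurable_abs_powR.
move=> x; rewrite ger0_norm ?powR_ge0//.
apply: le_trans (powR_add_le l0 (normr_ge0 _) (normr_ge0 _)).
by apply: powR_le => //; exact: ler_normD.
Qed.

Lemma rLpZ (l c : R) (f : T -> R) : rLp l f -> rLp l (fun x => c * f x).
Proof.
move=> [mf fi]; split; first exact: measurable_funM.
have := intgZ (`|c| `^ l) fi; congr intg; apply/funext => x.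
by rewrite normrM powRM.
Qed.

(* [|g f| <= (1 + |g|^l) |f|] *)
Lemma rLp_mul_intg (l C : R) (g f : T -> R) : 1 <= l -> rLp l g -> intg mu f ->
  (forall x, `|f x| <= C) -> intg mu (fun x => g x * f x).
Proof.
move=> l1 [mg gi] fi fC; apply: (intg_le _ _ (intgD (intg_norm fi) (intgZ C gi))).
  by apply: measurable_funM => //; exact: intg_measurable fi.
move=> x; rewrite normrM.
apply: le_trans (ler_wpM2r (normr_ge0 _) (le_powR1 l1 (normr_ge0 (g x)))) _.
by rewrite mulrDl mul1r lerD2l mulrC ler_wpM2r// powR_ge0.
Qed.

End real_Lp.

Section complex_Lp.
Context {R : realType} {d : nat}.
Local Notation Rd := 'rV[R]_d.
Local Notation C := R[i].
Local Notation intgd := (intg (leb R d)).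
Implicit Types g : Rd -> C.

Lemma cmeasurable_cabs g : cmeasurable g -> measurable_fun [set: Rd] (fun x => cabs (g x)).
Proof.
move=> [m1 m2]; rewrite (_ : (fun x => _) =
  fun x => Num.sqrt (complex.Re (g x) ^+ 2 + complex.Im (g x) ^+ 2)); last first.
  by apply/funext => x; case: (g x).
apply: (measurableT_comp (continuous_measurable_fun (@sqrt_continuous R))).
by apply: measurable_funD; apply: measurable_funX.
Qed.

Lemma Lpnorm_powR (l : R) g : l != 0 ->
  (Lpnorm l g `^ l = \int[leb R d]_x (cabs (g x) `^ l)%:E)%E.
Proof.
move=> l0; rewrite /Lpnorm (powR_Lnorm _ _ l0).
apply: eq_integral => x _.
rewrite abse_EFin.
rewrite ger0_norm; last exact: cabs_ge0.
by [].
Qed.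

Lemma in_Lp_intg (l : R) g : 0 < l ->
  in_Lp l g <-> cmeasurable g /\ intgd (fun x => cabs (g x) `^ l).
Proof.
move=> l0; split=> -[mg H]; split => //.
  apply/integrableP; split.
    apply/measurable_EFinP; apply: (measurableT_comp (measurable_powR l)).
    exact: cmeasurable_cabs.
  rewrite (_ : (\int[_]_(_ in _) _ = Lpnorm l g `^ l)%E).
    by rewrite poweR_lty.
  rewrite Lpnorm_powR ?gt_eqF//; apply: eq_integral => x _ /=.
  by rewrite ger0_norm// powR_ge0.
have {}H : (Lpnorm l g `^ l < +oo)%E.
  rewrite Lpnorm_powR ?gt_eqF//; move/integrableP : H => [_].
  by under eq_integral do rewrite /= ger0_norm ?powR_ge0//.
by rewrite ltNge leye_eq; apply/negP => /eqP E; move: H; rewrite E/= gt_eqF.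
Qed.

Lemma in_Lp_rLp (l : R) g : 0 < l -> in_Lp l g <->
  rLp (leb R d) l (fun x => complex.Re (g x)) /\ rLp (leb R d) l (fun x => complex.Im (g x)).
Proof.
move=> l0; rewrite in_Lp_intg//; split=> [[[m1 m2] gi]|[[m1 g1] [m2 g2]]].
  split; split => //; apply: intg_le _ _ gi; try exact: measurable_abs_powR.
    by move=> x; rewrite ger0_norm ?powR_ge0// powR_le ?(ltW l0)// Re_le_cabs.
  by move=> x; rewrite ger0_norm ?powR_ge0// powR_le ?(ltW l0)// Im_le_cabs.
split => //; apply: (intg_le _ _ (intgZ (2 `^ l) (intgD g1 g2))).
  by apply: (measurableT_comp (measurable_powR l)); exact: cmeasurable_cabs.
move=> x; rewrite ger0_norm ?powR_ge0//.
apply: le_trans (powR_add_le (ltW l0) (normr_ge0 _) (normr_ge0 _)).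
by apply: powR_le; rewrite ?cabs_ge0 ?(ltW l0)// cabs_le.
Qed.

End complex_Lp.

(** * Tempered distributions and their real and imaginary parts *)

Section bridge.
Context {R : realType} {d : nat}.
Local Notation Rd := 'rV[R]_d.
Local Notation C := R[i].
Local Notation fam T := (T -> 'rV[R]_d -> R).
Local Notation intgd := (intg (leb R d)).

Definition rpart (s : seq 'I_d) (g : Rd -> R) : Rd -> R :=
  foldr (fun i g x => 'D_(delta_mx ord0 i) g x) g s.

Lemma Re_iter_partial s (f : Rd -> C) :
  (fun x => complex.Re (iter_partial s f x)) = rpart s (fun x => complex.Re (f x)).
Proof. by elim: s => //= i s IH; rewrite -IH. Qed.

Lemma Im_iter_partial s (f : Rd -> C) :
  (fun x => complex.Im (iter_partial s f x)) = rpart s (fun x => complex.Im (f x)).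
Proof. by elim: s => //= i s IH; rewrite -IH. Qed.

Lemma SF_rpart {T : Type} (eps : T -> R) (F : fam T) s :
  SF eps F -> SF eps (fun t => rpart s (F t)).
Proof.
move=> HF; elim: s => [|i s IH]//=.
by have [_] := Rap_partial openT IH; apply.
Qed.

Lemma SF_rpart_bound {T : Type} (eps : T -> R) (F : fam T) N n : SF eps F ->
  exists2 K : R, 0 <= K & forall s t x, (size s <= n)%N ->
    `|rpart s (F t) x| * Ws x ^+ N <= K * eps t.
Proof.
elim: n F => [|n IH] F HF.
  have [K [K0 HK]] := Rap_bd HF N; exists K => // -[|]// t x _; exact: HK.
have [K K0 HK] := IH F HF.
have /choice[L HL] : forall i, exists L : R, 0 <= L /\ forall s t x, (size s <= n)%N ->
    `|rpart s (rpart [:: i] (F t)) x| * Ws x ^+ N <= L * eps t.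
  by move=> i; have [L L0 HL] := IH _ (SF_rpart [:: i] HF); exists L.
have L0 i : 0 <= L i by have [] := HL i.
exists (K + \sum_i L i); first by rewrite addr_ge0// sumr_ge0.
move=> s t x sn.
have e0 : 0 <= K * eps t.
  by apply: le_trans (HK [::] t x isT); rewrite mulr_ge0// exprn_ge0// ltW// Ws_gt0.
have Le i : 0 <= L i * eps t.
  have [_ h] := HL i.
  by apply: le_trans (h [::] t x isT); rewrite mulr_ge0// exprn_ge0// ltW// Ws_gt0.
(* The last entry of [s] is the derivative taken first. Peeling it off replaces the family by one of
   its partial derivatives, to which the induction hypothesis applies. *)
rewrite mulrDl; case/lastP: s sn => [|s i] sn.
  apply: le_trans (HK [::] t x isT) _.
  by rewrite lerDl mulr_suml sumr_ge0.
rewrite size_rcons in sn; rewrite /rpart foldr_rcons.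
have [_ h] := HL i; apply: le_trans (h s t x sn) _.
by rewrite mulr_suml (bigD1 i)//= addrCA lerDl addr_ge0// sumr_ge0.
Qed.

Lemma hasgrad_partial (f : Rd -> R) x : differentiable f x ->
  hasgrad f x (fun i => 'D_(delta_mx ord0 i) f x).
Proof. by move=> df; split. Qed.

Lemma schw_intro (g : Rd -> R) : (forall s x, differentiable (rpart s g) x) ->
  (forall N s, exists2 c : R, 0 <= c & forall x, `|rpart s g x| * Ws x ^+ N <= c) -> schw g.
Proof.
move=> dg bg n.
apply: (@Cn_coind _ _ _ _ _ (fun F => exists s, F = fun=> rpart s g)); last by exists [::].
move=> _ [s ->]; split; last first.
  exists (fun i _ => rpart (i :: s) g); split; last by move=> i; exists (i :: s).
  by move=> _ x _; exact: hasgrad_partial.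
by move=> N; have [c c0 hc] := bg N s; exists c; split => // _ x _; rewrite mulr1.
Qed.

Lemma schw_diff (g : Rd -> R) s x : schw g -> differentiable (rpart s g) x.
Proof.
move=> Hg; have [G [FG _]] := SF_hasgrad (SF_rpart s Hg).
by have [] := FG tt x.
Qed.

Lemma schwartz_norm_ub (N : nat) (f : Rd -> C) s x : (size s <= N)%N ->
  (((1 + enorm x) ^+ N * cabs (iter_partial s f x))%:E <= schwartz_norm N f)%E.
Proof. by move=> sN; apply: ereal_sup_ubound; exists (s, x). Qed.

Lemma schwartz_norm_le (N : nat) (f : Rd -> C) (c : R) :
  (forall s x, (size s <= N)%N -> (1 + enorm x) ^+ N * cabs (iter_partial s f x) <= c) ->
  (schwartz_norm N f <= c%:E)%E.
Proof.
by move=> H; apply: ge_ereal_sup => _ [[s x] /= sN <-]; rewrite lee_fin; exact: H.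
Qed.

Lemma schwartz_bound (N : nat) (f : Rd -> C) s : schwartz f ->
  exists2 c : R, 0 <= c & forall x, cabs (iter_partial s f x) * Ws x ^+ N <= c.
Proof.
move=> [_ Nf]; pose M := maxn N (size s).
have fin : schwartz_norm M f \is a fin_num.
  rewrite ge0_fin_numE ?Nf//.
  apply: le_trans (@schwartz_norm_ub M f [::] 0 isT); rewrite lee_fin.
  by rewrite mulr_ge0 ?cabs_ge0// exprn_ge0// addr_ge0// enorm_ge0.
have ub x : cabs (iter_partial s f x) * Ws x ^+ N <= fine (schwartz_norm M f).
  rewrite -lee_fin fineK//; apply: le_trans (@schwartz_norm_ub M f s x (leq_maxr _ _)).
  rewrite lee_fin mulrC ler_wpM2r ?cabs_ge0//.
  by apply: ler_weXn2l; [exact: Ws_ge1|exact: leq_maxl].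
exists (fine (schwartz_norm M f)) => //; apply: le_trans (ub 0).
by rewrite mulr_ge0 ?cabs_ge0// exprn_ge0// ltW// Ws_gt0.
Qed.

Lemma schwartz_Re_Im (f : Rd -> C) : schwartz f ->
  schw (fun x => complex.Re (f x)) /\ schw (fun x => complex.Im (f x)).
Proof.
move=> Hf; have [Sf _] := Hf.
split; apply: schw_intro => [s x|N s].
- by have [+ _] := Sf s x; rewrite Re_iter_partial.
- have [c c0 hc] := schwartz_bound N s Hf; exists c => // x.
  apply: le_trans (hc x); rewrite -Re_iter_partial ler_wpM2r ?Re_le_cabs//.
  by rewrite exprn_ge0// ltW// Ws_gt0.
- by have [_] := Sf s x; rewrite Im_iter_partial.
- have [c c0 hc] := schwartz_bound N s Hf; exists c => // x.
  apply: le_trans (hc x); rewrite -Im_iter_partial ler_wpM2r ?Im_le_cabs//.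
  by rewrite exprn_ge0// ltW// Ws_gt0.
Qed.

Lemma SF_schwartz_norm {T : Type} (eps : T -> R) (F G : fam T) N : SF eps F -> SF eps G ->
  exists2 c : R, 0 <= c & forall t,
    (schwartz_norm N (fun x => Complex (F t x) (G t x)) <= (c * eps t)%:E)%E.
Proof.
move=> HF HG; have [K K0 HK] := SF_rpart_bound N N HF; have [L L0 HL] := SF_rpart_bound N N HG.
exists (K + L); first exact: addr_ge0.
move=> t; apply: schwartz_norm_le => s x sN; rewrite mulrC.
apply: le_trans (ler_wpM2r _ (cabs_le _)) _; first by rewrite exprn_ge0// ltW// Ws_gt0.
rewrite !mulrDl; apply: lerD.
  by rewrite -[complex.Re _]/((fun x => complex.Re (iter_partial s _ x)) x) Re_iter_partial; exact: HK.
by rewrite -[complex.Im _]/((fun x => complex.Im (iter_partial s _ x)) x) Im_iter_partial; exact: HL.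
Qed.

Lemma schw_schwartz (a b : Rd -> R) : schw a -> schw b -> schwartz (fun x => Complex (a x) (b x)).
Proof.
move=> Ha Hb; split.
  by move=> s x; rewrite Re_iter_partial Im_iter_partial; split; exact: schw_diff.
move=> N; have [c c0 hc] := SF_schwartz_norm N Ha Hb.
by apply: le_lt_trans (hc tt) _; rewrite ltry.
Qed.

Lemma complexP (z w : C) : complex.Re z = complex.Re w -> complex.Im z = complex.Im w -> z = w.
Proof. by move=> e1 e2; apply/eqP; rewrite eq_complex e1 e2 !eqxx. Qed.

Lemma schwartz0_Re_Im (f : Rd -> C) : schwartz0 f <->
  schw0 (fun x => complex.Re (f x)) /\ schw0 (fun x => complex.Im (f x)).
Proof.
have reE a : (fun x => complex.Re ((monomial a x)%:C%C * f x)) =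
    (fun x => monomial a x * complex.Re (f x)).
  by apply/funext => x; case: (f x) => u v /=; rewrite mul0r subr0.
have imE a : (fun x => complex.Im ((monomial a x)%:C%C * f x)) =
    (fun x => monomial a x * complex.Im (f x)).
  by apply/funext => x; case: (f x) => u v /=; rewrite mul0r addr0.
split=> [[Hf f0]|[[Ha a0] [Hb b0]]].
  have [Ha Hb] := schwartz_Re_Im Hf.
  by split; split => // a; have := f0 a; rewrite /cint reE imE => -[].
split; first by rewrite (_ : f = fun x => Complex (complex.Re (f x)) (complex.Im (f x)));
  [exact: schw_schwartz|apply/funext => x; case: (f x)].
by move=> a; rewrite /cint reE imE a0 b0.
Qed.

(* [U] is the restriction of (a real component of) a tempered distribution
   to real Schwartz functions; continuity is expressed on families *)
Definition rtemp (U : (Rd -> R) -> R) :=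
  (forall (a : R) f g, schw f -> schw g -> U (fun x => a * f x + g x) = a * U f + U g) /\
  (forall (eps : nat -> R) (F : fam nat), SF eps F ->
    exists2 c : R, 0 <= c & forall t, `|U (F t)| <= c * eps t).

Definition Ure (u : tempered R d) (f : Rd -> R) := complex.Re (u (fun x => (f x)%:C%C)).
Definition Uim (u : tempered R d) (f : Rd -> R) := complex.Im (u (fun x => (f x)%:C%C)).

Lemma schw0_zero : schw0 (fun _ : Rd => 0).
Proof.
have Z : schw (fun _ : Rd => 0).
  have := SFZ 0 (@Theta_SF R d); congr SF; apply/funext => _; apply/funext => x.
  by rewrite mul0r.
split => // a; under eq_Rintegral do rewrite mulr0.
by rewrite /Rintegral integral0.
Qed.

Lemma schwartz_real (f : Rd -> R) : schw f -> schwartz (fun x => (f x)%:C%C).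
Proof. by move=> Hf; exact: schw_schwartz Hf schw0_zero.1. Qed.

Lemma rtemp_Ure_Uim (u : tempered R d) : rtemp (Ure u) /\ rtemp (Uim u).
Proof.
have lin (a : R) (f g : Rd -> R) : schw f -> schw g ->
    u (fun x => (a * f x + g x)%:C%C) = a%:C%C * u (fun x => (f x)%:C%C) + u (fun x => (g x)%:C%C).
  move=> Hf Hg; rewrite -pairing_linear; try exact: schwartz_real.
  by congr (u _); apply/funext => x; apply: complexP => /=; rewrite ?mul0r ?mulr0 ?subr0 ?addr0.
have [c [N Hc]] := pairing_continuous u.
have cont (eps : nat -> R) (F : fam nat) : SF eps F ->
    exists2 c : R, 0 <= c & forall t, cabs (u (fun x => (F t x)%:C%C)) <= c * eps t.
  move=> HF; have HZ : SF eps (fun (_ : nat) (_ : Rd) => 0).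
    have := SFZ 0 HF; congr SF; apply/funext => t; apply/funext => x.
    by rewrite mul0r.
  have [K K0 HK] := SF_schwartz_norm N HF HZ.
  exists (`|c| * K); first exact: mulr_ge0.
  move=> t; rewrite -lee_fin; apply: le_trans (Hc _ (schwartz_real (SF_schw t HF))) _.
  have n0 : (0 <= schwartz_norm N (fun x => (F t x)%:C%C))%E.
    apply: le_trans (@schwartz_norm_ub N _ [::] 0 isT); rewrite lee_fin.
    by rewrite mulr_ge0 ?cabs_ge0// exprn_ge0// addr_ge0// enorm_ge0.
  apply: (@le_trans _ _ (`|c|%:E * schwartz_norm N (fun x => (F t x)%:C%C))%E).
    by apply: lee_wpmul2r => //; rewrite lee_fin ler_norm.
  rewrite -mulrA EFinM; apply: lee_wpmul2l; first by rewrite lee_fin.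
  exact: HK.
have reE (a : R) (z w : C) : complex.Re (a%:C%C * z + w) = a * complex.Re z + complex.Re w.
  by case: z w => p q [p' q'] /=; rewrite mul0r subr0.
have imE (a : R) (z w : C) : complex.Im (a%:C%C * z + w) = a * complex.Im z + complex.Im w.
  by case: z w => p q [p' q'] /=; rewrite mul0r addr0.
split; split.
- by move=> a f g Hf Hg; rewrite /Ure lin// reE.
- move=> eps F HF; have [K K0 HK] := cont eps F HF; exists K => // t.
  exact: le_trans (Re_le_cabs _) (HK t).
- by move=> a f g Hf Hg; rewrite /Uim lin// imE.
- move=> eps F HF; have [K K0 HK] := cont eps F HF; exists K => // t.
  exact: le_trans (Im_le_cabs _) (HK t).
Qed.

Lemma pairing_Re_Im (u : tempered R d) (a b : Rd -> R) : schw a -> schw b ->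
  u (fun x => Complex (a x) (b x)) = Complex (Ure u a - Uim u b) (Uim u a + Ure u b).
Proof.
move=> Ha Hb; rewrite (_ : (fun x => _) = (fun x => 'i%C * (b x)%:C%C + (a x)%:C%C)).
  rewrite pairing_linear; try exact: schwartz_real.
  rewrite /Ure /Uim; case: (u _) => p q; case: (u _) => p' q'.
  by apply: complexP => /=; ring.
by apply/funext => x; apply: complexP => /=; ring.
Qed.

(* real counterpart of [D_represents] *)
Definition rep (sigma l : R) (U : (Rd -> R) -> R) (g : Rd -> R) :=
  rLp (leb R d) l g /\ forall f, schw0 f ->
    U (Tm (fun xi => enorm xi `^ sigma) f) = \int[leb R d]_x (g x * f x).

Lemma Tm0 (m : Rd -> R) : Tm m (fun=> 0) = fun=> 0.
Proof.
have H0 : Ht (fun _ : Rd => 0 : R) = fun=> 0.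
  apply/funext => xi; rewrite /Ht; under eq_Rintegral do rewrite mulr0.
  by rewrite /Rintegral integral0.
apply/funext => x; rewrite /Tm H0; under eq_fun do rewrite mulr0.
by rewrite H0 mulr0.
Qed.

(** The symbol is real and even, so the complex Fourier multiplier preserves real and imaginary
    parts and acts on each as [Tm]. Both transforms are expressed by the cosine and sine integrals
    [Cc] and [Sc], even and odd in xi. *)
Lemma Dtest_Tm (sigma : R) (a b : Rd -> R) : schw0 a -> schw0 b ->
  Dtest sigma (fun x => Complex (a x) (b x)) =
  fun x => Complex (Tm (fun xi => enorm xi `^ sigma) a x) (Tm (fun xi => enorm xi `^ sigma) b x).
Proof.
move=> Ha Hb; pose m (xi : Rd) := enorm xi `^ sigma.
pose Cc (f : Rd -> R) (xi : Rd) := \int[leb R d]_x (cos (dotp x xi) * f x).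
pose Sc (f : Rd -> R) (xi : Rd) := \int[leb R d]_x (sin (dotp x xi) * f x).
have mN xi : m (- xi) = m xi by rewrite /m enormN.
have tri (h : R -> R) f xi : continuous h -> (forall s, `|h s| <= 1) -> intgd f ->
    intgd (fun x => h (dotp x xi) * f x).
  move=> ch h1 fi; apply: (intg_le _ _ (intg_norm fi)).
    apply: measurable_funM; last exact: intg_measurable fi.
    apply: measurableT_comp; first exact: continuous_measurable_fun ch.
    exact: measurable_dotp.
  by move=> x; rewrite normrM ler_piMl.
have tc f xi : intgd f -> intgd (fun x => cos (dotp x xi) * f x).
  by apply: tri; [exact: continuous_cos|by move=> s; rewrite ler_norml cos_geN1 cos_le1].
have ts f xi : intgd f -> intgd (fun x => sin (dotp x xi) * f x).
  by apply: tri; [exact: continuous_sin|by move=> s; rewrite ler_norml sin_geN1 sin_le1].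
have CN f xi : Cc f (- xi) = Cc f xi.
  by apply: eq_Rintegral => x _; rewrite dotpNr cosN.
have SN f xi : intgd f -> Sc f (- xi) = - Sc f xi.
  move=> fi; rewrite -mulN1r -RintegralZl//; last exact: ts.
  by apply: eq_Rintegral => x _; rewrite dotpNr sinN; ring.
have HE f xi : intgd f -> Ht f xi = Cc f xi + Sc f xi.
  move=> fi; rewrite -RintegralD//; [|exact: tc|exact: ts].
  by apply: eq_Rintegral => x _; rewrite /cas mulrDl.
(* These are the even and the odd part of m times [Ht f], which is flat and therefore integrable. *)
have mi f : schw0 f -> intgd (fun xi => m xi * Cc f xi) /\ intgd (fun xi => m xi * Sc f xi).
  move=> Hf; have fi := schw_intg Hf.1.
  have F1 := flatM (Mult_powR sigma) (schw0_flat Hf).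
  have i1 := schw_intg (flat_schw F1); have i2 := schw_intg (flat_schw (flat_reflect F1)).
  split.
    have := intgZ 2^-1 (intgD i1 i2); congr intg; apply/funext => xi.
    by rewrite enormN !HE// CN SN// /m; field.
  have := intgZ 2^-1 (intgB i1 i2); congr intg; apply/funext => xi.
  by rewrite enormN !HE// CN SN// /m; field.
have ai := schw_intg Ha.1; have bi := schw_intg Hb.1.
have fE xi : fourier (fun x => Complex (a x) (b x)) xi = Complex (Cc a xi + Sc b xi) (Cc b xi - Sc a xi).
  apply: complexP => /=.
    rewrite -RintegralD//; [|exact: tc|exact: ts].
    by apply: eq_Rintegral => x _; rewrite cosN sinN; ring.
  rewrite -RintegralB//; [|exact: tc|exact: ts].
  by apply: eq_Rintegral => x _; rewrite cosN sinN; ring.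
have key (f g : Rd -> R) x : schw0 f -> schw0 g ->
    \int[leb R d]_xi (cos (dotp xi x) * (m xi * (Cc f xi + Sc g xi)) +
      sin (dotp xi x) * (m xi * (Sc f xi - Cc g xi))) = Ht (fun xi => m xi * Ht f xi) x.
  move=> Hf Hg; have [f1 f2] := mi f Hf; have [g1 g2] := mi g Hg.
  have fi := schw_intg Hf.1; have gi := schw_intg Hg.1.
  (* The difference between the Fourier and the Hartley integrand is odd in xi. *)
  pose o xi := cos (dotp xi x) * (m xi * Sc g xi - m xi * Sc f xi) +
    sin (dotp xi x) * (- 1 * (m xi * Cc g xi + m xi * Cc f xi)).
  have oi : intgd o.
    apply: intgD; [apply: tc; exact: intgB|apply: ts; apply: intgZ; exact: intgD].
  have o0 : \int[leb R d]_xi o xi = 0.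
    apply: Rint_odd oi _ => xi.
    by rewrite /o dotpNl cosN sinN mN !CN !SN//; ring.
  rewrite -[RHS]addr0 -o0 -RintegralD//; last first.
    apply: cas_intg; exact: (schw_intg (flat_schw (flatM (Mult_powR sigma) (schw0_flat Hf)))).
  by apply: eq_Rintegral => xi _; rewrite /o HE// /cas; ring.
apply/funext => x; rewrite /Dtest /inv_fourier (funext fE); apply: complexP.
  rewrite /= mul0r subr0 /Tm -(key a b x Ha Hb); congr (_ * _).
  by apply: eq_Rintegral => xi _; rewrite (dotpC x) -/(m xi); ring.
rewrite /= mul0r addr0 /Tm; congr (_ * _).
(* The imaginary part of a + ib is the real part of b - ia, so [key] is used for the pair (b,
   -a). *)
have Ha' := schw0Z (-1) Ha; have CZ f xi : intgd f -> Cc (fun x => -1 * f x) xi = - Cc f xi.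
  move=> fi; rewrite -[RHS]mulN1r -RintegralZl//; last exact: tc.
  by apply: eq_Rintegral => y _; ring.
have SZ f xi : intgd f -> Sc (fun x => -1 * f x) xi = - Sc f xi.
  move=> fi; rewrite -[RHS]mulN1r -RintegralZl//; last exact: ts.
  by apply: eq_Rintegral => y _; ring.
rewrite -(key b _ x Hb Ha').
by apply: eq_Rintegral => xi _; rewrite CZ// SZ// (dotpC x) -/(m xi); ring.
Qed.

Lemma rLp_schw_intg (l : R) (g f : Rd -> R) : 1 <= l -> rLp (leb R d) l g -> schw f ->
  intgd (fun x => g x * f x).
Proof.
move=> l1 Hg Hf; have [K [K0 HK]] := Rap_bd Hf 0%N.
apply: (@rLp_mul_intg _ _ _ _ l K) => //; first exact: schw_intg.
by move=> x; have := HK tt x I; rewrite expr0 !mulr1.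
Qed.

(** By [Dtest_Tm] a representative of a complex distribution splits into representatives of its real
    components; afterwards all analysis is over the reals. *)
Lemma D_represents_rep (sigma l : R) (u : tempered R d) (g : Rd -> C) : 1 < l ->
  D_represents sigma l u g <->
  rep sigma l (Ure u) (fun x => complex.Re (g x)) /\ rep sigma l (Uim u) (fun x => complex.Im (g x)).
Proof.
move=> l1; have l0 : 0 < l by exact: lt_trans l1.
split=> [[/(in_Lp_rLp _ l0)[g1 g2] H]|[[g1 H1] [g2 H2]]].
  have key f : schw0 f -> u (fun x => Complex (Tm (fun xi => enorm xi `^ sigma) f x) 0) =
      Complex (\int[leb R d]_x (complex.Re (g x) * f x)) (\int[leb R d]_x (complex.Im (g x) * f x)).
    move=> Hf; have := H (fun x => Complex (f x) 0); rewrite Dtest_Tm//; last exact: schw0_zero.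
    rewrite Tm0 => ->; last by apply/schwartz0_Re_Im; split => //; exact: schw0_zero.
    by apply: complexP; apply: eq_Rintegral => x _; case: (g x) => p q /=; ring.
  by split; split => // f Hf; rewrite /Ure /Uim key.
split; first exact/in_Lp_rLp.
move=> f /schwartz0_Re_Im[Ha Hb].
rewrite (_ : f = fun x => Complex (complex.Re (f x)) (complex.Im (f x))); last first.
  by apply/funext => x; case: (f x).
set a := fun x => complex.Re (f x) in Ha *; set b := fun x => complex.Im (f x) in Hb *.
have l1' := ltW l1.
rewrite Dtest_Tm// pairing_Re_Im; [|exact: (schw0_Tm (Mult_powR _) Ha).1|exact: (schw0_Tm (Mult_powR _) Hb).1].
rewrite !H1// !H2//; apply: complexP => /=.
  rewrite -RintegralB//; [|exact: rLp_schw_intg l1' g1 Ha.1|exact: rLp_schw_intg l1' g2 Hb.1].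
  by apply: eq_Rintegral => x _; case: (g x) => p q /=.
rewrite -RintegralD//; [|exact: rLp_schw_intg l1' g2 Ha.1|exact: rLp_schw_intg l1' g1 Hb.1].
by apply: eq_Rintegral => x _; case: (g x) => p q /=; rewrite addrC.
Qed.

End bridge.

(** * Uniqueness of representatives *)

Section orthants.
Context {R : realType} {d : nat}.
Local Notation Rd := 'rV[R]_d.
Local Notation intgd := (intg (leb R d)).

(** Closed orthants form a pi-system generating the Borel sets, and their indicators are limits of
    products of logistic functions of the coordinates. *)
Definition orthant (a : Rd) : set Rd := [set x | forall i, a ord0 i <= x ord0 i].

Lemma measurable_orthant a : measurable (orthant a).
Proof.
rewrite (_ : orthant a = \big[setI/setT]_(i < d) (fun x : Rd => x ord0 i) @^-1` `[a ord0 i, +oo[).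
  apply: bigsetI_measurable => i _; rewrite -[X in measurable X]setTI.
  by apply: (@measurable_coord R d i) => //; exact: measurable_itv.
apply/seteqP; split=> [x Hx|x].
  by rewrite -bigcap_seq => i _ /=; rewrite in_itv/= andbT.
by rewrite -bigcap_seq => Hx i; have := Hx i (mem_index_enum _); rewrite /= in_itv/= andbT.
Qed.

Lemma orthantI a b : exists c, orthant a `&` orthant b = orthant c.
Proof.
exists (\row_i Num.max (a ord0 i) (b ord0 i)); apply/seteqP; split=> x.
  by move=> [xa xb] i; rewrite mxE ge_max xa xb.
by move=> H; split=> i; have := H i; rewrite mxE ge_max => /andP[].
Qed.

Let G : set (set Rd) := [set A | exists a, A = orthant a].

Lemma bigcup_orthant : \bigcup_k orthant (const_mx (- k%:R)) = [set: Rd].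
Proof.
apply/seteqP; split=> // x _; exists (Num.bound `|x|) => // i; rewrite mxE.
have := archi_boundP (normr_ge0 x); have := ler_coord_norm x i; rewrite ler_norml => /andP[xi _] xb.
by apply: le_trans xi; rewrite lerN2 ltW.
Qed.

(** A coordinate half-space is the union of the orthants whose other corner coordinates tend to
    -oo. *)
Lemma measurable_orthantE : @measurable _ (Rd) = <<s G >>.
Proof.
apply/seteqP; split; last first.
  apply: smallest_sub; first exact: sigma_algebra_measurable.
  by move=> _ [a ->]; exact: measurable_orthant.
apply: smallest_sub; first exact: smallest_sigma_algebra.
move=> A; rewrite -bigcup_seq => -[i _ [B + <-]].
suff : measurable `<=` image_set_system [set: Rd] (rV_coord i) <<s G >> by apply.
rewrite RGenCInfty.measurableE; apply: smallest_sub.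
  by apply: sigma_algebra_image; exact: smallest_sigma_algebra.
move=> _ [c ->]; rewrite /image_set_system/= setTI.
rewrite (_ : _ @^-1` _ = \bigcup_k orthant (\row_j if j == i then c else - k%:R)).
  by apply: sigma_algebra_bigcup => k; apply: sub_sigma_algebra; eexists.
apply/seteqP; split=> x; rewrite /= in_itv/= andbT.
  move=> cx; exists (Num.bound `|x|) => // j; rewrite mxE; case: eqP => [->//|_].
  have := archi_boundP (normr_ge0 x); have := ler_coord_norm x j; rewrite ler_norml => /andP[xi _] xb.
  by apply: le_trans xi; rewrite lerN2 ltW.
by move=> [k _ /(_ i)]; rewrite mxE eqxx.
Qed.

(** The measurable sets over which [F] integrates to 0 form a Dynkin system that contains a
    generating pi-system. *)
Lemma orthant_ae0 (F : Rd -> R) : intgd F ->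
  (forall a, \int[leb R d]_x (\1_(orthant a) x * F x) = 0) ->
  {ae leb R d, forall x, F x = 0}.
Proof.
move=> Fi F0; have mF := intg_measurable Fi.
have iI A : measurable A -> intgd (fun x => \1_A x * F x).
  move=> mA; apply: (intg_le _ _ (intg_norm Fi)).
    by apply: measurable_funM => //; exact: measurable_indic.
  by move=> x; rewrite normrM ler_piMl// indicE; case: (_ \in _); rewrite ?normr1 ?normr0.
pose H := [set A : set Rd | measurable A /\ \int[leb R d]_x (\1_A x * F x) = 0].
have ndH : ndseq_closed H.
  move=> A ndA HA; have mU : measurable (\bigcup_k A k) by apply: bigcupT_measurable => k; exact: (HA k).1.
  split => //.
  have [|||||_ c] := @dct_Rint _ _ R (leb R d) (fun n x => \1_(A n) x * F x)
     (fun x => \1_(\bigcup_k A k) x * F x) (fun x => `|F x|).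
  - by move=> n; apply: intg_measurable (iI _ (HA n).1).
  - exact: intg_measurable (iI _ mU).
  - apply: aeW => x; apply: cvgM; last exact: cvg_cst.
    apply: cvg_near_cst; have [[k _ Ak]|nA] := pselect ((\bigcup_k A k) x).
      exists k => // n /= kn; rewrite !indicE !mem_set//; first by exists k.
      by move: Ak; apply/subsetPset/ndA.
    apply: nearW => n; rewrite !indicE !memNset// => An; apply: nA; by exists n.
  - exact: intg_norm.
  - by move=> n x; rewrite normrM ler_piMl// indicE; case: (_ \in _); rewrite ?normr1 ?normr0.
  move: c; rewrite (_ : (fun n => _) = fun=> 0); last by apply/funext => n; exact: (HA n).2.
  by move=> /(cvg_unique (@Rhausdorff R)) /(_ (cvg_cst _)).
have lH : lambda_system setT H.
  split=> //.
  - rewrite -bigcup_orthant; apply: ndH.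
      move=> m n mn; apply/subsetPset => x Hx i; apply: le_trans (Hx i).
      by rewrite !mxE lerN2 ler_nat.
    by move=> k; split; [exact: measurable_orthant|exact: F0].
  - move=> A B BA [mA A0] [mB B0]; split; first exact: measurableD.
    rewrite -[RHS](subrr 0) -{1}A0 -{1}B0 -RintegralB//; [|exact: iI|exact: iI].
    apply: eq_Rintegral => x _; rewrite -mulrBl; congr (_ * _); rewrite !indicE.
    rewrite in_setD; case: (boolP (x \in B)) => [xB|xB]; rewrite ?andbF ?andbT ?subr0//.
    by rewrite (_ : x \in A)// ?subrr// inE; apply: BA; rewrite -inE.
have GH : G `<=` H.
  by move=> _ [a ->]; split; [exact: measurable_orthant|exact: F0].
have IG : setI_closed G.
  by move=> _ _ [a ->] [b ->]; have [c ->] := orthantI a b; exists c.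
have mH (A : set Rd) : measurable A -> H A.
  by rewrite measurable_orthantE => mA; apply: (lambda_system_subset IG lH GH _ mA).
have : ae_eq (leb R d) setT (EFin \o F) (cst 0%E).
  apply: integral_ae_eq => // E _ mE; rewrite integral0.
  have [_ E0] := mH E mE; rewrite -[RHS]/(0%R%:E) -E0 EFin_Rint ?iI//.
  rewrite integral_mkcond; apply: eq_integral => x _.
  by rewrite /patch indicE; case: (x \in E); rewrite ?mul1r ?mul0r.
by apply: filterS => x /(_ I) /= [].
Qed.

End orthants.

(** * Functions determined by their pairings with S_oo *)

Section uniqueness.
Context {R : realType} {d : nat}.
Local Notation Rd := 'rV[R]_d.
Local Notation intgd := (intg (leb R d)).
Hypothesis d_gt0 : (0 < d)%N.

Let lam (n : nat) : R := 2 ^+ n.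

Let lam_gt0 n : 0 < lam n. Proof. exact: exprn_gt0. Qed.

Let lam_ge1 n : 1 <= lam n. Proof. by rewrite exprn_ege1 ?ler1n. Qed.

Let schw_ThetaM n (f : Rd -> R) : schw f -> schw (fun xi => Theta (lam n *: xi) * f xi).
Proof.
move=> Hf; have Ts : schw (fun xi : Rd => Theta (lam n *: xi)).
  exact: (SF_dilate (lt0r_neq0 (lam_gt0 n)) (@Theta_SF R d)).
have := RapM (@Ws_ge1' R d) (fun=> ler01) (Rap_Mod Ts) Hf.
by under [X in Rap _ _ X]eq_fun do rewrite mul1r.
Qed.

(** After the substitution xi -> xi / lam n the symbol becomes Theta(xi) Ht psi(xi / lam n), a
    uniformly Schwartz family because the dilation factors are at most 1; the Jacobian gives the
    factor lam^-d. *)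
Lemma lowpass_le (psi : Rd -> R) : schw psi -> exists2 C : R, 0 <= C & forall n x,
  `|Tm (fun xi => Theta (lam n *: xi)) psi x| <=
    C * ((lam n)^-1 ^+ d * (Ws ((lam n)^-1 *: x))^-1 ^+ (2 * d)).
Proof.
move=> Hpsi; have HH := schw_Ht Hpsi.
have li n : 0 < (lam n)^-1 <= 1 by rewrite invr_gt0 lam_gt0 invf_le1 ?lam_gt0 ?lam_ge1.
have M1 : Mod setT Ws (fun=> 1) (fun n xi => Ht psi ((lam n)^-1 *: xi)).
  move=> m.
  have -> : (fun n (xi : Rd) => Ht psi ((lam n)^-1 *: xi)) =
      (fun n xi => (lam n)^-1 ^+ 0 * Ht psi ((lam n)^-1 *: xi)).
    by apply/funext => t; apply/funext => x; rewrite expr0 mul1r.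
  apply: (@Cn_dilate _ _ unit nat setT (rapb setT Ws (fun=> 1)) _ (fun=> tt) (fun n => (lam n)^-1)) (HH m) => //.
  move=> F k HF; have [C [C0 FC]] := HF 0%N; exists 0%N, C; split => // {}m x _.
  have /andP[l0 l1] := li m; rewrite normrM normrX (gtr0_norm l0) expr0 !mulr1.
  have := FC tt ((lam m)^-1 *: x) I; rewrite expr0 !mulr1; apply: le_trans.
  by rewrite ler_piMl// exprn_ile1// ltW.
have S1 : SF (fun=> 1) (fun n xi => Ht psi ((lam n)^-1 *: xi) * Theta xi).
  have := RapM (@Ws_ge1' R d) (fun=> ler01) M1 (schw_SF (@Theta_SF R d)).
  by under [X in Rap _ _ X]eq_fun do rewrite mul1r.
have [C [C0 HC]] := Rap_bd (SF_Ht (fun=> ler01) S1) (2 * d)%N.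
exists ((2 * pi) ^- d * C); first by rewrite mulr_ge0// invr_ge0 ltW// twopi_gt0.
move=> n x; rewrite /Tm normrM ger0_norm; last by rewrite invr_ge0 ltW// twopi_gt0.
rewrite -[leRHS]mulrA ler_wpM2l//; first by rewrite invr_ge0 ltW// twopi_gt0.
have /andP[l0 l1] := li n.
have Hi := schw_ThetaM n HH.
have l0' : (lam n)^-1 != 0 by rewrite gt_eqF.
rewrite /Ht (Rint_affine 0 l0' (cas_intg x (schw_intg Hi))) normrM normrX.
rewrite normr_id (gtr0_norm l0) [leRHS]mulrCA.
rewrite ler_wpM2l ?exprn_ge0 ?(ltW l0)//.
rewrite (_ : Rintegral _ _ _ = Ht (fun xi => Ht psi ((lam n)^-1 *: xi) * Theta xi) ((lam n)^-1 *: x)); last first.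
  apply: eq_Rintegral => xi _; rewrite addr0 scalerA divff ?gt_eqF// scale1r dotpZl dotpZr.
  by rewrite [X in _ * X]mulrC.
rewrite exprVn ler_pdivlMr ?exprn_gt0 ?Ws_gt0//.
by have := HC n ((lam n)^-1 *: x) I; rewrite mulr1.
Qed.


(* Young's inequality with weights lam^(-kappa) and lam^kappa; kappa balances the
   two resulting powers of lam *)
Lemma lowpass_pairing (l : R) (g psi : Rd -> R) : 1 < l -> rLp (leb R d) l g -> schw psi ->
  exists C r : R, 0 < r < 1 /\ forall n,
    `|\int[leb R d]_x (g x * Tm (fun xi => Theta (lam n *: xi)) psi x)| <= C * r ^+ n.
Proof.
move=> l1 Hg Hpsi; have [mg gi] := Hg; have [C C0 HC] := lowpass_le Hpsi.
have l0 : 0 < l := lt_trans ltr01 l1.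
pose l' := (1 - l^-1)^-1.
have l'i : l^-1 + l'^-1 = 1 by rewrite invrK addrC subrK.
have li1 : l^-1 < 1 by rewrite invf_lt1.
have l'0 : 0 < l' by rewrite invr_gt0 subr_gt0.
have l'1 : 1 < l' by rewrite -invf_lt1// invrK gtrBl invr_gt0.
have dR : 0 < d%:R :> R by rewrite ltr0n.
pose kappa : R := d%:R * (l' - 1) / (l + l').
have k0 : 0 < kappa by rewrite divr_gt0 ?addr_gt0// mulr_gt0// subr_gt0.
have kE : d%:R * (l' - 1) - kappa * l' = kappa * l.
  by rewrite /kappa; field; rewrite gt_eqF// addr_gt0.
pose r := 2 `^ (- (kappa * l)).
have r0 : 0 < r by rewrite powR_gt0.
have r1 : r < 1.
  rewrite /r powRN invf_lt1 ?powR_gt0//.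
  have := @gt0_ltr_powR R (kappa * l) (mulr_gt0 k0 l0) 1 2; rewrite powR1.
  by apply; rewrite ?nnegrE ?ltr1n ?ler01.
pose v (x : Rd) : R := (Ws x)^-1 ^+ (2 * d).
have v0 x : 0 < v x by rewrite exprn_gt0// invr_gt0 Ws_gt0.
have v1 x : v x <= 1 by rewrite exprn_ile1 ?invr_ge0 ?(ltW (Ws_gt0 _))// invf_le1 ?Ws_gt0// Ws_ge1.
pose V := \int[leb R d]_x v x; pose M := \int[leb R d]_x (`|g x| `^ l).
exists (C * (M + V)), r; split; first by rewrite r0.
move=> n; set T := Tm _ _.
have lp : forall s, lam n `^ s = 2 `^ (s * n%:R).
  by move=> s; rewrite /lam -powR_mulrn// -powRrM mulrC.
have HT : schw T by exact/schw_Tm/schw_ThetaM/schw_Ht.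
have li0 : (lam n)^-1 != 0 by rewrite invr_eq0 gt_eqF.
have vi : intgd (fun x => v ((lam n)^-1 *: x)).
  by have := intg_affine 0 li0 (@intg_WsV R d); under eq_fun do rewrite addr0.
have vE : \int[leb R d]_x v ((lam n)^-1 *: x) = lam n ^+ d * V.
  rewrite /V (Rint_affine 0 li0 (@intg_WsV R d)) normrV ?unitfE ?gt_eqF// gtr0_norm//.
  rewrite mulrA -exprMn divff ?gt_eqF// expr1n mul1r.
  by apply: eq_Rintegral => x _; rewrite addr0.
have Yg x : `|g x * T x| <= C * (lam n `^ (- (kappa * l)) * `|g x| `^ l +
    lam n `^ (- (kappa * l) - d%:R) * v ((lam n)^-1 *: x)).
  rewrite normrM; apply: le_trans (ler_wpM2l (normr_ge0 _) (HC n x)) _.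
  rewrite mulrCA ler_wpM2l// -/(v _).
  move: (v ((lam n)^-1 *: x)) (v0 ((lam n)^-1 *: x)) (v1 ((lam n)^-1 *: x)) => w w0 w1.
  have := @conjugate_powR R (lam n `^ (- kappa) * `|g x|) (lam n `^ kappa * ((lam n)^-1 ^+ d * w)) l l'.
  have pk : lam n `^ (- kappa) * lam n `^ kappa = 1 by rewrite powRN mulVf// gt_eqF// powR_gt0.
  rewrite mulrACA pk mul1r => H.
  apply: (le_trans (H _ _ l0 l'0 l'i)); rewrite ?mulr_ge0 ?powR_ge0 ?exprn_ge0 ?invr_ge0 ?(ltW (lam_gt0 _)) ?(ltW w0)//.
  apply: lerD.
    rewrite powRM ?powR_ge0// -powRrM mulNr ler_piMr ?mulr_ge0 ?powR_ge0//.
    exact: ltW.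
  rewrite !powRM ?powR_ge0 ?mulr_ge0 ?exprn_ge0 ?invr_ge0 ?(ltW (lam_gt0 _)) ?(ltW w0)//.
  rewrite -!powRrM exprVn -powR_invn ?(ltW (lam_gt0 _))// -powRrM.
  rewrite mulrA -powRD ?(gt_eqF (lam_gt0 n)) ?implybT//.
  apply: (@le_trans _ _ (lam n `^ (kappa * l' + - d%:R * l') * w `^ l')).
    rewrite ler_piMr ?mulr_ge0 ?powR_ge0//.
    by rewrite ltW// invf_lt1.
  rewrite (_ : kappa * l' + _ = - (kappa * l) - d%:R); last by rewrite -kE; ring.
  rewrite ler_wpM2l ?powR_ge0// -[leRHS]powRr1 ?(ltW w0)//.
  by rewrite ger_powR// ?w0// ltW.
have i1 := intgZ (lam n `^ (- (kappa * l))) gi.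
have i2 := intgZ (lam n `^ (- (kappa * l) - d%:R)) vi.
apply: le_trans (Rint_norm_le (rLp_schw_intg (ltW l1) Hg HT) (intgZ C (intgD i1 i2)) Yg) _.
rewrite RintegralZl//; last exact: intgD.
rewrite RintegralD// RintegralZl// RintegralZl// vE -/M -mulrA.
rewrite ler_wpM2l// mulrDl [M * _]mulrC [V * _]mulrC mulrA.
rewrite -powR_mulrn ?(ltW (lam_gt0 _))// -powRD ?(gt_eqF (lam_gt0 n)) ?implybT// subrK.
by rewrite lp /r -powR_mulrn ?powR_ge0// -powRrM.
Qed.

(** S_oo sees functions only modulo polynomials, and integrability removes the rest: up to an
    element of S_oo a Schwartz function is its low-pass part, whose pairings with both functions
    tend to 0. *)
Lemma rLp_pairing_schw (l1 l2 : R) (g1 g2 : Rd -> R) : 1 < l1 -> 1 < l2 ->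
  rLp (leb R d) l1 g1 -> rLp (leb R d) l2 g2 ->
  (forall f, schw0 f -> \int[leb R d]_x (g1 x * f x) = \int[leb R d]_x (g2 x * f x)) ->
  forall f, schw f -> \int[leb R d]_x (g1 x * f x) = \int[leb R d]_x (g2 x * f x).
Proof.
move=> l11 l21 H1 H2 H f Hf.
have [C1 [r1 [/andP[r10 r11] E1]]] := lowpass_pairing l11 H1 Hf.
have [C2 [r2 [/andP[r20 r21] E2]]] := lowpass_pairing l21 H2 Hf.
have HL n := schw_ThetaM n (schw_Ht Hf).
have E n : \int[leb R d]_x (g1 x * f x) - \int[leb R d]_x (g2 x * f x) =
    \int[leb R d]_x (g1 x * Tm (fun xi => Theta (lam n *: xi)) f x) -
    \int[leb R d]_x (g2 x * Tm (fun xi => Theta (lam n *: xi)) f x).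
  (* This part of [f] lies in S_oo, where the two pairings agree by hypothesis. *)
  have F0 : flat (fun xi => (1 - Theta (lam n *: xi)) * Ht f xi).
    split; first by apply: ThetaC_flat => //; exact: schw_Ht.
    by rewrite scaler0 Theta0 subrr mul0r.
  have S0 := schw0_TmF F0; have L := schw_Tm (HL n).
  have fE x : f x = Tm (fun xi => 1 - Theta (lam n *: xi)) f x + Tm (fun xi => Theta (lam n *: xi)) f x.
    have := congr1 (fun h => h x) (TmDm (flat_schw F0) (HL n)).
    move=> <-; under [X in Tm X]eq_fun do rewrite subrK.
    by rewrite Tm1.
  have D l g : 1 < l -> rLp (leb R d) l g -> \int[leb R d]_x (g x * f x) =
      \int[leb R d]_x (g x * Tm (fun xi => 1 - Theta (lam n *: xi)) f x) +
      \int[leb R d]_x (g x * Tm (fun xi => Theta (lam n *: xi)) f x).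
    move=> gl Hg; rewrite -RintegralD//; last 2 first.
    - exact: rLp_schw_intg (ltW gl) Hg S0.1.
    - exact: rLp_schw_intg (ltW gl) Hg L.
    by apply: eq_Rintegral => x _; rewrite -mulrDr -fE.
  have sub2 (a b c a' b' c' : R) : a = b + c -> a' = b' + c' -> b = b' -> a - a' = c - c'.
    by move=> -> -> ->; rewrite opprD addrACA subrr add0r.
  exact: sub2 (D _ _ l11 H1) (D _ _ l21 H2) (H _ S0).
have c0 (C r : R) : 0 < r -> r < 1 -> C * r ^+ n @[n --> \oo] --> (0 : R).
  move=> r0' r1'; rewrite -[X in _ --> X](mulr0 C); apply: cvgMl_tmp.
  by apply: cvg_expr; rewrite ger0_norm// ltW.
apply/eqP; rewrite -subr_eq0 -normr_le0.
have : C1 * r1 ^+ n + C2 * r2 ^+ n @[n --> \oo] --> (0 + 0 : R) by apply: cvgD; exact: c0.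
rewrite addr0 => /(ler_cvg_to (cvg_cst _)); apply.
by apply: nearW => n; rewrite (E n); apply: le_trans (ler_normB _ _) _; exact: lerD.
Qed.


(** The shift by n makes the limit 1 at t = 0 as well, so that the indicator of the closed half-line
    results; the factor n^2 outweighs the shift for negative t. *)
Lemma sg_cvg (t : R) : sg (n%:R ^+ 2 * t + n%:R) @[n --> \oo] --> ((0 <= t)%R%:R : R).
Proof.
have sgle (s : R) : 0 <= s -> sg (- s) <= (1 + s)^-1.
  move=> s0; have s1 : 0 < 1 + s by rewrite ltr_wpDr.
  have e1 : 0 < 1 + expR s by rewrite addr_gt0// expR_gt0.
  rewrite /sg opprK lef_pV2 ?posrE//.
  by rewrite lerD2l; apply: le_trans (expR_ge1Dx _); rewrite lerDr.
have h0 : (1 + n%:R)^-1 @[n --> \oo] --> (0 : R).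
  by under eq_fun do rewrite addrC natr1; exact: cvg_harmonic.
have sq (u : nat -> R) : (\forall n \near \oo, 0 <= u n <= (1 + n%:R)^-1) -> u n @[n --> \oo] --> (0 : R).
  by move=> H; apply: (squeeze_cvgr H) (cvg_cst _) h0.
have [t0|t0] := leP 0 t.
  have : 1 - sg (n%:R ^+ 2 * t + n%:R) @[n --> \oo] --> (0 : R).
    apply: sq; apply: nearW => n; rewrite -sgN ltW ?sg_gt0//=.
    have p0 : 0 <= n%:R ^+ 2 * t + n%:R by rewrite addr_ge0// mulr_ge0// exprn_ge0.
    apply: le_trans (sgle _ p0) _; rewrite lef_pV2 ?posrE ?ltr_wpDr// lerD2l lerDr.
    by rewrite mulr_ge0// exprn_ge0.
  move=> h1; rewrite (_ : true%:R = 1 - 0 :> R); last by rewrite subr0.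
  under eq_fun do rewrite -[sg _](subKr 1).
  by apply: cvgB h1; exact: cvg_cst.
apply: sq; exists (Num.bound (2 / - t)) => // n /= nb; rewrite ltW ?sg_gt0//=.
have nt : 2 / - t <= n%:R.
  apply: (@le_trans _ _ (Num.bound (2 / - t))%:R); last by rewrite ler_nat.
  by apply/ltW/archi_boundP; rewrite divr_ge0// oppr_ge0 ltW.
have nt2 : 2 <= n%:R * - t by rewrite -ler_pdivrMr// oppr_gt0.
rewrite -[_ + n%:R]opprK.
have p0 : n%:R <= - (n%:R ^+ 2 * t + n%:R) :> R.
  rewrite [leRHS](_ : _ = n%:R * (n%:R * - t - 1)); last by ring.
  by rewrite ler_peMr// lerBrDr.
apply: le_trans (sgle _ (le_trans _ p0)) _ => //.
by rewrite lef_pV2 ?posrE ?lerD2l// ltr_wpDr// (le_trans _ p0).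
Qed.

Lemma Theta_gt0 (x : Rd) : 0 < Theta x.
Proof. by rewrite /Theta; case: ifP => // _; exact: sg_gt0. Qed.

Let stp (a : Rd) (n : nat) (x : Rd) : R :=
  Theta x * \prod_i sg (n%:R ^+ 2 * (x ord0 i - a ord0 i) + n%:R).

Let schw_stp a n : schw (stp a n).
Proof.
have Msg i : Mod setT (@Ws R d) (fun _ : unit => 1)
    (fun _ x => sg (n%:R ^+ 2 * (x ord0 i - a ord0 i) + n%:R)).
  have := @Mod_horner_sg R d unit setT Ws (@Ws_ge1' R d)
    (fun _ x => n%:R ^+ 2 * x ord0 i + (n%:R - n%:R ^+ 2 * a ord0 i)) _ 'X.
  have -> : (fun (_ : unit) (x : Rd) => 'X.[sg (n%:R ^+ 2 * x ord0 i + (n%:R - n%:R ^+ 2 * a ord0 i))]) =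
      (fun _ x => sg (n%:R ^+ 2 * (x ord0 i - a ord0 i) + n%:R)).
    by apply/funext => _; apply/funext => x; rewrite hornerX; congr sg; ring.
  apply; apply: (ModD (@Ws_ge1' R d)) => //; last exact: Mod_cst.
  have := ModM (@Ws_ge1' R d) (fun=> ler01) (fun=> ler01)
    (@Mod_cst R d unit setT Ws (n%:R ^+ 2))
    (@Mod_coord R d unit setT Ws i (fun x _ => coord_le_Ws x i)).
  by under [X in Mod _ _ X]eq_fun do rewrite mul1r.
have P (s : seq 'I_d) : schw (fun x => (\prod_(i <- s) sg (n%:R ^+ 2 * (x ord0 i - a ord0 i) + n%:R)) * Theta x).
  elim: s => [|i s IH].
    rewrite (_ : (fun x => _) = @Theta R d); first exact: Theta_SF.
    by apply/funext => x; rewrite big_nil mul1r.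
  have := RapM (@Ws_ge1' R d) (fun=> ler01) (Msg i) IH.
  under [X in Rap _ _ X]eq_fun do rewrite mul1r.
  by congr SF; apply/funext => _; apply/funext => x; rewrite big_cons mulrA.
by have := P (index_enum _); congr SF; apply/funext => _; apply/funext => x; rewrite mulrC.
Qed.

(** Weighting the difference by the positive function [Theta] makes it integrable, and the Schwartz
    functions [stp a n] approximate [Theta] times the indicator of an orthant. The exponents may
    differ, as they do for the two descriptions of a frequency piece. *)
Lemma rLp_pairing_ae (l1 l2 : R) (g1 g2 : Rd -> R) : 1 < l1 -> 1 < l2 ->
  rLp (leb R d) l1 g1 -> rLp (leb R d) l2 g2 ->
  (forall f, schw0 f -> \int[leb R d]_x (g1 x * f x) = \int[leb R d]_x (g2 x * f x)) ->
  {ae leb R d, forall x, g1 x = g2 x}.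
Proof.
move=> l11 l21 H1 H2 /(rLp_pairing_schw l11 l21 H1 H2) H.
have i1 f (Hf : schw f) := rLp_schw_intg (ltW l11) H1 Hf.
have i2 f (Hf : schw f) := rLp_schw_intg (ltW l21) H2 Hf.
have HT : schw (@Theta R d) := @Theta_SF R d.
pose F x : R := (g1 x - g2 x) * Theta x.
have Fi : intgd F.
  by have := intgB (i1 _ HT) (i2 _ HT); congr intg; apply/funext => x; rewrite -mulrBl.
suff : {ae leb R d, forall x, F x = 0}.
  apply: filterS => x /eqP; rewrite mulf_eq0 subr_eq0 => /orP[/eqP//|].
  by rewrite gt_eqF// Theta_gt0.
apply: orthant_ae0 => // a; have mF := intg_measurable Fi.
have iI : intgd (fun x => \1_(orthant a) x * F x).
  apply: (intg_le _ _ (intg_norm Fi)).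
    by apply: measurable_funM => //; apply: measurable_indic; exact: measurable_orthant.
  by move=> x; rewrite normrM ler_piMl// indicE; case: (_ \in _); rewrite ?normr1 ?normr0.
pose sp n (x : Rd) : R := \prod_i sg (n%:R ^+ 2 * (x ord0 i - a ord0 i) + n%:R).
have FE n x : F x * sp n x = g1 x * stp a n x - g2 x * stp a n x.
  by rewrite /F /stp -/(sp n x); ring.
have [|||||_ c] := @dct_Rint _ _ R (leb R d) (fun n x => F x * sp n x)
   (fun x => \1_(orthant a) x * F x) (fun x => `|F x|).
- move=> n; have := intgB (i1 _ (schw_stp a n)) (i2 _ (schw_stp a n)).
  by move=> /intg_measurable; congr measurable_fun; apply/funext => x; rewrite FE.
- exact: intg_measurable iI.
- apply: aeW => x; rewrite mulrC; apply: cvgM; first exact: cvg_cst.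
  rewrite (_ : \1_(orthant a) x = \prod_(i < d) (0 <= x ord0 i - a ord0 i)%R%:R).
    rewrite /sp; elim: (index_enum _) => [|i s IH].
      by under eq_fun do rewrite big_nil; rewrite big_nil; exact: cvg_cst.
    under eq_fun do rewrite big_cons; rewrite big_cons; apply: cvgM IH; exact: sg_cvg.
  rewrite indicE; have [xa|] := pselect (orthant a x).
    by rewrite mem_set// big1// => i _; rewrite subr_ge0 xa.
  move=> nxa; rewrite memNset//; move/existsNP : nxa => [i /negP nxi].
  by rewrite (bigD1 i)//= subr_ge0 (negbTE nxi) mul0r.
- exact: intg_norm.
- move=> n x; rewrite normrM ler_piMr// ger0_norm; last by apply: prodr_ge0 => i _; rewrite ltW// sg_gt0.
  rewrite -[leRHS](expr1n R d) -[X in _ <= 1 ^+ X](card_ord d) -prodr_const.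
  by apply: ler_prod => i _; exact: sg_itv.
move: c; rewrite (_ : (fun n => _) = fun=> 0).
  by move=> /(cvg_unique (@Rhausdorff R)) /(_ (cvg_cst _)).
apply/funext => n; under eq_Rintegral do rewrite FE.
rewrite RintegralB//; [|exact: i1 (schw_stp a n)|exact: i2 (schw_stp a n)].
by rewrite H ?subrr//; exact: schw_stp.
Qed.

End uniqueness.

Lemma geometric_le (R : realType) (C r : R) N : 0 <= C -> 0 < r < 1 ->
  \sum_(0 <= n < N) (C * r ^+ n) <= C / (1 - r).
Proof.
move=> C0 /andP[r0 r1]; rewrite -mulr_sumr ler_wpM2l// big_mkord.
have p0 : 0 < 1 - r by rewrite subr_gt0.
rewrite -[leRHS]mul1r ler_pdivlMr// mulrC -opprB mulNr -subrX1 opprB.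
by rewrite gerBl exprn_ge0// ltW.
Qed.

(** * Interpolation inequality *)

Section Lp_series.
Context dd (T : measurableType dd) (R : realType) (mu : {measure set T -> \bar R}).
Variables (q C rho : R) (g : nat -> T -> R).
Hypotheses (q1 : 1 < q) (C0 : 0 <= C) (rho01 : 0 < rho < 1).
Hypotheses (mg : forall n, measurable_fun [set: T] (g n))
  (gi : forall n, intg mu (fun x => `|g n x| `^ q))
  (gC : forall n, \int[mu]_x (`|g n x| `^ q) <= C * rho ^+ n).

Let r := Num.sqrt rho.
Let r01 : 0 < r < 1.
Proof.
have /andP[r0 r1] := rho01; rewrite sqrtr_gt0 r0/= -[ltRHS]sqrtr1.
by rewrite ltr_sqrt.
Qed.
Let r0 : 0 < r. Proof. by have /andP[] := r01. Qed.

(** The decay rho^n = r^(2n) is shared out: one factor r^n keeps the sum [K] integrable, the other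
    becomes pointwise geometric decay of |g n|^q. *)
Let k n x : R := r ^- n * `|g n x| `^ q.

Let k0 n x : 0 <= k n x.
Proof. by rewrite mulr_ge0 ?powR_ge0// invr_ge0 exprn_ge0// ltW. Qed.

Let mk n : measurable_fun [set: T] (k n).
Proof. by apply: measurable_funM => //; exact: measurable_abs_powR. Qed.

Let K x : \bar R := (\sum_(0 <= n <oo) (k n x)%:E)%E.

Let K0 x : (0 <= K x)%E.
Proof. by apply: nneseries_ge0 => n _ _; rewrite lee_fin. Qed.

Let mK : measurable_fun [set: T] K.
Proof.
apply: (ge0_emeasurable_sum (P := xpredT)) => [n x _ _|n _].
  by rewrite lee_fin.
exact/measurable_EFinP.
Qed.

Let intK : (\int[mu]_x K x < +oo)%E.
Proof.
have /andP[_ r1] := r01.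
rewrite integral_nneseries//; last 2 first.
- by move=> n; exact/measurable_EFinP.
- by move=> n x _; rewrite lee_fin.
apply: (@le_lt_trans _ _ (C / (1 - r))%:E); last exact: ltry.
apply: lime_le; first by apply: is_cvg_nneseries => n _ _; apply: integral_ge0 => x _; rewrite lee_fin.
apply: nearW => N; apply: (@le_trans _ _ (\sum_(0 <= n < N) (C * r ^+ n)%:E)%E).
  apply: lee_sum => n _; rewrite -EFin_Rint; last exact: (intgZ _ (gi n)).
  rewrite lee_fin RintegralZl//; last exact: gi.
  rewrite mulrC ler_pdivrMr ?exprn_gt0// -mulrA -exprD addnn -mul2n exprM sqr_sqrtr.
    exact: gC.
  by have /andP[/ltW] := rho01.
by rewrite sumEFin lee_fin geometric_le.
Qed.


Let iK : mu.-integrable [set: T] K.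
Proof.
apply/integrableP; split => //; rewrite (eq_integral K)// => x _.
by rewrite gee0_abs.
Qed.

Let E : set T := [set x | (K x < +oo)%E].

Let mE : measurable E.
Proof. by rewrite -[E]setTI; exact: emeasurable_fun_infty_o. Qed.

Let kap x : R := fine (K x).

Let kap0 x : 0 <= kap x. Proof. exact: fine_ge0. Qed.

Let ikap : intg mu kap.
Proof.
have mk' : measurable_fun [set: T] kap by exact: (measurableT_comp (fine_measurable measurableT)).
apply/integrableP; split; first exact/measurable_EFinP.
apply: le_lt_trans intK; apply: ge0_le_integral => //.
- by apply/measurable_EFinP; exact: measurableT_comp.
- move=> x _ /=; rewrite /kap ger0_norm ?fine_ge0//.
  by have := K0 x; case: (K x) => [s||]//= _; exact: leey.
Qed.

Let tau : R := r `^ q^-1.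

Let q0 : 0 < q. Proof. exact: lt_trans q1. Qed.

Let tau01 : 0 < tau < 1.
Proof.
have /andP[_ r1] := r01; rewrite powR_gt0//=.
have := @gt0_ltr_powR R q^-1; rewrite invr_gt0 => /(_ q0 r 1); rewrite powR1.
by apply; rewrite ?nnegrE ?ler01// ltW.
Qed.

(** Cutting off to the set where [K] is finite makes the series converge at every point, with a
    bound at every point. *)
Let h n x : R := \1_E x * g n x.

Let mh n : measurable_fun [set: T] (h n).
Proof. by apply: measurable_funM => //; exact: measurable_indic. Qed.

Let h_le n x : `|h n x| <= kap x `^ q^-1 * tau ^+ n.
Proof.
rewrite /h indicE; have [Ex|nEx] := pselect (E x); last first.
  by rewrite memNset// mul0r normr0 mulr_ge0 ?powR_ge0// exprn_ge0// powR_ge0.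
rewrite mem_set// mul1r.
have kK : k n x <= kap x.
  rewrite -lee_fin fineK ?ge0_fin_numE//.
  apply: le_trans (@nneseries_lim_ge R (fun n => (k n x)%:E) xpredT 0%N n.+1 _) => //.
    rewrite big_nat_recr//= leeDr// sume_ge0// => i _.
    by rewrite lee_fin.
  by move=> i _ _; rewrite lee_fin.
have gk : `|g n x| `^ q <= kap x * r ^+ n.
  by move: kK; rewrite /k mulrC ler_pdivrMr ?exprn_gt0.
rewrite -[leLHS]powRr1// -(divff (lt0r_neq0 q0)) powRrM.
apply: le_trans (powR_le _ _ gk) _; rewrite ?invr_ge0 ?powR_ge0 ?(ltW q0)//.
rewrite powRM ?exprn_ge0 ?(ltW r0)// ler_wpM2l ?powR_ge0//.
by rewrite -(powR_mulrn n (powR_ge0 r q^-1)) -(powR_mulrn n (ltW r0)) -[leLHS]powRrM -[leRHS]powRrM mulrC.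
Qed.

Let D x : R := kap x `^ q^-1 / (1 - tau).

Let sum_le N x : `|\sum_(0 <= n < N) h n x| <= D x.
Proof.
apply: le_trans (ler_norm_sum _ _ _) _.
apply: le_trans (geometric_le N (powR_ge0 _ _) tau01).
by apply: ler_sum => n _; exact: h_le.
Qed.

Let G x : R := limn (fun N => \sum_(0 <= n < N) h n x).

Let cvgG x : (fun N => \sum_(0 <= n < N) h n x) @ \oo --> G x.
Proof.
have /andP[t0 t1] := tau01.
suff : cvgn (series (fun n => h n x)) by [].
apply: normed_cvg; apply: series_le_cvg (@is_cvg_geometric_series R (kap x `^ q^-1) tau _).
- by move=> n; exact: normr_ge0.
- by move=> n; rewrite mulr_ge0 ?powR_ge0// exprn_ge0// ltW.
- by move=> n; exact: h_le.
- by rewrite ger0_norm// ltW.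
Qed.

Let G_le x : `|G x| <= D x.
Proof.
have H : `|\sum_(0 <= n < N) h n x| @[N --> \oo] --> `|G x| by apply: cvg_norm; exact: cvgG.
apply: (ler_cvg_to H (cvg_cst (D x))).
by apply: nearW => N; exact: sum_le.
Qed.

Let mG : measurable_fun [set: T] G.
Proof.
apply: (@measurable_fun_cvg _ _ _ setT (fun N x => \sum_(0 <= n < N) h n x)).
  by move=> N; apply: measurable_sum => n; exact: mh.
by move=> x _; exact: cvgG.
Qed.

(** Pointwise |g_n| is at most K^(1/q) tau^n where [K] is finite, so the sum is dominated by a
    multiple of K^(1/q), a function in L^q; dominated convergence then yields the pairings. *)
Lemma Lp_series : exists G, rLp mu q G /\ forall phi (B : R), intg mu phi ->
  (forall x, `|phi x| <= B) ->
  (fun N => \sum_(0 <= n < N) \int[mu]_x (g n x * phi x)) @ \oo --> \int[mu]_x (G x * phi x).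
Proof.
have /andP[t0 t1] := tau01.
have p0 : 0 < 1 - tau by rewrite subr_gt0.
exists G; split.
  split => //; apply: (intg_le _ _ (intgZ ((1 - tau)^-1 `^ q) ikap)).
    exact: measurable_abs_powR.
  move=> x; rewrite ger0_norm ?powR_ge0//.
  apply: le_trans (powR_le (ltW q0) (normr_ge0 _) (G_le x)) _.
  rewrite /D mulrC powRM ?powR_ge0 ?invr_ge0 ?(ltW p0)//.
  by rewrite -powRrM mulVf ?gt_eqF// powRr1.
move=> phi B phii phiB.
have gphi n : intg mu (fun x => g n x * phi x).
  exact: (rLp_mul_intg (ltW q1) (conj (mg n) (gi n)) phii phiB).
have hphi n : intg mu (fun x => h n x * phi x).
  apply: (intg_le _ _ (intg_norm (gphi n))).
    by apply: measurable_funM => //; exact: intg_measurable phii.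
  move=> x; rewrite /h -mulrA normrM ler_piMl// indicE.
  by case: (_ \in _); rewrite ?normr1 ?normr0.
rewrite (_ : (fun N => _) = fun N => \int[mu]_x ((\sum_(0 <= n < N) h n x) * phi x)).
  apply: (dct_Rint _ _ _ (intgZ (1 - tau)^-1 (intgD (intg_norm phii) (intgZ B ikap))) _).2.
  - move=> N; apply: measurable_funM; last exact: intg_measurable phii.
    by apply: measurable_sum => n; exact: mh.
  - by apply: measurable_funM => //; exact: intg_measurable phii.
  - by apply: aeW => x; apply: cvgM; [exact: cvgG|exact: cvg_cst].
  - move=> N x; rewrite normrM; apply: le_trans (ler_wpM2r (normr_ge0 _) (sum_le N x)) _.
    rewrite /D mulrAC mulrC ler_wpM2l ?invr_ge0 ?(ltW p0)//.
    have k1 : kap x `^ q^-1 <= 1 + kap x.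
      apply: le_trans (le_powR1 (ltW q1) (powR_ge0 _ _)) _.
      by rewrite -powRrM mulVf ?gt_eqF// powRr1.
    apply: le_trans (ler_wpM2r (normr_ge0 _) k1) _.
    by rewrite mulrDl mul1r lerD2l mulrC ler_wpM2r.
apply/funext => N; rewrite -[RHS]/(\int[mu]_x ((\sum_(0 <= n < N) h n x) * phi x)).
transitivity (\sum_(0 <= n < N) \int[mu]_x (h n x * phi x)).
  apply: eq_bigr => n _; apply: eq_ae_Rint.
  - exact: intg_measurable (gphi n).
  - exact: intg_measurable (hphi n).
  have := integrable_ae measurableT iK; apply: filterS => x /(_ I) Kf.
  rewrite /h indicE mem_set ?mul1r//.
  by rewrite /E/= ltey_eq Kf.
rewrite -Rint_sum; last by move=> n; exact: hphi.
by apply: eq_Rintegral => x _; rewrite mulr_suml.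
Qed.

End Lp_series.

(** * Convolution with dilated Schwartz kernels *)

Section convolution.
Context {R : realType} {d : nat}.
Local Notation Rd := 'rV[R]_d.
Local Notation intgd := (intg (leb R d)).

Let v (x : Rd) : R := (Ws x)^-1 ^+ (2 * d).

Let v0 x : 0 <= v x.
Proof. by rewrite exprn_ge0// invr_ge0 ltW// Ws_gt0. Qed.

Let v1 x : v x <= 1.
Proof. by rewrite exprn_ile1 ?invr_ge0 ?(ltW (Ws_gt0 _))// invf_le1 ?Ws_gt0// Ws_ge1. Qed.

Let V := \int[leb R d]_x v x.

Let V0 : 0 <= V. Proof. exact: Rint_ge0. Qed.

(** The weight dilated to scale 1/b: its mass [V] does not depend on b, its height is at most
    b^d. *)
Let w (b : R) (z : Rd) : R := b ^+ d * v (b *: z).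

Let w_itv b z : 0 < b -> 0 <= w b z <= b ^+ d.
Proof.
move=> b0; have bd : 0 <= b ^+ d by rewrite exprn_ge0// ltW.
by rewrite (mulr_ge0 bd (v0 _))/=; apply: ler_piMr.
Qed.

Let mv : measurable_fun [set: Rd] v.
Proof. exact: measurable_WsV. Qed.

Let measurable_scale (b : R) (h : Rd -> R) : measurable_fun [set: Rd] h ->
  measurable_fun [set: Rd] (fun x => h (b *: x)).
Proof.
move=> mh; have := measurableT_comp mh (measurable_affine b (0 : Rd)).
by congr measurable_fun; apply/funext => x /=; rewrite addr0.
Qed.

Let w_i b : 0 < b -> intgd (w b) /\ \int[leb R d]_z w b z = V.
Proof.
move=> b0; have bn : b != 0 by rewrite gt_eqF.
have i0 : intgd (fun z => v (b *: z)).
  by have := intg_affine 0 bn (@intg_WsV R d); congr intg; apply/funext => z; rewrite addr0.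
split; first exact: intgZ.
rewrite /V (Rint_affine 0 bn (@intg_WsV R d)) gtr0_norm// /w RintegralZl//.
by congr (_ * _); apply: eq_Rintegral => z _; rewrite addr0.
Qed.

Let w_y b x : 0 < b -> intgd (fun y => w b (x - y)) /\ \int[leb R d]_y w b (x - y) = V.
Proof.
move=> b0; have [i0 <-] := w_i b0; split; first exact: intg_reflect i0.
exact: Rint_reflect.
Qed.

Let w_x b y : 0 < b -> intgd (fun x => w b (x - y)) /\ \int[leb R d]_x w b (x - y) = V.
Proof.
move=> b0; have [i0 <-] := w_i b0; split; first exact: (intg_shift (- y) i0).
exact: (Rint_shift (- y) i0).
Qed.

(* Tangent-line form of Jensen's inequality: [t <= s^(1-l) t^l + s] *)
Lemma jensen_weight (l : R) (f u : Rd -> R) : 1 < l -> rLp (leb R d) l f -> intgd u ->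
  (forall x, 0 <= u x) -> intgd (fun x => `|f x| `^ l * u x) ->
  (\int[leb R d]_x (`|f x| * u x)) `^ l <=
    (1 + \int[leb R d]_x u x) `^ l * \int[leb R d]_x (`|f x| `^ l * u x).
Proof.
move=> l1 [mf fi] ui u0 fui; have l0 : 0 < l := lt_trans ltr01 l1.
set J := \int[leb R d]_x (`|f x| `^ l * u x); set W := Rintegral _ _ u.
have J0 : 0 <= J by apply: Rint_ge0 => x; rewrite mulr_ge0// powR_ge0.
have W0 : 0 <= W by exact: Rint_ge0.
have fu : intgd (fun x => `|f x| * u x).
  apply: (intg_le _ _ (intgD ui fui)).
    by apply: measurable_funM; [exact: measurableT_comp|exact: intg_measurable ui].
  move=> x; rewrite normrM normr_id (ger0_norm (u0 x)).
  rewrite -[X in _ <= X + _]mul1r -mulrDl ler_wpM2r//.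
  exact: le_powR1 (ltW l1) _.
set I := Rintegral _ _ (fun x => `|f x| * u x).
have I0 : 0 <= I by apply: Rint_ge0 => x; rewrite mulr_ge0.
have tang (s t : R) : 0 < s -> 0 <= t -> t <= s `^ (1 - l) * t `^ l + s.
  move=> s0 t0; have [ts|/ltW st] := leP t s.
    by apply: le_trans ts _; rewrite lerDr mulr_ge0// powR_ge0.
  apply: (@le_trans _ _ (s `^ (1 - l) * t `^ l)); last by rewrite lerDl ltW.
  have -> : t `^ l = t `^ (l - 1) * t.
    by rewrite -(mulr_powRB1 t0 l0) mulrC.
  rewrite mulrA ler_peMl// -[leLHS](mulVf (lt0r_neq0 (powR_gt0 (l - 1) s0))).
  rewrite -powRN opprB ler_wpM2l ?powR_ge0// powR_le ?(ltW s0)//.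
  by rewrite subr_ge0 ltW.
have Is s : 0 < s -> I <= s `^ (1 - l) * J + s * W.
  move=> s0; rewrite -RintegralZl// -RintegralZl// -RintegralD//; try exact: intgZ.
  apply: Rint_le => //; first by apply: intgD; exact: intgZ.
  move=> x; rewrite [s `^ _ * _]mulrA -mulrDl ler_wpM2r//.
  exact: tang.
(* The bound [Is] is optimised in s: s tends to 0 when [J] vanishes, and s = J^(1/l) otherwise. *)
have [J1|J1] := ltP 0 J; last first.
  have J00 : J = 0 by apply/eqP; rewrite eq_le J1.
  have -> : I = 0; last by rewrite powR0 ?gt_eqF// mulr_ge0// powR_ge0.
  apply/eqP; rewrite eq_le I0 andbT; apply/ler_addgt0Pr => e e0; rewrite add0r.
  have e1 : 0 < e / (1 + W) by rewrite divr_gt0// ltr_wpDr.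
  apply: (le_trans (Is _ e1)); rewrite J00 mulr0 add0r.
  by rewrite mulrAC ler_pdivrMr ?ltr_wpDr// ler_pM2l// lerDr.
have s0 : 0 < J `^ l^-1 by rewrite powR_gt0.
have jp (z : R) : 0 < z -> (z `^ l^-1) `^ (1 - l) * z = z `^ l^-1.
  move=> z0; rewrite -powRrM -{2}[z](powRr1 (ltW z0)) -powRD; last by rewrite (gt_eqF z0) implybT.
  by congr (_ `^ _); field; rewrite gt_eqF.
have Ile : I <= (1 + W) * J `^ l^-1.
  by have := Is _ s0; rewrite (jp _ J1) mulrDl mul1r [W * _]mulrC.
apply: le_trans (powR_le (ltW l0) I0 Ile) _.
by rewrite powRM ?addr_ge0 ?powR_ge0// -powRrM mulVf ?gt_eqF// powRr1.
Qed.

(* convolution of [f] with the dilate [b^d k(- b x)] *)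
Definition cv (k : Rd -> R) (b : R) (f : Rd -> R) (y : Rd) : R :=
  \int[leb R d]_x (f x * (b ^+ d * k (b *: (x - y)))).

(** [J] is the average of |f|^l at scale 1/b. Jensen's inequality bounds the convolution by it, its
    integral is bounded independently of b, and its height grows like b^d; interpolating between
    mass and height later produces powers of b. *)
Lemma cv_bound (l : R) (k f : Rd -> R) : 1 < l -> schw k -> rLp (leb R d) l f ->
  exists2 C : R, 0 <= C & forall b : R, 0 < b ->
    [/\ measurable_fun [set: Rd] (cv k b f),
      exists J : Rd -> R, [/\ intgd J, forall y, 0 <= J y <= C * b ^+ d,
        \int[leb R d]_y J y <= C & forall y, `|cv k b f y| `^ l <= C * J y] &
      forall phi, schw phi ->
        \int[leb R d]_x (f x * \int[leb R d]_y (b ^+ d * k (b *: (x - y)) * phi y)) =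
        \int[leb R d]_y (cv k b f y * phi y)].
Proof.
move=> l1 Hk Hf; have [mf fi] := Hf; have l0 : 0 < l := lt_trans ltr01 l1.
have [c [c0 kc]] := Rap_bd Hk (2 * d)%N.
have kv x : `|k x| <= c * v x.
  have := kc tt x I; rewrite mulr1 => h.
  by rewrite /v exprVn ler_pdivlMr// exprn_gt0// Ws_gt0.
have mk := schw_measurable Hk.
pose M := \int[leb R d]_x (`|f x| `^ l).
have M0 : 0 <= M by apply: Rint_ge0 => x; exact: powR_ge0.
pose C1 := c `^ l * (1 + V) `^ l.
have C10 : 0 <= C1 by rewrite mulr_ge0// powR_ge0.
(* One constant for three bounds: C1 in Jensen's inequality, M for the height of [J], M V for its
   integral. *)
exists (C1 + M + M * V); first by rewrite !addr_ge0// mulr_ge0.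
move=> b b0; have bd0 : 0 <= b ^+ d by rewrite exprn_ge0// ltW.
pose J y := \int[leb R d]_x (`|f x| `^ l * w b (x - y)).
have Ji y : intgd (fun x => `|f x| `^ l * w b (x - y)).
  apply: (intg_le _ _ (intgZ (b ^+ d) fi)).
    apply: measurable_funM; first exact: measurable_abs_powR.
    exact: intg_measurable (w_x y b0).1.
  move=> x; have /andP[w0 w1] := w_itv (x - y) b0.
  by rewrite normrM mulrC (ger0_norm w0) ger0_norm ?powR_ge0// ler_wpM2r// powR_ge0.
have J0 y : 0 <= J y.
  by apply: Rint_ge0 => x; rewrite mulr_ge0 ?powR_ge0//; have /andP[] := w_itv (x - y) b0.
have mdiff : measurable_fun [set: Rd * Rd] (fun z : Rd * Rd => z.1 - z.2).
  apply: measurable_fun_rV => i.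
  rewrite (_ : _ \o _ = fun z : Rd * Rd => z.1 ord0 i - z.2 ord0 i); last first.
    by apply/funext => z; rewrite /rV_coord/= !mxE.
  by apply: measurable_funB; exact: measurable_coord_comp.
have mwd (h : Rd -> R) : measurable_fun [set: Rd] h ->
    measurable_fun [set: Rd * Rd] (fun z : Rd * Rd => b ^+ d * h (b *: (z.1 - z.2))).
  move=> mh; apply: measurable_funM => //.
  exact: (measurableT_comp (measurable_scale b mh) mdiff).
have [||||_ _ _ JI [E1 E2]] := @Rfubini _ _ _ _ R (leb R d) (leb R d)
  (fun z => `|f z.1| `^ l * w b (z.1 - z.2)) (fun x => `|f x| `^ l * V).
- apply: measurable_funM; last exact: mwd.
  exact: (measurableT_comp (measurable_abs_powR l mf) measurable_fst).
- by move=> x; exact: (intgZ (`|f x| `^ l) (w_y x b0).1).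
- by under eq_fun do rewrite mulrC; exact: intgZ.
- move=> x /=; rewrite -(w_y x b0).2 -RintegralZl//; last exact: (w_y x b0).1.
  rewrite le_eqVlt; apply/orP; left; apply/eqP; apply: eq_Rintegral => y _.
  by rewrite ger0_norm// mulr_ge0 ?powR_ge0//; have /andP[] := w_itv (x - y) b0.
have JE : \int[leb R d]_y J y = M * V.
  rewrite E2 -E1 /M mulrC -RintegralZl//; apply: eq_Rintegral => x _.
  by rewrite /= RintegralZl ?(w_y x b0).2 1?mulrC//; exact: (w_y x b0).1.
have JM y : J y <= b ^+ d * M.
  rewrite /M -RintegralZl//; apply: Rint_le => //; first exact: intgZ.
  move=> x; have /andP[w0 w1] := w_itv (x - y) b0.
  by rewrite mulrC ler_wpM2r// powR_ge0.
have cvi y : intgd (fun x => f x * (b ^+ d * k (b *: (x - y)))).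
  apply: (intg_le _ _ (intgZ c (intgD (w_x y b0).1 (Ji y)))).
    apply: measurable_funM => //; apply: measurable_funM => //.
    have := measurableT_comp (measurable_scale b mk) (measurable_affine 1 (- y)).
    by congr measurable_fun; apply/funext => x /=; rewrite scale1r.
  move=> x; rewrite !normrM (ger0_norm bd0).
  apply: (@le_trans _ _ (`|f x| * (c * w b (x - y)))).
    by rewrite ler_wpM2l// /w mulrCA ler_wpM2l.
  rewrite mulrCA ler_wpM2l// -[X in _ <= X + _]mul1r -mulrDl ler_wpM2r//.
    by have /andP[] := w_itv (x - y) b0.
  exact: le_powR1 (ltW l1) _.
have fwi y : intgd (fun x => `|f x| * w b (x - y)).
  apply: (@rLp_mul_intg _ _ _ _ l (b ^+ d) (fun x => `|f x|)) => //.
  - exact: ltW.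
  - by apply: rLp_le Hf => //; [exact: ltW|exact: measurableT_comp|move=> x; rewrite normr_id].
  - exact: (w_x y b0).1.
  - by move=> x; have /andP[w0 w1] := w_itv (x - y) b0; rewrite ger0_norm.
pose S y := \int[leb R d]_x (`|f x| * w b (x - y)).
have S0 y : 0 <= S y.
  by apply: Rint_ge0 => x; rewrite mulr_ge0//; have /andP[] := w_itv (x - y) b0.
have SJ y : S y `^ l <= (1 + V) `^ l * J y.
  rewrite -(w_x y b0).2; apply: jensen_weight => //.
  - exact: (w_x y b0).1.
  - by move=> x; have /andP[] := w_itv (x - y) b0.
have ptle y x : `|f x * (b ^+ d * k (b *: (x - y)))| <= c * (`|f x| * w b (x - y)).
  by rewrite !normrM (ger0_norm bd0) [leRHS]mulrCA ler_wpM2l// /w [leRHS]mulrCA ler_wpM2l.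
have cvle y : `|cv k b f y| <= c * S y.
  rewrite -RintegralZl//; last exact: fwi.
  exact: Rint_norm_le (cvi y) (intgZ c (fwi y)) (ptle y).
have cvJ y : `|cv k b f y| `^ l <= C1 * J y.
  apply: le_trans (powR_le (ltW l0) (normr_ge0 _) (cvle y)) _.
  by rewrite powRM// -mulrA ler_wpM2l ?powR_ge0.
pose B := 1 + (1 + V) `^ l * (b ^+ d * M).
have SB y : S y <= B.
  apply: le_trans (le_powR1 (ltW l1) (S0 y)) _; rewrite lerD2l.
  by apply: le_trans (SJ y) _; rewrite ler_wpM2l// powR_ge0.
have fub phi : schw phi -> intgd (fun y => phi y * cv k b f y) /\
    \int[leb R d]_x (f x * \int[leb R d]_y (b ^+ d * k (b *: (x - y)) * phi y)) =
        \int[leb R d]_y (cv k b f y * phi y).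
  move=> Hphi; have phii := schw_intg Hphi; have [K [K0 phiK]] := Rap_bd Hphi 0%N.
  have [||||_ I2 _ _ [F1 F2]] := @Rfubini _ _ _ _ R (leb R d) (leb R d)
    (fun z => phi z.1 * (f z.2 * (b ^+ d * k (b *: (z.2 - z.1))))) (fun y => c * B * `|phi y|).
  - apply: measurable_funM; first exact: (measurableT_comp (schw_measurable Hphi) measurable_fst).
    apply: measurable_funM; first exact: (measurableT_comp mf measurable_snd).
    have msw : measurable_fun [set: Rd * Rd] (fun z : Rd * Rd => (z.2, z.1)).
      by apply: measurable_fun_pair; [exact: measurable_snd|exact: measurable_fst].
    exact: (measurableT_comp (mwd _ mk) msw).
  - by move=> y; exact: (intgZ (phi y) (cvi y)).
  - exact: intgZ (intg_norm phii).
  - move=> y /=; apply: (@le_trans _ _ (`|phi y| * (c * S y))); last first.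
      by rewrite mulrC ler_wpM2r// ler_wpM2l.
    rewrite /S -RintegralZl//; last exact: fwi.
    rewrite -RintegralZl//; last exact: (intgZ c (fwi y)).
    apply: Rint_le.
    - by apply: intg_norm; exact: (intgZ (phi y) (cvi y)).
    - exact: (intgZ _ (intgZ c (fwi y))).
    - by move=> x; rewrite normrM ler_wpM2l.
  split.
    move: I2; congr intg; apply/funext => y /=; rewrite RintegralZl//; exact: cvi.
  transitivity (\int[leb R d]_x \int[leb R d]_y (phi y * (f x * (b ^+ d * k (b *: (x - y)))))).
    apply: eq_Rintegral => x _; rewrite -RintegralZl//.
      by apply: eq_Rintegral => y _; ring.
    apply: (intg_le _ _ (intgZ (c * K) (w_y x b0).1)).
      apply: measurable_funM; last exact: schw_measurable.
      exact: (measurableT_comp (mwd _ mk) (pair1_measurable x)).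
    move=> y; rewrite !normrM (ger0_norm bd0).
    have := phiK tt y I; rewrite expr0 !mulr1 => pK.
    apply: (@le_trans _ _ (b ^+ d * (c * v (b *: (x - y))) * K)).
      by rewrite ler_pM// ?mulr_ge0// ler_wpM2l.
    by rewrite le_eqVlt; apply/orP; left; apply/eqP; rewrite /w; ring.
  rewrite F2 -F1; apply: eq_Rintegral => y _ /=; rewrite RintegralZl 1?mulrC//.
  exact: cvi.
have mTV : measurable_fun [set: Rd] (fun x : Rd => (Theta x)^-1).
  have [G [TG _]] := SF_hasgrad (@Theta_SF R d).
  apply: continuous_measurable_rV => x.
  exact: (cvgV (lt0r_neq0 (Theta_gt0 x)) (hasgrad_continuous (TG tt x))).
split.
(* Fubini gives measurability of the convolution only after multiplication by a Schwartz function;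
   [Theta] is one without zeros and is divided out. *)
- have := measurable_funM mTV (intg_measurable (fub _ (@Theta_SF R d)).1).
  congr measurable_fun; apply/funext => y /=.
  by rewrite mulrA mulVf ?mul1r// gt_eqF// Theta_gt0.
- exists J; split => //.
  + move=> y; rewrite J0 /=; apply: le_trans (JM y) _; rewrite mulrC ler_wpM2r//.
    by rewrite addrAC lerDr addr_ge0// mulr_ge0.
  + by rewrite JE lerDr addr_ge0.
  + move=> y; apply: le_trans (cvJ y) _; rewrite ler_wpM2r// -addrA lerDl.
    by rewrite addr_ge0// mulr_ge0.
- by move=> phi /fub[].
Qed.

End convolution.

Lemma rLp_dom d (T : measurableType d) (R : realType) (mu : {measure set T -> \bar R})
    (l : R) (f g : T -> R) : measurable_fun [set: T] f -> intg mu g ->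
  (forall x, `|f x| `^ l <= g x) -> rLp mu l f.
Proof.
move=> mf gi fg; split => //; apply: intg_le _ _ gi; first exact: measurable_abs_powR.
by move=> x; rewrite ger0_norm ?powR_ge0.
Qed.

(** * Frequency pieces and their summation *)

Section interpolation.
Context {R : realType} {d : nat}.
Local Notation Rd := 'rV[R]_d.
Local Notation fam T := (T -> 'rV[R]_d -> R).
Local Notation intgd := (intg (leb R d)).
Hypothesis d_gt0 : (0 < d)%N.

Lemma chiN (x : Rd) : chi (- x) = chi x.
Proof. by rewrite /chi scalerN !ThetaN. Qed.

Lemma flat_chi : flat (@chi R d).
Proof. by split; [exact: chi_flat|rewrite /chi scaler0 subrr]. Qed.

Lemma schw_Mult (f : Rd -> R) : schw f -> Mult f.
Proof.
move=> Hf n; apply: Cn_sub (Hf n); first by [].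
move=> F HF; have [C [C0 FC]] := HF 0%N; exists 0%N, C; split => // t x _.
by have := FC t x I; rewrite !expr0 !mulr1.
Qed.

Lemma MultM (m m' : Rd -> R) : Mult m -> Mult m' -> Mult (fun x => m x * m' x).
Proof.
move=> H H'; have := ModM (@Wp_ge1 R d) (fun=> ler01) (fun=> ler01) H H'.
by under [X in Mod _ _ X]eq_fun do rewrite mul1r.
Qed.

Lemma Mult_Theta (b : R) : b != 0 -> Mult (fun x : Rd => Theta (b *: x)).
Proof. by move=> b0; exact: schw_Mult (SF_dilate b0 (@Theta_SF R d)). Qed.

Lemma Mult_chi (b : R) : b != 0 -> Mult (fun x : Rd => chi (b *: x)).
Proof. by move=> b0; exact: schw_Mult (SF_dilate b0 (flat_schw flat_chi)). Qed.

Definition kmul (sigma : R) (xi : Rd) : R := enorm xi `^ sigma * chi xi.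

Lemma flat_kmul sigma : flat (kmul sigma).
Proof. exact: flatM (Mult_powR sigma) flat_chi. Qed.

(** The convolution kernel of the frequency piece at scale 1; the piece at frequency b uses its
    dilate. *)
Definition ker (sigma : R) (x : Rd) : R := (2 * pi) ^- d * Ht (kmul sigma) x.

Lemma schw_ker sigma : schw (ker sigma).
Proof. exact/schwZ/schw_Ht/flat_schw/flat_kmul. Qed.

Lemma kmul_dilate (b sigma : R) xi : 0 < b ->
  enorm xi `^ sigma * chi (b^-1 *: xi) = b `^ sigma * kmul sigma (b^-1 *: xi).
Proof.
move=> b0; rewrite /kmul enormZ gtr0_norm ?invr_gt0// mulrA -powRM ?invr_ge0 ?enorm_ge0 ?(ltW b0)//.
  by rewrite mulrA divff ?gt_eqF// mul1r.
by rewrite mulr_ge0 ?enorm_ge0// invr_ge0 ltW.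
Qed.

Lemma Tm_kernel (b sigma : R) (phi : Rd -> R) x : 0 < b -> schw phi ->
  Tm (fun xi => enorm xi `^ sigma * chi (b^-1 *: xi)) phi x =
  b `^ sigma * \int[leb R d]_y (b ^+ d * ker sigma (b *: (x - y)) * phi y).
Proof.
move=> b0 Hphi; have bi0 : b^-1 != 0 by rewrite invr_eq0 gt_eqF.
have K0 := schw_intg (flat_schw (flat_kmul sigma)).
have mi : intgd (fun xi => enorm xi `^ sigma * chi (b^-1 *: xi)).
  have := intgZ (b `^ sigma) (intg_affine 0 bi0 K0); congr intg; apply/funext => xi.
  by rewrite addr0 kmul_dilate.
rewrite Tm_conv//; last by move=> xi; rewrite enormN scalerN chiN.
have HtE z : Ht (fun xi => enorm xi `^ sigma * chi (b^-1 *: xi)) z =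
    b `^ sigma * (b ^+ d * Ht (kmul sigma) (b *: z)).
  have b1 : b != 0 by rewrite gt_eqF.
  rewrite /Ht (Rint_affine 0 b1 (cas_intg z mi)) gtr0_norm// [RHS]mulrCA; congr (_ * _).
  rewrite -RintegralZl//; last exact: cas_intg.
  apply: eq_Rintegral => xi _; rewrite addr0 kmul_dilate// scalerA mulVf ?gt_eqF// scale1r.
  by rewrite dotpZl dotpZr mulrCA.
have Ki : intgd (fun y => b ^+ d * ker sigma (b *: (x - y)) * phi y).
  have [c [c0 kc]] := Rap_bd (schw_ker sigma) 0%N.
  apply: (intg_le _ _ (intgZ (b ^+ d * c) (intg_norm (schw_intg Hphi)))).
    apply: measurable_funM; last exact: schw_measurable.
    apply: measurable_funM => //.
    have := measurableT_comp (schw_measurable (schw_ker sigma)) (measurable_affine (- b) (b *: x)).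
    by congr measurable_fun; apply/funext => y /=; rewrite scalerBr scaleNr addrC.
  move=> y; rewrite normrM ler_wpM2r// normrM (ger0_norm (exprn_ge0 _ (ltW b0))).
  by rewrite ler_wpM2l ?exprn_ge0 ?(ltW b0)//; have := kc tt (b *: (x - y)) I; rewrite expr0 !mulr1.
have -> : \int[leb R d]_y (Ht (fun xi => enorm xi `^ sigma * chi (b^-1 *: xi)) (x - y) * phi y) =
    b `^ sigma * (2 * pi) ^+ d * \int[leb R d]_y (b ^+ d * ker sigma (b *: (x - y)) * phi y).
  rewrite -RintegralZl//; apply: eq_Rintegral => y _; rewrite HtE /ker.
  move: (lt0r_neq0 (@twopi_gt0 R d)); move: ((2 * pi) ^+ d) => c c0.
  by field; exact: c0.
by rewrite mulrA mulrCA mulVf ?mulr1// gt_eqF// twopi_gt0.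
Qed.

Lemma rtempD (U : (Rd -> R) -> R) (f g : Rd -> R) : rtemp U -> schw f -> schw g ->
  U (fun x => f x + g x) = U f + U g.
Proof.
move=> [UL _] Hf Hg; have := UL 1 f g Hf Hg; rewrite mul1r => <-.
by congr U; apply/funext => x; rewrite mul1r.
Qed.

Lemma rtemp_TmD (U : (Rd -> R) -> R) (m m' f : Rd -> R) : rtemp U -> Mult m -> Mult m' ->
  schw0 f -> U (Tm (fun xi => m xi + m' xi) f) = U (Tm m f) + U (Tm m' f).
Proof.
move=> HU Hm Hm' Hf; rewrite TmDm.
- by apply: rtempD => //; exact: (schw0_Tm _ Hf).1.
- exact/flat_schw/flatM/schw0_flat.
- exact/flat_schw/flatM/schw0_flat.
Qed.

(** The order sigma of the symbol is absorbed by the representative [F], and the remaining order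
    tau, localised at frequency b, is convolution with a dilated kernel of size b^tau. *)
Lemma rep_conv (U : (Rd -> R) -> R) (sigma tau l b : R) (F phi : Rd -> R) :
  1 < l -> rep sigma l U F -> 0 < b -> schw0 phi ->
  U (Tm (fun xi => enorm xi `^ (sigma + tau) * chi (b^-1 *: xi)) phi) =
  \int[leb R d]_y (b `^ tau * cv (ker tau) b F y * phi y).
Proof.
move=> l1 [FL FE] b0 Hphi.
have bi0 : b^-1 != 0 by rewrite invr_eq0 gt_eqF.
have Hm : Mult (fun xi : Rd => enorm xi `^ tau * chi (b^-1 *: xi)).
  by apply: MultM; [exact: Mult_powR|exact: Mult_chi].
have [C C0 /(_ b b0)[mc [J [Ji J0 _ cJ]] cE]] := cv_bound l1 (schw_ker tau) FL.
rewrite (@Tm_eq _ _ _ (fun xi => enorm xi `^ sigma * (enorm xi `^ tau * chi (b^-1 *: xi))))//; last first.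
  by move=> xi x0; rewrite mulrA -powRD// enorm_eq0 (negbTE x0) implybT.
rewrite -Tm_comp// FE; last exact: schw0_Tm.
have cL : rLp (leb R d) l (cv (ker tau) b F) := rLp_dom mc (intgZ C Ji) cJ.
have ci := rLp_schw_intg (ltW l1) cL Hphi.1.
transitivity (b `^ tau * \int[leb R d]_y (cv (ker tau) b F y * phi y)).
  rewrite -cE; last exact: Hphi.1.
  under eq_Rintegral do rewrite (Tm_kernel _ _ b0 Hphi.1) mulrCA.
  rewrite RintegralZl//.
  have := rLp_schw_intg (ltW l1) FL (schw0_Tm Hm Hphi).1.
  move=> /(intgZ (b `^ (- tau))); congr intg; apply/funext => x.
  rewrite (Tm_kernel _ _ b0 Hphi.1) [F x * _]mulrCA powRN mulKf//.
  by rewrite gt_eqF// powR_gt0.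
by rewrite -RintegralZl//; apply: eq_Rintegral => y _; rewrite mulrA.
Qed.


Lemma rep_conv_bound (U : (Rd -> R) -> R) (sigma tau l : R) (F : Rd -> R) :
  1 < l -> rep sigma l U F -> exists2 C : R, 0 <= C & forall b : R, 0 < b ->
  exists g J : Rd -> R, [/\ rLp (leb R d) l g,
    intgd J /\ \int[leb R d]_y J y <= C, forall y, 0 <= J y <= C * b ^+ d,
    forall y, `|g y| `^ l <= b `^ (tau * l) * (C * J y) &
    forall phi, schw0 phi ->
      U (Tm (fun xi => enorm xi `^ (sigma + tau) * chi (b^-1 *: xi)) phi) =
      \int[leb R d]_y (g y * phi y)].
Proof.
move=> l1 HF; have [C C0 H] := cv_bound l1 (schw_ker tau) HF.1.
exists C => // b b0; have [mc [J [Ji J0 JC cJ]] _] := H b b0.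
exists (fun y => b `^ tau * cv (ker tau) b F y), J; split.
- exact: rLpZ _ (rLp_dom mc (intgZ C Ji) cJ).
- by split.
- exact: J0.
- move=> y; rewrite normrM (ger0_norm (powR_ge0 _ _)) powRM ?powR_ge0// -powRrM.
  by rewrite ler_wpM2l ?powR_ge0.
- by move=> phi Hphi; exact: (rep_conv tau l1 HF b0 Hphi).
Qed.

Section piece.
Variables (p q r s1 s2 theta : R).
Hypotheses (p1 : 1 < p) (q1 : 1 < q) (theta01 : 0 < theta < 1).
Hypothesis scaling : 1 / q - (s1 - r) / d%:R
  = (1 - theta) * (1 / p - r / d%:R) + theta * (1 / 2 - (r + s2) / d%:R).
Hypothesis s1_small : s1 - 2 * r < theta * s2.
Hypothesis a_gt0 : 0 < s2 + d%:R / p - d%:R / 2.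
Variables (U : (Rd -> R) -> R) (f h : Rd -> R).
Hypotheses (HU : rtemp U) (Hf : rep r p U f) (Hh : rep (r + s2) 2 U h).

Let s0 := s1 - 2 * r.
Let p0 : 0 < p. Proof. exact: lt_trans p1. Qed.
Let q0 : 0 < q. Proof. exact: lt_trans q1. Qed.
Let dR : 0 < d%:R :> R. Proof. by rewrite ltr0n. Qed.
Let mult (b : R) (xi : Rd) : R := enorm xi `^ (s1 - r) * chi (b^-1 *: xi).

(* [|g|^q = (|g|^p)^alpha (|g|^2)^beta], where both powers of the frequency-[b]
   piece [g] are controlled by local averages of mass O(1) and height O(b^d) *)
Let piece_bound (alpha beta : R) : 0 < alpha -> 0 < beta -> p * alpha + 2 * beta = q ->
  1 <= alpha + beta -> exists2 C : R, 0 <= C & forall b : R, 0 < b -> exists g : Rd -> R,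
  [/\ measurable_fun [set: Rd] g, intgd (fun x => `|g x| `^ q),
      \int[leb R d]_x (`|g x| `^ q) <=
        C * b `^ (s0 * q - 2 * s2 * beta + d%:R * (alpha + beta - 1)) &
      forall phi, schw0 phi -> U (Tm (mult b) phi) = \int[leb R d]_x (g x * phi x)].
Proof.
move=> al0 be0 abq ab1.
have l2 : 1 < 2 :> R by rewrite ltr1n.
have [C1 C10 H1] := rep_conv_bound s0 p1 Hf.
have [C2 C20 H2] := rep_conv_bound (s0 - s2) l2 Hh.
pose C := C1 + C2; have C0 : 0 <= C by exact: addr_ge0.
exists (C `^ (alpha + beta) * C `^ (alpha + beta - 1) * C); first by rewrite !mulr_ge0 ?powR_ge0.
move=> b b0; have [g1 [J1 [L1 [J1i J1C] J10 cJ1 P1']]] := H1 b b0.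
have [g2 [J2 [L2 [J2i J2C] J20 cJ2 P2']]] := H2 b b0.
have e1 : s1 - r = r + s0 by rewrite /s0; ring.
have e2 : s1 - r = r + s2 + (s0 - s2) by rewrite /s0; ring.
have P1 phi : schw0 phi -> U (Tm (mult b) phi) = \int[leb R d]_y (g1 y * phi y).
  by move=> Hphi; rewrite /mult e1 P1'.
have P2 phi : schw0 phi -> U (Tm (mult b) phi) = \int[leb R d]_y (g2 y * phi y).
  by move=> Hphi; rewrite /mult e2 P2'.
(* The piece has been computed from D^r u in L^p and from D^(r+s2) u in L^2; both bounds are needed
   for the same function. *)
have g12 : {ae leb R d, forall y, g1 y = g2 y}.
  by apply: (rLp_pairing_ae d_gt0 p1 l2 L1 L2) => phi Hphi; rewrite -P1// P2.
pose E := [set y | g1 y = g2 y].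
have mE : measurable E.
  rewrite (_ : E = setT `&` (fun y => g1 y - g2 y) @^-1` [set 0]).
    apply: (measurable_funB L1.1 L2.1) => //.
  by apply/seteqP; split => y /=; [move=> ->; rewrite subrr|move=> [_ /eqP]; rewrite subr_eq0 => /eqP].
(* On [E] both bounds hold at every point, and elsewhere [g] is 0. *)
pose g y := \1_E y * g1 y.
have mg : measurable_fun [set: Rd] g.
  by apply: measurable_funM; [exact: measurable_indic|exact: L1.1].
pose e := s0 * q - 2 * s2 * beta + d%:R * (alpha + beta - 1).
pose J y := J1 y + J2 y.
have J0 y : 0 <= J y <= C * b ^+ d.
  have /andP[a1 a2] := J10 y; have /andP[a3 a4] := J20 y.
  by rewrite addr_ge0//= mulrDl lerD.
have gJ y : `|g y| `^ q <= C `^ (alpha + beta) * C `^ (alpha + beta - 1) * b `^ e * J y.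
  have /andP[Jy0 JyC] := J0 y.
  have rhs0 : 0 <= C `^ (alpha + beta) * C `^ (alpha + beta - 1) * b `^ e * J y.
    by rewrite !mulr_ge0 ?powR_ge0.
  rewrite /g indicE; have [Ey|nEy] := pselect (E y); last first.
    by rewrite memNset// mul0r normr0 powR0// gt_eqF.
  rewrite mem_set// mul1r.
  have G1 : `|g1 y| `^ p <= b `^ (s0 * p) * (C * J y).
    apply: (le_trans (cJ1 y)); rewrite ler_wpM2l ?powR_ge0// ler_pM//.
    - by have /andP[] := J10 y.
    - by rewrite lerDl.
    - by rewrite lerDl; have /andP[] := J20 y.
  have G2 : `|g1 y| `^ 2 <= b `^ ((s0 - s2) * 2) * (C * J y).
    rewrite Ey; apply: (le_trans (cJ2 y)); rewrite ler_wpM2l ?powR_ge0// ler_pM//.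
    - by have /andP[] := J20 y.
    - by rewrite lerDr.
    - by rewrite lerDr; have /andP[] := J10 y.
  have [g0|g0] := eqVneq (g1 y) 0; first by rewrite g0 normr0 powR0 ?gt_eqF.
  have CJ0 : 0 <= C * J y by rewrite mulr_ge0.
  rewrite -abq [leLHS]powRD; last by rewrite normr_eq0 (negbTE g0) implybT.
  rewrite !powRrM; apply: (@le_trans _ _ ((b `^ (s0 * p) * (C * J y)) `^ alpha *
      (b `^ ((s0 - s2) * 2) * (C * J y)) `^ beta)).
    by apply: ler_pM; rewrite ?powR_ge0//; apply: powR_le => //; exact: ltW.
  rewrite !(powRM _ (powR_ge0 _ _) CJ0) -!powRrM mulrACA.
  have bb : b `^ (s0 * p * alpha) * b `^ ((s0 - s2) * 2 * beta) =
      b `^ (s0 * p * alpha + (s0 - s2) * 2 * beta).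
    by rewrite powRD// (gt_eqF b0) implybT.
  rewrite bb; have CJab : (C * J y) `^ alpha * (C * J y) `^ beta = C `^ (alpha + beta) * J y `^ (alpha + beta).
    rewrite -powRD; last by rewrite gt_eqF ?addr_gt0.
    by rewrite powRM.
  (* The height C b^d of [J] pays for the surplus power alpha + beta - 1, and one factor [J] is kept
     for its mass. *)
  have Jab : J y `^ (alpha + beta) <= C `^ (alpha + beta - 1) * b `^ (d%:R * (alpha + beta - 1)) * J y.
    rewrite -mulr_powRB1//; last exact: addr_gt0.
    rewrite mulrC ler_wpM2r// (powRrM b) -powRM ?powR_ge0//.
    by rewrite powR_le ?subr_ge0// powR_mulrn// ltW.
  rewrite CJab [leRHS](_ : _ = b `^ (s0 * p * alpha + (s0 - s2) * 2 * beta) * (C `^ (alpha + beta) *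
      (C `^ (alpha + beta - 1) * b `^ (d%:R * (alpha + beta - 1)) * J y))).
    by rewrite ler_wpM2l ?powR_ge0// ler_wpM2l ?powR_ge0.
  rewrite (_ : e = (s0 * p * alpha + (s0 - s2) * 2 * beta) + d%:R * (alpha + beta - 1)).
    have -> : forall x y, b `^ (x + y) = b `^ x * b `^ y.
      by move=> x z; rewrite powRD// (gt_eqF b0) implybT.
    by ring.
  by rewrite /e -abq; ring.
have Ji : intgd J := intgD J1i J2i.
have gi : intgd (fun x => `|g x| `^ q).
  apply: (intg_le _ _ (intgZ _ Ji)); first exact: measurable_abs_powR.
  by move=> y; rewrite ger0_norm ?powR_ge0//; exact: gJ.
exists g; split => //.
- apply: (le_trans (Rint_le gi (intgZ _ Ji) gJ)).
  rewrite RintegralZl// -/e [leRHS]mulrAC ler_wpM2l//.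
  + by rewrite !mulr_ge0 ?powR_ge0.
  + by rewrite RintegralD// lerD.
- move=> phi Hphi; rewrite P1//; apply: eq_ae_Rint.
  + by apply: measurable_funM; [exact: L1.1|exact: schw_measurable Hphi.1].
  + by apply: measurable_funM => //; exact: schw_measurable Hphi.1.
  + by apply: filterS g12 => y gy; rewrite /g indicE mem_set// mul1r.
Qed.

Let pow2 (n : nat) : R := 2 ^+ n.
Let pow2_gt0 n : 0 < pow2 n. Proof. exact: exprn_gt0. Qed.

(** The pieces at frequencies 2^n, and those at 2^-(n+1), have geometrically decaying L^q integrals,
    so that [Lp_series] sums each half; telescoping identifies the total with D^(s1-r) u. *)
Lemma rep_interp : exists g, rep (s1 - r) q U g.
Proof.
have /andP[t0 t1] := theta01.
pose a := s2 + d%:R / p - d%:R / 2.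
(* The exponents of the scale-invariant inequality, for which [scal0] makes the power of b
   vanish. *)
pose al0 := (1 - theta) * q / p; pose be0 := theta * q / 2.
have al0_gt0 : 0 < al0 by rewrite divr_gt0// mulr_gt0// subr_gt0.
have be0_gt0 : 0 < be0 by rewrite divr_gt0// mulr_gt0.
have scal0 : s0 * q - 2 * s2 * be0 + d%:R * (al0 + be0 - 1) = 0.
  have dn : d%:R != 0 :> R by rewrite gt_eqF.
  have : d%:R * q * (1 / q - (s1 - r) / d%:R) =
    d%:R * q * ((1 - theta) * (1 / p - r / d%:R) + theta * (1 / 2 - (r + s2) / d%:R)).
    by rewrite scaling.
  have -> : d%:R * q * (1 / q - (s1 - r) / d%:R) = d%:R - q * (s1 - r).
    by field; rewrite dn gt_eqF.
  have -> : d%:R * q * ((1 - theta) * (1 / p - r / d%:R) + theta * (1 / 2 - (r + s2) / d%:R)) =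
     d%:R * (al0 + be0) - q * (1 - theta) * r - q * theta * (r + s2).
    by rewrite /al0 /be0; field; rewrite dn gt_eqF.
  by rewrite /s0 /be0; lra.
(* By [scal0], d (al0 + be0 - 1) equals q (theta s2 - (s1 - 2r)). *)
have ab_gt1 : 1 < al0 + be0.
  have : 0 < q * (theta * s2 - s0) by rewrite mulr_gt0// subr_gt0.
  have -> : q * (theta * s2 - s0) = d%:R * (al0 + be0 - 1).
    by move: scal0; rewrite /be0; lra.
  by rewrite pmulr_rgt0// subr_gt0.
(* The three bounds keep beta positive, alpha positive and alpha + beta at least 1 after a
   perturbation of size [dl]; the last one uses |1 - 2/p| <= 1. *)
pose dl := Num.min (be0 / 2) (Num.min (p * al0 / 4) (al0 + be0 - 1)).
have dl0 : 0 < dl.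
  rewrite !lt_min; apply/and3P; split; last by rewrite subr_gt0.
  - exact: divr_gt0.
  - by rewrite divr_gt0// mulr_gt0.
have dl1 : dl <= be0 / 2 by rewrite ge_min lexx.
have dl2 : dl <= p * al0 / 4 by rewrite !ge_min lexx orbT.
have dl3 : dl <= al0 + be0 - 1 by rewrite !ge_min lexx !orbT.
(* Passing to (al0 - 2e/p, be0 + e) preserves p alpha + 2 beta = q and changes the vanishing power
   of b into -2 a e. The choice e = dl serves high frequencies, e = -dl low ones. *)
have gen (e : R) : `|e| <= dl -> exists2 C : R, 0 <= C & forall b : R, 0 < b -> exists g : Rd -> R,
  [/\ measurable_fun [set: Rd] g, intgd (fun x => `|g x| `^ q),
      \int[leb R d]_x (`|g x| `^ q) <= C * b `^ (- 2 * a * e) &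
      forall phi, schw0 phi -> U (Tm (mult b) phi) = \int[leb R d]_x (g x * phi x)].
  move=> edl; have /ler_normlP[e1 e2] := edl.
  have -> : - 2 * a * e = s0 * q - 2 * s2 * (be0 + e) + d%:R * ((al0 - 2 * e / p) + (be0 + e) - 1).
    transitivity (- 2 * a * e + (s0 * q - 2 * s2 * be0 + d%:R * (al0 + be0 - 1))).
      by rewrite scal0 addr0.
    by rewrite /a; field; rewrite gt_eqF.
  have ep : `|2 * e / p| <= 2 * dl / p.
    by rewrite !normrM normfV (gtr0_norm p0) normr_nat ler_pM2r ?invr_gt0// ler_pM2l.
  apply: piece_bound.
  - rewrite subr_gt0; apply: (le_lt_trans (ler_norm _)); apply: (le_lt_trans ep).
    rewrite ltr_pdivrMr// mulrC; apply: (@le_lt_trans _ _ (p * al0 / 2)); first by lra.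
    have : 0 < p * al0 by rewrite mulr_gt0.
    by rewrite mulrC; lra.
  - by lra.
  - rewrite mulrBr [p * (_ / p)]mulrC divfK ?gt_eqF// /al0 /be0.
    rewrite [p * (_ / p)]mulrC divfK ?gt_eqF//; lra.
  - have : `|e - 2 * e / p| <= dl.
      rewrite (_ : e - 2 * e / p = e * (1 - 2 / p)); last by field; rewrite gt_eqF.
      rewrite normrM (le_trans _ edl)// ler_piMr// ler_norml.
      have : 2 / p < 2 by rewrite ltr_pdivrMr// ltr_pMr.
      have : 0 < 2 / p by rewrite divr_gt0.
      by lra.
    by move=> /ler_normlP[? ?]; lra.
have [Ch Ch0 Hhigh] := gen dl (eq_ind_r (fun x => is_true (x <= dl)) (lexx dl) (gtr0_norm dl0)).
have [Cl Cl0 Hlow] := gen (- dl) (eq_ind_r (fun x => is_true (x <= dl)) (lexx dl)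
  (etrans (normrN dl) (gtr0_norm dl0))).

pose rho := 2 `^ (- 2 * a * dl).
have rho0 : 0 < rho by rewrite powR_gt0.
have a0 : 0 < a by [].
have rho1 : rho < 1.
  rewrite /rho !mulNr powRN invf_lt1 ?powR_gt0//.
  have adl : 0 < 2 * a * dl by rewrite !mulr_gt0.
  have := @gt0_ltr_powR R _ adl 1 2; rewrite powR1.
  by apply; rewrite ?nnegrE ?ltr1n ?ler01.
have rho01 : 0 < rho < 1 by rewrite rho0.
have pow2E n x : pow2 n `^ x = (2 `^ x) ^+ n.
  by rewrite /pow2 -powR_mulrn// -powRrM mulrC powRrM powR_mulrn// powR_ge0.
have Hh' n : exists g : Rd -> R, [/\ measurable_fun [set: Rd] g,
    intgd (fun x => `|g x| `^ q), \int[leb R d]_x (`|g x| `^ q) <= Ch * rho ^+ n &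
    forall phi, schw0 phi -> U (Tm (mult (pow2 n)) phi) = \int[leb R d]_x (g x * phi x)].
  have [g [g1 g2 g3 g4]] := Hhigh _ (pow2_gt0 n); exists g; split => //.
  by move: g3; rewrite pow2E.
(* The index starts at n+1 since frequency 1 belongs to the high pieces; the extra factor rho is
   discarded. *)
have Hl' n : exists g : Rd -> R, [/\ measurable_fun [set: Rd] g,
    intgd (fun x => `|g x| `^ q), \int[leb R d]_x (`|g x| `^ q) <= Cl * rho ^+ n &
    forall phi, schw0 phi -> U (Tm (mult (pow2 n.+1)^-1) phi) = \int[leb R d]_x (g x * phi x)].
  have bi : 0 < (pow2 n.+1)^-1 by rewrite invr_gt0.
  have [g [g1 g2 g3 g4]] := Hlow _ bi; exists g; split => //.
  apply: (le_trans g3); rewrite ler_wpM2l// mulrN powRN.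
  have iE x y : 0 < x -> x^-1 `^ y = (x `^ y)^-1 :> R.
    by move=> x0; rewrite -powRN -mulN1r powRrM powR_inv1// ltW.
  rewrite iE// invrK pow2E -/rho exprS.
  by rewrite ler_piMl ?exprn_ge0// ltW.
have /choice[gh Hgh] := Hh'; have /choice[gl Hgl] := Hl'.
have [Gh [GhL GhE]] := Lp_series q1 Ch0 rho01 (fun n => let: And4 A _ _ _ := Hgh n in A)
  (fun n => let: And4 _ A _ _ := Hgh n in A) (fun n => let: And4 _ _ A _ := Hgh n in A).
have [Gl [GlL GlE]] := Lp_series q1 Cl0 rho01 (fun n => let: And4 A _ _ _ := Hgl n in A)
  (fun n => let: And4 _ A _ _ := Hgl n in A) (fun n => let: And4 _ _ A _ := Hgl n in A).
exists (fun x => Gh x + Gl x); split; first exact: rLpD (ltW q0) GhL GlL.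
move=> phi Hphi; have [B [B0 phiB0]] := Rap_bd Hphi.1 0%N.
have phiB x : `|phi x| <= B by have := phiB0 tt x I; rewrite expr0 !mulr1.
have phii := schw_intg Hphi.1.
pose u b := U (Tm (fun xi => enorm xi `^ (s1 - r) * Theta (b *: xi)) phi).
pose S := U (Tm (fun xi => enorm xi `^ (s1 - r)) phi).
have MT b : 0 < b -> Mult (fun xi : Rd => enorm xi `^ (s1 - r) * Theta (b *: xi)).
  by move=> b0; apply: MultM; [exact: Mult_powR|apply: Mult_Theta; rewrite gt_eqF].
have step b : 0 < b -> u (2^-1 * b^-1) = U (Tm (mult b) phi) + u b^-1.
  move=> b0; rewrite -rtemp_TmD//.
  - congr (U (Tm _ _)); apply/funext => xi.
    by rewrite /mult /chi scalerA -mulrDr subrK.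
  - by apply: MultM; [exact: Mult_powR|apply: Mult_chi; rewrite invr_eq0 gt_eqF].
  - by apply: MT; rewrite invr_gt0.
have geo0 (c : R) (v : nat -> R) : (forall n, `|v n| <= c * (pow2 n)^-1) -> v n @[n --> \oo] --> (0 : R).
  move=> vc; apply: norm_cvg0; apply: (squeeze_cvgr _ (cvg_cst 0)).
    by apply: nearW => n; rewrite normr_ge0; exact: vc.
  rewrite -[X in _ --> X](mulr0 c); apply: cvgMl_tmp.
  under eq_fun do rewrite /pow2 -exprVn; apply: cvg_expr.
  by rewrite ger0_norm ?invr_ge0// invf_lt1// ltr1n.
have pinv0 n : 0 <= (pow2 n)^-1 by rewrite invr_ge0 ltW.
(* Low-pass parts at frequencies below about 2^-n are O(2^-n) on a function without moments. *)
have lim_low : u (pow2 n) @[n --> \oo] --> (0 : R).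
  have SFl : SF (fun n => (pow2 n)^-1) (fun n => Tm (fun xi => enorm xi `^ (s1 - r) * Theta (pow2 n *: xi)) phi).
    apply: (SF_Tm0 (m := fun n xi => enorm xi `^ (s1 - r) * Theta (pow2 n *: xi))) => //.
    have := ModM (@Wp_ge1 R d) (fun=> ler01) pinv0 (@Mod_powR R d nat (s1 - r))
      (@Theta_dilate_Mod R d nat pow2 (fun n => exprn_ege1 n (ler1n R 2))).
    by under eq_fun do rewrite mul1r.
  by have [c _ Hc] := HU.2 _ _ SFl; exact: (geo0 c).
(* The filter with cutoff near 2^n differs from 1 by O(2^-n) as a symbol on flat functions. *)
have lim_high : u (pow2 n)^-1 @[n --> \oo] --> S.
  have pi01 n : 0 < (pow2 n)^-1 <= 1 by rewrite invr_gt0 pow2_gt0 invf_le1// exprn_ege1// ler1n.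
  have MM : Mod Omp Wp (fun n => (pow2 n)^-1)
      (fun n (xi : Rd) => enorm xi `^ (s1 - r) * (1 - Theta ((pow2 n)^-1 *: xi))).
    have := ModM (@Wp_ge1 R d) (fun=> ler01) pinv0 (@Mod_powR R d nat (s1 - r))
      (@ThetaC_dilate_Mod R d nat _ pi01).
    by under eq_fun do rewrite mul1r.
  have [c _ Hc] := HU.2 _ _ (SF_Tm0 pinv0 MM Hphi).
  have uE n : u (pow2 n)^-1 = S - U (Tm (fun xi => enorm xi `^ (s1 - r) * (1 - Theta ((pow2 n)^-1 *: xi))) phi).
    apply/eqP; rewrite eq_sym subr_eq; apply/eqP; rewrite -rtemp_TmD//.
    - by congr (U (Tm _ _)); apply/funext => xi; rewrite -mulrDr [_ + (1 - _)]addrC subrK mulr1.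
    - by apply: MT; have /andP[] := pi01 n.
    - have M1 : Mult (fun xi : Rd => 1 - Theta ((pow2 n)^-1 *: xi)).
        apply: (ModD (@Wp_ge1 R d)) => //; first exact: Mod_cst.
        have := MultM (@Mod_cst R d unit Omp Wp (-1)) (Mult_Theta (lt0r_neq0 (proj1 (andP (pi01 n))))).
        by congr Mult; apply/funext => xi; rewrite mulN1r.
      by apply: MultM => //; exact: Mult_powR.
  pose v n := U (Tm (fun xi => enorm xi `^ (s1 - r) * (1 - Theta ((pow2 n)^-1 *: xi))) phi).
  have H : S - v n @[n --> \oo] --> S - 0 by apply: cvgB; [exact: cvg_cst|exact: (geo0 c)].
  by rewrite subr0 in H; rewrite (funext uE).
(* By [step] each piece is a difference of two consecutive low-pass values, so the sum
   telescopes. *)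
have Eh N : \sum_(0 <= n < N) \int[leb R d]_x (gh n x * phi x) = u (pow2 N)^-1 - u (pow2 0)^-1.
  rewrite -(@telescope_sumr R 0%N N (fun n => u (pow2 n)^-1))//; apply: eq_bigr => n _.
  have [_ _ _ <-//] := Hgh n; have := step _ (pow2_gt0 n).
  by rewrite -invfM -exprS => ->; rewrite addrK.
have El N : \sum_(0 <= n < N) \int[leb R d]_x (gl n x * phi x) = u (pow2 0) - u (pow2 N).
  rewrite -opprB.
  rewrite -(@telescope_sumr R 0%N N (fun n => u (pow2 n)))// -sumrN; apply: eq_bigr => n _.
  have [_ _ _ <-//] := Hgl n; have bi : 0 < (pow2 n.+1)^-1 by rewrite invr_gt0.
  have := step _ bi; rewrite invrK /pow2 exprS mulrA mulVf ?pnatr_eq0// mul1r => ->.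
  by rewrite opprB addrK.
have Lh : u (pow2 n)^-1 - u (pow2 0)^-1 @[n --> \oo] --> S - u (pow2 0)^-1.
  by apply: cvgB; [exact: lim_high|exact: cvg_cst].
have GhS : \int[leb R d]_x (Gh x * phi x) = S - u (pow2 0)^-1.
  by apply: (cvg_unique (@Rhausdorff R) _ Lh); rewrite -(funext Eh); exact: GhE phii phiB.
have Ll : u (pow2 0) - u (pow2 n) @[n --> \oo] --> u (pow2 0) - 0.
  by apply: cvgB; [exact: cvg_cst|exact: lim_low].
have GlS : \int[leb R d]_x (Gl x * phi x) = u (pow2 0) - 0.
  by apply: (cvg_unique (@Rhausdorff R) _ Ll); rewrite -(funext El); exact: GlE phii phiB.
transitivity (\int[leb R d]_x (Gh x * phi x) + \int[leb R d]_x (Gl x * phi x)).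
  have e0 : u (pow2 0)^-1 = u (pow2 0) by rewrite /pow2 expr0 invr1.
  by rewrite GhS GlS e0 subr0 subrK.
rewrite -RintegralD//.
- by apply: eq_Rintegral => x _; rewrite mulrDl.
- exact: rLp_schw_intg (ltW q1) GhL Hphi.1.
- exact: rLp_schw_intg (ltW q1) GlL Hphi.1.
Qed.

End piece.

End interpolation.

(** * Gateaux derivative of the L^l norm *)

Section gateaux.
Context {R : realType}.

(** Covers the zeros of the function inside the modulus, where |.|^l is not a smooth function of the
    squared modulus. *)
Let is_derive_order (phi : R -> R) (t0 c l : R) : 1 < l -> 0 <= c ->
  (forall h, `|phi (h + t0) - phi t0| <= c * `|h| `^ l) -> is_derive t0 1 phi 0.
Proof.
move=> l1 c0 H.
have l10 : 0 < l - 1 by rewrite subr_gt0.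
have L : h^-1 *: (phi (h *: 1 + t0) - phi t0) @[h --> 0^'] --> (0 : R).
  apply/cvgr0Pnorm_lt => e e0.
  have ec : 0 < e / (c + 1) by rewrite divr_gt0// ltr_wpDl.
  near=> h; have h0 : h != 0 by near: h; exact: nbhs_dnbhs_neq.
  have hd : `|h| < (e / (c + 1)) `^ (l - 1)^-1.
    near: h; apply: dnbhs0_lt; exact: powR_gt0.
  have hp : 0 < `|h| by rewrite normr_gt0.
  rewrite [h *: 1]mulr1 normrZ normfV mulrC ltr_pdivrMr//.
  apply: (le_lt_trans (H h)); rewrite -(mulr_powRB1 (normr_ge0 h) (lt_trans ltr01 l1)).
  rewrite mulrCA [ltRHS]mulrC ltr_pM2l//.
  have hl : `|h| `^ (l - 1) < e / (c + 1).
    have := @gt0_ltr_powR R _ l10 `|h| ((e / (c + 1)) `^ (l - 1)^-1).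
    rewrite !nnegrE powR_ge0 normr_ge0 => /(_ isT isT hd).
    by rewrite -powRrM mulVf ?gt_eqF// powRr1// ltW.
  apply: (@le_lt_trans _ _ (c * (e / (c + 1)))); first by rewrite ler_wpM2l// ltW.
  by rewrite mulrCA gtr_pMr// ltr_pdivrMr ?ltr_wpDl// mul1r ltrDl.
apply: DeriveDef; first by apply/cvg_ex; exists 0.
by apply: cvg_lim L; exact: Rhausdorff.
Unshelve. all: by end_near. Qed.

Definition cnorm2 (z : R[i]) : R := complex.Re z ^+ 2 + complex.Im z ^+ 2.

Lemma cabs_powR (z : R[i]) (l : R) : cabs z `^ l = cnorm2 z `^ (l / 2).
Proof.
rewrite /cnorm2 -sqr_cabs -powR_mulrn ?cabs_ge0// -powRrM; congr (_ `^ _).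
by field.
Qed.

Lemma cnorm2_ge0 (z : R[i]) : 0 <= cnorm2 z.
Proof. by rewrite addr_ge0// sqr_ge0. Qed.

Definition cdot (z w : R[i]) : R := complex.Re z * complex.Re w + complex.Im z * complex.Im w.

Lemma cdot_le (z w : R[i]) : `|cdot z w| <= cabs z * cabs w.
Proof.
rewrite -(@ler_pXn2r _ 2)// ?nnegrE ?mulr_ge0 ?cabs_ge0//.
rewrite exprMn !sqr_cabs real_normK ?num_real// /cdot -subr_ge0.
rewrite (_ : _ - _ = (complex.Re z * complex.Im w - complex.Im z * complex.Re w) ^+ 2); last by ring.
exact: sqr_ge0.
Qed.

(** Away from zeros |.|^l is the power l/2 of a quadratic polynomial in t; at a zero the function is
    |h|^l |w|^l with l > 1, and the derivative is 0. *)
Lemma is_derive_cabs_powR (l : R) (z w : R[i]) (t : R) : 1 < l ->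
  is_derive t 1 (fun t => cabs (z + t%:C%C * w) `^ l)
    (l * (cabs (z + t%:C%C * w) `^ (l - 2) * cdot (z + t%:C%C * w) w)).
Proof.
move=> l1; have l0 : 0 < l := lt_trans ltr01 l1.
have nE' (z' w' : R[i]) s :
    cnorm2 (z' + s%:C%C * w') = cnorm2 z' + s * (2 * cdot z' w') + s * s * cnorm2 w'.
  by case: z' => z1 z2; case: w' => w1 w2; rewrite /cnorm2 /cdot/=; ring.
have nE := nE' z w.
have dE' (z' w' : R[i]) s : cdot (z' + s%:C%C * w') w' = cdot z' w' + s * cnorm2 w'.
  by case: z' => z1 z2; case: w' => w1 w2; rewrite /cnorm2 /cdot/=; ring.
have dE := dE' z w.
have cE' s (w' : R[i]) : cabs (s%:C%C * w') ^+ 2 = (s * cabs w') ^+ 2.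
  by rewrite exprMn !sqr_cabs; case: w' => w1 w2 /=; ring.
have [n0|n0] := eqVneq (cnorm2 (z + t%:C%C * w)) 0.
  have z0 : z + t%:C%C * w = 0.
    by apply/eqP; rewrite -cabs_eq0 -(@sqrf_eq0 R) sqr_cabs; apply/eqP.
  (* For l < 2 the power with exponent l - 2 is a default value at 0; it is multiplied by a
     vanishing [cdot]. *)
  rewrite z0 [X in is_derive _ _ _ X](_ : _ = 0); last by rewrite /cdot/= !mul0r addr0 !mulr0.
  apply: (@is_derive_order _ _ (cabs w `^ l) l) => //; first exact: powR_ge0.
  move=> h.
  have -> : z + (h + t)%:C%C * w = h%:C%C * w.
    rewrite (_ : (h + t)%:C%C = h%:C%C + t%:C%C); last by apply: complexP; rewrite //= addr0.
    by rewrite mulrDl addrCA z0 addr0.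
  have -> : cabs (h%:C%C * w) = `|h| * cabs w.
    apply/eqP; rewrite -(@eqrXn2 _ 2)// ?mulr_ge0 ?cabs_ge0// cE' !exprMn.
    by rewrite real_normK ?num_real.
  rewrite z0 (_ : cabs 0 = 0); last by apply/eqP; rewrite cabs_eq0.
  by rewrite powR0 ?gt_eqF// subr0 ger0_norm ?powR_ge0// powRM ?cabs_ge0// mulrC.
have np : 0 < cnorm2 (z + t%:C%C * w) by rewrite lt_neqAle eq_sym n0 cnorm2_ge0.
have dn : is_derive t 1 (fun s => cnorm2 (z + s%:C%C * w)) (2 * cdot (z + t%:C%C * w) w).
  rewrite (funext nE).
  have did := is_derive_id t (1 : R).
  have := derive1D (derive1D (is_derive_cst (cnorm2 z) t 1) (derive1M did (is_derive_cst (2 * cdot z w) t 1)))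
    (derive1M (derive1M did did) (is_derive_cst (cnorm2 w) t 1)).
  by move=> H; apply: is_derive_eq H _; rewrite dE /=; ring.
have H := @is_derive1_comp R (fun u : R => u `^ (l / 2)) (fun s : R => cnorm2 (z + s%:C%C * w)) t _ _
  (is_derive1_powR (l / 2) np) dn.
 rewrite (_ : (fun s => _) = (fun u : R => u `^ (l / 2)) \o (fun s : R => cnorm2 (z + s%:C%C * w))).
  apply: is_derive_eq H _; rewrite cabs_powR (_ : (l - 2) / 2 = l / 2 - 1); last by field.
  by field.
by apply/funext => s; rewrite /= cabs_powR.
Qed.

Context d (T : measurableType d) (mu : {measure set T -> \bar R}).

(** Differentiation under the integral sign for |t| < 1, with a multiple of |F|^l + |G|^l as
    dominating function. *)
Lemma is_derive_Lp (l : R) (F G : T -> R[i]) : 1 < l ->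
  measurable_fun [set: T] (fun x => complex.Re (F x)) ->
  measurable_fun [set: T] (fun x => complex.Im (F x)) ->
  measurable_fun [set: T] (fun x => complex.Re (G x)) ->
  measurable_fun [set: T] (fun x => complex.Im (G x)) ->
  intg mu (fun x => cabs (F x) `^ l) -> intg mu (fun x => cabs (G x) `^ l) ->
  is_derive (0 : R) 1 (fun t : R => \int[mu]_x (cabs (F x + t%:C%C * G x) `^ l))
    (l * \int[mu]_x (cabs (F x) `^ (l - 2) * cdot (F x) (G x))).
Proof.
move=> l1 mF1 mF2 mG1 mG2 Fi Gi; have l0 : 0 < l := lt_trans ltr01 l1.
pose f t x := cabs (F x + t%:C%C * G x) `^ l.
pose D t x := l * (cabs (F x + t%:C%C * G x) `^ (l - 2) * cdot (F x + t%:C%C * G x) (G x)).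
have df (t : R) (x : T) : is_derive t 1 (fun s => f s x) (D t x) by exact: is_derive_cabs_powR.
have mRe t : measurable_fun [set: T] (fun x => complex.Re (F x + t%:C%C * G x)).
  rewrite (_ : (fun x => _) = fun x => complex.Re (F x) + t * complex.Re (G x)).
    by apply: measurable_funD => //; exact: measurable_funM.
  by apply/funext => x; case: (F x) => a b; case: (G x) => c e /=; rewrite mul0r subr0.
have mIm t : measurable_fun [set: T] (fun x => complex.Im (F x + t%:C%C * G x)).
  rewrite (_ : (fun x => _) = fun x => complex.Im (F x) + t * complex.Im (G x)).
    by apply: measurable_funD => //; exact: measurable_funM.
  by apply/funext => x; case: (F x) => a b; case: (G x) => c e /=; rewrite mul0r addr0.
have mcabs t : measurable_fun [set: T] (fun x => cabs (F x + t%:C%C * G x)).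
  rewrite (_ : (fun x => _) = fun x => Num.sqrt (complex.Re (F x + t%:C%C * G x) ^+ 2 +
      complex.Im (F x + t%:C%C * G x) ^+ 2)).
    apply: (measurableT_comp (continuous_measurable_fun (@sqrt_continuous R))).
    by apply: measurable_funD; apply: measurable_funX.
  by apply/funext => x; case: (F x + _).
have cle t x : `|t| <= 1 -> cabs (F x + t%:C%C * G x) <= cabs (F x) + cabs (G x).
  move=> t1; rewrite -(@ler_pXn2r _ 2)// ?nnegrE ?addr_ge0 ?cabs_ge0//.
  have E : cabs (F x + t%:C%C * G x) ^+ 2 = cabs (F x) ^+ 2 + t * (2 * cdot (F x) (G x)) + t ^+ 2 * cabs (G x) ^+ 2.
    by rewrite !sqr_cabs; case: (F x) => a b; case: (G x) => c e; rewrite /cdot/=; ring.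
  rewrite E sqrrD; apply: lerD; last first.
    by rewrite ler_piMl ?sqr_ge0// -real_normK ?num_real// exprn_ile1.
  rewrite lerD2l; apply: le_trans (ler_norm _) _.
  rewrite normrM normrM normr_nat mulrCA -[leRHS]mulr_natl ler_wpM2l//.
  by apply: le_trans (ler_piMl _ t1) (cdot_le _ _).
have intf t : `|t| <= 1 -> intg mu (f t).
  move=> t1; apply: (intg_le _ _ (intgZ (2 `^ l) (intgD Fi Gi))).
    exact: (measurableT_comp (measurable_powR l) (mcabs t)).
  move=> x; rewrite ger0_norm ?powR_ge0//.
  apply: le_trans (powR_add_le (ltW l0) (cabs_ge0 _) (cabs_ge0 _)).
  by apply: powR_le; rewrite ?cabs_ge0 ?(ltW l0)// cle.
(* Cauchy-Schwarz reduces the derivative to l |F + tG|^(l-1) |G|, which is at most l (|F| +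
   |G|)^l. *)
have Db t x : `|t| <= 1 -> `|D t x| <= l * 2 `^ l * (cabs (F x) `^ l + cabs (G x) `^ l).
  move=> t1; rewrite /D normrM gtr0_norm// -mulrA ler_wpM2l ?(ltW l0)// normrM ger0_norm ?powR_ge0//.
  apply: le_trans (powR_add_le (ltW l0) (cabs_ge0 _) (cabs_ge0 _)).
  have [c0|c0] := eqVneq (cabs (F x + t%:C%C * G x)) 0.
    move/eqP: c0; rewrite cabs_eq0 => /eqP ->.
    by rewrite /cdot/= !mul0r addr0 normr0 mulr0 powR_ge0.
  have cp : 0 < cabs (F x + t%:C%C * G x) by rewrite lt_neqAle eq_sym c0 cabs_ge0.
  apply: le_trans (ler_wpM2l (powR_ge0 _ _) (cdot_le _ _)) _.
  have -> : cabs (F x + t%:C%C * G x) `^ (l - 2) * (cabs (F x + t%:C%C * G x) * cabs (G x)) =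
      cabs (F x + t%:C%C * G x) `^ (l - 1) * cabs (G x).
    rewrite mulrA; congr (_ * _); rewrite -{2}[cabs _](powRr1 (ltW cp)) -powRD ?c0 ?implybT//.
    by congr (_ `^ _); ring.
  rewrite -(mulr_powRB1 (addr_ge0 (cabs_ge0 (F x)) (cabs_ge0 (G x))) l0) [leRHS]mulrC.
  apply: ler_pM; rewrite ?powR_ge0 ?cabs_ge0//; last by rewrite lerDr cabs_ge0.
  by apply: powR_le; rewrite ?cabs_ge0 ?cle// subr_ge0 ltW.
have I0 : `]-1, 1[%classic (0 : R) by rewrite /= in_itv/= ltrN10 ltr01.
have It t : `]-1, 1[%classic t -> `|t| <= (1 : R).
  by rewrite /= in_itv/= ler_norml => /andP[/ltW -> /ltW ->].
have Gd : mu.-integrable [set: T] (EFin \o (fun x => l * 2 `^ l * (cabs (F x) `^ l + cabs (G x) `^ l))).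
  exact: (intgZ (l * 2 `^ l) (intgD Fi Gi)).
have dE t x : partial1of2 f t x = D t x.
  by rewrite partial1of2E; exact: (@derive_val _ _ _ _ _ _ _ (df t x)).
have L := @cvg_differentiation_under_integral R _ T mu f setT measurableT 0 (-1) 1 I0
  (fun t It' => intf t (It t It')) (fun t x _ _ => @ex_derive _ _ _ _ _ _ _ (df t x))
  (fun x => l * 2 `^ l * (cabs (F x) `^ l + cabs (G x) `^ l)).
have Db' t x : `]-1, 1[%classic t -> [set: T] x ->
    `|partial1of2 f t x| <= l * 2 `^ l * (cabs (F x) `^ l + cabs (G x) `^ l).
  by move=> /It t1 _; rewrite dE; exact: Db.
have G0 x : 0 <= l * 2 `^ l * (cabs (F x) `^ l + cabs (G x) `^ l).
  by rewrite !mulr_ge0 ?addr_ge0 ?powR_ge0// ltW.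
have {}L := L G0 Gd Db'.
have F0 x : F x + 0%:C%C * G x = F x.
  by apply: complexP; case: (F x) => a b; case: (G x) => c e /=; ring.
have mc : measurable_fun [set: T] (fun x => cabs (F x)).
  by have := mcabs 0; under eq_fun do rewrite F0.
have di : intg mu (fun x => cabs (F x) `^ (l - 2) * cdot (F x) (G x)).
  apply: (intg_le _ _ (intgZ (2 `^ l) (intgD Fi Gi))).
    apply: measurable_funM; first exact: (measurableT_comp (measurable_powR (l - 2)) mc).
    by apply: measurable_funD; exact: measurable_funM.
  move=> x; have := Db 0 x; rewrite normr0 => /(_ ler01); rewrite /D F0 normrM gtr0_norm//.
  by rewrite -mulrA ler_pM2l.
have E0 : \int[mu]_x (partial1of2 f 0 x) = l * \int[mu]_x (cabs (F x) `^ (l - 2) * cdot (F x) (G x)).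
  by rewrite -RintegralZl//; apply: eq_Rintegral => x _; rewrite dE /D F0.
have L' : h^-1 *: (\int[mu]_x f (h *: 1 + 0) x - \int[mu]_x f 0 x) @[h --> 0^'] -->
    l * \int[mu]_x (cabs (F x) `^ (l - 2) * cdot (F x) (G x)).
  by rewrite -E0; under eq_fun do rewrite scaler1.
apply: DeriveDef; first by apply/cvg_ex; eexists; exact: L'.
by apply: cvg_lim L'; exact: Rhausdorff.
Qed.

End gateaux.

(** * Combinations and dilations of distributions *)

Section tempered_operations.
Context {R : realType} {d : nat}.
Local Notation Rd := 'rV[R]_d.
Local Notation C := R[i].
Local Notation intgd := (intg (leb R d)).
Implicit Types (u v : tempered R d) (f g : Rd -> C).

Lemma schwartz_norm_ge0 N f : (0 <= schwartz_norm N f)%E.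
Proof.
apply: le_trans (@schwartz_norm_ub R d N f [::] 0 isT); rewrite lee_fin.
by rewrite mulr_ge0 ?cabs_ge0// exprn_ge0// addr_ge0// enorm_ge0.
Qed.

Lemma schwartz_norm_mono M N f : (M <= N)%N -> (schwartz_norm M f <= schwartz_norm N f)%E.
Proof.
move=> MN; apply: ge_ereal_sup => _ [[s x] /= sM <-].
apply: le_trans (@schwartz_norm_ub R d N f s x (leq_trans sM MN)).
rewrite lee_fin ler_wpM2r ?cabs_ge0//; apply: ler_weXn2l => //.
by rewrite lerDl enorm_ge0.
Qed.

Lemma cabsM (z w : C) : cabs (z * w) = cabs z * cabs w.
Proof. exact: Normc.normcM. Qed.

Lemma cabsD (z w : C) : cabs (z + w) <= cabs z + cabs w.
Proof.
have [z0 w0] := (cabs_ge0 z, cabs_ge0 w).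
rewrite -(@ler_pXn2r _ 2) ?nnegrE ?addr_ge0 ?cabs_ge0//.
rewrite sqrrD !sqr_cabs; have := cdot_le z w; rewrite /cdot.
case: z z0 => a b z0; case: w w0 => c e w0 /= /(le_trans (ler_norm _)) H.
have : (a * c + b * e) *+ 2 <= cabs (a +i* b)%C * cabs (c +i* e)%C *+ 2 by rewrite lerMn2r.
by rewrite !mulr2n; lra.
Qed.

Section tcomb.
Variables (c : C) (u v : tempered R d).

Let tc f := c * u f + v f.

Let tc_linear (a : C) f g : schwartz f -> schwartz g ->
  tc (fun x => a * f x + g x) = a * tc f + tc g.
Proof. by move=> Hf Hg; rewrite /tc !pairing_linear//; ring. Qed.

Let tc_continuous : exists (K : R) (N : nat), forall f, schwartz f ->
  ((cabs (tc f))%:E <= K%:E * schwartz_norm N f)%E.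
Proof.
have [K1 [N1 H1]] := pairing_continuous u; have [K2 [N2 H2]] := pairing_continuous v.
exists (cabs c * `|K1| + `|K2|), (maxn N1 N2) => f Hf.
have B (K : R) N (z : C) : (N <= maxn N1 N2)%N ->
    ((cabs z)%:E <= K%:E * schwartz_norm N f)%E ->
    ((cabs z)%:E <= `|K|%:E * schwartz_norm (maxn N1 N2) f)%E.
  move=> NM h; apply: (le_trans h).
  apply: (@le_trans _ _ (`|K|%:E * schwartz_norm N f)%E).
    by apply: lee_wpmul2r; [exact: schwartz_norm_ge0|rewrite lee_fin ler_norm].
  by apply: lee_wpmul2l; [rewrite lee_fin|exact: schwartz_norm_mono].
have b1 := B _ _ _ (leq_maxl _ _) (H1 f Hf); have b2 := B _ _ _ (leq_maxr _ _) (H2 f Hf).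
apply: (@le_trans _ _ ((cabs c)%:E * (cabs (u f))%:E + (cabs (v f))%:E)%E).
  by rewrite -EFinM -EFinD lee_fin -cabsM; exact: cabsD.
rewrite EFinD EFinM ge0_muleDl ?lee_fin ?mulr_ge0 ?cabs_ge0//; apply: leeD => //.
by rewrite -muleA; apply: lee_wpmul2l => //; rewrite lee_fin cabs_ge0.
Qed.

Definition tcomb : tempered R d := Tempered tc_linear tc_continuous.

End tcomb.

(* [u (b .)], by duality *)
Section tdil.
Variables (b : R) (b_gt0 : 0 < b) (u : tempered R d).

Let bi0 : b^-1 != 0. Proof. by rewrite invr_eq0 gt_eqF. Qed.

Let dil f : Rd -> C := fun x => f (b^-1 *: x).

Let schwartz_dil f : schwartz f -> schwartz (dil f).
Proof.
move=> /schwartz_Re_Im[Ha Hb].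
have := schw_schwartz (SF_dilate bi0 Ha) (SF_dilate bi0 Hb).
by congr schwartz; apply/funext => x; rewrite /dil; case: (f _).
Qed.

Let rpart_dil (h : Rd -> R) s x : schw h ->
  rpart s (fun x => h (b^-1 *: x)) x = b^-1 ^+ size s * rpart s h (b^-1 *: x).
Proof.
move=> Hh; elim: s x => [|i s IH] x /=; first by rewrite expr0 mul1r.
rewrite (funext IH).
have H := hasgradZ (b^-1 ^+ size s) (hasgrad_scale (hasgrad_partial (@schw_diff R d h s (b^-1 *: x) Hh))).
by have [_ ->] := H; rewrite exprSr mulrA.
Qed.

Let td f : C := (b ^- d)%:C%C * u (dil f).

Let td_linear (a : C) f g : schwartz f -> schwartz g ->
  td (fun x => a * f x + g x) = a * td f + td g.
Proof.
move=> /schwartz_dil Hf /schwartz_dil Hg.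
by rewrite /td /dil (pairing_linear u a Hf Hg) -/(dil f) -/(dil g); ring.
Qed.

(** The factor (1 + b)^N pays for the weight at x in terms of that at x/b, and (1 + b^-1)^N for the
    at most N factors b^-1 produced by the derivatives. *)
Let schwartz_norm_dil N f : schwartz f ->
  (schwartz_norm N (dil f) <= ((1 + b) ^+ N * (1 + b^-1) ^+ N)%:E * schwartz_norm N f)%E.
Proof.
move=> Hf; have [Ha Hb] := schwartz_Re_Im Hf.
apply: ge_ereal_sup => _ [[s x] /= sN <-].
have E : iter_partial s (dil f) x = (b^-1 ^+ size s)%:C%C * iter_partial s f (b^-1 *: x).
  apply: complexP.
    rewrite -[LHS]/((fun x => complex.Re (iter_partial s (dil f) x)) x) Re_iter_partial.
    rewrite (rpart_dil s x Ha) -Re_iter_partial.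
    by case: (iter_partial s f _) => p q /=; rewrite mul0r subr0.
  rewrite -[LHS]/((fun x => complex.Im (iter_partial s (dil f) x)) x) Im_iter_partial.
  rewrite (rpart_dil s x Hb) -Im_iter_partial.
  by case: (iter_partial s f _) => p q /=; rewrite mul0r addr0.
have bi : 0 < b^-1 by rewrite invr_gt0.
apply: (@le_trans _ _ (((1 + b) ^+ N * (1 + b^-1) ^+ N)%:E *
    ((1 + enorm (b^-1 *: x)) ^+ N * cabs (iter_partial s f (b^-1 *: x)))%:E)%E); last first.
  apply: lee_wpmul2l; last exact: schwartz_norm_ub.
  by rewrite lee_fin mulr_ge0// exprn_ge0// addr_ge0// ltW.
rewrite -EFinM lee_fin E cabsM.
have -> : cabs (b^-1 ^+ size s)%:C%C = b^-1 ^+ size s.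
  by rewrite /cabs/= expr0n addr0 sqrtr_sqr ger0_norm// exprn_ge0// ltW.
have w1 : (1 + enorm x) ^+ N <= (1 + b) ^+ N * (1 + enorm (b^-1 *: x)) ^+ N.
  rewrite -exprMn lerXn2r ?nnegrE ?addr_ge0 ?mulr_ge0 ?addr_ge0 ?enorm_ge0 ?(ltW b_gt0)//.
  have -> : enorm x = b * enorm (b^-1 *: x).
    by rewrite enormZ gtr0_norm// mulrA divff ?gt_eqF// mul1r.
  have := enorm_ge0 (b^-1 *: x); move: (enorm _) => e e0.
  by rewrite -subr_ge0 (_ : _ - _ = b + e) ?addr_ge0 ?(ltW b_gt0)//; ring.
have w2 : b^-1 ^+ size s <= (1 + b^-1) ^+ N.
  apply: (@le_trans _ _ ((1 + b^-1) ^+ size s)).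
    by rewrite lerXn2r ?nnegrE ?addr_ge0 ?(ltW bi)// lerDr.
  by apply: ler_weXn2l => //; rewrite lerDl ltW.
rewrite [leRHS](_ : _ = ((1 + b) ^+ N * (1 + enorm (b^-1 *: x)) ^+ N) *
   ((1 + b^-1) ^+ N * cabs (iter_partial s f (b^-1 *: x)))); last by ring.
apply: ler_pM => //; first by rewrite exprn_ge0// addr_ge0// enorm_ge0.
  by rewrite mulr_ge0 ?cabs_ge0// exprn_ge0// ltW.
by rewrite ler_wpM2r ?cabs_ge0.
Qed.

Let td_continuous : exists (K : R) (N : nat), forall f, schwartz f ->
  ((cabs (td f))%:E <= K%:E * schwartz_norm N f)%E.
Proof.
have [K [N H]] := pairing_continuous u.
exists (cabs (b ^- d)%:C%C * (`|K| * ((1 + b) ^+ N * (1 + b^-1) ^+ N))), N => f Hf.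
rewrite /td cabsM EFinM [X in (_ <= X * _)%E]EFinM -muleA; apply: lee_wpmul2l.
  by rewrite lee_fin cabs_ge0.
apply: (le_trans (H _ (schwartz_dil Hf))).
apply: (@le_trans _ _ (`|K|%:E * schwartz_norm N (dil f))%E).
  by apply: lee_wpmul2r; [exact: schwartz_norm_ge0|rewrite lee_fin ler_norm].
rewrite EFinM -muleA; apply: lee_wpmul2l; first by rewrite lee_fin.
exact: schwartz_norm_dil.
Qed.

Definition tdil : tempered R d := Tempered td_linear td_continuous.

Lemma Ure_tdil (h : Rd -> R) : Ure tdil h = b ^- d * Ure u (fun x => h (b^-1 *: x)).
Proof. by rewrite /Ure /= /td /dil; case: (u _) => p q /=; rewrite mul0r subr0. Qed.

Lemma Uim_tdil (h : Rd -> R) : Uim tdil h = b ^- d * Uim u (fun x => h (b^-1 *: x)).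
Proof. by rewrite /Uim /= /td /dil; case: (u _) => p q /=; rewrite mul0r addr0. Qed.

End tdil.

Lemma rep_comb (sigma l a : R) (U V : (Rd -> R) -> R) (g g' : Rd -> R) : 1 < l ->
  rep sigma l U g -> rep sigma l V g' ->
  rep sigma l (fun f : Rd -> R => a * U f + V f) (fun x : Rd => a * g x + g' x).
Proof.
move=> l1 [gL gE] [gL' gE']; have l0 : 0 <= l by rewrite ltW// (lt_trans ltr01).
split; first by apply: rLpD => //; exact: rLpZ.
move=> f Hf; rewrite gE// gE'// -RintegralZl//; last exact: rLp_schw_intg (ltW l1) gL Hf.1.
rewrite -RintegralD//.
- by apply: eq_Rintegral => x _; rewrite mulrDl mulrA.
- by apply: intgZ; exact: rLp_schw_intg (ltW l1) gL Hf.1.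
- exact: rLp_schw_intg (ltW l1) gL' Hf.1.
Qed.

Lemma D_represents_comb (sigma l : R) (c : C) u v g g' : 1 < l ->
  D_represents sigma l u g -> D_represents sigma l v g' ->
  D_represents sigma l (tcomb c u v) (fun x => c * g x + g' x).
Proof.
move=> l1 /(D_represents_rep _ _ _ l1)[g1 g2] /(D_represents_rep _ _ _ l1)[g1' g2'].
apply/(D_represents_rep _ _ _ l1); split.
- have := rep_comb (complex.Re c) l1 g1 (rep_comb (- complex.Im c) l1 g2 g1').
  congr rep; last by apply/funext => x; case: (c) => p q; case: (g x) => r s; case: (g' x) => t w /=; ring.
  by apply/funext => f; rewrite /Ure /Uim /=; case: (c) => p q; case: (u _) => r s; case: (v _) => t w /=; ring.
- have := rep_comb (complex.Re c) l1 g2 (rep_comb (complex.Im c) l1 g1 g2').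
  congr rep; last by apply/funext => x; case: (c) => p q; case: (g x) => r s; case: (g' x) => t w /=; ring.
  by apply/funext => f; rewrite /Ure /Uim /=; case: (c) => p q; case: (u _) => r s; case: (v _) => t w /=; ring.
Qed.

Lemma Ht_dilate (c : R) (f : Rd -> R) xi : 0 < c -> intgd f ->
  Ht (fun x => f (c *: x)) xi = c ^- d * Ht f (c^-1 *: xi).
Proof.
move=> c0 fi; have c1 : c != 0 by rewrite gt_eqF.
rewrite [in RHS]/Ht (Rint_affine 0 c1 (cas_intg _ fi)) gtr0_norm// mulrA mulVf ?expf_neq0// mul1r.
by apply: eq_Rintegral => x _; rewrite addr0 dotpZl dotpZr mulrA divff// mul1r.
Qed.

Lemma schw0_dilate (c : R) (f : Rd -> R) : 0 < c -> schw0 f -> schw0 (fun x => f (c *: x)).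
Proof.
move=> c0 [Hf f0]; have c1 : c != 0 by rewrite gt_eqF.
split; first exact: (SF_dilate c1 Hf).
move=> a; have ci1 : c^-1 != 0 by rewrite invr_eq0.
rewrite (Rint_affine 0 ci1 (schw_intg (schw_monomial a (SF_dilate c1 Hf)))).
rewrite (_ : Rintegral _ _ _ = \int[leb R d]_x (c^-1 ^+ (\sum_i a i) * (monomial a x * f x))).
  by rewrite RintegralZl ?f0 ?mulr0//; exact: schw_intg (schw_monomial a Hf).
apply: eq_Rintegral => x _; rewrite addr0 scalerA divff// scale1r mulrA; congr (_ * _).
rewrite /monomial -prodrXr -big_split; apply: eq_bigr => i _.
by rewrite mxE; exact: exprMn.
Qed.

Lemma rep_dil (sigma l b : R) (U : (Rd -> R) -> R) (g : Rd -> R) : 1 < l -> 0 < b ->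
  rtemp U -> rep sigma l U g ->
  rep sigma l (fun f : Rd -> R => b ^- d * U (fun x : Rd => f (b^-1 *: x))) (fun x : Rd => b `^ sigma * g (b *: x)).
Proof.
move=> l1 b0 HU [[mg gi] gE]; have b1 : b != 0 by rewrite gt_eqF.
have bi0 : 0 < b^-1 by rewrite invr_gt0.
have mg' : measurable_fun [set: Rd] (fun x => g (b *: x)).
  have := measurableT_comp mg (measurable_affine b 0).
  by congr measurable_fun; apply/funext => x /=; rewrite addr0.
have gL' : rLp (leb R d) l (fun x => g (b *: x)).
  split => //; have := intg_affine 0 b1 gi.
  by congr intg; apply/funext => x; rewrite addr0.
split; first exact: rLpZ.
move=> f Hf; pose m (xi : Rd) := enorm xi `^ sigma.
have Hfb := schw0_dilate bi0 Hf.
(* Homogeneity of the symbol: dilating before or after the multiplier differs by the factor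
   b^sigma. *)
have TE x : Tm m f (b^-1 *: x) = b `^ sigma * Tm m (fun x => f (b^-1 *: x)) x.
  have Hm := schw_intg (flat_schw (flatM (Mult_powR sigma) (schw0_flat Hf))).
  rewrite /Tm [RHS]mulrCA; congr (_ * _).
  rewrite (_ : (fun xi => m xi * Ht (fun x => f (b^-1 *: x)) xi) =
      fun xi => b ^+ d * b `^ (- sigma) * (m (b *: xi) * Ht f (b *: xi))).
    rewrite HtZ; last first.
      by have := intg_affine 0 b1 Hm; congr intg; apply/funext => xi; rewrite addr0.
    rewrite (Ht_dilate x b0 Hm) powRN; field.
    by rewrite expf_neq0//= gt_eqF// powR_gt0.
  apply/funext => xi; rewrite (Ht_dilate xi bi0 (schw_intg Hf.1)) invrK exprVn invrK.
  rewrite /m enormZ gtr0_norm// powRM ?enorm_ge0 ?(ltW b0)// powRN.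
  by field; rewrite gt_eqF// powR_gt0.
rewrite (funext TE); have := HU.1 (b `^ sigma) _ _ (schw0_Tm (Mult_powR sigma) Hfb).1 schw0_zero.1.
under [X in U X = _]eq_fun do rewrite addr0.
move=> ->; have -> : U (fun=> 0) = 0.
  have := HU.1 (-1) _ _ schw0_zero.1 schw0_zero.1.
  under [X in U X = _]eq_fun do rewrite mulr0 addr0.
  by rewrite mulN1r addNr.
rewrite addr0 gE//.
have gf := rLp_schw_intg (ltW l1) (conj mg gi) Hfb.1.
rewrite (Rint_affine 0 b1 gf) gtr0_norm// mulrCA mulKf ?expf_neq0//.
rewrite -RintegralZl//; last first.
  by have := intg_affine 0 b1 gf.
by apply: eq_Rintegral => x _; rewrite addr0 scalerA mulVf// scale1r mulrA.
Qed.

Lemma D_represents_dil (sigma l b : R) (b0 : 0 < b) u g : 1 < l ->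
  D_represents sigma l u g ->
  D_represents sigma l (tdil b0 u) (fun x => (b `^ sigma)%:C%C * g (b *: x)).
Proof.
move=> l1 /(D_represents_rep _ _ _ l1)[g1 g2]; have [U1 U2] := rtemp_Ure_Uim u.
apply/(D_represents_rep _ _ _ l1); split.
- rewrite (funext (Ure_tdil b0 u)); have := rep_dil l1 b0 U1 g1.
  by congr rep; apply/funext => x; case: (g _) => p q /=; rewrite mul0r subr0.
- rewrite (funext (Uim_tdil b0 u)); have := rep_dil l1 b0 U2 g2.
  by congr rep; apply/funext => x; case: (g _) => p q /=; rewrite mul0r addr0.
Qed.

End tempered_operations.

(** * The variational argument *)

Section local_minimum.
Context {R : realType}.

Lemma powRB1 (a l : R) : 0 < a -> a `^ (l - 1) = a `^ l / a.
Proof.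
move=> a0; have a1 : a != 0 by rewrite gt_eqF.
by rewrite (@powRD R a) ?a1 ?implybT// powRN powRr1// ltW.
Qed.

Lemma is_derive_local_min (F : R -> R) (t0 D : R) : is_derive t0 1 F D ->
  (\forall t \near t0, F t0 <= F t) -> D = 0.
Proof.
move=> [/cvg_ex[D' L] DE] /nbhs_ballP[e1 /= e10 Hmin].
have {}L : h^-1 *: ((F \o shift t0) (h *: 1) - F t0) @[h --> 0^'] --> D.
  have <- : D' = D by rewrite -DE; apply/esym/cvg_lim.
  exact: L.
apply/eqP; apply: contraT => D0.
have nD : 0 < `|D| by rewrite normr_gt0.
have /cvgrPdist_lt/(_ _ nD) := L; rewrite near_withinE => /nbhs_ballP[e2 /= e20 H].
pose e := Num.min e1 e2 / 2; have m0 : 0 < Num.min e1 e2 by rewrite lt_min e10.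
have e0 : 0 < e by rewrite divr_gt0.
have em : e < Num.min e1 e2 by rewrite ltr_pdivrMr// mulr2n ltr_pMr// ltrDl.
(* A step against the sign of [D] makes the difference quotient at a minimum zero or of sign
   opposite to [D], so that it stays at distance at least |D| from [D]. *)
pose h := - Num.sg D * e.
have h0 : h != 0 by rewrite mulf_neq0// ?oppr_eq0 ?sgr_eq0// gt_eqF.
have hE : `|h| = e by rewrite normrM normrN normr_sg D0 mul1r gtr0_norm.
have /Hmin /= hm : ball t0 e1 (h + t0).
  by rewrite /ball/= opprD addrCA subrr addr0 normrN hE (lt_le_trans em)// ge_min lexx.
have /H /(_ h0) : ball (0 : R) e2 h.
  by rewrite /ball/= sub0r normrN hE (lt_le_trans em)// ge_min lexx orbT.
rewrite /= [h *: 1]mulr1 => Hq; exfalso.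
have Q0 : 0 <= F (h + t0) - F t0 by rewrite subr_ge0.
move: Hq; apply/negP; rewrite -leNgt.
move: Q0; set Q := _ - _ => Q0; rewrite /GRing.scale/= /h invfM invrN.
have ei : 0 <= e^-1 by rewrite invr_ge0 ltW.
have : 0 <= e^-1 * Q by rewrite mulr_ge0.
case: (ltgtP D 0) D0 => // D0 _; [rewrite ltr0_sg// | rewrite gtr0_sg//];
  rewrite ?invrN invr1 ?opprK ?mulNr !mul1r ?mulN1r ?opprK => qq.
  by rewrite ltr0_norm// ler0_norm// ?opprB; lra.
by rewrite gtr0_norm// ger0_norm; lra.
Qed.

End local_minimum.

(* The value set [V] of the triples (A, B, M) on X, up to what is needed of X:
   invariance under scalar multiples and under the dilations that fix M. *)
Section sharp_inequality.
Context {R : realType}.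
Variables (p q theta lam : R) (V : R -> R -> R -> Prop).
Hypotheses (p1 : 1 < p) (q1 : 1 < q) (theta01 : 0 < theta < 1) (lam_gt0 : 0 < lam).
Let x := theta * q / 2.
Let y := (1 - theta) * q / p.
Hypothesis V_ge0 : forall A B M, V A B M -> [/\ 0 <= A, 0 <= B & 0 <= M].
Hypothesis V_scale : forall c A B M, 0 < c -> V A B M -> V (c `^ 2 * A) (c `^ q * B) (c `^ p * M).
Hypothesis V_dilate : forall mu A B M, 0 < mu -> V A B M -> V (mu * A) (mu `^ x * B) M.
Hypothesis V_nondeg : forall A B M, V A B M -> 0 < M -> 0 < A.
Variables (A0 B0 : R).
Hypothesis V0 : V A0 B0 lam.
Let e A B : R := 2^-1 * A - q^-1 * B.
Hypothesis Hmin : (x <= 1 /\ forall A B, V A B lam -> e A0 B0 <= e A B) \/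
  [/\ 1 < x, A0 - theta * B0 = 0 &
      forall A B, V A B lam -> A - theta * B = 0 -> e A0 B0 <= e A B].

Let q0 : 0 < q. Proof. exact: lt_trans q1. Qed.
Let p0 : 0 < p. Proof. exact: lt_trans p1. Qed.
Let th0 : 0 < theta. Proof. by case/andP: theta01. Qed.
Let x0 : 0 < x. Proof. by rewrite divr_gt0// mulr_gt0. Qed.
Let A0_gt0 : 0 < A0. Proof. exact: V_nondeg V0 lam_gt0. Qed.

(** Without the constraint P = 0, the curve mu -> (mu A0, mu^x B0) is admissible and the energy
    along it is minimal at mu = 1; its derivative there is (A0 - theta B0) / 2. *)
Lemma minimizer_pohozaev : A0 = theta * B0.
Proof.
case: Hmin => [[x1 H]|[_ /eqP + _]]; last by rewrite subr_eq0 => /eqP.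
have D : is_derive (1 : R) 1 (fun mu : R => e (mu * A0) (mu `^ x * B0))
    (2^-1 * A0 - q^-1 * (x * B0)).
  have d1 := is_derive1_powR x (ltr01 : 0 < 1 :> R).
  rewrite powR1 mulr1 in d1.
  have -> : (fun mu : R => e (mu * A0) (mu `^ x * B0)) =
      (2^-1 * A0) \*: (id : R -> R) - (q^-1 * B0) \*: (fun mu : R => mu `^ x).
    apply/funext => mu; rewrite /e !fctE /=.
    by rewrite /GRing.scale/=; ring.
  have := is_deriveB (is_deriveZ (2^-1 * A0) (is_derive_id (1 : R) 1))
     (is_deriveZ (q^-1 * B0) d1).
  move=> /is_derive_eq; apply.
  by rewrite /GRing.scale/=; ring.
have := is_derive_local_min D; have nb : \forall t \near (1 : R),
    e (1 * A0) (1 `^ x * B0) <= e (t * A0) (t `^ x * B0).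
  near=> t; rewrite powR1 !mul1r; apply: H; apply: V_dilate => //.
  by near: t; exact: lt_nbhsr.
move=> /(_ nb) h.
have : 2 * (2^-1 * A0 - q^-1 * (x * B0)) = 0 by rewrite h mulr0.
rewrite /x => hh; apply/eqP; rewrite -subr_eq0 -hh; apply/eqP.
by field; rewrite gt_eqF.
Unshelve. all: by end_near. Qed.

(** For x <> 1 a competitor is dilated until A = theta B holds. There the energy is A (x - 1) /
    (2x), so minimality compares mu A with A0, in a direction that depends on the sign of x - 1;
    raising to the power x - 1 undoes this dependence. *)
Let ineq_sphere A B : V A B lam -> B * A0 `^ x <= B0 * A `^ x.
Proof.
move=> HV; have [A1 B1 _] := V_ge0 HV; have Ap := V_nondeg HV lam_gt0.
have A0E := minimizer_pohozaev.
have B0E : B0 = A0 / theta by rewrite A0E mulrAC divff ?mul1r// gt_eqF.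
have B0_gt0 : 0 < B0 by rewrite B0E divr_gt0.
have [->|Bn0] := eqVneq B 0; first by rewrite mul0r mulr_ge0 ?powR_ge0// ltW.
have Bp : 0 < B by rewrite lt_neqAle eq_sym Bn0.
(* For x = 1 dilations multiply A and B alike and cannot enforce A = theta B. Here theta = 2/q makes
   the minimal energy 0, and the claim is the nonnegativity of the energy. *)
have [xE1|x1] := eqVneq x 1.
  have thE : theta = 2 / q by apply: (mulIf (lt0r_neq0 q0)); rewrite divfK ?gt_eqF//; move: xE1; rewrite /x; lra.
  have [x1 H] : x <= 1 /\ forall A B, V A B lam -> e A0 B0 <= e A B.
    by case: Hmin => // -[]; rewrite xE1 ltxx.
  have e0 : e A0 B0 = 0 by rewrite /e A0E thE; field; rewrite gt_eqF.
  have := H _ _ HV; rewrite e0 /e xE1 !powRr1 ?(ltW A0_gt0)// B0E thE => h.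
  have h2 : B <= q / 2 * A by rewrite -(@ler_pM2l _ (q^-1)) ?invr_gt0// (_ : q^-1 * (q / 2 * A) = 2^-1 * A); [lra|field; rewrite gt_eqF].
  apply: (le_trans (ler_wpM2r (ltW A0_gt0) h2)).
  by rewrite le_eqVlt; apply/orP; left; apply/eqP; field; rewrite gt_eqF.
(* The solution of theta mu^x B = mu A. *)
pose mu := (A / (theta * B)) `^ (x - 1)^-1.
have thB : 0 < theta * B by rewrite mulr_gt0.
have mu0 : 0 < mu by rewrite powR_gt0// divr_gt0.
have x10 : x - 1 != 0 by rewrite subr_eq0.
have muE : mu `^ (x - 1) = A / (theta * B).
  by rewrite -powRrM mulVf// powRr1// divr_ge0// ltW.
have muxE : theta * (mu `^ x * B) = mu * A.
  have -> : mu `^ x = mu * (A / (theta * B)).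
    by rewrite -muE powRB1//; field; rewrite gt_eqF.
  by field; rewrite !gt_eqF.
have Vmu := V_dilate mu0 HV.
have eE A' B' : A' = theta * B' -> e A' B' = A' * ((x - 1) / (2 * x)).
  move=> AE; rewrite /e (_ : B' = A' / theta); last by rewrite AE mulrAC divff ?mul1r// gt_eqF.
  by rewrite /x; field; rewrite !gt_eqF.
have key : A0 * ((x - 1) / (2 * x)) <= mu * A * ((x - 1) / (2 * x)).
  rewrite -(eE _ _ A0E) -(eE _ (mu `^ x * B))//.
  case: Hmin => [[_]|[_ _]] H; first exact: H.
  by apply: H => //; rewrite muxE subrr.
have goal : (A0 / A) `^ (x - 1) <= A / (theta * B).
  rewrite -muE; have [xlt|xgt] := ltP x 1.
    have : mu <= A0 / A.
      rewrite ler_pdivlMr//; move: key; rewrite ler_nM2r// pmulr_llt0 ?subr_lt0//.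
      by rewrite invr_gt0 mulr_gt0.
    move=> h; have nx : 0 <= 1 - x by rewrite subr_ge0 ltW.
    have := powR_le nx (ltW mu0) h.
    rewrite -(opprB x 1) !powRN; rewrite lef_pV2 ?posrE ?powR_gt0// divr_gt0//.
  have xgt1 : 1 < x by rewrite lt_neqAle eq_sym x1.
  have h : A0 / A <= mu.
    rewrite ler_pdivrMr//; move: key; rewrite ler_pM2r// divr_gt0 ?subr_gt0//.
    by rewrite mulr_gt0.
  by apply: powR_le h; rewrite ?subr_ge0// divr_ge0// ltW.
have px : (A0 / A) `^ (x - 1) = (A0 `^ x / A0) / (A `^ x / A).
  have Ai : A^-1 `^ (x - 1) = (A `^ (x - 1))^-1.
    by rewrite -[in LHS](powR_inv1 (ltW Ap)) -powRrM mulN1r powRN.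
  by rewrite powRM ?invr_ge0 ?(ltW Ap)// ?(ltW A0_gt0)// Ai !powRB1.
move: goal; rewrite px ler_pdivlMr// B0E => h.
have Axp : 0 < A `^ x by rewrite powR_gt0.
have A0xp : 0 < A0 `^ x by rewrite powR_gt0.
have := ler_wpM2r (ltW (divr_gt0 (mulr_gt0 A0_gt0 Axp) (mulr_gt0 Ap th0))) h.
rewrite [leLHS](_ : _ = B * A0 `^ x); last by field; rewrite !gt_eqF.
by rewrite [leRHS](_ : _ = A0 / theta * A `^ x)//; field; rewrite !gt_eqF.
Qed.

(** A multiple c brings M to [lam], where [ineq_sphere] applies. *)
Lemma minimizer_sharp A B M : V A B M -> 0 < M ->
  B * A0 `^ x * lam `^ y <= B0 * A `^ x * M `^ y.
Proof.
move=> HV M0; have [A1 B1 _] := V_ge0 HV.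
pose c := (lam / M) `^ p^-1; have lM : 0 < lam / M by rewrite divr_gt0.
have c0 : 0 < c by rewrite powR_gt0.
have cp : c `^ p * M = lam.
  by rewrite -powRrM mulVf ?gt_eqF// powRr1 ?(ltW lM)// divfK// gt_eqF.
have := V_scale c0 HV; rewrite cp => /ineq_sphere.
have cpy : c `^ (p * y) = lam `^ y / M `^ y.
  rewrite -powRrM mulrA mulVf ?gt_eqF// mul1r powRM ?(ltW lam_gt0) ?invr_ge0 ?(ltW M0)//.
  by rewrite -[in LHS](powR_inv1 (ltW M0)) -powRrM mulN1r powRN.
clearbody c.
have -> : (c `^ 2 * A) `^ x = c `^ (2 * x) * A `^ x.
  by rewrite (powRM x (powR_ge0 c 2) A1) powRrM.
(* Both sides are homogeneous of degree q = 2x + py. *)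
have -> : c `^ q = c `^ (2 * x) * c `^ (p * y).
  rewrite -(@powRD R c) ?(gt_eqF c0) ?implybT//; congr (_ `^ _).
  by rewrite /x /y; field; rewrite gt_eqF.
rewrite cpy.
have My : 0 < M `^ y by rewrite powR_gt0.
have cx : 0 < c `^ (2 * x) by rewrite powR_gt0.
rewrite -[in X in _ -> X](ler_pM2l (divr_gt0 cx My)).
move=> h; rewrite [leLHS](_ : _ = c `^ (2 * x) * (lam `^ y / M `^ y) * B * A0 `^ x); last by field; rewrite gt_eqF.
by rewrite [leRHS](_ : _ = B0 * (c `^ (2 * x) * A `^ x))//; field; rewrite gt_eqF.
Qed.

(** The difference of the two sides of [minimizer_sharp] along the path is minimal at t = 0, where
    it vanishes. No constraint is imposed on the path: M may vary, and this produces the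
    multiplier. *)
Lemma minimizer_critical (fA fB fM : R -> R) (a b m : R) :
  fA 0 = A0 -> fB 0 = B0 -> fM 0 = lam -> (forall t, V (fA t) (fB t) (fM t)) ->
  is_derive (0 : R) 1 fA (2 * a) -> is_derive (0 : R) 1 fB (q * b) ->
  is_derive (0 : R) 1 fM (p * m) ->
  a - b + (1 - theta) / (theta * lam) * A0 * m = 0.
Proof.
move=> hA hB hM HV dA dB dM.
(* The sharp inequality is available for positive M only. *)
have Mnear : \forall t \near (0 : R), 0 < fM t.
  have /differentiable_continuous cM : differentiable fM (0 : R).
    by apply/derivable1_diffP; case: dM.
  have : fM 0 > 0 by rewrite hM.
  by move=> h; have := cM _ (lt_nbhsr h); rewrite near_simpl.
have dAx : is_derive (0 : R) 1 (fun t => fA t `^ x) (x * A0 `^ (x - 1) * (2 * a)).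
  apply: (@is_derive1_comp R (fun u : R => u `^ x) fA 0 _ _ _ dA).
  by rewrite hA; exact: is_derive1_powR.
have dMy : is_derive (0 : R) 1 (fun t => fM t `^ y) (y * lam `^ (y - 1) * (p * m)).
  apply: (@is_derive1_comp R (fun u : R => u `^ y) fM 0 _ _ _ dM).
  by rewrite hM; exact: is_derive1_powR.
pose F (t : R) := B0 * (fA t `^ x * fM t `^ y) - A0 `^ x * lam `^ y * fB t.
have dF : is_derive (0 : R) 1 F (B0 * (A0 `^ x * (y * lam `^ (y - 1) * (p * m)) +
    lam `^ y * (x * A0 `^ (x - 1) * (2 * a))) - A0 `^ x * lam `^ y * (q * b)).
  have := is_deriveB (is_deriveZ B0 (is_deriveM dAx dMy)) (is_deriveZ (A0 `^ x * lam `^ y) dB).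
  by rewrite hA hM.
have F0 : \forall t \near (0 : R), F 0 <= F t.
  near=> t; have Mt : 0 < fM t by near: t.
  have h := minimizer_sharp (HV t) Mt.
  rewrite /F hA hB hM [leLHS](_ : _ = 0); last by ring.
  rewrite subr_ge0 [leLHS](_ : _ = fB t * A0 `^ x * lam `^ y); last by ring.
  by rewrite mulrA.
have := is_derive_local_min dF F0.
rewrite !powRB1//; have Ax : 0 < A0 `^ x by rewrite powR_gt0.
have ly : 0 < lam `^ y by rewrite powR_gt0.
move: (A0 `^ x) (lam `^ y) Ax ly => X Y X0 Y0 H.
have B0E : B0 = A0 / theta by rewrite minimizer_pohozaev mulrAC divff ?mul1r// gt_eqF.
(* With X = A0^x and Y = lam^y the derivative of [F] is X Y q times the left-hand side, once B0 = A0
   / theta is inserted. *)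
apply: (@mulfI _ (X * Y * q)); first by rewrite !mulf_neq0// gt_eqF.
rewrite mulr0 -H B0E /x /y; field.
by rewrite !gt_eqF.
Unshelve. all: by end_near. Qed.

End sharp_inequality.

(** * Norms through arbitrary representatives *)

Section representatives.
Context {R : realType} {d : nat}.
Local Notation Rd := 'rV[R]_d.
Local Notation C := R[i].
Local Notation intgd := (intg (leb R d)).
Implicit Types (u v : tempered R d) (g h : Rd -> C).

Definition nrm (l : R) g : R := \int[leb R d]_x (cabs (g x) `^ l).

Lemma nrm_ge0 l g : 0 <= nrm l g.
Proof. by apply: Rint_ge0 => x; rewrite powR_ge0. Qed.

Lemma D_represents_intg sigma l u g : 1 < l -> D_represents sigma l u g ->
  cmeasurable g /\ intgd (fun x => cabs (g x) `^ l).
Proof. by move=> l1 [/(in_Lp_intg _ (lt_trans ltr01 l1))]. Qed.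

Lemma D_represents_Drep sigma l u : D_in_Lp sigma l u ->
  D_represents sigma l u (Drep sigma l u).
Proof. exact: xgetPex. Qed.

Lemma D_represents_unique sigma l u g h : (0 < d)%N -> 1 < l ->
  D_represents sigma l u g -> D_represents sigma l u h ->
  {ae leb R d, forall x, g x = h x}.
Proof.
move=> d0 l1 /(D_represents_rep _ _ _ l1)[[g1 g1E] [g2 g2E]] /(D_represents_rep _ _ _ l1)[[h1 h1E] [h2 h2E]].
have a1 := rLp_pairing_ae d0 l1 l1 g1 h1 (fun f Hf => etrans (esym (g1E f Hf)) (h1E f Hf)).
have a2 := rLp_pairing_ae d0 l1 l1 g2 h2 (fun f Hf => etrans (esym (g2E f Hf)) (h2E f Hf)).
by apply: filterS2 a1 a2 => x; exact: complexP.
Qed.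

(** [Dnorm] is defined by a chosen representative; almost everywhere uniqueness lets any explicit
    one be used, such as that of a dilate. *)
Lemma Dnorm_powR sigma l u g : (0 < d)%N -> 1 < l -> D_represents sigma l u g ->
  (Dnorm sigma l u `^ l = (nrm l g)%:E)%E.
Proof.
move=> d0 l1 Hg; have Hin : D_in_Lp sigma l u by exists g.
have HD := D_represents_Drep Hin; have [mg ig] := D_represents_intg l1 Hg.
have [mD iD] := D_represents_intg l1 HD.
have l0 : l != 0 by rewrite gt_eqF// (lt_trans ltr01).
rewrite /Dnorm (asboolT Hin) (Lpnorm_powR _ l0) -(EFin_Rint iD); congr EFin.
apply: eq_ae_Rint; [exact: intg_measurable iD|exact: intg_measurable ig|].
by apply: filterS (D_represents_unique d0 l1 HD Hg) => x ->.
Qed.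

Lemma cabs_real (a : R) : 0 <= a -> cabs a%:C%C = a.
Proof. by move=> a0; rewrite /cabs/= expr0n addr0 sqrtr_sqr ger0_norm. Qed.

Lemma nrmZ (l a : R) g : 0 <= a -> intgd (fun x => cabs (g x) `^ l) ->
  nrm l (fun x => a%:C%C * g x) = a `^ l * nrm l g.
Proof.
move=> a0 ig; rewrite /nrm -RintegralZl//.
by apply: eq_Rintegral => x _; rewrite cabsM cabs_real// powRM ?cabs_ge0.
Qed.

Lemma nrm_dil (l b c c' : R) g : 0 < b -> 0 <= c -> 0 <= c' ->
  intgd (fun x => cabs (g x) `^ l) ->
  nrm l (fun x => c%:C%C * (c'%:C%C * g (b *: x))) = (c * c') `^ l * b `^ (- d%:R) * nrm l g.
Proof.
move=> b0 c0 c'0 ig; have b1 : b != 0 by rewrite gt_eqF.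
have ib : intgd (fun x => cabs (g (b *: x)) `^ l).
  by have := intg_affine 0 b1 ig; congr intg; apply/funext => x; rewrite addr0.
have -> : (fun x => c%:C%C * (c'%:C%C * g (b *: x))) = (fun x => (c * c')%:C%C * g (b *: x)).
  by apply/funext => x; rewrite mulrA -rmorphM.
rewrite (nrmZ (mulr_ge0 c0 c'0) ib) /nrm (Rint_affine 0 b1 ig) gtr0_norm//.
rewrite powRN powR_mulrn ?(ltW b0)//.
have -> : \int[leb R d]_x (cabs (g (b *: x)) `^ l) = \int[leb R d]_x (cabs (g (b *: x + 0)) `^ l).
  by apply: eq_Rintegral => x _; rewrite addr0.
move: (Rintegral _ _ _) (_ `^ l) (expf_neq0 d b1) => X Y bd0; move: (b ^+ d) bd0 => Z Z0.
by field.
Qed.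

(* [|xi|^r = |xi|^(r+s) |xi|^(-s)] *)
Lemma rep_ae0 (r s p l : R) (U : (Rd -> R) -> R) (h : Rd -> R) :
  rep (r + s) l U h -> {ae leb R d, forall x, h x = 0} -> 0 < p ->
  rep r p U (fun=> 0).
Proof.
move=> [[mh _] hE] h0 p0; split.
  split; first exact: measurable_cst.
  rewrite (_ : (fun _ => _) = (fun=> 0)); first exact: intg0.
  by apply/funext => x; rewrite normr0 powR0// gt_eqF.
move=> f Hf; have Hs := schw0_Tm (Mult_powR (- s)) Hf.
have := hE _ Hs; rewrite Tm_comp//; last exact: Mult_powR.
rewrite (@Tm_eq _ _ _ (fun xi => enorm xi `^ r))//; last first.
  move=> xi xi0; have e0 : enorm xi != 0 by rewrite gt_eqF// enorm_gt0.
  by rewrite -(@powRD R) ?e0 ?implybT//; congr (_ `^ _); ring.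
move=> ->; apply: eq_ae_Rint.
- apply: measurable_funM => //; exact: intg_measurable (schw_intg Hs.1).
- by under eq_fun do rewrite mul0r; exact: measurable_cst.
- by apply: filterS h0 => x ->; rewrite !mul0r.
Qed.

(** If D^(r+s) u vanishes, then so does D^r u as a class modulo polynomials; this is what keeps A
    positive where M is. *)
Lemma D_represents_nrm0 (r s p l : R) u h : 1 < p -> 1 < l ->
  D_represents (r + s) l u h -> nrm l h = 0 -> D_represents r p u (fun=> 0).
Proof.
move=> p1 l1 Hh h0; have [mh ih] := D_represents_intg l1 Hh.
have ae0 : {ae leb R d, forall x, h x = 0}.
  have := ae_eq0_Rint ih (fun x => powR_ge0 _ _) h0.
  apply: filterS => x /powR_eq0_eq0/eqP; rewrite cabs_eq0 => /eqP //.
have p0 := lt_trans ltr01 p1.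
have /(D_represents_rep _ _ _ l1)[h1 h2] := Hh.
apply/(D_represents_rep _ _ _ p1); split.
- by apply: rep_ae0 h1 _ p0; apply: filterS ae0 => x ->.
- by apply: rep_ae0 h2 _ p0; apply: filterS ae0 => x ->.
Qed.

Lemma nrm0 (l : R) : 0 < l -> nrm l (fun=> 0) = 0.
Proof.
move=> l0; rewrite /nrm /Rintegral (_ : (fun _ => _) = cst 0%E) ?integral0//.
apply/funext => x; congr EFin; rewrite /cabs/= expr0n addr0 sqrtr0 powR0// gt_eqF//.
Qed.

End representatives.

(** * Invariances of the values (A, B, M) and the weak equation *)

Section variational.
Context {R : realType} {d : nat}.
Local Notation Rd := 'rV[R]_d.
Local Notation C := R[i].
Local Notation intgd := (intg (leb R d)).
Variables (p q r s1 s2 theta : R).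
Hypotheses (d_gt0 : (0 < d)%N) (p1 : 1 < p) (q1 : 1 < q) (theta01 : 0 < theta < 1).
Hypothesis scaling : 1 / q - (s1 - r) / d%:R
  = (1 - theta) * (1 / p - r / d%:R) + theta * (1 / 2 - (r + s2) / d%:R).
Hypothesis s1_small : s1 - 2 * r < theta * s2.
Let a := s2 + d%:R / p - d%:R / 2.
Hypothesis a_gt0 : 0 < a.
Implicit Types (u v : tempered R d) (f g h : Rd -> C).

Let two1 : (1 : R) < 2. Proof. by rewrite ltr1n. Qed.
Let p0 : 0 < p. Proof. exact: lt_trans p1. Qed.
Let q0 : 0 < q. Proof. exact: lt_trans q1. Qed.

(** The scaling relation multiplied by -d. Under the dilation by b that fixes M, A is multiplied by
    b^(2a) and B by b^(q theta a). *)
Lemma scaling_dilation : d%:R / p + (s1 - 2 * r) - d%:R / q = theta * a.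
Proof.
have d0 : (d%:R : R) != 0 by rewrite pnatr_eq0 -lt0n.
have := congr1 (fun z => - d%:R * z) scaling; rewrite /= => H.
have E1 : - d%:R * (1 / q - (s1 - r) / d%:R) = s1 - r - d%:R / q.
  by field; rewrite d0 gt_eqF.
have E2 : - d%:R * ((1 - theta) * (1 / p - r / d%:R) + theta * (1 / 2 - (r + s2) / d%:R))
    = (1 - theta) * (r - d%:R / p) + theta * (r + s2 - d%:R / 2).
  by field; rewrite d0 gt_eqF.
rewrite E1 E2 in H; rewrite /a.
rewrite (_ : _ - _ = d%:R / p - r + (s1 - r - d%:R / q)); last by ring.
by rewrite H; ring.
Qed.

(** Representatives are arbitrary rather than the chosen [Drep], because the choice does not commute
    with linear combinations and dilations. *)
Definition triple_rep u f h g := [/\ D_represents r p u f, D_represents (r + s2) 2 u h &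
  D_represents (s1 - r) q u g].

Definition values (A B M : R) := exists u f h g,
  triple_rep u f h g /\ [/\ A = nrm 2 h, B = nrm q g & M = nrm p f].

(** The existence of the third representative is the interpolation inequality: [rep_interp] is
    applied to the real and to the imaginary component. *)
Lemma Xspace_triple_rep u : Xspace p r s2 u <-> exists f h g, triple_rep u f h g.
Proof.
split=> [[[f Hf] [h Hh]]|[f [h [g [Hf Hh _]]]]]; last by split; [exists f|exists h].
have [U1 U2] := rtemp_Ure_Uim u.
have /(D_represents_rep _ _ _ p1)[f1 f2] := Hf.
have /(D_represents_rep _ _ _ two1)[h1 h2] := Hh.
have [g1 Hg1] := rep_interp d_gt0 p1 q1 theta01 scaling s1_small a_gt0 U1 f1 h1.
have [g2 Hg2] := rep_interp d_gt0 p1 q1 theta01 scaling s1_small a_gt0 U2 f2 h2.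
exists f, h, (fun x => Complex (g1 x) (g2 x)); split => //.
by apply/(D_represents_rep _ _ _ q1); split.
Qed.

Lemma Xspace_triple_Drep u : Xspace p r s2 u ->
  triple_rep u (Drep r p u) (Drep (r + s2) 2 u) (Drep (s1 - r) q u).
Proof.
move=> /Xspace_triple_rep[f [h [g [Hf Hh Hg]]]].
by split; apply: D_represents_Drep; [exists f|exists h|exists g].
Qed.

Lemma functionals_triple_rep u f h g : triple_rep u f h g ->
  [/\ A_fun r s2 u = (nrm 2 h)%:E, B_fun q r s1 u = (nrm q g)%:E &
      M_fun p r u = (nrm p f)%:E].
Proof.
by move=> [Hf Hh Hg]; split; exact: Dnorm_powR.
Qed.

(** The available operation is c u + v, so the multiple c u is obtained as (c - 1) u + u. *)
Definition tscale (c : C) u := tcomb (c - 1) u u.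

Lemma triple_rep_comb (c : C) u v f h g f' h' g' :
  triple_rep u f h g -> triple_rep v f' h' g' ->
  triple_rep (tcomb c u v) (fun x => c * f x + f' x) (fun x => c * h x + h' x)
    (fun x => c * g x + g' x).
Proof. by move=> [Hf Hh Hg] [Hf' Hh' Hg']; split; exact: D_represents_comb. Qed.

Lemma triple_rep_scale (c : C) u f h g : triple_rep u f h g ->
  triple_rep (tscale c u) (fun x => c * f x) (fun x => c * h x) (fun x => c * g x).
Proof.
move=> H; have := triple_rep_comb (c - 1) H H.
by congr triple_rep; apply/funext => x; rewrite mulrBl mul1r subrK.
Qed.

Lemma triple_rep_dil b (b0 : 0 < b) u f h g : triple_rep u f h g ->
  triple_rep (tdil b0 u) (fun x => (b `^ r)%:C%C * f (b *: x))
    (fun x => (b `^ (r + s2))%:C%C * h (b *: x))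
    (fun x => (b `^ (s1 - r))%:C%C * g (b *: x)).
Proof. by move=> [Hf Hh Hg]; split; exact: D_represents_dil. Qed.

Lemma triple_rep_intg u f h g : triple_rep u f h g ->
  [/\ intgd (fun x => cabs (f x) `^ p), intgd (fun x => cabs (h x) `^ 2) &
      intgd (fun x => cabs (g x) `^ q)].
Proof.
move=> [Hf Hh Hg]; split.
- exact: (D_represents_intg p1 Hf).2.
- exact: (D_represents_intg two1 Hh).2.
- exact: (D_represents_intg q1 Hg).2.
Qed.

Lemma values_ge0 A B M : values A B M -> [/\ 0 <= A, 0 <= B & 0 <= M].
Proof. by move=> [u [f [h [g [_ [-> -> ->]]]]]]; split; exact: nrm_ge0. Qed.

Lemma values_scale c A B M : 0 < c -> values A B M ->
  values (c `^ 2 * A) (c `^ q * B) (c `^ p * M).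
Proof.
move=> c0 [u [f [h [g [H [-> -> ->]]]]]]; have [i1 i2 i3] := triple_rep_intg H.
exists (tscale c%:C%C u), (fun x => c%:C%C * f x), (fun x => c%:C%C * h x), (fun x => c%:C%C * g x).
split; first exact: triple_rep_scale.
by split; rewrite (nrmZ (ltW c0)).
Qed.

(** The witness is k u(b .), with the amplitude k chosen so that M is unchanged. *)
Lemma values_dilate mu A B M : 0 < mu -> values A B M ->
  values (mu * A) (mu `^ (theta * q / 2) * B) M.
Proof.
move=> mu0 [u [f [h [g [H [-> -> ->]]]]]].
(* A is then multiplied by b^(2a) = mu; the factor of M is (k b^r)^p b^-d = 1 for k = b^(d/p -
   r). *)
pose b := mu `^ (2 * a)^-1; have b0 : 0 < b by rewrite powR_gt0.
pose k := b `^ (d%:R / p - r); have k0 : 0 <= k by rewrite powR_ge0.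
have [i1 i2 i3] := triple_rep_intg H.
have H1 := triple_rep_dil b0 H.
have H2 := triple_rep_scale k%:C%C H1.
have bmu t : b `^ (2 * a * t) = mu `^ t.
  by rewrite -powRrM mulrA mulVf ?mul1r// gt_eqF// mulr_gt0.
have kE l sigma : (k * b `^ sigma) `^ l * b `^ (- d%:R) = b `^ (l * (d%:R / p - r + sigma) - d%:R).
  have powbD t t' : b `^ t * b `^ t' = b `^ (t + t').
    by rewrite -(@powRD R b) ?(gt_eqF b0) ?implybT.
  by rewrite powbD -powRrM powbD; congr (_ `^ _); ring.
have nE l sigma (w : Rd -> C) : intgd (fun x => cabs (w x) `^ l) ->
    nrm l (fun x => k%:C%C * ((b `^ sigma)%:C%C * w (b *: x))) =
    b `^ (l * (d%:R / p - r + sigma) - d%:R) * nrm l w.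
  by move=> i; rewrite -kE; exact: nrm_dil b0 k0 (powR_ge0 _ _) i.
eexists; eexists; eexists; eexists; split; first exact: H2.
rewrite (nE _ _ _ i1) (nE _ _ _ i2) (nE _ _ _ i3); split.
- rewrite -[in LHS](powRr1 (ltW mu0)) -bmu; congr (_ `^ _ * _).
  by rewrite /a; field; rewrite gt_eqF.
- rewrite -bmu; congr (_ `^ _ * _).
  rewrite (_ : 2 * a * (theta * q / 2) = q * (theta * a)); last by field.
  by rewrite -scaling_dilation; field; rewrite !gt_eqF.
- rewrite (_ : p * _ - _ = 0) ?powRr0 ?mul1r//.
  by field; rewrite gt_eqF.
Qed.

Lemma values_nondeg A B M : values A B M -> 0 < M -> 0 < A.
Proof.
move=> [u [f [h [g [[Hf Hh _] [-> _ ->]]]]]] M0.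
rewrite lt_neqAle nrm_ge0 andbT eq_sym; apply/eqP => h0.
have Hf0 := D_represents_nrm0 p1 two1 Hh h0.
have := Dnorm_powR d_gt0 p1 Hf; rewrite (Dnorm_powR d_gt0 p1 Hf0) nrm0// => -[E].
by move: M0; rewrite -E ltxx.
Qed.

(** The real part of the integral of |z|^(l-2) z times the conjugate of w: by [is_derive_nrm], 1/l
    times the derivative of the l-th power of the L^l norm at z in the direction w. *)
Definition dual_pairing (l : R) (z w : Rd -> C) : R := \int[leb R d]_x (cabs (z x) `^ (l - 2) * cdot (z x) (w x)).

(** The imaginary part of z times the conjugate of w is the real part of z times the conjugate of
    iw, so that the complex equation reduces to real directional derivatives. *)
Lemma cint_dual_power (l : R) (z w : Rd -> C) :
  cint (fun x => dual_power l (z x) * (w x)^*%C) =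
  Complex (dual_pairing l z w) (dual_pairing l z (fun x => 'i%C * w x)).
Proof.
rewrite /cint /dual_pairing; congr Complex; apply: eq_Rintegral => x _;
  rewrite /dual_power /cdot; case: (z x) => z1 z2; case: (w x) => w1 w2 /=; ring.
Qed.

Lemma cint_mul_conj (z w : Rd -> C) : cint (fun x => z x * (w x)^*%C) =
  Complex (dual_pairing 2 z w) (dual_pairing 2 z (fun x => 'i%C * w x)).
Proof.
rewrite -cint_dual_power; congr cint; apply/funext => x.
by rewrite /dual_power subrr powRr0 mul1r.
Qed.

Lemma cint_dual_pairing_eq0 (omega : R) (z2 zq zp w2 wq wp : Rd -> C) :
  dual_pairing 2 z2 w2 - dual_pairing q zq wq + omega * dual_pairing p zp wp = 0 ->
  dual_pairing 2 z2 (fun x => 'i%C * w2 x) - dual_pairing q zq (fun x => 'i%C * wq x) +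
    omega * dual_pairing p zp (fun x => 'i%C * wp x) = 0 ->
  cint (fun x => z2 x * (w2 x)^*%C) - cint (fun x => dual_power q (zq x) * (wq x)^*%C)
    + omega%:C%C * cint (fun x => dual_power p (zp x) * (wp x)^*%C) = 0.
Proof.
have := cint_mul_conj z2 w2; have := cint_dual_power q zq wq; have := cint_dual_power p zp wp.
move: (cint _) (cint _) (cint _) => c1 c2 c3 -> -> ->.
do 6!move: (dual_pairing _ _ _) => ?.
by move=> E1 E2; apply: complexP => /=; rewrite !mul0r ?subr0 ?addr0.
Qed.

Lemma is_derive_nrm (l sigma tau : R) u v f h : 1 < l ->
  D_represents sigma l u f -> D_represents tau l v h ->
  is_derive (0 : R) 1 (fun t : R => nrm l (fun x => t%:C%C * h x + f x)) (l * dual_pairing l f h).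
Proof.
move=> l1 /(D_represents_intg l1)[[mf1 mf2] jf] /(D_represents_intg l1)[[mh1 mh2] jh].
have := is_derive_Lp l1 mf1 mf2 mh1 mh2 jf jh.
congr is_derive; apply/funext => t.
by apply: eq_Rintegral => x _; rewrite addrC.
Qed.

Variables (lam : R) (lam_gt0 : 0 < lam) (psi : tempered R d).

(** The path is psi + t u with representatives f0 + t f, h0 + t h and g0 + t g; it stays in X since
    X is a linear space. *)
Lemma dual_pairing_critical f0 h0 g0 : triple_rep psi f0 h0 g0 ->
  nrm p f0 = lam ->
  (theta * q / 2 <= 1 /\ (forall A B, values A B lam ->
      2^-1 * nrm 2 h0 - q^-1 * nrm q g0 <= 2^-1 * A - q^-1 * B) \/
   [/\ 1 < theta * q / 2, nrm 2 h0 - theta * nrm q g0 = 0 &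
      forall A B, values A B lam -> A - theta * B = 0 ->
        2^-1 * nrm 2 h0 - q^-1 * nrm q g0 <= 2^-1 * A - q^-1 * B]) ->
  forall u f h g, triple_rep u f h g ->
  dual_pairing 2 h0 h - dual_pairing q g0 g + (1 - theta) / (theta * lam) * nrm 2 h0 * dual_pairing p f0 f = 0.
Proof.
move=> H0 f0lam Hmin u f h g H; have [Hf0 Hh0 Hg0] := H0; have [Hf Hh Hg] := H.
have V0 : values (nrm 2 h0) (nrm q g0) lam by exists psi, f0, h0, g0.
have at0 l (z w : Rd -> C) : nrm l (fun x => 0%:C%C * w x + z x) = nrm l z.
  by congr nrm; apply/funext => x; rewrite mul0r add0r.
apply: (minimizer_critical p1 q1 theta01 lam_gt0 values_ge0 values_scale values_dilate
  values_nondeg V0 Hmin _ _ _ _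
  (is_derive_nrm two1 Hh0 Hh) (is_derive_nrm q1 Hg0 Hg) (is_derive_nrm p1 Hf0 Hf)).
- exact: at0.
- exact: at0.
- by rewrite at0.
- move=> t; exists (tcomb t%:C%C u psi); do 3!eexists; split; first exact: triple_rep_comb H H0.
  by [].
Qed.

End variational.

Theorem corollary1p6 (R : realType) (d : nat) (p q r s1 s2 theta : R)
    (hd : (1 <= d)%N)
    (hp : 1 < p) (hq : 1 < q)
    (hr : 0 <= r) (hrs1 : r <= s1)
    (hs2 : Num.max 0 (d%:R / 2 - d%:R / p) < s2)
    (htheta : 0 < theta < 1)
    (hscaling : 1 / q - (s1 - r) / d%:R
      = (1 - theta) * (1 / p - r / d%:R) + theta * (1 / 2 - (r + s2) / d%:R))
    (hlow : 0 <= r < s1 / 2 -> s1 - 2 * r < theta * s2)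
    (hhigh : s1 / 2 <= r <= s1 -> 2 * r - s1 < d%:R / p)
    (lam : R) (hlam : 0 < lam) (psi : tempered R d)
    (hpsi :
      [\/ [/\ q_0 d p r s1 < q, q < q_c d p r s1 s2 &
              minimizer (E_fun q r s1 s2) (S_sphere p r s2 lam) psi],
          [/\ q = q_c d p r s1 s2,
              lam = lambda_star d p q r s1 s2 theta &
              minimizer (E_fun q r s1 s2) (S_sphere p r s2 lam) psi] |
          [/\ q_c d p r s1 s2 < q, (q%:E < q_S d r s1 s2)%E &
              minimizer (E_fun q r s1 s2) (P_set p q r s1 s2 theta lam) psi]]) :
  exists omega : R,
    [/\ omega%:E = (((1 - theta) / (theta * lam))%:E * A_fun r s2 psi)%E,
        0 < omega &
        euler_lagrange p q r s1 s2 omega psi].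
Proof.
have p0 : 0 < p := lt_trans ltr01 hp; have q0 : 0 < q := lt_trans ltr01 hq.
have /andP[th0 th1] := htheta.
move: hs2; rewrite gt_max => /andP[s20 hs2'].
have a0 : 0 < s2 + d%:R / p - d%:R / 2 by lra.
have ths2 : 0 < theta * s2 by rewrite mulr_gt0.
(* For r >= s1/2 the left-hand side is at most 0 while theta s2 is positive. *)
have s1s : s1 - 2 * r < theta * s2.
  have [h|h] := ltP r (s1 / 2); first by apply: hlow; rewrite hr.
  by apply: le_lt_trans ths2; lra.
(* This makes the denominator of [q_c] positive: s1 - 2r is positive for r < s1/2, and otherwise
   hypothesis (4) bounds it below by -d/p. *)
have D0 : 0 < d%:R / p + (s1 - 2 * r).
  have dp : 0 < (d%:R : R) / p by rewrite divr_gt0// ltr0n.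
  have [h|h] := ltP r (s1 / 2); first by lra.
  by have := hhigh; rewrite h hrs1 => /(_ isT); lra.
have dE : d%:R + p * (s1 - 2 * r) = p * (d%:R / p + (s1 - 2 * r)).
  by field; rewrite gt_eqF.
have dps : 0 < d%:R + p * (s1 - 2 * r) by rewrite dE mulr_gt0.
set a := s2 + d%:R / p - d%:R / 2 in a0.
(* As a and p are positive, theta q / 2 - 1 has the sign of q - q_c. This links the three cases to x
   < 1, x = 1 and x > 1. *)
have xE : 2 * a * (theta * q / 2 - 1) * p =
    q * (d%:R + p * (s1 - 2 * r)) - 2 * (d%:R + p * s2).
  rewrite (_ : _ * p = q * p * (theta * a) - 2 * p * a); last by field.
  rewrite -(scaling_dilation hd hp hq hscaling) /a; field.
  by rewrite !gt_eqF.
have sgx (t : R) : (0 < 2 * a * t * p) = (0 < t).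
  by rewrite pmulr_lgt0// pmulr_rgt0// mulr_gt0.
have x_gt1 : (q_c d p r s1 s2 < q) = (1 < theta * q / 2).
  by rewrite /q_c ltr_pdivrMr// -[RHS]subr_gt0 -sgx xE subr_gt0.
pose fA := @values R d p q r s1 s2.
have Xpsi : Xspace p r s2 psi by case: hpsi => -[_ _ [[]]] // [].
have TD := Xspace_triple_Drep hd hp hq htheta hscaling s1s a0.
have H0 := TD _ Xpsi.
set f0 := Drep r p psi in H0; set h0 := Drep (r + s2) 2 psi in H0.
set g0 := Drep (s1 - r) q psi in H0.
have [EA EB EM] := functionals_triple_rep hd hp hq H0.
have Mpsi : M_fun p r psi = lam%:E by case: hpsi => -[_ _ [[]]] // [].
have f0lam : nrm p f0 = lam by move: Mpsi; rewrite EM => -[].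
have EE (u : tempered R d) f h g : triple_rep p q r s1 s2 u f h g ->
    E_fun q r s1 s2 u = (2^-1 * nrm 2 h - q^-1 * nrm q g)%:E.
  by move=> /(functionals_triple_rep hd hp hq)[A1 B1 _]; rewrite /E_fun A1 B1.
have PE (u : tempered R d) f h g : triple_rep p q r s1 s2 u f h g ->
    P_fun q r s1 s2 theta u = (nrm 2 h - theta * nrm q g)%:E.
  by move=> /(functionals_triple_rep hd hp hq)[A1 B1 _]; rewrite /P_fun A1 B1.
have Su (u : tempered R d) f h g : triple_rep p q r s1 s2 u f h g -> lam = nrm p f -> S_sphere p r s2 lam u.
  move=> Hu ->; have [_ _ EMu] := functionals_triple_rep hd hp hq Hu; split; last exact: EMu.
  by apply/(Xspace_triple_rep hd hp hq htheta hscaling s1s a0); exists f, h, g.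
have Hmin : theta * q / 2 <= 1 /\ (forall A B, fA A B lam ->
      2^-1 * nrm 2 h0 - q^-1 * nrm q g0 <= 2^-1 * A - q^-1 * B) \/
   [/\ 1 < theta * q / 2, nrm 2 h0 - theta * nrm q g0 = 0 &
      forall A B, fA A B lam -> A - theta * B = 0 ->
        2^-1 * nrm 2 h0 - q^-1 * nrm q g0 <= 2^-1 * A - q^-1 * B].
  have S : minimizer (E_fun q r s1 s2) (S_sphere p r s2 lam) psi -> forall A B, fA A B lam ->
      2^-1 * nrm 2 h0 - q^-1 * nrm q g0 <= 2^-1 * A - q^-1 * B.
    move=> [_ H] A B [u [f [h [g [Hu [-> -> Mu]]]]]].
    by have := H u (Su _ _ _ _ Hu Mu); rewrite (EE _ _ _ _ Hu) (EE _ _ _ _ H0) lee_fin.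
  case: hpsi => [[_ qc /S HS]|[qc _ /S HS]|[qc _ [[_ P0] H]]].
  - by left; split => //; rewrite leNgt -x_gt1 -leNgt ltW.
  - by left; split => //; rewrite leNgt -x_gt1 -leNgt qc.
  right; split; first by rewrite -x_gt1.
    by move: P0; rewrite (PE _ _ _ _ H0) => -[].
  move=> A B [u [f [h [g [Hu [-> -> Mu]]]]]] PA.
  have := H u; rewrite (EE _ _ _ _ Hu) (EE _ _ _ _ H0) lee_fin; apply.
  by split; [exact: Su Hu Mu|rewrite (PE _ _ _ _ Hu) PA].
have A0 : 0 < nrm 2 h0.
  have /(values_nondeg hd hp) : fA (nrm 2 h0) (nrm q g0) lam by exists psi, f0, h0, g0.
  exact.
have crit := dual_pairing_critical hd hp hq htheta hscaling a0 hlam H0 f0lam Hmin.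
exists ((1 - theta) / (theta * lam) * nrm 2 h0); split.
- by rewrite EA.
- by rewrite mulr_gt0// divr_gt0 ?subr_gt0// mulr_gt0.
move=> phi /TD H.
(* Testing with phi gives the real part of the equation, testing with i phi the imaginary part. *)
have := crit _ _ _ _ H; have := crit _ _ _ _ (triple_rep_scale hp hq 'i%C H).
rewrite -/f0 -/h0 -/g0.
by move=> E1 E2; exact: cint_dual_pairing_eq0.
Qed.
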